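(* Let $F:\mathcal{H}_g\to\mathbb{P}^N(\mathbb{C})$ be a holomorphic map given in coordinates by Siegel modular forms with respect to $Sp(2g,\mathbb{Z})$ which induces an embedding of $Sp(2g,\mathbb{Z})\backslash\mathcal{H}_g$ into $\mathbb{P}^N(\mathbb{C})$ whose image is Zariski open in some projective algebraic variety. Then there is a definable open set $U\subseteq\mathcal{H}_g$ containing $\mathfrak{F}_g$ such that $F\restriction U$ is definable in $\mathbb{R}_{an,exp}$. Moreover, for all $\tau,\tau'\in U$, $F(\tau)=F(\tau')$ if and only if $\tau$ and $\tau'$ are in the same $Sp(2g,\mathbb{Z})$-orbit, and $F(U)$ is a quasi-projective subset of $\mathbb{P}^N(\mathbb{C})$.
   Context: $\mathbb{R}_{an,exp}$ is the expansion of the real ordered field by the real exponential function and all restricted analytic functions (restrictions to compact boxes of functions real analytic on a neighbourhood of the box); subsets of $\mathbb{C}^k$ are definable if definable under $\mathbb{C}=\mathbb{R}^2$, and $\mathbb{P}^N(\mathbb{C})$ is regarded as a semialgebraic set via its standard affine charts. Fix $g\geq1$; $\mathcal{H}_g=\{\tau\in\mathrm{Sym}(g,\mathbb{C}):\mathrm{Im}\tau\text{ positive definite}\}$, viewed in $\mathbb{C}^{g(g+1)/2}$. $Sp(2g,\mathbb{Z})=\{M\in GL(2g,\mathbb{Z}):MJ\,{}^tM=J\}$, $J=\begin{pmatrix}0&I_g\\-I_g&0\end{pmatrix}$, acting on $\mathcal{H}_g$ by $\begin{pmatrix}\alpha&\beta\\\gamma&\delta\end{pmatrix}\cdot\tau=(\alpha\tau+\beta)(\gamma\tau+\delta)^{-1}$.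 A holomorphic $\phi:\mathcal{H}_g\to\mathbb{C}$ is a Siegel modular form of weight $k$ for $Sp(2g,\mathbb{Z})$ if $\phi(M\cdot\tau)=\det(\gamma\tau+\delta)^k\phi(\tau)$ for all $M\in Sp(2g,\mathbb{Z})$. (Such an $F$ exists by Baily–Borel.) $\beta\in\mathrm{Sym}(g,\mathbb{R})$ is Minkowski reduced if (I) $\beta_{1,1}>0$; (II) ${}^t a\beta a\geq\beta_{k,k}$ for all $k$ and all $a\in\mathbb{Z}^g$ with $\gcd(a_k,\dots,a_g)=1$; (III) $\beta_{k,k+1}\geq0$. The Siegel fundamental set $\mathfrak{F}_g$ is the set of $\tau\in\mathrm{Sym}(g,\mathbb{C})$ with $\mathrm{Im}\tau$ Minkowski reduced, $|\mathrm{Re}\tau_{i,j}|\leq1/2$, and $|\det(\gamma\tau+\delta)|\geq1$ for all $\begin{pmatrix}\alpha&\beta\\\gamma&\delta\end{pmatrix}\in Sp(2g,\mathbb{Z})$. *)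

(* Defs.v *)
From HB Require Import structures.
From mathcomp Require Import all_boot all_order all_algebra finmap.
From mathcomp Require Import all_classical all_reals all_analysis.
From mathcomp Require Import complex zify.
From mathcomp Require mpoly.
From mathcomp.analysis.showcase Require summability.

Set Implicit Arguments.
Unset Strict Implicit.
Unset Printing Implicit Defensive.

Import Order.TTheory GRing.Theory Num.Theory.
Import numFieldNormedType.Exports.
(* The notations of mpoly clash with those of mathcomp-analysis. *)
Import -(notations) mpoly.

Local Open Scope ring_scope.
Local Open Scope classical_set_scope.
Local Open Scope complex_scope.

(* With this instance, [differentiable] on functions 'rV[R[i]]_n -> R[i] is
   complex (Frechet) differentiability, so holomorphic on an open set means
   [differentiable] at each of its points. *)
HB.instance Definition _ (R : realType) := NormedModule.copy R[i] R[i]^o.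

Section RanExp.
Variable R : realType.

Definition monomial m (y : 'rV[R]_m) (alpha : {ffun 'I_m -> nat}) : R :=
  \prod_i y 0 i ^+ alpha i.

(* The power series is summed over all multi-indices along the filter of
   finite sets of multi-indices, i.e. unconditionally (absolutely). *)
Definition analytic_at m (f : 'rV[R]_m -> R) (a : 'rV[R]_m) : Prop :=
  exists c : {ffun 'I_m -> nat} -> R, \forall x \near a,
    summability.partial_sum
      (fun alpha => c alpha * monomial (x - a) alpha)
      @ summability.totally --> f x.

Definition box m (lo hi : 'rV[R]_m) : set 'rV[R]_m :=
  [set x | forall i, lo 0 i <= x 0 i <= hi 0 i].

Record restricted_analytic m := RestrictedAnalytic {
  ra_fun : 'rV[R]_m -> R;
  ra_lo : 'rV[R]_m;
  ra_hi : 'rV[R]_m;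
  ra_analytic : exists U : set 'rV[R]_m,
    [/\ open U, box ra_lo ra_hi `<=` U & forall x, U x -> analytic_at ra_fun x]
}.

(* As usual, a restricted function is made total by the value 0 off its box. *)
Definition ra_eval m (f : restricted_analytic m) (x : 'rV[R]_m) : R :=
  if `[< box (ra_lo f) (ra_hi f) x >] then ra_fun f x else 0.

(* First-order formulas, with real parameters, in the language of ordered
   rings extended by exp and all restricted analytic functions; [term n] and
   [formula n] have their free variables among n variables. *)
Inductive term (n : nat) : Type :=
| TVar of 'I_n
| TCst of R
| TOpp of term n
| TAdd of term n & term n
| TMul of term n & term n
| TExp of term n
| TAn m of restricted_analytic m & ('I_m -> term n).

Inductive formula : nat -> Type :=
| FEq n of term n & term n : formula n
| FLt n of term n & term n : formula n
| FNot n of formula n : formula n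
| FAnd n of formula n & formula n : formula n
| FEx n of formula (1 + n) : formula n.

Fixpoint eval n (x : 'rV[R]_n) (t : term n) : R :=
  match t with
  | TVar i => x 0 i
  | TCst c => c
  | TOpp s => - eval x s
  | TAdd s1 s2 => eval x s1 + eval x s2
  | TMul s1 s2 => eval x s1 * eval x s2
  | TExp s => expR (eval x s)
  | TAn m f s => ra_eval f (\row_j eval x (s j))
  end.

Fixpoint holds n (p : formula n) : 'rV[R]_n -> Prop :=
  match p with
  | FEq n s t => fun x => eval x s = eval x t
  | FLt n s t => fun x => eval x s < eval x t
  | FNot n q => fun x => ~ holds q x
  | FAnd n q1 q2 => fun x => holds q1 x /\ holds q2 x
  | FEx n q => fun x => exists y : R, holds q (row_mx (const_mx y) x)
  end.

Definition definable n (X : set 'rV[R]_n) : Prop :=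
  exists p : formula n, X = [set x | holds p x].

Definition complex_vec n (x : 'rV[R]_(n + n)) : 'rV[R[i]]_n :=
  \row_j (x 0 (lshift n j) +i* x 0 (rshift n j)).

Definition definableC n (X : set 'rV[R[i]]_n) : Prop :=
  definable (@complex_vec n @^-1` X).

End RanExp.

Section SymmetricMatrices.
Variable g : nat.

Definition sym_index := {ij : 'I_g * 'I_g | (ij.1 <= ij.2)%N}.

Definition sym_dim : nat := #|{: sym_index}|.

Lemma sym_dimE : sym_dim = (g * g.+1)./2.
Proof.
rewrite /sym_dim card_sig -sum1_card.
rewrite (_ : (\sum_(_ in _) 1)%N = (\sum_(j < g) j.+1)%N); last first.
  rewrite -(pair_big_dep predT (fun i j : 'I_g => (i <= j)%N)
              (fun _ _ => 1%N)) /= (exchange_big_dep predT) //=.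
  apply: eq_bigr => j _.
  by rewrite -(big_ord_widen g (fun=> 1%N) (ltn_ord j)) sum1_card card_ord.
elim: g => [|n IHn]; first by rewrite big_ord0.
rewrite big_ord_recr /= IHn; have := odd_double_half (n * n.+1).
by lia.
Qed.

Fact sym_pair_subproof (i j : 'I_g) :
  let ij := if (i <= j)%N then (i, j) else (j, i) in (ij.1 <= ij.2)%N.
Proof. by case: leqP => //= /ltnW. Qed.

Definition sym_pair (i j : 'I_g) : sym_index :=
  Sub (if (i <= j)%N then (i, j) else (j, i)) (sym_pair_subproof i j).

(* The identification of C^(g(g+1)/2) with Sym(g, C): the coordinates of v are
   the entries on and above the diagonal. *)
Definition sym_mx (T : Type) (v : 'rV[T]_sym_dim) : 'M[T]_g :=
  \matrix_(i, j) v 0 (enum_rank (sym_pair i j)).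

Lemma tr_sym_mx (T : Type) (v : 'rV[T]_sym_dim) : (sym_mx v)^T = sym_mx v.
Proof.
apply/matrixP => i j; rewrite !mxE; congr (v 0 (enum_rank _)).
apply: val_inj => /=; case: ltngtP => // /val_inj -> //.
Qed.

Lemma sym_mx_onto (T : Type) (A : 'M[T]_g) :
  A^T = A -> exists v : 'rV[T]_sym_dim, A = sym_mx v.
Proof.
move=> symA; exists (\row_k A (val (enum_val k)).1 (val (enum_val k)).2).
apply/matrixP => i j; rewrite !mxE enum_rankK /=; case: leqP => //= _.
by rewrite -{1}symA mxE.
Qed.

End SymmetricMatrices.

Section Siegel.
Variables (R : realType) (g : nat).
Local Notation C := R[i].

Definition posdef (b : 'M[R]_g) : Prop :=
  forall x : 'cV[R]_g, x != 0 -> 0 < (x^T *m b *m x) 0 0.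

Definition siegel_space : set 'M[C]_g :=
  [set tau | tau^T = tau /\ posdef (map_mx (@complex.Im R) tau)].

Definition symplectic_form : 'M[int]_(g + g) := block_mx 0 1%:M (- 1%:M) 0.

Definition SpZ : set 'M[int]_(g + g) :=
  [set M | M \in unitmx /\
    M *m symplectic_form *m M^T = symplectic_form].

Definition num_mx (M : 'M[int]_(g + g)) (tau : 'M[C]_g) : 'M[C]_g :=
  map_mx intr (ulsubmx M) *m tau + map_mx intr (ursubmx M).

Definition den_mx (M : 'M[int]_(g + g)) (tau : 'M[C]_g) : 'M[C]_g :=
  map_mx intr (dlsubmx M) *m tau + map_mx intr (drsubmx M).

Definition siegel_act (M : 'M[int]_(g + g)) (tau : 'M[C]_g) : 'M[C]_g :=
  num_mx M tau *m invmx (den_mx M tau).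

Definition same_orbit (tau tau' : 'M[C]_g) : Prop :=
  exists2 M, SpZ M & tau' = siegel_act M tau.

Definition open_sym (W : set 'M[C]_g) : Prop :=
  W `<=` [set tau | tau^T = tau] /\ open (@sym_mx g C @^-1` W).

Definition holomorphic_on (W : set 'M[C]_g) (h : 'M[C]_g -> C) : Prop :=
  forall v, W (sym_mx v) -> differentiable (h \o @sym_mx g C) v.

Definition modular_form (k : int) (phi : 'M[C]_g -> C) : Prop :=
  holomorphic_on siegel_space phi /\
  forall M tau, SpZ M -> siegel_space tau ->
    phi (siegel_act M tau) = \det (den_mx M tau) ^ k * phi tau.

(* Rows and columns are numbered from 0. *)
Definition minkowski_reduced (b : 'M[R]_g) : Prop :=
  [/\ b^T = b,
      forall i : 'I_g, i = 0%N :> nat -> 0 < b i i,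
      forall (k : 'I_g) (a : 'cV[int]_g),
        \big[gcdz/0]_(i < g | (k <= i)%N) a i 0 = 1 ->
        b k k <= ((map_mx intr a)^T *m b *m map_mx intr a) 0 0
    & forall i j : 'I_g, j = i.+1 :> nat -> 0 <= b i j].

Definition siegel_fundamental_set : set 'M[C]_g :=
  [set tau | [/\ tau^T = tau,
    minkowski_reduced (map_mx (@complex.Im R) tau),
    forall i j, `|complex.Re (tau i j)| <= 2^-1
  & forall M, SpZ M -> 1 <= `|\det (den_mx M tau)|]].

Definition definable_sym (W : set 'M[C]_g) : Prop :=
  W `<=` [set tau | tau^T = tau] /\ definableC (@sym_mx g C @^-1` W).

End Siegel.

Section ProjectiveSpace.
Variables (R : realType) (N : nat).
Local Notation C := R[i].

(* Points are the lines of C^(N+1); the nonzero row vectors v with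
   \val p = <[v]>%VS are the homogeneous coordinates of p. *)
Definition projective_space :=
  {L : {vspace 'rV[C]_N.+1} | \dim L == 1%N}.

Definition affine_vec (i : 'I_N.+1) (z : 'rV[C]_N) : 'rV[C]_N.+1 :=
  \row_j (if unlift i j is Some k then z 0 k else 1).

Fact affine_chart_subproof (i : 'I_N.+1) (z : 'rV[C]_N) :
  \dim <[affine_vec i z]>%VS == 1%N.
Proof.
rewrite dim_vline; suff -> : affine_vec i z != 0 by [].
by apply/negP => /eqP/rowP/(_ i)/eqP; rewrite !mxE unlift_none oner_eq0.
Qed.

Definition affine_chart (i : 'I_N.+1) (z : 'rV[C]_N) : projective_space :=
  Sub <[affine_vec i z]>%VS (affine_chart_subproof i z).

Definition open_proj (O : set projective_space) : Prop :=
  forall i, open (affine_chart i @^-1` O).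

Definition holomorphic_proj_on (O : set projective_space)
    (h : projective_space -> C) : Prop :=
  forall i z, O (affine_chart i z) -> differentiable (h \o affine_chart i) z.

Definition projective_variety (V : set projective_space) : Prop :=
  exists ps : seq (mpoly N.+1 C),
    (forall p, p \in ps ->
       exists d, p \is ishomog1 d (@mdeg N.+1)) /\
    V = [set x | forall p (v : 'rV[C]_N.+1), p \in ps -> \val x = <[v]>%VS ->
           meval (fun i => v 0 i) p = 0].

Definition zariski_open_in (V X : set projective_space) : Prop :=
  exists2 Z, projective_variety Z & X = V `\` Z.

Definition quasi_projective (X : set projective_space) : Prop :=
  exists2 V, projective_variety V & zariski_open_in V X.

End ProjectiveSpace.

Section MapsToProjectiveSpace.
Variables (R : realType) (g N : nat).
Local Notation C := R[i].
Local Notation H := (@siegel_space R g).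
Implicit Type F : 'M[C]_g -> projective_space R N.

(* Morphism of ringed spaces: F is continuous and pulls local holomorphic
   functions back to holomorphic functions. *)
Definition holomorphic_map F : Prop :=
  forall O, open_proj O ->
    open_sym (H `&` F @^-1` O) /\
    forall h, holomorphic_proj_on O h ->
      holomorphic_on (H `&` F @^-1` O) (h \o F).

Definition given_by_modular_forms F : Prop :=
  exists (k : int) (phi : 'I_N.+1 -> 'M[C]_g -> C),
    (forall i, modular_form k (phi i)) /\
    forall tau, H tau -> \val (F tau) = <[\row_i phi i tau]>%VS.

Definition SpZ_invariant (W : set 'M[C]_g) : Prop :=
  forall M tau, SpZ M -> W tau -> W (siegel_act M tau).

(* The open sets of the quotient of H by Sp(2g, Z) are the invariant open
   subsets W of H, with the invariant holomorphic functions on W as sections of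
   its structure sheaf.  F induces an embedding of this analytic space when the
   induced map is well defined and injective, a homeomorphism onto its image,
   and surjective on stalks of structure sheaves. *)
Definition induces_embedding F : Prop :=
  [/\ forall tau tau', H tau -> H tau' ->
        (F tau = F tau' <-> same_orbit tau tau'),
      forall O, open_proj O -> open_sym (H `&` F @^-1` O),
      forall W, W `<=` H -> open_sym W -> SpZ_invariant W ->
        exists2 O, open_proj O & forall tau, H tau -> (W tau <-> O (F tau))
    & forall W h tau, W `<=` H -> open_sym W -> SpZ_invariant W ->
        holomorphic_on W h ->
        (forall M tau', SpZ M -> W tau' -> h (siegel_act M tau') = h tau') ->
        W tau ->
        exists O hP, [/\ open_proj O, O (F tau), holomorphic_proj_on O hP
          & forall tau', W tau' -> O (F tau') -> h tau' = hP (F tau')]].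

(* Definability of the graph of F on U, as a subset of C^(g(g+1)/2) x P^N read
   in each standard affine chart of P^N. *)
Definition definable_restriction F (U : set 'M[C]_g) : Prop :=
  forall i : 'I_N.+1,
    definableC [set w : 'rV[C]_(sym_dim g + N) |
      U (sym_mx (lsubmx w)) /\
      F (sym_mx (lsubmx w)) = affine_chart i (rsubmx w)].

End MapsToProjectiveSpace.

(* Main.v *)
From HB Require Import structures.
From mathcomp Require Import all_boot all_order all_algebra finmap.
From mathcomp Require Import all_classical all_reals all_analysis.
From mathcomp Require Import complex ring lra zify closed_field.
From mathcomp Require mpoly.
Require Import Defs.

Set Implicit Arguments.
Unset Strict Implicit.
Unset Printing Implicit Defensive.

Import Order.TTheory GRing.Theory Num.Theory.
Import numFieldNormedType.Exports.

Local Open Scope ring_scope.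
Local Open Scope classical_set_scope.
Local Open Scope complex_scope.

(** By reduction theory the fundamental set, and a point of every orbit, lie in
    finitely many regions of the following kind: after conjugation by one of
    finitely many integer matrices [P], the imaginary part is nearly diagonal,
    so that [tau] is a combination, with coefficients [z_l] of imaginary part
    bounded below, of matrices [b b^T] with [b] an integer vector.  A modular
    form is a Fourier series in [tau]; by Koecher's principle, for [g >= 2], only
    nonnegative powers of the [e(z_l)] occur, and the series converges on the
    open unit polydisc.  Where [Im z_l] is bounded below it is therefore a
    restricted analytic function of the polar coordinates of [e(z_l)], that is, of
    [exp(- 2 pi Im z_l)] and [2 pi Re z_l].  [U] is the union of these regions;
    it meets every orbit, so [F(U) = F(H_g)].

    For [g = 1] the modular forms are not assumed to be regular at the cusp.  A
    linear combination [h] of the coordinates vanishes on a countable set, whose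
    image is a countable constructible set, hence finite; so [h] has no zeros of
    large height.  By the open mapping theorem and Baire's theorem each quotient
    [q_i] of coordinates then omits a disc around some [c_i] near the cusp, and
    multiplication of the coordinates by a common factor built from the
    [1 / (q_i - c_i)] makes them bounded there, with a power series in [e(z)]. *)

(** * Real-valued modulus on [R[i]], whose own norm takes values in [R[i]] *)

Section ComplexNorm.
Variable R : realType.
Local Notation C := R[i].
Local Notation Re := (@complex.Re R).
Local Notation Im := (@complex.Im R).
Implicit Types z w : C.

(** All the function theory is drawn from complex differentiability through one source: Goursat's
    bisection, run on dyadic trapezoid sums, shows that the averages of a periodic function at two
    heights agree asymptotically. Fourier coefficients are ultrafilter limits of such averages, so
    no integral is ever formed. A disc is reached through [w = s e(u)], so that the maximum
    principle, the open mapping theorem and the identity theorem come from the same expansion.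
    Definability asks for explicit terms that stay valid as [Im tau] tends to infinity. This is why
    the cone coordinates need a positive lower bound uniform on each piece, and why only finitely
    many matrices [P] may occur. The inclusion of the fundamental set in [U] and the equality
    [F(U) = F(H_g)] rest on two different reductions: Minkowski's conditions for the former, Hermite
    reduction with nearly maximal [det (Im tau)] for the latter. They meet in the common shape
    [siegel_form], and it is this shape that the pieces cover. *)

Definition nm (z : C) : R := Normc.normc z.

Lemma nmE z : nm z = Num.sqrt (Re z ^+ 2 + Im z ^+ 2).
Proof. by case: z. Qed.

Lemma nm_sqr z : nm z ^+ 2 = Re z ^+ 2 + Im z ^+ 2.
Proof. by rewrite nmE sqr_sqrtr // addr_ge0 ?sqr_ge0. Qed.

Lemma normE z : `|z| = (nm z)%:C.
Proof. by rewrite normc_def nmE. Qed.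

Lemma nm_ge0 z : 0 <= nm z.
Proof. by rewrite nmE sqrtr_ge0. Qed.

Lemma nm_eq0 z : (nm z == 0) = (z == 0).
Proof. by rewrite -[RHS]normr_eq0 normE eq_complex /= eqxx andbT. Qed.

Lemma nm_gt0 z : (0 < nm z) = (z != 0).
Proof. by rewrite lt_def nm_ge0 andbT nm_eq0. Qed.

Lemma nm0 : nm 0 = 0.
Proof. by apply/eqP; rewrite nm_eq0. Qed.

Lemma nmM z w : nm (z * w) = nm z * nm w.
Proof. exact: Normc.normcM. Qed.

Lemma nmR (x : R) : nm x%:C = `|x|.
Proof. by rewrite nmE /= expr0n addr0 sqrtr_sqr. Qed.

Lemma nm1 : nm 1 = 1.
Proof. by rewrite (_ : 1 = 1%:C) // nmR normr1. Qed.

Lemma nmV z : nm z^-1 = (nm z)^-1.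
Proof. exact: Normc.normcV. Qed.

Lemma nmN z : nm (- z) = nm z.
Proof. exact: normcN. Qed.

Lemma nmD z w : nm (z + w) <= nm z + nm w.
Proof. exact: le_normcD. Qed.

Lemma nmB z w : nm (z - w) <= nm z + nm w.
Proof. by rewrite -(nmN w) nmD. Qed.

Lemma nmBC z w : nm (z - w) = nm (w - z).
Proof. by rewrite -nmN opprB. Qed.

Lemma nm_triangle z w u : nm (z - u) <= nm (z - w) + nm (w - u).
Proof. by rewrite -[z - u](subrKA w) nmD. Qed.

Lemma le_nmB z w : nm z - nm w <= nm (z - w).
Proof. by rewrite lerBlDr -{1}(subrK w z) nmD. Qed.

Lemma nmX z n : nm (z ^+ n) = nm z ^+ n.
Proof. by elim: n => [|n IH]; rewrite ?expr0 ?nm1 // !exprS nmM IH. Qed.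

Lemma nm_prod (I : Type) (s : seq I) (P : pred I) (F : I -> C) :
  nm (\prod_(i <- s | P i) F i) = \prod_(i <- s | P i) nm (F i).
Proof. exact: (big_morph nm nmM nm1). Qed.

Lemma nm_sum (I : Type) (s : seq I) (P : pred I) (F : I -> C) :
  nm (\sum_(i <- s | P i) F i) <= \sum_(i <- s | P i) nm (F i).
Proof.
elim/big_ind2: _ => [|z x w y zx wy|//]; first by rewrite nm0.
exact: le_trans (nmD _ _) (lerD _ _).
Qed.

Lemma nm_nat n : nm n%:R = n%:R.
Proof. by rewrite -(rmorph_nat (real_complex R)) nmR normr_nat. Qed.

Lemma nm_Re z : `|Re z| <= nm z.
Proof.
by rewrite nmE -sqrtr_sqr ler_wsqrtr // lerDl sqr_ge0.
Qed.

Lemma nm_Im z : `|Im z| <= nm z.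
Proof.
by rewrite nmE -sqrtr_sqr ler_wsqrtr // lerDr sqr_ge0.
Qed.

Lemma nm_le_ReIm z : nm z <= `|Re z| + `|Im z|.
Proof.
rewrite [z in nm z]complexE; apply: le_trans (nmD _ _) _.
by rewrite nmM !nmR (_ : nm _ = 1) ?mul1r // nmE /= expr0n add0r expr1n sqrtr1.
Qed.

Lemma cReD z w : Re (z + w) = Re z + Re w. Proof. by case: z; case: w. Qed.
Lemma cImD z w : Im (z + w) = Im z + Im w. Proof. by case: z; case: w. Qed.
Lemma cReN z : Re (- z) = - Re z. Proof. by case: z. Qed.
Lemma cImN z : Im (- z) = - Im z. Proof. by case: z. Qed.
Lemma cReB z w : Re (z - w) = Re z - Re w. Proof. by rewrite cReD cReN. Qed.
Lemma cImB z w : Im (z - w) = Im z - Im w. Proof. by rewrite cImD cImN. Qed.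
Lemma cReM z w : Re (z * w) = Re z * Re w - Im z * Im w.
Proof. by case: z; case: w. Qed.
Lemma cImM z w : Im (z * w) = Re z * Im w + Im z * Re w.
Proof. by case: z => a b; case: w. Qed.
Lemma cRe_sum (I : Type) (s : seq I) (P : pred I) (F : I -> C) :
  Re (\sum_(i <- s | P i) F i) = \sum_(i <- s | P i) Re (F i).
Proof. exact: (big_morph Re cReD). Qed.
Lemma cIm_sum (I : Type) (s : seq I) (P : pred I) (F : I -> C) :
  Im (\sum_(i <- s | P i) F i) = \sum_(i <- s | P i) Im (F i).
Proof. exact: (big_morph Im cImD). Qed.
Lemma cRe_nat n : Re n%:R = n%:R.
Proof. by rewrite -(rmorph_nat (real_complex R)). Qed.
Lemma cIm_nat n : Im n%:R = 0.
Proof. by rewrite -(rmorph_nat (real_complex R)). Qed.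
Lemma cRe_int (m : int) : Re m%:~R = m%:~R.
Proof. by rewrite -(rmorph_int (real_complex R)). Qed.
Lemma cIm_int (m : int) : Im m%:~R = 0.
Proof. by rewrite -(rmorph_int (real_complex R)). Qed.
Lemma cReMi (m : int) z : Re (m%:~R * z) = m%:~R * Re z.
Proof. by rewrite cReM cRe_int cIm_int mul0r subr0. Qed.
Lemma cImMi (m : int) z : Im (m%:~R * z) = m%:~R * Im z.
Proof. by rewrite cImM cRe_int cIm_int mul0r addr0. Qed.
Lemma cReMR (x : R) z : Re (x%:C * z) = x * Re z.
Proof. by rewrite cReM /= mul0r subr0. Qed.
Lemma cImMR (x : R) z : Im (x%:C * z) = x * Im z.
Proof. by rewrite cImM /= mul0r addr0. Qed.
Lemma complex_ext z w : Re z = Re w -> Im z = Im w -> z = w.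
Proof. by case: z => a b; case: w => c d /= -> ->. Qed.

Lemma nm_lt_norm z (e : R) : (`|z| < e%:C) = (nm z < e).
Proof. by rewrite normE ltcR. Qed.

Lemma nm_le_norm z (e : R) : (`|z| <= e%:C) = (nm z <= e).
Proof. by rewrite normE lecR. Qed.

Lemma gt0_complexP (e : C) : 0 < e -> exists2 r : R, 0 < r & e = r%:C.
Proof.
by case: e => a b; rewrite ltcE /= => /andP[/eqP -> a0]; exists a.
Qed.

End ComplexNorm.

(** * Epsilon-delta form of complex differentiability *)

Section ComplexDifferentiable.

Lemma differentiable_eps (K : numFieldType) (f : K -> K) (z : K) :
  differentiable f z -> forall eps, 0 < eps -> exists2 del, 0 < del &
  forall h, `|h| < del -> `|f (z + h) - f z - h * 'd f z 1| <= eps * `|h|.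
Proof.
move=> df eps e0.
have /eqaddoP /(_ eps e0) /nbhs_ballP [del d0 H] := diff_locally df.
exists del => // h hd; have := H h.
rewrite -ball_normE /ball_ /= sub0r normrN => /(_ hd).
rewrite !fctE /= [h + z]addrC opprD addrA.
by rewrite -[in 'd f z h](mulr1 h) -[h * 1]/(h *: 1) linearZ.
Qed.

Variable R : realType.
Local Notation C := R[i].

Lemma differentiable_nm (f : C -> C) (z : C) : differentiable f z ->
  exists d : C, forall eps : R, 0 < eps -> exists2 del : R, 0 < del &
  forall h, nm h < del -> nm (f (z + h) - f z - d * h) <= eps * nm h.
Proof.
move=> /differentiable_eps H; exists ('d f z 1) => eps e0.
have [|del /gt0_complexP[r r0 ->] {}H] := H eps%:C; first by rewrite ltcR.
exists r => // h hr; have := H h; rewrite nm_lt_norm => /(_ hr).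
by rewrite normE -rmorphM nm_le_norm [h * _]mulrC.
Qed.

Lemma nm_differentiable (f : C -> C) (z d : C) :
  (forall eps : R, 0 < eps -> exists2 del : R, 0 < del &
   forall h, nm h < del -> nm (f (z + h) - f z - d * h) <= eps * nm h) ->
  differentiable f z.
Proof.
move=> H; apply/derivable1_diffP; rewrite /derivable.
apply/cvg_ex; exists d; apply/cvgrPdist_le => e /gt0_complexP[r r0 ->].
have [del d0 {}H] := H r r0.
apply/nbhs_ballP; exists del%:C; first by rewrite /= ltcR.
move=> h; rewrite -ball_normE /ball_ /= sub0r normrN nm_lt_norm => hd h0.
rewrite nm_le_norm nmBC -(ler_pM2l (_ : 0 < nm h)) ?nm_gt0 // -nmM mulrBr.
have -> : h%:A + z = z + h by rewrite addrC -[h%:A]/(h * 1) mulr1.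
rewrite (mulrA h h^-1) divff // mul1r.
by rewrite [h * d]mulrC [nm h * r]mulrC H.
Qed.

Lemma differentiable_cont (f : C -> C) (z : C) : differentiable f z ->
  forall eps : R, 0 < eps -> exists2 del : R, 0 < del &
  forall w, nm (w - z) < del -> nm (f w - f z) < eps.
Proof.
move=> /differentiable_continuous/cvgrPdist_lt H eps e0.
have /nbhs_ballP [del /gt0_complexP[r r0 ->] {}H] := H eps%:C ltac:(by rewrite ltcR).
exists r => // w wr.
have := H w; rewrite -ball_normE /ball_ /= !nm_lt_norm [nm (z - w)]nmBC.
by move=> /(_ wr); rewrite nmBC.
Qed.

Lemma differentiable_affine (a b z : C) : differentiable (fun u : C => a + u * b) z.
Proof.
apply: differentiableD; first exact: differentiable_cst.
exact: differentiableM.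
Qed.

End ComplexDifferentiable.

(** * The exponential of [2 pi i z] and its derivative *)

Section ComplexExponential.
Variable R : realType.
Local Notation C := R[i].
Local Notation Re := (@complex.Re R).
Local Notation Im := (@complex.Im R).
Implicit Types z w : C.

(* e(z) = exp(2 pi i z) *)
Definition ce (z : C) : C :=
  (expR (- (2 * pi * Im z)))%:C * (cos (2 * pi * Re z) +i* sin (2 * pi * Re z)).

Lemma ceD z w : ce (z + w) = ce z * ce w.
Proof.
rewrite /ce cReD cImD !mulrDr opprD expRD cosD sinD.
by apply: complex_ext; rewrite !(cReM, cImM) /=; ring.
Qed.

Lemma ce0 : ce 0 = 1.
Proof. by rewrite /ce /= !mulr0 oppr0 expR0 cos0 sin0 mul1r. Qed.

Lemma nm_ce z : nm (ce z) = expR (- (2 * pi * Im z)).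
Proof.
rewrite /ce nmM nmR ger0_norm ?expR_ge0 // nmE /= cos2Dsin2 sqrtr1 mulr1.
by [].
Qed.

Lemma ce_neq0 z : ce z != 0.
Proof. by rewrite -nm_gt0 nm_ce expR_gt0. Qed.

Lemma ceN z : ce (- z) = (ce z)^-1.
Proof.
by apply: (mulfI (ce_neq0 z)); rewrite -ceD subrr ce0 divff ?ce_neq0.
Qed.

Lemma ceB z w : ce (z - w) = ce z / ce w.
Proof. by rewrite ceD ceN. Qed.

Lemma ceMn z n : ce (n%:R * z) = ce z ^+ n.
Proof.
elim: n => [|n IH]; first by rewrite mul0r ce0.
by rewrite -natr1 mulrDl mul1r ceD IH exprSr.
Qed.

Lemma ce1 : ce 1 = 1.
Proof.
rewrite /ce /= mulr0 oppr0 expR0 mulr1 (_ : 2 * pi = pi *+ 2 :> R) ?mulr_natl //.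
by rewrite cos2pi sin2pi mulr1.
Qed.

Lemma ce_nat n : ce n%:R = 1.
Proof. by rewrite -[n%:R]mulr1 ceMn ce1 expr1n. Qed.

Lemma ce_int (m : int) : ce m%:~R = 1.
Proof. by case: m => n; rewrite ?NegzE ?mulrNz ?ceN ce_nat ?invr1. Qed.

Lemma ce_sum (I : Type) (s : seq I) (P : pred I) (F : I -> C) :
  ce (\sum_(i <- s | P i) F i) = \prod_(i <- s | P i) ce (F i).
Proof. exact: (big_morph ce ceD ce0). Qed.

(** The modulus forces [Im z = 0]; then [cos (2 pi x) = 1] gives [sin (pi x) = 0], excluded for
    [0 < |x| < 1] by the sign of the sine on [(0, pi)]. *)
Lemma ce_eq1 z : ce z = 1 -> `|Re z| < 1 -> z = 0.
Proof.
move=> z1 zlt; have Imz : Im z = 0.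
  have := nm_ce z; rewrite z1 nm1 => /esym; rewrite -[RHS]expR0.
  move=> /expR_inj/eqP; rewrite oppr_eq0 mulf_eq0 => /orP[|/eqP//].
  by rewrite mulf_eq0 pnatr_eq0 /= (gt_eqF (pi_gt0 _)).
apply: complex_ext => //=; have := congr1 Re z1.
rewrite /ce Imz mulr0 oppr0 expR0 mul1r /= => c1.
have {c1} s0 : sin (pi * Re z) = 0.
  apply/eqP; rewrite -sqrf_eq0; apply/eqP.
  have := cosD (pi * Re z) (pi * Re z).
  have -> : pi * Re z + pi * Re z = 2 * pi * Re z by ring.
  rewrite c1 -!expr2 => e1.
  have := cos2Dsin2 (pi * Re z); move: e1; lra.
apply/eqP/negPn/negP => x0.
have [x_lt0|x_gt0] := ltP (Re z) 0.
  have : 0 < sin (pi * - Re z).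
    rewrite sin_gt0_pi //; apply/andP; split.
      by rewrite mulr_gt0 ?pi_gt0 // oppr_gt0.
    by rewrite -[ltRHS]mulr1 ltr_pM2l ?pi_gt0 // -ltr0_norm.
  by rewrite mulrN sinN s0 oppr0 ltxx.
have xp : 0 < Re z by rewrite lt_def x0.
have : 0 < sin (pi * Re z).
  rewrite sin_gt0_pi //; apply/andP; split; first by rewrite mulr_gt0 ?pi_gt0.
  by rewrite -[ltRHS]mulr1 ltr_pM2l ?pi_gt0 // -(gtr0_norm xp).
by rewrite s0 ltxx.
Qed.

Let real_eps (f : R -> R) (x d : R) : is_derive x 1 f d ->
  forall eps : R, 0 < eps -> exists2 del : R, 0 < del &
  forall h, `|h| < del -> `|f (x + h) - f x - h * d| <= eps * `|h|.
Proof.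
move=> fd; have df : differentiable f x by apply/derivable1_diffP.
have := differentiable_eps df; rewrite -derive1E' //.
by rewrite derive1E derive_val.
Qed.

(** By [ceD] only the derivative at 0 matters, and there it splits into the real derivatives of
    [expR], [cos] and [sin]. *)
Lemma ce_derive z (eps : R) : 0 < eps -> exists2 del : R, 0 < del &
  forall h, nm h < del ->
  nm (ce (z + h) - ce z - ce z * (0 +i* (2 * pi)) * h) <= eps * nm h.
Proof.
move=> e0.
pose P : R := 2 * pi.
have P0 : 0 < P by rewrite mulr_gt0 ?pi_gt0.
have nz : 0 < nm (ce z) by rewrite nm_gt0 ce_neq0.
(* The real and imaginary remainders below add up to at most [10 et P |h|]; 16 leaves room. *)
pose et := Num.min 1 (eps / (nm (ce z) * P * 16)).
have et0 : 0 < et.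
  by rewrite /et lt_min ltr01 divr_gt0 // mulr_gt0 // mulr_gt0.
have et1 : et <= 1 by rewrite /et ge_min lexx.
have etP : et * (nm (ce z) * P * 16) <= eps.
  have D0 : 0 < nm (ce z) * P * 16 by rewrite mulr_gt0 // mulr_gt0.
  by rewrite -ler_pdivlMr // /et ge_min lexx orbT.
clearbody et.
have [d1 d10 H1] := real_eps (is_derive_expR 0) et0.
have [d2 d20 H2] := real_eps (is_derive_cos 0) et0.
have [d3 d30 H3] := real_eps (is_derive_sin 0) et0.
(* The cruder tolerance 1 serves only for the bounds [expR a <= 4] and [|expR a - 1| <= 2 |a|]. *)
have [d4 d40 H4] := real_eps (is_derive_expR 0) (ltr01 : 0 < 1 :> R).
pose d := Num.min (Num.min d1 d2) (Num.min (Num.min d3 d4) et).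
have dP x : x < d -> [/\ x < d1, x < d2, x < d3, x < d4 & x < et].
  by rewrite /d !lt_min => /andP[/andP[-> ->]] /andP[/andP[-> ->]] ->.
exists (d / P); first by rewrite divr_gt0 // /d !lt_min d10 d20 d30 d40 et0.
move=> h hd; rewrite ceD.
have -> : ce z * ce h - ce z - ce z * (0 +i* (2 * pi)) * h =
          ce z * (ce h - 1 - (0 +i* (2 * pi)) * h) by ring.
rewrite nmM.
set a := - (P * Im h); set b := P * Re h.
have hP : P * nm h < d by rewrite mulrC -ltr_pdivlMr.
have aP : `|a| <= P * nm h.
  by rewrite normrN normrM gtr0_norm // ler_pM2l // nm_Im.
have bP : `|b| <= P * nm h.
  by rewrite normrM gtr0_norm // ler_pM2l // nm_Re.
have [a1 _ _ a4 a6] := dP _ (le_lt_trans aP hP).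
have [_ b2 b3 _ b6] := dP _ (le_lt_trans bP hP).
have := H1 a a1; have := H2 b b2; have := H3 b b3; have := H4 a a4.
rewrite !(add0r, expR0, cos0, sin0, oppr0, mulr0, mulr1, subr0, mul1r) => K4 K3 K2 K1.
have Ea : expR a <= 4.
  have := ler_norm (expR a - 1 - a); have := ler_norm a; lra.
have Ea0 : `|expR a - 1| <= 2 * `|a|.
  have -> : expR a - 1 = (expR a - 1 - a) + a by ring.
  by apply: le_trans (ler_normD _ _) _; lra.
have sb : `|sin b| <= 2 * `|b|.
  have -> : sin b = (sin b - b) + b by ring.
  apply: le_trans (ler_normD _ _) _.
  have : et * `|b| <= 1 * `|b| by rewrite ler_wpM2r.
  by lra.
have N1 := ler_normD (expR a - 1 - a) (expR a * (cos b - 1)).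
have N2 := ler_normD ((expR a - 1) * sin b) (sin b - b).
have M1 : `|expR a * (cos b - 1)| <= 4 * (et * `|b|).
  by rewrite normrM (ger0_norm (expR_ge0 _)) ler_pM ?expR_ge0.
have M2 : `|(expR a - 1) * sin b| <= 2 * et * (2 * `|b|).
  rewrite normrM ler_pM // (le_trans Ea0) // ler_pM2l //.
  exact: ltW.
have S : nm (ce h - 1 - (0 +i* (2 * pi)) * h) <= 16 * (et * (P * nm h)).
  apply: le_trans (nm_le_ReIm _) _.
  have -> : Re (ce h - 1 - (0 +i* (2 * pi)) * h) =
       (expR a - 1 - a) + expR a * (cos b - 1).
    by rewrite !(cReB, cReM) /= -/P -/a -/b /a; ring.
  have -> : Im (ce h - 1 - (0 +i* (2 * pi)) * h) =
       (expR a - 1) * sin b + (sin b - b).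
    by rewrite !(cImB, cImM) /= -/P -/a -/b /b; ring.
  have B1 : et * `|a| <= et * (P * nm h) by rewrite ler_pM2l.
  have B2 : et * `|b| <= et * (P * nm h) by rewrite ler_pM2l.
  have B3 : 0 <= et * (P * nm h) by rewrite mulr_ge0 ?(ltW et0) // mulr_ge0 ?nm_ge0 ?(ltW P0).
  by lra.
apply: le_trans (_ : nm (ce z) * (16 * (et * (P * nm h))) <= _).
  by rewrite ler_pM2l.
have -> : nm (ce z) * (16 * (et * (P * nm h))) = et * (nm (ce z) * P * 16) * nm h by ring.
by rewrite ler_wpM2r ?nm_ge0.
Qed.

Lemma differentiable_ce z : differentiable ce z.
Proof. by apply: nm_differentiable => eps; exact: ce_derive. Qed.

End ComplexExponential.

(** * Limits of bounded sequences along an ultrafilter *)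

Section BoundedLimit.
Variable R : realType.
Local Notation C := R[i].
Local Notation Re := (@complex.Re R).
Local Notation Im := (@complex.Im R).

Definition nat_ultra : set_system nat :=
  sval (cid (ultraFilterLemma eventually_filter)).

Instance nat_ultra_ultra : UltraFilter nat_ultra.
Proof. by rewrite /nat_ultra; case: cid => /= U []. Qed.

Lemma nat_ultra_near (P : nat -> Prop) :
  (exists j0, forall j, (j0 <= j)%N -> P j) -> nat_ultra P.
Proof.
rewrite /nat_ultra; case: cid => /= U [_ sub] [j0 Pj]; apply: sub.
by exists j0.
Qed.

(** By compactness of [[-B, B]] the image ultrafilter has a cluster point, and for an ultrafilter a
    cluster point is a limit. *)
Lemma bounded_ultra_cvg (u : nat -> R) (B : R) :
  (forall j, `|u j| <= B) -> exists l : R, u @ nat_ultra --> l.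
Proof.
move=> uB; have := @segment_compact R (- B) B => /(_ (u @ nat_ultra)) [|l [_ lcl]].
  apply: filterS (filterT : nat_ultra setT) => j _ /=.
  by rewrite in_itv /= -ler_norml.
exists l => V Vl; have [//|VC] := in_ultra_setVsetC (u @^-1` V) nat_ultra_ultra.
by have [x [/= VCx Vx]] := lcl (~` V) V VC Vl.
Qed.

Definition bounded_seq (u : nat -> C) := exists B : R, forall j, nm (u j) <= B.

(* A limit along a fixed nonprincipal ultrafilter: it is linear and norm
   decreasing on all bounded sequences, so no convergence has to be proved. *)
Definition blim (u : nat -> C) : C :=
  lim ((fun j => Re (u j)) @ nat_ultra) +i* lim ((fun j => Im (u j)) @ nat_ultra).

Lemma blim_cvg u : bounded_seq u ->
  (fun j => Re (u j)) @ nat_ultra --> Re (blim u) /\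
  (fun j => Im (u j)) @ nat_ultra --> Im (blim u).
Proof.
move=> [B uB].
have [|l lP] := @bounded_ultra_cvg (fun j => Re (u j)) B.
  by move=> j; apply: le_trans (nm_Re _) (uB j).
have [|k kP] := @bounded_ultra_cvg (fun j => Im (u j)) B.
  by move=> j; apply: le_trans (nm_Im _) (uB j).
by rewrite /blim /=; split; [rewrite (cvg_lim _ lP)|rewrite (cvg_lim _ kP)].
Qed.

Lemma blim_unique u (l : C) : (fun j => Re (u j)) @ nat_ultra --> Re l ->
  (fun j => Im (u j)) @ nat_ultra --> Im l -> blim u = l.
Proof.
move=> ul1 ul2; apply: complex_ext; rewrite /blim /=.
  by rewrite (cvg_lim _ ul1).
by rewrite (cvg_lim _ ul2).
Qed.

Lemma bounded_seqD u v : bounded_seq u -> bounded_seq v ->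
  bounded_seq (fun j => u j + v j).
Proof.
move=> [A uA] [B vB]; exists (A + B) => j.
exact: le_trans (nmD _ _) (lerD (uA j) (vB j)).
Qed.

Lemma bounded_seqZ c u : bounded_seq u -> bounded_seq (fun j => c * u j).
Proof. by move=> [A uA]; exists (nm c * A) => j; rewrite nmM ler_wpM2l ?nm_ge0. Qed.

Lemma bounded_seq_cst c : bounded_seq (fun=> c).
Proof. by exists (nm c). Qed.

Lemma blimD u v : bounded_seq u -> bounded_seq v ->
  blim (fun j => u j + v j) = blim u + blim v.
Proof.
move=> /blim_cvg[u1 u2] /blim_cvg[v1 v2]; apply: blim_unique.
  by rewrite cReD; under eq_fun do rewrite cReD; apply: cvgD.
by rewrite cImD; under eq_fun do rewrite cImD; apply: cvgD.
Qed.

Lemma blimZ c u : bounded_seq u -> blim (fun j => c * u j) = c * blim u.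
Proof.
move=> /blim_cvg[u1 u2]; apply: blim_unique.
  rewrite cReM; under eq_fun do rewrite cReM.
  by apply: cvgB; apply: cvgM => //; exact: cvg_cst.
rewrite cImM; under eq_fun do rewrite cImM.
by apply: cvgD; apply: cvgM => //; exact: cvg_cst.
Qed.

Lemma blim_cst c : blim (fun=> c) = c.
Proof. by apply: blim_unique; exact: cvg_cst. Qed.

Lemma blim_sum (I : Type) (s : seq I) (u : I -> nat -> C) :
  (forall i, bounded_seq (u i)) ->
  bounded_seq (fun j => \sum_(i <- s) u i j) /\
  blim (fun j => \sum_(i <- s) u i j) = \sum_(i <- s) blim (u i).
Proof.
move=> ub; elim: s => [|i s [IH1 IH2]].
  rewrite big_nil; under eq_fun do rewrite big_nil.
  by split; [exact: bounded_seq_cst|exact: blim_cst].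
rewrite big_cons; under eq_fun do rewrite big_cons.
by split; [exact: bounded_seqD|rewrite blimD // IH2].
Qed.

Lemma blim_le u (B : R) : bounded_seq u ->
  (exists j0, forall j, (j0 <= j)%N -> nm (u j) <= B) -> nm (blim u) <= B.
Proof.
move=> /blim_cvg[u1 u2] uB.
have B0 : 0 <= B by case: uB => j0 /(_ j0 (leqnn _)); apply: le_trans; exact: nm_ge0.
rewrite -(ler_pXn2r (_ : 0 < 2)%N) ?nnegrE ?nm_ge0 // nm_sqr.
have cv : (fun j => Re (u j) ^+ 2 + Im (u j) ^+ 2) @ nat_ultra -->
   Re (blim u) ^+ 2 + Im (blim u) ^+ 2.
  by apply: cvgD; rewrite !expr2; under eq_fun do rewrite expr2; exact: cvgM.
rewrite -(cvg_lim _ cv) //; apply: limr_le; first by apply/cvg_ex; eexists; exact: cv.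
apply: nat_ultra_near; case: uB => j0 H; exists j0 => j /H.
by rewrite -nm_sqr ler_pXn2r ?nnegrE ?nm_ge0.
Qed.

Lemma blim_eq u l : bounded_seq u ->
  (forall eps : R, 0 < eps -> exists j0, forall j, (j0 <= j)%N -> nm (u j - l) <= eps) ->
  blim u = l.
Proof.
move=> ub H; apply/eqP; rewrite -subr_eq0 -nm_eq0; apply/eqP/le_anti.
rewrite nm_ge0 andbT; apply/ler_addgt0Pl => e e0; rewrite addr0.
rewrite -[blim u - l]/(blim u + - l) -[- l]blim_cst -blimD //; last exact: bounded_seq_cst.
apply: blim_le; last exact: H.
by apply: bounded_seqD => //; exact: bounded_seq_cst.
Qed.

End BoundedLimit.

(** * Goursat's theorem for trapezoid sums *)

Section Goursat.
Variable R : realType.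
Local Notation C := R[i].
Local Notation Re := (@complex.Re R).
Local Notation Im := (@complex.Im R).
Implicit Types (f g : C -> C) (p q z w A B : C).

(* Trapezoid sum of f along [p, q] with 2^j equal steps. *)
Fixpoint trap f j p q : C :=
  if j is j'.+1 then trap f j' p ((p + q) / 2) + trap f j' ((p + q) / 2) q
  else (f p + f q) / 2 * (q - p).

Lemma trapC f j p q : trap f j q p = - trap f j p q.
Proof.
elim: j p q => [|j IH] p q /=; first by ring.
by rewrite [q + p]addrC (IH ((p + q) / 2) q) (IH p ((p + q) / 2)); ring.
Qed.

Lemma trapD f g j p q :
  trap (fun z => f z + g z) j p q = trap f j p q + trap g j p q.
Proof. by elim: j p q => [|j IH] p q /=; [ring|rewrite !IH; ring]. Qed.

(** Exactness at every level [j] is what lets [goursat] subtract the tangent map without error. *)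
Lemma trap_affine (a b : C) j p q :
  trap (fun z => a + b * z) j p q = (a + b * ((p + q) / 2)) * (q - p).
Proof.
by elim: j p q => [|j IH] p q /=; [|rewrite !IH]; field.
Qed.

Lemma trap_le f (D : C -> Prop) (M : R) j p q :
  (forall x y, D x -> D y -> D ((x + y) / 2)) -> (forall x, D x -> nm (f x) <= M) ->
  D p -> D q -> nm (trap f j p q) <= M * nm (q - p).
Proof.
move=> Dm DM; elim: j p q => [|j IH] p q Dp Dq /=.
  rewrite nmM ler_wpM2r ?nm_ge0 // nmM nmV nm_nat ler_pdivrMr //.
  by rewrite mulr_natr mulr2n; apply: le_trans (nmD _ _) (lerD _ _); exact: DM.
have Dpq := Dm _ _ Dp Dq.
apply: le_trans (nmD _ _) _; apply: le_trans (lerD (IH _ _ Dp Dpq) (IH _ _ Dpq Dq)) _.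
have -> : (p + q) / 2 - p = (q - p) / 2 by field.
have -> : q - (p + q) / 2 = (q - p) / 2 by field.
by rewrite nmM nmV nm_nat; lra.
Qed.

Lemma trap_step f j p q m : m = (p + q) / 2 ->
  trap f j.+1 p q = trap f j p m + trap f j m q.
Proof. by move=> ->. Qed.

Definition oint f j z A B : C :=
  trap f j z (z + A) + trap f j (z + A) (z + A + B) +
  trap f j (z + A + B) (z + B) + trap f j (z + B) z.

(** One more level on an edge is the lower level on its two halves, so the inner edges cancel
    exactly, with no limit taken. *)
Lemma oint_split f j z A B : oint f j.+1 z A B =
  oint f j z (A / 2) (B / 2) + oint f j (z + A / 2) (A / 2) (B / 2) +
  oint f j (z + B / 2) (A / 2) (B / 2) + oint f j (z + A / 2 + B / 2) (A / 2) (B / 2).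
Proof.
rewrite /oint.
rewrite (@trap_step f j z (z + A) (z + A / 2)); last by field.
rewrite (@trap_step f j (z + A) (z + A + B) (z + A + B / 2)); last by field.
rewrite (@trap_step f j (z + A + B) (z + B) (z + A / 2 + B)); last by field.
rewrite (@trap_step f j (z + B) z (z + B / 2)); last by field.
have -> : z + A / 2 + A / 2 = z + A by field.
have -> : z + B / 2 + B / 2 = z + B by field.
have -> : z + B / 2 + A / 2 = z + A / 2 + B / 2 by ring.
have -> : z + A / 2 + B / 2 + B / 2 = z + A / 2 + B by field.
have -> : z + A / 2 + B / 2 + A / 2 = z + A + B / 2 by field.
have -> : z + A + B / 2 + B / 2 = z + A + B by field.
rewrite (trapC f j (z + A / 2) (z + A / 2 + B / 2)).
rewrite (trapC f j (z + A / 2 + B / 2) (z + A / 2 + B)).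
rewrite (trapC f j (z + B / 2) (z + A / 2 + B / 2)).
rewrite (trapC f j (z + A / 2 + B / 2) (z + A + B / 2)).
ring.
Qed.

Lemma ointD f g j z A B :
  oint (fun z => f z + g z) j z A B = oint f j z A B + oint g j z A B.
Proof. by rewrite /oint !trapD; ring. Qed.

Lemma oint_affine (a b : C) j z A B : oint (fun z => a + b * z) j z A B = 0.
Proof. by rewrite /oint !trap_affine; field. Qed.

Definition in_pgram z A B w := exists s t : R,
  [/\ 0 <= s <= 1, 0 <= t <= 1 & w = z + s%:C * A + t%:C * B].

Lemma in_pgram_mid z A B p q : in_pgram z A B p -> in_pgram z A B q ->
  in_pgram z A B ((p + q) / 2).
Proof.
move=> [s [t [s1 t1 ->]]] [s' [t' [s2 t2 ->]]].
exists ((s + s') / 2), ((t + t') / 2); split; [lra|lra|].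
by rewrite !rmorphM !rmorphD fmorphV rmorph_nat; field.
Qed.

Lemma oint_le f (M : R) j z A B : (forall w, in_pgram z A B w -> nm (f w) <= M) ->
  nm (oint f j z A B) <= 2 * M * (nm A + nm B).
Proof.
move=> fM.
have c p q := @trap_le f (in_pgram z A B) M j p q (@in_pgram_mid z A B) fM.
have d1 : in_pgram z A B z by exists 0, 0; split; [lra|lra|rewrite !mul0r !addr0].
have d2 : in_pgram z A B (z + A).
  by exists 1, 0; split; [lra|lra|rewrite !mul0r mul1r !addr0].
have d3 : in_pgram z A B (z + A + B).
  by exists 1, 1; split; [lra|lra|rewrite !mul1r].
have d4 : in_pgram z A B (z + B).
  by exists 0, 1; split; [lra|lra|rewrite !mul1r mul0r addr0].
have := c _ _ d1 d2; have := c _ _ d2 d3; have := c _ _ d3 d4; have := c _ _ d4 d1.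
have -> : nm (z - (z + B)) = nm B by rewrite nmBC addrAC subrr add0r.
have -> : nm (z + B - (z + A + B)) = nm A.
  by rewrite nmBC; congr nm; ring.
have -> : z + A + B - (z + A) = B by ring.
have -> : z + A - z = A by ring.
have := nmD (trap f j z (z + A)) (trap f j (z + A) (z + A + B)).
have := nmD (trap f j z (z + A) + trap f j (z + A) (z + A + B))
            (trap f j (z + A + B) (z + B)).
have := nmD (trap f j z (z + A) + trap f j (z + A) (z + A + B) +
             trap f j (z + A + B) (z + B)) (trap f j (z + B) z).
rewrite -/(oint f j z A B); lra.
Qed.

Definition ev (P : nat -> Prop) := exists j0, forall j, (j0 <= j)%N -> P j.

Lemma ev_and P Q : ev P -> ev Q -> ev (fun j => P j /\ Q j).
Proof.
move=> [a Pa] [b Qb]; exists (maxn a b) => j; rewrite geq_max => /andP[aj bj].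
by split; [exact: Pa|exact: Qb].
Qed.

Lemma ev_impl (P Q : nat -> Prop) : (forall j, P j -> Q j) -> ev P -> ev Q.
Proof. by move=> PQ [j0 Pj]; exists j0 => j /Pj /PQ. Qed.

Lemma ev_shift (P Q : nat -> Prop) : (forall j, P j -> Q j.+1) -> ev P -> ev Q.
Proof. by move=> PQ [j0 Pj]; exists j0.+1 => -[//|j] /Pj /PQ. Qed.

(* Bisection, with the parallelogram cut into four at each step; a degenerate
   parallelogram is allowed. *)
Lemma goursat f z A B : (forall w, in_pgram z A B w -> differentiable f w) ->
  forall eps : R, 0 < eps -> ev (fun j => nm (oint f j z A B) < eps).
Proof.
move=> df eps e0; apply: contrapT => nev.
pose c (n : nat) (s t : R) := z + s%:C * A + t%:C * B.
pose An n := A / (2 ^+ n); pose Bn n := B / (2 ^+ n).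
(* The sums are not known to converge in [j], so a bad parallelogram is one whose sums fail to be
   eventually small; the threshold [eps / 4 ^ n] matches the number of parts at depth [n]. *)
pose bad n (st : R * R) := ~ ev (fun j =>
  nm (oint f j (c n st.1 st.2) (An n) (Bn n)) < eps / 4 ^+ n).
have half n (st : R * R) : bad n st -> exists st' : R * R,
   [/\ bad n.+1 st', st'.1 = st.1 \/ st'.1 = st.1 + (2 ^+ n.+1)^-1 &
       st'.2 = st.2 \/ st'.2 = st.2 + (2 ^+ n.+1)^-1].
  move=> bd; apply: contrapT => H; apply: bd.
  have good s' t' : s' = st.1 \/ s' = st.1 + (2 ^+ n.+1)^-1 ->
      t' = st.2 \/ t' = st.2 + (2 ^+ n.+1)^-1 ->
      ev (fun j => nm (oint f j (c n.+1 s' t') (An n.+1) (Bn n.+1)) < eps / 4 ^+ n.+1).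
    by move=> h1 h2; apply: contrapT => nb; apply: H; exists (s', t').
  have g1 := good _ _ (or_introl erefl) (or_introl erefl).
  have g2 := good _ _ (or_intror erefl) (or_introl erefl).
  have g3 := good _ _ (or_introl erefl) (or_intror erefl).
  have g4 := good _ _ (or_intror erefl) (or_intror erefl).
  apply: ev_shift (ev_and (ev_and g1 g2) (ev_and g3 g4)) => j [[h1 h2] [h3 h4]].
  have A2 : An n / 2 = An n.+1 by rewrite /An exprSr invfM mulrA.
  have B2 : Bn n / 2 = Bn n.+1 by rewrite /Bn exprSr invfM mulrA.
  rewrite oint_split A2 B2.
  have E (x : R) : (x + (2 ^+ n.+1)^-1)%:C = x%:C + (2 ^+ n.+1)^-1.
    by rewrite rmorphD fmorphV rmorphXn rmorph_nat.
  move: h1 h2 h3 h4; rewrite /c !E.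
  have -> : z + (st.1%:C + (2 ^+ n.+1)^-1) * A + st.2%:C * B =
            z + st.1%:C * A + st.2%:C * B + An n.+1 by rewrite /An; ring.
  have -> : z + st.1%:C * A + (st.2%:C + (2 ^+ n.+1)^-1) * B =
            z + st.1%:C * A + st.2%:C * B + Bn n.+1 by rewrite /Bn; ring.
  have -> : z + (st.1%:C + (2 ^+ n.+1)^-1) * A + (st.2%:C + (2 ^+ n.+1)^-1) * B =
            z + st.1%:C * A + st.2%:C * B + An n.+1 + Bn n.+1 by rewrite /An /Bn; ring.
  have -> : eps / 4 ^+ n = 4 * (eps / 4 ^+ n.+1) by rewrite exprS; field; rewrite expf_neq0.
  set a := oint _ _ _ _ _; set b := oint _ _ _ _ _; set a' := oint _ _ _ _ _.
  set b' := oint _ _ _ _ _ => h1 h2 h3 h4.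
  by have := nmD a b; have := nmD (a + b) a'; have := nmD (a + b + a') b'; lra.
have /choice[step stepP] : forall nst : nat * (R * R), exists st', bad nst.1 nst.2 ->
   [/\ bad nst.1.+1 st', st'.1 = nst.2.1 \/ st'.1 = nst.2.1 + (2 ^+ nst.1.+1)^-1 &
       st'.2 = nst.2.2 \/ st'.2 = nst.2.2 + (2 ^+ nst.1.+1)^-1].
  move=> [n st] /=; have [bd|nb] := pselect (bad n st); last by exists st.
  by have [st' ?] := half n st bd; exists st'.
pose fix s n : R * R := if n is m.+1 then step (m, s m) else (0, 0).
have sbad n : bad n (s n).
  elim: n => [|n IH] /=; last by case: (stepP (n, s n) IH).
  rewrite /bad /c /An /Bn /= !mul0r !addr0 !expr0 !divr1; exact: nev.
pose h n : R := (2 ^+ n)^-1.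
have h2 n : h n = h n.+1 + h n.+1.
  by rewrite /h exprS; field; rewrite expf_neq0.
have h0 n : 0 <= h n by rewrite invr_ge0 exprn_ge0.
(* A corner coordinate grows by 0 or by the new side length, so all the nested intervals share the
   point [sup (range x)]. *)
have lim1 (x : nat -> R) : x 0 = 0 ->
   (forall n, x n.+1 = x n \/ x n.+1 = x n + h n.+1) ->
   exists l, forall n, x n <= l <= x n + h n.
  move=> x0 xs.
  have mono m n : (x m <= x (m + n)%N) /\ (x (m + n)%N + h (m + n)%N <= x m + h m).
    elim: n => [|n [IH1 IH2]]; first by rewrite addn0.
    rewrite addnS; have := h0 (m + n).+1; have := h2 (m + n)%N.
    by case: (xs (m + n)%N) => ->; split; lra.
  have cmp m n : x m <= x n + h n.
    have [mn|nm'] := leqP m n.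
      by have [+ _] := mono m (n - m)%N; rewrite subnKC // => e; have := h0 n; lra.
    by have [_ +] := mono n (m - n)%N; rewrite subnKC ?(ltnW nm') // => e; have := h0 m; lra.
  exists (sup (range x)) => n; apply/andP; split.
    apply: sup_upper_bound; last by exists n.
    split; first by exists (x 0); exists 0.
    by exists (x 0 + h 0) => _ [m _ <-]; exact: cmp.
  by apply: ge_sup; [exists (x 0); exists 0|move=> _ [m _ <-]; exact: cmp].
have [//||s1 s1P] := lim1 (fun n => (s n).1).
  by move=> n; case: (stepP (n, s n) (sbad n)).
have [//||t1 t1P] := lim1 (fun n => (s n).2).
  by move=> n; case: (stepP (n, s n) (sbad n)).
pose p := z + s1%:C * A + t1%:C * B.
have dp : differentiable f p.
  apply: df; exists s1, t1; split => //.
    by have := s1P 0; rewrite /h /= expr0 invr1 add0r.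
  by have := t1P 0; rewrite /h /= expr0 invr1 add0r.
have [d dP] := differentiable_nm dp.
pose S := nm A + nm B; have S0 : 0 <= S by rewrite addr_ge0 ?nm_ge0.
(* Perimeter times remainder at depth [n] is of order [et S^2 / 4^n]; the added 1 covers the
   degenerate case [S = 0]. *)
pose et := eps / (4 * (S * S + 1)).
have SS : 0 <= S * S by rewrite mulr_ge0.
have et0 : 0 < et by rewrite divr_gt0 //; lra.
have [del d0 {}dP] := dP et et0.
have [n nP] : exists n, S * h n < del.
  have [n nP] := @ltr_add_invr R 0 (del / (S + 1)) ltac:(by rewrite divr_gt0 //; lra).
  exists n; rewrite add0r in nP.
  have hn : h n <= n.+1%:R^-1.
    rewrite /h lef_pV2 ?posrE ?exprn_gt0 // -natrX ler_nat; exact: ltn_expl.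
  have : (S + 1) * h n < del.
    rewrite mulrC -ltr_pdivlMr; [exact: le_lt_trans hn nP|lra].
  by have := h0 n; lra.
apply: (sbad n); exists 0%N => j _.
pose cn := c n (s n).1 (s n).2.
have near w : in_pgram cn (An n) (Bn n) w -> nm (w - p) <= S * h n.
  move=> [s' [t' [s'P t'P ->]]].
  have -> : cn + s'%:C * An n + t'%:C * Bn n - p =
     ((s n).1 + s' * h n - s1)%:C * A + ((s n).2 + t' * h n - t1)%:C * B.
    rewrite /cn /c /p /An /Bn !rmorphD !rmorphM !rmorphN fmorphV rmorphXn rmorph_nat.
    by ring.
  apply: le_trans (nmD _ _) _; rewrite !nmM !nmR /S mulrDl.
  have b1 : `|(s n).1 + s' * h n - s1| <= h n.
    have := s1P n; have := h0 n; rewrite ler_norml => hh ?.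
    have : 0 <= s' * h n <= h n by rewrite mulr_ge0 ?ler_piMl //; lra.
    lra.
  have b2 : `|(s n).2 + t' * h n - t1| <= h n.
    have := t1P n; have := h0 n; rewrite ler_norml => hh ?.
    have : 0 <= t' * h n <= h n by rewrite mulr_ge0 ?ler_piMl //; lra.
    lra.
  by apply: lerD; rewrite mulrC ler_wpM2l ?nm_ge0.
pose aff w := (f p - d * p) + d * w.
pose g w := f w - aff w.
have -> : oint f j (c n (s n).1 (s n).2) (An n) (Bn n) = oint g j cn (An n) (Bn n).
  have -> : f = (fun w => g w + aff w) by apply/funext => w; rewrite /g subrK.
  by rewrite ointD oint_affine addr0.
apply: le_lt_trans (_ : 2 * (et * (S * h n)) * (nm (An n) + nm (Bn n)) < _).
  apply: oint_le => w /near wp.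
  have := dP (w - p) (le_lt_trans wp nP).
  rewrite [p + _]addrC subrK => H; apply: le_trans (_ : et * nm (w - p) <= _).
    by rewrite (_ : g w = f w - f p - d * (w - p)) // /g /aff; ring.
  by rewrite ler_pM2l.
have -> : nm (An n) = nm A * h n by rewrite nmM nmV nmX nm_nat.
have -> : nm (Bn n) = nm B * h n by rewrite nmM nmV nmX nm_nat.
have -> : eps / 4 ^+ n = (eps * h n) * h n.
  by rewrite /h -mulrA -invfM -exprMn -natrM.
have -> : 2 * (et * (S * h n)) * (nm A * h n + nm B * h n) =
   (2 * et * (S * S) * h n) * h n by rewrite /S; ring.
have hp : 0 < h n by rewrite invr_gt0 exprn_gt0.
rewrite !ltr_pM2r // /et.
have -> : 2 * (eps / (4 * (S * S + 1))) * (S * S) = eps * ((S * S) / (2 * (S * S + 1))).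
  by field; lra.
by rewrite -[ltRHS]mulr1 ltr_pM2l // ltr_pdivrMr; lra.
Qed.

End Goursat.

(** * Goursat's theorem with one removable singularity *)

Section Removable.
Variable R : realType.
Local Notation C := R[i].
Local Notation Re := (@complex.Re R).
Local Notation Im := (@complex.Im R).

(* The exceptional point sits at relative coordinates in {1/3, 2/3}, a set
   stable under bisection, so it never meets a dyadic subdivision line. *)
Lemma goursat_removable_le (f : C -> C) (w : C) (r M : R) :
  0 < r -> (forall v, nm (v - w) < r -> nm (f v) <= M) ->
  forall m z (a b : R) (sx ty : bool), 0 < a -> 0 < b ->
  w = z + ((1 + sx%:R) / 3)%:C * a%:C + ((1 + ty%:R) / 3)%:C * (0 +i* b) ->
  (a + b) / 2 ^+ m < r ->
  (forall v, in_pgram z a%:C (0 +i* b) v -> v <> w -> differentiable f v) ->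
  forall eps : R, 0 < eps ->
  ev (fun j => nm (oint f j z a%:C (0 +i* b)) < eps + 2 * M * (a + b) / 2 ^+ m).
Proof.
move=> r0 fM; have M0 : 0 <= M.
  by apply: le_trans (fM w _); rewrite ?nm_ge0 // subrr nm0.
elim=> [|m IH] z a b sx ty a0 b0 wE abr df eps e0.
  exists 0%N => j _; apply: le_lt_trans (_ : 2 * M * (a + b) < _); last first.
    by rewrite expr0 divr1; lra.
  have -> : a + b = nm (a%:C : C) + nm (0 +i* b : C).
    by rewrite nmR gtr0_norm // nmE /= expr0n add0r sqrtr_sqr gtr0_norm.
  apply: oint_le => v [s [t [s1 t1 ->]]]; apply: fM.
  have -> : z + s%:C * a%:C + t%:C * (0 +i* b) - w =
     ((s - (1 + sx%:R) / 3) * a) +i* ((t - (1 + ty%:R) / 3) * b).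
    by rewrite wE; apply: complex_ext; rewrite !(cReD, cImD, cReN, cImN, cReM, cImM) /=; ring.
  apply: le_lt_trans (nm_le_ReIm _) _; rewrite /= !normrM !(gtr0_norm a0) (gtr0_norm b0).
  apply: le_lt_trans abr; rewrite expr0 divr1; apply: lerD.
    by apply: ler_piMl; [exact: ltW|rewrite ler_norml; case: sx {wE} => /=; lra].
  by apply: ler_piMl; [exact: ltW|rewrite ler_norml; case: ty {wE} => /=; lra].
pose cn (x y : bool) : C := z + (x%:R / 2)%:C * a%:C + (y%:R / 2)%:C * (0 +i* b).
have sub x y v : in_pgram (cn x y) (a / 2)%:C (0 +i* (b / 2)) v ->
    in_pgram z a%:C (0 +i* b) v.
  move=> [s [t [s1 t1 ->]]].
  exists (x%:R / 2 + s / 2), (y%:R / 2 + t / 2); split; [case: x => /=; lra|case: y => /=; lra|].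
  by apply: complex_ext; rewrite !(cReD, cImD, cReM, cImM) /=; ring.
(* A relative coordinate 1/3 or 2/3 determines the half that contains it, so [w] avoids the three
   other quarters. *)
have third (u v : bool) (p : R) : 0 <= p <= 1 -> u%:R / 2 + p / 2 = (1 + v%:R) / 3 -> u = v.
  by clear; case: u; case: v => //= h1 h2; exfalso; lra.
have other x y : ~~ ((x == sx) && (y == ty)) ->
    ev (fun j => nm (oint f j (cn x y) (a / 2)%:C (0 +i* (b / 2))) < eps / 4).
  move=> nxy; apply: goursat; last by rewrite divr_gt0.
  move=> v vin; apply: df; first exact: sub vin.
  case: vin => s [t [s1 t1 ->]] vw; move: (congr1 Re vw) (congr1 Im vw); rewrite wE /cn.
  rewrite !(cReD, cImD, cReM, cImM) /= !(mulr0, mul0r, subr0, addr0, add0r) => h1 h2.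
  have {}h1 : x%:R / 2 + s / 2 = (1 + sx%:R) / 3.
    by apply: (mulIf (lt0r_neq0 a0)); lra.
  have {}h2 : y%:R / 2 + t / 2 = (1 + ty%:R) / 3.
    by apply: (mulIf (lt0r_neq0 b0)); lra.
  by move: nxy; rewrite (third _ _ _ s1 h1) (third _ _ _ t1 h2) !eqxx.
have main : ev (fun j => nm (oint f j (cn sx ty) (a / 2)%:C (0 +i* (b / 2))) <
     eps / 4 + 2 * M * (a + b) / 2 ^+ m.+1).
  have -> : 2 * M * (a + b) / 2 ^+ m.+1 = 2 * M * (a / 2 + b / 2) / 2 ^+ m.
    by rewrite exprS; field; rewrite expf_neq0.
  (* Rescaling the half that contains the point exchanges the relative coordinates 1/3 and 2/3. *)
  apply: (IH _ _ _ (~~ sx) (~~ ty)); rewrite ?divr_gt0 //.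
  - have nb (u : bool) : (~~ u)%:R = 1 - u%:R :> R by case: u; rewrite ?subrr ?subr0.
    rewrite wE /cn !nb; clear.
    by apply: complex_ext; rewrite !(cReD, cImD, cReM, cImM) /=; field.
  - have -> // : (a / 2 + b / 2) / 2 ^+ m = (a + b) / 2 ^+ m.+1.
    by rewrite exprS; field; rewrite expf_neq0.
  - by move=> v vin; apply: df; exact: sub vin.
have all4 x y : ev (fun j => nm (oint f j (cn x y) (a / 2)%:C (0 +i* (b / 2))) <
     eps / 4 + if (x == sx) && (y == ty) then 2 * M * (a + b) / 2 ^+ m.+1 else 0).
  case: ifPn => [/andP[/eqP -> /eqP ->]|/other]; first exact: main.
  by rewrite addr0.
apply: ev_shift (ev_and (ev_and (all4 false false) (all4 true false))
                        (ev_and (all4 false true) (all4 true true))) => j.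
have i2 : (2^-1 : C) = (2^-1 : R)%:C by rewrite fmorphV rmorph_nat.
have A2 : (a%:C : C) / 2 = (a / 2)%:C by rewrite i2 rmorphM.
have B2 : (0 +i* b : C) / 2 = 0 +i* (b / 2).
  by rewrite i2; apply: complex_ext; rewrite !(cReM, cImM) /=; ring.
rewrite oint_split A2 B2.
have -> : z + (a / 2)%:C + 0 +i* (b / 2) = cn true true.
  by apply: complex_ext; rewrite /cn !(cReD, cImD, cReM, cImM) /=; ring.
have -> : z + (a / 2)%:C = cn true false.
  by apply: complex_ext; rewrite /cn !(cReD, cImD, cReM, cImM) /=; ring.
have -> : z + 0 +i* (b / 2) = cn false true.
  by apply: complex_ext; rewrite /cn !(cReD, cImD, cReM, cImM) /=; ring.
have {1}-> : z = cn false false.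
  by apply: complex_ext; rewrite /cn !(cReD, cImD, cReM, cImM) /=; ring.
set o1 := oint _ _ _ _ _; set o2 := oint _ _ _ _ _.
set o3 := oint _ _ _ _ _; set o4 := oint _ _ _ _ _ => -[[h1 h2] [h3 h4]].
have := nmD o1 o2; have := nmD (o1 + o2) o3; have := nmD (o1 + o2 + o3) o4.
by move: h1 h2 h3 h4; clear wE other main all4; case: sx; case: ty => /=; lra.
Qed.

(** The part around the exceptional point contributes at most [2 M (1 + b) / 2 ^ m], made small by
    the depth [m]. *)
Lemma goursat_removable (f : C -> C) (z : C) (b r M : R) :
  0 < b -> 0 < r ->
  let w := z + (3^-1)%:C + (3^-1)%:C * (0 +i* b) in
  (forall v, nm (v - w) < r -> nm (f v) <= M) ->
  (forall v, in_pgram z 1 (0 +i* b) v -> v <> w -> differentiable f v) ->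
  forall eps : R, 0 < eps -> ev (fun j => nm (oint f j z 1 (0 +i* b)) < eps).
Proof.
move=> b0 r0 w fM df eps e0.
have M0 : 0 <= M.
  by apply: le_trans (fM w _); rewrite ?nm_ge0 // subrr nm0.
pose c := Num.min r (eps / 2 / (2 * M + 1)).
have c0 : 0 < c by rewrite lt_min r0 !divr_gt0 //; lra.
have [m mP] := @ltr_add_invr R 0 (c / (1 + b)) ltac:(by rewrite divr_gt0 //; lra).
rewrite add0r in mP.
have hm : (1 + b) / 2 ^+ m < c.
  rewrite mulrC -ltr_pdivlMr; last lra.
  apply: le_lt_trans mP; rewrite lef_pV2 ?posrE ?exprn_gt0 // -natrX ler_nat.
  exact: ltn_expl.
have := @goursat_removable_le f w r M r0 fM m z 1 b false false ltr01 b0.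
move=> /(_ _ _ _ (eps / 2)) H.
apply: ev_impl (H _ _ _ _) => //.
- move=> j hj; apply: lt_le_trans hj _.
  have : (1 + b) / 2 ^+ m <= eps / 2 / (2 * M + 1).
    by apply: le_trans (ltW hm) _; rewrite ge_min lexx orbT.
  rewrite ler_pdivlMr; last lra.
  set x := (1 + b) / 2 ^+ m => xe.
  have -> : 2 * M * (1 + b) / 2 ^+ m = 2 * M * x by rewrite /x; ring.
  have x0 : 0 <= x by rewrite divr_ge0 ?exprn_ge0 //; lra.
  by lra.
- by rewrite /w addr0 div1r mulr1.
- by apply: lt_le_trans hm _; rewrite ge_min lexx.
- by rewrite divr_gt0.
Qed.

End Removable.

(** * Dyadic averages over a period *)

Section Averages.
Variable R : realType.
Local Notation C := R[i].
Local Notation Re := (@complex.Re R).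
Local Notation Im := (@complex.Im R).
Implicit Types (f g : C -> C) (z w B : C).

Definition avg j z g : C :=
  (2 ^ j)%:R^-1 * \sum_(k < 2 ^ j) g (z + k%:R / (2 ^ j)%:R).

Lemma natr2X_neq0 j : (2 ^ j)%:R != 0 :> C.
Proof. by rewrite pnatr_eq0 expn_eq0. Qed.

Lemma trap_sum g j p d : trap g j p (p + d) =
  \sum_(0 <= k < 2 ^ j) (g (p + d * k%:R / (2 ^ j)%:R) + g (p + d * k.+1%:R / (2 ^ j)%:R)) / 2 *
    (d / (2 ^ j)%:R).
Proof.
elim: j p d => [|j IH] p d.
  rewrite expn0 big_nat1 /= !divr1 mulr0 mulr1 addr0; ring.
rewrite (@trap_step _ _ _ _ _ (p + d / 2)); last by field.
have -> : p + d = p + d / 2 + d / 2 by field.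
rewrite !IH expnS mul2n -addnn [RHS](big_cat_nat (n := 2 ^ j)) ?leq_addr //=.
have K0 := natr2X_neq0 j.
have KK : (2 ^ j + 2 ^ j)%:R = 2 * (2 ^ j)%:R :> C by rewrite natrD; ring.
congr (_ + _).
  apply: eq_big_nat => k _; rewrite KK invfM.
  by congr ((g _ + g _) / 2 * _); ring.
rewrite -[X in \sum_(X <= i < 2 ^ j + 2 ^ j) _]add0n big_addn addnK.
apply: eq_big_nat => k _; rewrite KK -addSn !natrD.
by congr ((g _ + g _) / 2 * _); field.
Qed.

(** Both endpoints of the period carry the same value, so the half weights of the trapezoid rule
    merge. *)
Lemma trap_avg g j z : (forall z, g (z + 1) = g z) -> trap g j z (z + 1) = avg j z g.
Proof.
move=> per; rewrite trap_sum /avg big_mkord.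
under eq_bigr do rewrite !mul1r.
rewrite -mulr_suml mulrC; congr (_ * _).
rewrite -mulr_suml big_split /=.
suff -> : \sum_(i < 2 ^ j) g (z + i.+1%:R / (2 ^ j)%:R) =
          \sum_(i < 2 ^ j) g (z + i%:R / (2 ^ j)%:R) by field.
have : \sum_(i < (2 ^ j).+1) g (z + i%:R / (2 ^ j)%:R) =
    g (z + 0 / (2 ^ j)%:R) + \sum_(i < 2 ^ j) g (z + i.+1%:R / (2 ^ j)%:R).
  by rewrite big_ord_recl.
rewrite big_ord_recr /= divff ?natr2X_neq0 // per mul0r addr0 addrC => /addrI ->.
by [].
Qed.

Lemma trap_per g j p q : (forall z, g (z + 1) = g z) ->
  trap g j (p + 1) (q + 1) = trap g j p q.
Proof.
move=> per; elim: j p q => [|j IH] p q /=; first by rewrite !per; congr (_ * _); ring.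
have -> : (p + 1 + (q + 1)) / 2 = (p + q) / 2 + 1 by field.
by rewrite !IH.
Qed.

(** The sides in direction [B] differ by the period 1 and cancel. With [goursat] this says that the
    averages at [z] and [z + B] become equal. *)
Lemma oint_avg g j z B : (forall z, g (z + 1) = g z) ->
  oint g j z 1 B = avg j z g - avg j (z + B) g.
Proof.
move=> per; rewrite /oint trap_avg // [z + 1 + B]addrAC trap_per //.
by rewrite (trapC g j (z + B) (z + B + 1)) trap_avg // (trapC g j z); ring.
Qed.

Lemma avg_le g (M : R) j z : (forall x : R, nm (g (z + x%:C)) <= M) ->
  nm (avg j z g) <= M.
Proof.
move=> gM; rewrite /avg nmM nmV nm_nat mulrC ler_pdivrMr ?ltr0n ?expn_gt0 //.
apply: le_trans (nm_sum _ _ _) _.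
apply: le_trans (_ : \sum_(k < 2 ^ j) M <= _); last first.
  by rewrite sumr_const card_ord mulr_natr.
apply: ler_sum => k _.
by have := gM (k%:R / (2 ^ j)%:R); rewrite rmorphM fmorphV !rmorph_nat.
Qed.

Lemma avgD f g j z : avg j z (fun u => f u + g u) = avg j z f + avg j z g.
Proof. by rewrite /avg big_split mulrDr. Qed.

Lemma avgZ c g j z : avg j z (fun u => c * g u) = c * avg j z g.
Proof. by rewrite /avg -mulr_sumr mulrCA. Qed.

Lemma avg_sum (I : Type) (s : seq I) (F : I -> C -> C) j z :
  avg j z (fun u => \sum_(i <- s) F i u) = \sum_(i <- s) avg j z (F i).
Proof.
by rewrite /avg exchange_big /= mulr_sumr.
Qed.

Lemma eq_avg f g j z : (forall x : R, f (z + x%:C) = g (z + x%:C)) -> avg j z f = avg j z g.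
Proof.
move=> fg; rewrite /avg; congr (_ * _); apply: eq_bigr => k _.
by have := fg (k%:R / (2 ^ j)%:R); rewrite rmorphM fmorphV !rmorph_nat.
Qed.

(** A geometric sum over the powers of a [K]-th root of unity, which differs from 1 by [ce_eq1]
    because [0 < |m / K| < 1]. *)
Lemma sum_ce_root (K : nat) (m : int) : m != 0 -> (`|m| < K)%N ->
  \sum_(k < K) ce (m%:~R * (k%:R / K%:R)) = 0 :> C.
Proof.
move=> m0 mK; have Kp : (0 < K)%N by exact: leq_ltn_trans mK.
have K0 : K%:R != 0 :> C by rewrite pnatr_eq0 -lt0n.
pose x : C := ce (m%:~R / K%:R).
have xk (k : nat) : ce (m%:~R * (k%:R / K%:R)) = x ^+ k.
  by rewrite /x -ceMn; congr ce; ring.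
under eq_bigr do rewrite xk.
have x1 : x != 1.
  apply/eqP => /ce_eq1 x1; have {}x1 : m%:~R / K%:R = 0 :> C.
    apply: x1; rewrite cReMi (_ : K%:R^-1 = (K%:R^-1)%:C); last by rewrite fmorphV rmorph_nat.
    rewrite /= normrM normfV normr_nat ltr_pdivrMr ?mul1r ?ltr0n //.
    by rewrite -intr_norm -abszE ltr_nat.
  move: x1 => /eqP; rewrite mulf_eq0 invr_eq0 (negPf K0) orbF intr_eq0.
  by rewrite (negPf m0).
apply: (mulfI (_ : x - 1 != 0)); first by rewrite subr_eq0.
rewrite mulr0 -subrX1 /x -ceMn mulrCA divff // mulr1 ce_int subrr.
by [].
Qed.

Lemma avg_ce j z (m : int) : (`|m| < 2 ^ j)%N ->
  avg j z (fun u => ce (m%:~R * u)) = (m == 0)%:R.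
Proof.
move=> mj; rewrite /avg; have [->|m0] := eqVneq m 0.
  under eq_bigr do rewrite mul0r ce0.
  by rewrite sumr_const card_ord mulVf ?natr2X_neq0.
under eq_bigr do rewrite mulrDr ceD.
by rewrite -mulr_sumr sum_ce_root // !mulr0.
Qed.

End Averages.

(** * Symmetric partial sums and the Laurent expansion in a strip *)

Section SymmetricSums.
Variable V : zmodType.

Definition symsum (N : nat) (F : int -> V) : V := \sum_(k < N.*2.+1) F (k%:Z - N%:Z).

Lemma symsumS N F : symsum N.+1 F = F (- N.+1%:Z) + symsum N F + F N.+1%:Z.
Proof.
rewrite /symsum doubleS big_ord_recl big_ord_recr /= addrA; congr (_ + _ + _).
- by rewrite sub0r.
- by apply: eq_bigr => i _; congr F; rewrite /bump /=; lia.
- by congr F; rewrite /bump /=; lia.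
Qed.

Lemma symsumE N F :
  symsum N F = \sum_(k < N.+1) F k%:Z + \sum_(k < N) F (- k.+1%:Z).
Proof.
elim: N => [|N IH]; first by rewrite /symsum !big_ord1 big_ord0 subr0 addr0.
rewrite symsumS IH [X in _ = X + _]big_ord_recr [X in _ = _ + X]big_ord_recr /=.
by rewrite [LHS](AC (1*2*1)%AC ((2*4)*(3*1))%AC).
Qed.

End SymmetricSums.

Section Laurent.
Variable R : realType.
Local Notation C := R[i].
Local Notation Re := (@complex.Re R).
Local Notation Im := (@complex.Im R).
Implicit Types (z w : C).

Definition twist (f : C -> C) (m : int) z : C := f z * ce ((- m)%:~R * z).

(** The Fourier coefficient of frequency [m]: an integral over the real period, read through dyadic
    averages and [blim]. *)
Definition coef (f : C -> C) (m : int) : C := blim (fun j => avg j 0 (twist f m)).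

Lemma differentiable_ce_lin (c z : C) : differentiable (fun u : C => ce (c * u)) z.
Proof.
have d1 : differentiable (fun u : C => c * u) z by exact: differentiableM.
exact: differentiable_comp d1 (differentiable_ce _).
Qed.

Lemma differentiable_kernel (w v : C) : 1 - ce (w - v) != 0 ->
  differentiable (fun u : C => (1 - ce (w - u))^-1) v.
Proof.
move=> ne.
have d1 : differentiable (fun u : C => w - u) v.
  by apply: differentiableB; [exact: differentiable_cst|].
have d2 : differentiable (fun u : C => ce (w - u)) v.
  exact: differentiable_comp d1 (differentiable_ce _).
have d3 : differentiable (fun u : C => 1 - ce (w - u)) v.
  by apply: differentiableB d2; exact: differentiable_cst.
exact: (@differentiableV _ _ (fun u : C => 1 - ce (w - u)) v d3 ne).
Qed.

Variables (f : C -> C) (eps M : R).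
Hypothesis e0 : 0 < eps.
Hypothesis per : forall z, f (z + 1) = f z.
Hypothesis df : forall z, `|Im z| <= eps -> differentiable f z.
Hypothesis fM : forall z, `|Im z| <= eps -> nm (f z) <= M.

Let M0 : 0 <= M.
Proof. by apply: le_trans (fM (z := 0) _); rewrite ?nm_ge0 //= normr0 ltW. Qed.

Let twist_per m z : twist f m (z + 1) = twist f m z.
Proof. by rewrite /twist per mulrDr mulr1 ceD ce_int mulr1. Qed.

Let twist_le m z0 : `|Im z0| <= eps -> forall x : R,
  nm (twist f m (z0 + x%:C)) <= M * expR (2 * pi * (m%:~R * Im z0)).
Proof.
move=> z0e x; rewrite /twist nmM nm_ce cImMi cImD /= addr0.
rewrite ler_pM ?nm_ge0 ?expR_ge0 //; first by apply: fM; rewrite cImD /= addr0.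
by rewrite mulrNz mulNr mulrN opprK.
Qed.

Let bounded_twist m z0 : `|Im z0| <= eps ->
  bounded_seq (fun j => avg j z0 (twist f m)).
Proof.
move=> z0e; exists (M * expR (2 * pi * (m%:~R * Im z0))) => j.
exact/avg_le/twist_le.
Qed.

(** Contour shift: [goursat] on the parallelogram with sides 1 and [z0], possibly degenerate, which
    stays in the strip. *)
Lemma coef_base m z0 : `|Im z0| <= eps ->
  blim (fun j => avg j z0 (twist f m)) = coef f m.
Proof.
move=> z0e; have b0 : bounded_seq (fun j => avg j 0 (twist f m)).
  by apply: bounded_twist; rewrite /= normr0 ltW.
have b1 := bounded_twist m z0e.
apply/eqP; rewrite eq_sym -subr_eq0 /coef -mulN1r -blimZ // -blimD //; last exact: bounded_seqZ.
apply/eqP/blim_eq; first by apply: bounded_seqD => //; exact: bounded_seqZ.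
move=> e ep; have [|j0 H] := @goursat R (twist f m) 0 1 z0 _ e ep.
  move=> _ [s [t [s1 t1 ->]]]; apply: differentiableM; last exact: differentiable_ce_lin.
  apply: df; rewrite !cImD !cImMR /= !(mulr0, addr0, add0r) normrM.
  by apply: le_trans z0e; apply: ler_piMl; rewrite // ler_norml; lra.
exists j0 => j /H; rewrite oint_avg // add0r mulN1r subr0.
exact: ltW.
Qed.

Lemma coef_le_line m (y B : R) : `|y| <= eps ->
  (forall x : R, nm (f (x +i* y)) <= B) ->
  nm (coef f m) <= B * expR (2 * pi * (m%:~R * y)).
Proof.
move=> ye fB; rewrite -(@coef_base m (0 +i* y)) //.
apply: blim_le; first exact: bounded_twist.
exists 0%N => j _; apply: avg_le => x.
rewrite /twist nmM nm_ce cImMi cImD /= addr0 mulrNz mulNr mulrN opprK.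
rewrite ler_wpM2r ?expR_ge0 //; have := fB x; rewrite (_ : x +i* y = (0 +i* y) + x%:C) //.
by apply: complex_ext; rewrite !(cReD, cImD) /=; ring.
Qed.

Lemma coef_le m : nm (coef f m) <= M * expR (- (2 * pi * eps)) ^+ `|m|.
Proof.
(* The contour is moved to the edge of the strip on which [ce (- m z)] is small. *)
pose y : R := if (0 <= m)%R then - eps else eps.
have := @coef_le_line m y M _ _; rewrite -expRM_natl.
have -> : 2 * pi * (m%:~R * y) = `|m|%N%:R * - (2 * pi * eps).
  rewrite /y; case: (intP m) => [|n|n] /=; rewrite ?mulrNz; ring.
apply; first by rewrite /y; case: ifP => _; rewrite ?normrN ger0_norm // ltW.
move=> x; apply: fM => /=.
by rewrite /y; case: ifP => _; rewrite ?normrN ger0_norm // ltW.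
Qed.

(** The modulus of [ce (w - v)] for [v] lying [eps / 4] below [w], the lower contour of
    [laurent]. *)
Let rho : R := expR (- (pi * eps / 2)).

Let rho1 : rho < 1.
Proof. by rewrite -[ltRHS]expR0 ltr_expR oppr_lt0 !mulr_gt0 ?pi_gt0 ?invr_gt0. Qed.

Let rho0 : 0 < rho. Proof. exact: expR_gt0. Qed.

(** Numerator and denominator both vanish to first order at [w], and the derivative of the
    denominator has modulus [2 pi], so [|1 - ce (w - v)| >= |v - w|] nearby. *)
Let kernel_bounded w : `|Im w| < eps -> exists r B : R, 0 < r /\
  forall v, nm (v - w) < r -> nm ((f v - f w) / (1 - ce (w - v))) <= B.
Proof.
move=> we; have [d dP] := differentiable_nm (df (ltW we)).
have [r1 r10 H1] := dP 1 ltr01.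
have [r2 r20 H2] := @ce_derive R 0 1 ltr01.
exists (Num.min r1 r2), (nm d + 1); split; first by rewrite lt_min r10.
move=> v; rewrite lt_min => /andP[v1 v2].
have := H1 (v - w) v1; rewrite [w + _]addrC subrK mul1r => K1.
have N1 : nm (f v - f w) <= (nm d + 1) * nm (v - w).
  have := nmD (f v - f w - d * (v - w)) (d * (v - w)).
  by rewrite subrK nmM mulrDl mul1r; lra.
have := H2 (w - v); rewrite nmBC => /(_ v2); rewrite add0r ce0 !mul1r => K2.
have N2 : nm (v - w) <= nm (1 - ce (w - v)).
  rewrite [leRHS]nmBC.
  have := nmB (ce (w - v) - 1) (ce (w - v) - 1 - (2 * pi)*i * (w - v)).
  rewrite (_ : ce (w - v) - 1 - _ = (2 * pi)*i * (w - v)); last by ring.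
  rewrite nmM (_ : nm (2 * pi)*i = 2 * pi); last first.
    by rewrite nmE /= expr0n add0r sqrtr_sqr ger0_norm // mulr_ge0 // pi_ge0.
  have := nmBC w v; have : 2 * nm (v - w) <= 2 * pi * nm (v - w).
    by rewrite ler_wpM2r ?nm_ge0 //; have := pi_ge2 R; lra.
  by move=> ? ->; lra.
rewrite nmM nmV; have [->|vw] := eqVneq v w.
  by rewrite !subrr nm0 mul0r addr_ge0 ?nm_ge0.
have p0 : 0 < nm (v - w) by rewrite nm_gt0 subr_eq0.
rewrite ler_pdivrMr; last exact: lt_le_trans p0 N2.
by apply: le_trans N1 _; rewrite ler_wpM2l ?addr_ge0 ?nm_ge0.
Qed.

(** Goursat is applied to the quotient [(f v - f w) / (1 - ce (w - v))], which is bounded near [w].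
    On the lower contour the kernel expands in powers of [q = ce (w - v)], on the upper one in
    powers of [1 / q]; averaging turns the two expansions into the nonnegative and the negative
    frequencies, and each tail costs at most [2 M rho ^ (N + 1) / (1 - rho)]. *)
Lemma laurent w N : `|Im w| <= eps / 2 ->
  nm (f w - symsum N (fun m => coef f m * ce (m%:~R * w))) <=
  4 * M * rho ^+ N.+1 / (1 - rho).
Proof.
move=> we; have we' : `|Im w| < eps by have := e0; lra.
have [r [B [r0 kB]]] := kernel_bounded we'.
(* [goursat_removable] places [w] at one third of the height: [eps / 4] below it and [eps / 2] above
   it, inside the strip since [|Im w| <= eps / 2]. *)
pose H : R := 3 / 4 * eps.
have H0 : 0 < H by rewrite /H mulr_gt0 // divr_gt0.
pose z0 : C := w - (3^-1)%:C - (3^-1)%:C * (0 +i* H).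
pose z1 := z0 + (0 +i* H).
pose g v := (f v - f w) / (1 - ce (w - v)).
have wE : z0 + (3^-1)%:C + (3^-1)%:C * (0 +i* H) = w by rewrite /z0; ring.
have ImI (t : R) : Im (t%:C * (0 +i* H)) = t * H by rewrite cImMR.
have Imz0 : Im z0 = Im w - eps / 4.
  by rewrite /z0 !(cImD, cImN) ImI /= /H; field.
have Imz1 : Im z1 = Im w + eps / 2.
  by rewrite /z1 cImD Imz0 /= /H; field.
have gper v : g (v + 1) = g v.
  rewrite /g per; have -> : w - (v + 1) = w - v - 1 by ring.
  by rewrite (ceB (w - v)) ce1 divr1.
have gd v : in_pgram z0 1 (0 +i* H) v -> v <> w -> differentiable g v.
  move=> [s [t [s1 t1 vE]]] vw.
  have Imv : Im v = Im w - eps / 4 + t * H.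
    by rewrite vE cImD cImD Imz0 ImI cImMR /= mulr0 addr0.
  have ve : `|Im v| <= eps.
    have tH : 0 <= t * H <= 3 / 4 * eps.
      by rewrite mulr_ge0 ?(ltW H0) //= ?ler_piMl ?(ltW H0) //; lra.
    by move: we; rewrite Imv !ler_norml; lra.
  have ne : 1 - ce (w - v) != 0.
    rewrite subr_eq0 eq_sym; apply/eqP => /ce_eq1 c1; apply: vw.
    apply/esym/subr0_eq/c1; rewrite cReB vE /z0 !(cReD, cReN, cReMR) /=.
    by rewrite ltr_norml; lra.
  apply: differentiableM.
    by apply: differentiableB; [exact: df|exact: differentiable_cst].
  exact: differentiable_kernel.
have small e : 0 < e -> ev (fun j => nm (avg j z0 g - avg j z1 g) < e).
  move=> ep; have := @goursat_removable R g z0 H r B H0 r0.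
  rewrite wE => /(_ kB gd e ep); apply: ev_impl => j.
  by rewrite oint_avg.
pose E0 : R := 2 * M * rho ^+ N.+1 / (1 - rho).
(* [pc m] is the term of frequency [m] of the expanded kernel; its average is the [m]-th term of the
   Fourier sum, minus [f w] when [m = 0]. *)
pose pc (m : int) v := (f v - f w) * ce (m%:~R * (w - v)).
have pcE m j z : (`|m| < 2 ^ j)%N ->
    avg j z (pc m) = ce (m%:~R * w) * avg j z (twist f m) - (m == 0)%:R * f w.
  move=> mj; rewrite (@eq_avg _ _ (fun v => ce (m%:~R * w) * twist f m v +
     (- f w * ce (m%:~R * w)) * ce ((- m)%:~R * v))); last first.
    move=> x; rewrite /pc /twist mulrBr ceB mulrNz mulNr ceN.
    by rewrite mulrBl; field; exact: ce_neq0.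
  rewrite avgD !avgZ avg_ce ?abszN // oppr_eq0.
  case: eqP => [->|_]; last by rewrite mulr0 mul0r oppr0.
  by rewrite ?mulr0z mul0r ce0 !mulr1 !mul1r.
have fl (z : C) (x : R) : `|Im z| <= eps -> nm (f (z + x%:C) - f w) <= 2 * M.
  move=> ze; apply: le_trans (nmB _ _) _.
  have : nm (f (z + x%:C)) <= M by apply: fM; rewrite cImD /= addr0.
  by have := fM (ltW we'); lra.
have z0e : `|Im z0| <= eps by move: we; rewrite Imz0 !ler_norml; have := e0; lra.
have z1e : `|Im z1| <= eps by move: we; rewrite Imz1 !ler_norml; have := e0; lra.
have bot j : nm (avg j z0 g - \sum_(k < N.+1) avg j z0 (pc k)) <= E0.
  rewrite -avg_sum -mulN1r -avgZ -avgD; apply: avg_le => x.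
  set v := z0 + x%:C; set q := ce (w - v).
  have nq : nm q = rho.
    by rewrite /q nm_ce cImB /v cImD Imz0 /= /rho; congr expR; lra.
  have q1 : 1 - q != 0.
    by rewrite subr_eq0 eq_sym; apply/eqP => q1; move: rho1; rewrite -nq q1 nm1 ltxx.
  have -> : g v + -1 * (\sum_(k < N.+1) pc k v) = (f v - f w) * (q ^+ N.+1 / (1 - q)).
    rewrite /g -/q /pc -mulr_sumr.
    under eq_bigr do rewrite ceMn -/q.
    apply: (mulIf q1); rewrite mulrDl divfK // -[RHS]mulrA divfK //.
    have -> : q ^+ N.+1 = 1 + (q - 1) * \sum_(i < N.+1) q ^+ i by rewrite -subrX1; ring.
    by ring.
  rewrite nmM /E0 -mulrA ler_pM ?nm_ge0 //; first exact: fl.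
  rewrite nmM nmV nmX nq ler_wpM2l ?exprn_ge0 ?(ltW rho0) // lef_pV2 ?posrE ?nm_gt0 ?subr_gt0 //.
  by have := le_nmB 1 q; rewrite nm1 nq.
have top j : nm (avg j z1 g + \sum_(k < N) avg j z1 (pc (- k.+1%:Z))) <= E0.
  rewrite -avg_sum -avgD; apply: avg_le => x.
  set v := z1 + x%:C; set q := ce (v - w).
  have nq : nm q = rho ^+ 2.
    by rewrite /q nm_ce cImB /v cImD Imz1 /= /rho -expRM_natl; congr expR; lra.
  have nq1 : nm q <= rho.
    by rewrite nq expr2 ler_piMl ?ltW.
  have q1 : 1 - q != 0.
    rewrite subr_eq0 eq_sym; apply/eqP => q1; move: nq1; rewrite q1 nm1.
    by apply/negP; rewrite -ltNge.
  have qi : ce (w - v) = q^-1 by rewrite /q -ceN opprB.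
  have q0 : q != 0 by exact: ce_neq0.
  have -> : g v + (\sum_(k < N) pc (- k.+1%:Z) v) = - ((f v - f w) * (q ^+ N.+1 / (1 - q))).
    rewrite /g qi /pc -mulr_sumr.
    have -> : \sum_(k < N) ce ((- k.+1%:Z)%:~R * (w - v)) = q * \sum_(k < N) q ^+ k.
      rewrite mulr_sumr; apply: eq_bigr => k _.
      by rewrite mulrNz mulNr ceN -[X in ce (X * _)]/(k.+1%:R) ceMn qi exprVn invrK exprS.
    have -> : (1 - q^-1)^-1 = - (q / (1 - q)).
      by field; rewrite q0 q1 /= -opprB oppr_eq0.
    apply: (mulIf q1); rewrite mulrDl.
    have -> : (f v - f w) * (q * (\sum_(k < N) q ^+ k)) * (1 - q) =
       - ((f v - f w) * q * (q ^+ N - 1)) by rewrite subrX1; ring.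
    by rewrite exprS; field.
  rewrite nmN nmM /E0 -mulrA ler_pM ?nm_ge0 //; first exact: fl.
  rewrite nmM nmV nmX ler_pM ?exprn_ge0 ?invr_ge0 ?nm_ge0 //.
    by rewrite lerXn2r ?nnegrE ?nm_ge0 ?(ltW rho0).
  rewrite lef_pV2 ?posrE ?nm_gt0 ?subr_gt0 //.
  by have := le_nmB 1 q; rewrite nm1; move: nq1; lra.
(* The partial sum minus [f w], with averages in place of coefficients: nonnegative frequencies are
   read on the lower contour, negative ones on the upper. *)
pose v j := \sum_(k < N.+1) ce (k%:Z%:~R * w) * avg j z0 (twist f k) +
  \sum_(k < N) ce ((- k.+1%:Z)%:~R * w) * avg j z1 (twist f (- k.+1%:Z)) + (- f w).
have bA m z : `|Im z| <= eps -> bounded_seq (fun j => ce (m%:~R * w) * avg j z (twist f m)).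
  by move=> ze; apply: bounded_seqZ; exact: bounded_twist.
have [s1b s1E] := @blim_sum R _ (index_enum 'I_N.+1)
  (fun (k : 'I_N.+1) j => ce (k%:Z%:~R * w) * avg j z0 (twist f k)) (fun k => bA _ _ z0e).
have [s2b s2E] := @blim_sum R _ (index_enum 'I_N)
  (fun (k : 'I_N) j => ce ((- k.+1%:Z)%:~R * w) * avg j z1 (twist f (- k.+1%:Z)))
  (fun k => bA _ _ z1e).
have vb : bounded_seq v.
  by apply: bounded_seqD; [exact: bounded_seqD|exact: bounded_seq_cst].
have vE : blim v = symsum N (fun m => coef f m * ce (m%:~R * w)) - f w.
  rewrite /v blimD; [|exact: bounded_seqD|exact: bounded_seq_cst].
  rewrite blim_cst blimD // s1E s2E symsumE; congr (_ + _ - _); apply: eq_bigr => k _.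
    by rewrite blimZ ?coef_base 1?mulrC //; exact: bounded_twist.
  by rewrite blimZ ?coef_base 1?mulrC //; exact: bounded_twist.
rewrite nmBC -vE; apply/ler_addgt0Pl => e ep.
apply: blim_le => //.
have big : ev (fun j => (N < 2 ^ j)%N).
  by exists N => j Nj; apply: leq_ltn_trans Nj (ltn_expl _ _).
have : ev (fun j => nm (v j) <= e + 4 * M * rho ^+ N.+1 / (1 - rho)).
  apply: ev_impl (ev_and big (small e ep)) => j [jN sm].
  have -> : v j = (avg j z0 g - avg j z1 g) -
     (avg j z0 g - \sum_(k < N.+1) avg j z0 (pc k)) +
     (avg j z1 g + \sum_(k < N) avg j z1 (pc (- k.+1%:Z))).
    have -> : \sum_(k < N.+1) avg j z0 (pc k) =
        \sum_(k < N.+1) ce (k%:Z%:~R * w) * avg j z0 (twist f k) - f w.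
      rewrite (eq_bigr (fun k : 'I_N.+1 => ce (k%:Z%:~R * w) * avg j z0 (twist f k) +
                 - ((k%:Z == 0)%:R * f w))); last first.
        by move=> k _; rewrite pcE // absz_nat; apply: leq_trans jN; exact: ltn_ord.
      rewrite big_split /= sumrN; congr (_ - _).
      by rewrite big_ord_recl /= mul1r big1 ?addr0 // => k _; rewrite mul0r.
    have -> : \sum_(k < N) avg j z1 (pc (- k.+1%:Z)) =
        \sum_(k < N) ce ((- k.+1%:Z)%:~R * w) * avg j z1 (twist f (- k.+1%:Z)).
      apply: eq_bigr => k _; rewrite pcE ?mul0r ?subr0 //.
      by rewrite abszN absz_nat; apply: leq_trans jN; rewrite ltnS; exact: ltn_ord.
    by rewrite /v; ring.
  have := bot j; have := top j.
  set a := avg j z0 g - avg j z1 g in sm *.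
  set b := _ - \sum_(k < N.+1) _; set c := avg j z1 g + _ => cE bE.
  have := nmB a b; have := nmD (a - b) c.
  have -> : 4 * M * rho ^+ N.+1 / (1 - rho) = E0 + E0 by rewrite /E0; ring.
  by lra.
by [].
Qed.

(* Only the frequency t survives the average of the partial sum of order N. *)
Lemma avg_twist_coef (N j : nat) (t : int) z0 : (`|t| <= N)%N -> (N + `|t| < 2 ^ j)%N ->
  `|Im z0| <= eps / 2 ->
  nm (avg j z0 (twist f t) - coef f t) <=
  4 * M * rho ^+ N.+1 / (1 - rho) * expR (pi * eps * `|t|%N%:R).
Proof.
move=> tN Nj z0e.
pose S u := symsum N (fun m => coef f m * ce (m%:~R * u)).
have avgS : avg j z0 (fun u => S u * ce ((- t)%:~R * u)) = coef f t.
  rewrite (@eq_avg _ _ (fun u => \sum_(k < N.*2.+1)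
     coef f (k%:Z - N%:Z) * ce ((k%:Z - N%:Z - t)%:~R * u))); last first.
    move=> x; rewrite /S /symsum mulr_suml; apply: eq_bigr => k _.
    by rewrite -mulrA -ceD -mulrDl -rmorphD.
  have kt (k : 'I_N.*2.+1) : (`|(k%:Z - N%:Z - t)%R| < 2 ^ j)%N.
    apply: leq_ltn_trans Nj.
    by have := ltn_ord k; lia.
  have tk : (`|(t + N%:Z)%R| < N.*2.+1)%N by lia.
  rewrite avg_sum (bigD1 (Ordinal tk)) //= big1 ?addr0 => [|k kne].
    have -> : `|(t + N%:Z)%R|%N%:Z - N%:Z = t by lia.
    by rewrite avgZ subrr avg_ce ?mulr1 // absz0 expn_gt0.
  rewrite avgZ avg_ce // (_ : _ == 0 = false) ?mulr0 //.
  apply/negP => /eqP e; move/eqP: kne; apply; apply: val_inj => /=; lia.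
rewrite -avgS -mulN1r -avgZ -avgD; apply: avg_le => x.
rewrite mulN1r /twist -mulrBl nmM; apply: ler_pM; rewrite ?nm_ge0 //.
  by apply: laurent; rewrite cImD /= addr0.
rewrite nm_ce cImMi cImD /= addr0 ler_expR.
have : `|(- t)%:~R * Im z0 : R| <= `|t|%N%:R * (eps / 2).
  rewrite normrM; have -> : `|(- t)%:~R : R| = `|t|%N%:R.
    by rewrite mulrNz normrN -intr_norm -abszE.
  by rewrite ler_pM.
rewrite ler_norml => /andP[h _].
have -> : - (2 * pi * ((- t)%:~R * Im z0)) = 2 * pi * - ((- t)%:~R * Im z0) by ring.
have -> : pi * eps * `|t|%N%:R = 2 * pi * (`|t|%N%:R * (eps / 2)) by field.
rewrite ler_wpM2l ?mulr_ge0 ?pi_ge0 //; lra.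
Qed.

End Laurent.

(** * Polynomial against geometric growth, and connectedness of the unit interval *)

Section PolynomialDecay.
Variable R : realType.

(** With [y = 2 N + 1], [rho ^ N] is [exp (d - d y)], and [y ^ (n + 1)] is absorbed by the term of
    degree [n + 1] of the exponential series. *)
Lemma poly_geom_le (n : nat) (rho : R) : 0 < rho -> rho < 1 ->
  exists B : R, forall N : nat, (N.*2.+1)%:R ^+ n * rho ^+ N <= B / (N.*2.+1)%:R.
Proof.
move=> r0 r1; pose d := - ln rho / 2.
have d0 : 0 < d by rewrite divr_gt0 // oppr_gt0 ln_lt0 // r0 r1.
exists (expR d * (n.+1)`!%:R / d ^+ n.+1) => N; set y : R := (N.*2.+1)%:R.
have y0 : 0 < y by rewrite ltr0n.
rewrite ler_pdivlMr // mulrAC -exprSr.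
have -> : rho ^+ N = expR d * expR (- (d * y)).
  rewrite -expRD -{1}(lnK (x := rho)) ?posrE // -expRM_natl; congr expR.
  have yN : N.*2.+1 = (2 * N + 1)%N by lia.
  have -> : y = 2 * N%:R + 1 by rewrite /y yN natrD natrM.
  by rewrite /d; field.
rewrite mulrCA -mulrA ler_pM2l ?expR_gt0 //.
have := @expR_ge1Dxn R (d * y) n (ltW (mulr_gt0 d0 y0)).
move=> h; have {}h : (d * y) ^+ n.+1 <= (n.+1)`!%:R * expR (d * y).
  by rewrite -ler_pdivrMl ?ltr0n ?fact_gt0 // [_^-1 * _]mulrC; lra.
rewrite expRN ler_pdivrMr ?expR_gt0 // mulrAC ler_pdivlMr ?exprn_gt0 //.
by rewrite -exprMn [y * d]mulrC.
Qed.

Lemma poly_geom_cvg (n : nat) (rho C e : R) : 0 < rho -> rho < 1 -> 0 <= C -> 0 < e ->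
  exists N0 : nat, forall N, (N0 <= N)%N -> C * ((N.*2.+1)%:R ^+ n * rho ^+ N) <= e.
Proof.
move=> r0 r1 C0 e0; have [B BP] := poly_geom_le n r0 r1.
have B0 : 0 <= B by have := BP 0%N; rewrite divr1 expr1n mul1r expr0; lra.
have [N0 NP] := @ltr_add_invr R 0 (e / (C * B + 1)) ltac:(rewrite divr_gt0 //; nra).
exists N0 => N N0N; apply: le_trans (ler_wpM2l C0 (BP N)) _.
rewrite add0r in NP.
have h : (N.*2.+1)%:R^-1 <= N0.+1%:R^-1 :> R.
  by rewrite lef_pV2 ?posrE ?ltr0n // ler_nat ltnS; apply: leq_trans N0N _; rewrite -addnn leq_addr.
have CB : 0 <= C * B by rewrite mulr_ge0.
have : (N.*2.+1)%:R^-1 * (C * B + 1) <= e.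
  rewrite -ler_pdivlMr; first exact: le_trans h (ltW NP).
  lra.
have : 0 <= (N.*2.+1)%:R^-1 :> R by rewrite invr_ge0.
rewrite mulrA; set x := (_)^-1; nra.
Qed.

End PolynomialDecay.

Section LocallyConstant.
Variable R : realType.

(** Connectedness of [[0, 1]], through the supremum of the [t] such that [P] holds on [[0, t]]. It
    moves base points of Fourier coefficients along segments and propagates local vanishing. *)
Lemma locally_constant_unit (P : R -> Prop) : P 0 ->
  (forall t, 0 <= t <= 1 -> exists2 d : R, 0 < d &
     forall s, 0 <= s <= 1 -> `|s - t| < d -> (P s <-> P t)) -> P 1.
Proof.
move=> P0 loc; pose S := [set t : R | 0 <= t <= 1 /\ forall s, 0 <= s <= t -> P s].
have S0 : S 0.
  by split=> [|s s0]; [rewrite lexx ler01|have -> : s = 0 by lra].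
have ubS : ubound S 1 by move=> t [/andP[]].
have hS : has_sup S by split; [exists 0|exists 1].
pose c := sup S.
have c01 : 0 <= c <= 1.
  apply/andP; split; first exact: sup_upper_bound.
  by apply: ge_sup; first by exists 0.
have [d d0 dP] := loc c c01.
have [t St tc] := @sup_adherent _ S d d0 hS.
have tle : t <= c by exact: sup_upper_bound.
have Pc : P c.
  case: (St) => t01 tP; apply/(dP t); rewrite ?t01 //; last by apply: tP; lra.
  by rewrite distrC ger0_norm ?subr_ge0 //; rewrite -/c in tc; lra.
have good s : 0 <= s <= 1 -> s < c + d -> P s.
  move=> s01 scd; have [st|ts] := leP s t; first by case: St => _; apply; lra.
  apply/(dP s) => //; rewrite ltr_norml; rewrite -/c in tc; lra.
have [c1|c1] := ltP (c + d / 2) 1; last by apply: good; lra.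
suff : c + d / 2 <= c by lra.
apply: sup_upper_bound => //; split; first lra.
by move=> s s1; apply: good; lra.
Qed.

End LocallyConstant.

(** * Grid averages in several variables *)

Section Grid.
Variables (R : realType) (n : nat).
Local Notation C := R[i].
Local Notation Re := (@complex.Re R).
Local Notation Im := (@complex.Im R).
Implicit Types (v w : 'rV[C]_n) (h : 'rV[C]_n -> C) (T : 'rV[int]_n).

Definition ev_ (l : 'I_n) : 'rV[C]_n := delta_mx 0 l.
Definition imv v : 'rV[R]_n := map_mx Im v.
Definition rv (x : 'rV[R]_n) : 'rV[C]_n := map_mx (real_complex R) x.
Definition dot T v : C := \sum_l (T 0 l)%:~R * v 0 l.
Definition dotR T (y : 'rV[R]_n) : R := \sum_l (T 0 l)%:~R * y 0 l.

Lemma dotD T v w : dot T (v + w) = dot T v + dot T w.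
Proof. by rewrite /dot -big_split; apply: eq_bigr => l _; rewrite mxE mulrDr. Qed.

Lemma dotZ T c v : dot T (c *: v) = c * dot T v.
Proof. by rewrite /dot mulr_sumr; apply: eq_bigr => l _; rewrite mxE mulrCA. Qed.

Lemma dot_ev T l : dot T (ev_ l) = (T 0 l)%:~R.
Proof.
rewrite /dot (bigD1 l) //= mxE !eqxx mulr1 big1 ?addr0 // => k kl.
by rewrite mxE eqxx (negPf kl) mulr0.
Qed.

Lemma Im_dot T v : Im (dot T v) = dotR T (imv v).
Proof. by rewrite /dot cIm_sum; apply: eq_bigr => l _; rewrite cImMi mxE. Qed.

Lemma imvD v w : imv (v + w) = imv v + imv w.
Proof. by apply/rowP => l; rewrite !mxE cImD. Qed.

Lemma imv_rv x : imv (rv x) = 0.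
Proof. by apply/rowP => l; rewrite !mxE. Qed.

Lemma imvZev (u : C) l k : imv (u *: ev_ l) 0 k = Im u *+ (k == l).
Proof.
rewrite !mxE /=; case: (eqVneq k l) => [_|kl]; first by rewrite mulr1.
by rewrite mulr0.
Qed.

Definition gp j (k : 'rV['Z_(2 ^ j)]_n) : 'rV[C]_n :=
  \row_l ((val (k 0 l))%:R / (2 ^ j)%:R).

Lemma gp_rv j k : exists x, @gp j k = rv x.
Proof.
exists (\row_l ((val (k 0 l))%:R / (2 ^ j)%:R)).
by apply/rowP => l; rewrite !mxE rmorphM fmorphV !rmorph_nat.
Qed.

Lemma imv_gp j k : imv (@gp j k) = 0.
Proof. by have [x ->] := gp_rv k; exact: imv_rv. Qed.

Definition mavg j v h : C :=
  #|{: 'rV['Z_(2 ^ j)]_n}|%:R^-1 * \sum_k h (v + @gp j k).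

Lemma mavgE0 j : #|{: 'rV['Z_(2 ^ j)]_n}|%:R != 0 :> C.
Proof. by rewrite pnatr_eq0 -lt0n; apply/card_gt0P; exists 0. Qed.

Lemma mean_le (I : finType) (F : I -> C) (B : R) : 0 <= B -> (forall i, nm (F i) <= B) ->
  nm (#|I|%:R^-1 * \sum_i F i) <= B.
Proof.
move=> B0 FB; rewrite nmM nmV nm_nat.
have [->|I0] := eqVneq #|I| 0%N; first by rewrite invr0 mul0r.
rewrite mulrC ler_pdivrMr ?ltr0n ?lt0n //; apply: le_trans (nm_sum _ _ _) _.
apply: le_trans (_ : \sum_(i : I) B <= _); first exact: ler_sum.
by rewrite sumr_const mulr_natr.
Qed.

Lemma mavg_le j v h (B : R) : (forall x, nm (h (v + rv x)) <= B) -> nm (mavg j v h) <= B.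
Proof.
move=> hB; apply: mean_le => [|k].
  by apply: le_trans (hB 0); exact: nm_ge0.
by have [x ->] := gp_rv k; exact: hB.
Qed.

Definition upd j (k : 'rV['Z_(2 ^ j)]_n) (l : 'I_n) (m : 'Z_(2 ^ j)) :
  'rV['Z_(2 ^ j)]_n := \row_i (if i == l then m else k 0 i).

Lemma upd_id j k l : @upd j k l (k 0 l) = k.
Proof. by apply/rowP => i; rewrite mxE; case: eqP => [->|]. Qed.

Lemma updK j k l m m' : @upd j (upd k l m) l m' = upd k l m'.
Proof. by apply/rowP => i; rewrite !mxE; case: eqP. Qed.

Lemma upd_eq j k l m : @upd j k l m 0 l = m.
Proof. by rewrite mxE eqxx. Qed.

Lemma gp_upd j k l m : @gp j (upd k l m) =
  gp (upd k l 0) + ((val m)%:R / (2 ^ j)%:R) *: ev_ l.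
Proof.
apply/rowP => i; rewrite !mxE; case: (eqVneq i l) => [_|il].
  by rewrite ?eqxx mulr1 mul0r add0r.
by rewrite ?eqxx mulr0 addr0.
Qed.

(* Averaging over all grid points averages each coordinate separately: swap the
   value of the coordinate l with a dummy one. *)
Lemma sum_marginal j l (phi : 'Z_(2 ^ j) -> 'rV['Z_(2 ^ j)]_n -> C) :
  (forall m k m', phi m (upd k l m') = phi m k) ->
  \sum_(k : 'rV['Z_(2 ^ j)]_n) phi (k 0 l) k = #|'Z_(2 ^ j)|%:R^-1 * \sum_k \sum_m phi m k.
Proof.
move=> phiP.
have N0 : #|'Z_(2 ^ j)|%:R != 0 :> C by rewrite pnatr_eq0 -lt0n; apply/card_gt0P; exists 0.
apply: (mulfI N0); rewrite mulVKf // pair_bigA /=.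
pose sw (p : 'rV['Z_(2 ^ j)]_n * 'Z_(2 ^ j)) := (upd p.1 l p.2, p.1 0 l).
have swK : involutive sw.
  by move=> [k m]; rewrite /sw /= updK upd_id upd_eq.
rewrite (reindex_inj (inv_inj swK)) /=.
rewrite -(pair_bigA _ (fun (k : 'rV['Z_(2 ^ j)]_n) m => phi (k 0 l) (upd k l m))) /= mulr_sumr.
apply: eq_bigr => k _; under eq_bigr do rewrite phiP.
by rewrite sumr_const mulr_natl.
Qed.

(** The type ['Z_1] has two elements, so the identity is stated for [j > 0]. *)
Lemma avg_Zp j z (g : C -> C) : (0 < j)%N -> avg j z g =
  #|'Z_(2 ^ j)|%:R^-1 * \sum_(m : 'Z_(2 ^ j)) g (z + (val m)%:R / (2 ^ j)%:R).
Proof.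
move=> j0; have K1 : (1 < 2 ^ j)%N by rewrite -{1}(expn0 2) ltn_exp2l.
rewrite /avg card_ord Zp_cast // -(big_mkord xpredT (fun m => g (z + m%:R / (2 ^ j)%:R))).
Qed.

(** Averaging first in direction [l] reduces statements about grids to one-variable averages of
    slices. *)
Lemma mavg_slice j v h l : (0 < j)%N -> mavg j v h =
  #|{: 'rV['Z_(2 ^ j)]_n}|%:R^-1 *
    \sum_k avg j 0 (fun u => h (v + @gp j (upd k l 0) + u *: ev_ l)).
Proof.
move=> j0; rewrite /mavg; congr (_ * _).
pose phi m k := h (v + @gp j (upd k l m)).
have := @sum_marginal j l phi; rewrite /phi => H.
rewrite -(eq_bigr _ (fun k _ => congr1 (fun k' => h (v + gp k')) (upd_id k l))).
rewrite H; last by move=> m k m'; rewrite updK.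
rewrite mulr_sumr; apply: eq_bigr => k _; rewrite avg_Zp //; congr (_ * _).
by apply: eq_bigr => m _; rewrite add0r gp_upd addrA.
Qed.

Lemma avg_shift j z0 (g : C -> C) : avg j 0 (fun u => g (z0 + u)) = avg j z0 g.
Proof. by rewrite /avg; congr (_ * _); apply: eq_bigr => k _; rewrite add0r. Qed.

End Grid.

(** * Fourier expansion on a tube domain in several variables *)

Section BoxSums.
Variable n : nat.

Definition boxT N (k : {ffun 'I_n -> 'I_(N.*2.+1)}) : 'rV[int]_n :=
  \row_l ((k l)%:Z - N%:Z).

Definition boxsum (V : zmodType) N (F : 'rV[int]_n -> V) : V := \sum_k F (@boxT N k).

End BoxSums.

Section Fourier.
Variables (R : realType) (n : nat).
Local Notation C := R[i].
Local Notation Re := (@complex.Re R).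
Local Notation Im := (@complex.Im R).
Implicit Types (v w : 'rV[C]_n) (T : 'rV[int]_n) (Y : 'rV[R]_n).
Local Notation e_ := (@ev_ R n).

Variables (G : 'rV[C]_n -> C) (Om : 'rV[R]_n -> Prop).
Hypothesis Gper : forall v l, G (v + e_ l) = G v.
Hypothesis Gdif : forall v l (u : C), Om (imv (v + u *: e_ l)) ->
  differentiable (fun u : C => G (v + u *: e_ l)) u.
Hypothesis Gbnd : forall Y, Om Y -> exists eps M : R, 0 < eps /\
  forall v, (forall k, `|Im (v 0 k) - Y 0 k| <= eps) -> Om (imv v) /\ nm (G v) <= M.
Hypothesis Omconv : forall Y Y' (t : R), Om Y -> Om Y' -> 0 <= t <= 1 ->
  Om ((1 - t) *: Y + t *: Y').

Definition twG T v := G v * ce (- dot T v).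

(** The Fourier coefficient of index [T] read on the torus through [v]; by [mavg_const] it does not
    depend on the point [v] of the tube. *)
Definition mlim T v : C := blim (fun j => mavg j v (twG T)).

Definition near_bound Y (eps M : R) := 0 < eps /\
  forall v, (forall k, `|Im (v 0 k) - Y 0 k| <= eps) -> Om (imv v) /\ nm (G v) <= M.

Definition slice v l : C -> C := fun u => G (v + u *: e_ l).

Lemma slice_hyp v l (eps M : R) : near_bound (imv v) eps M ->
  [/\ 0 < eps, forall z, slice v l (z + 1) = slice v l z,
   forall z, `|Im z| <= eps -> differentiable (slice v l) z &
   forall z, `|Im z| <= eps -> nm (slice v l z) <= M].
Proof.
move=> [e0 H].
have K z : `|Im z| <= eps -> forall k, `|Im ((v + z *: e_ l) 0 k) - imv v 0 k| <= eps.
  move=> ze k; rewrite mxE cImD [imv v 0 k]mxE addrAC subrr add0r.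
  have := imvZev z l k; rewrite mxE => ->.
  by case: eqP => _; rewrite ?mulr1n // mulr0n normr0 ltW.
split=> [|z|z|z].
- exact: e0.
- by rewrite /slice scalerDl scale1r addrA Gper.
- by move=> /K/H[Oz _]; exact: Gdif.
- by move=> /K/H[_].
Qed.

Lemma twG_slice T v l u : twG T (v + u *: e_ l) =
  ce (- dot T v) * twist (slice v l) (T 0 l) u.
Proof.
rewrite /twG /twist /slice dotD dotZ dot_ev opprD ceD mulrNz.
have -> : - (T 0 l)%:~R * u = - (u * (T 0 l)%:~R) by ring.
by ring.
Qed.

Lemma nm_ce_dot T v : nm (ce (- dot T v)) = expR (2 * pi * dotR T (imv v)).
Proof. by rewrite nm_ce cImN Im_dot mulrN opprK. Qed.

Definition err (eps M : R) (t : int) (N : nat) : R :=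
  4 * M * expR (- (pi * eps / 2)) ^+ N.+1 / (1 - expR (- (pi * eps / 2))) *
  expR (pi * eps * `|t|%N%:R).

Lemma err_small (eps M : R) t (e : R) : 0 < eps -> 0 <= M -> 0 < e ->
  ev (fun j => exists N, [/\ (`|t| <= N)%N, (N + `|t| < 2 ^ j)%N & err eps M t N <= e]).
Proof.
move=> e0 M0 ep; set rho := expR (- (pi * eps / 2)).
have r0 : 0 < rho by exact: expR_gt0.
have r1 : rho < 1 by rewrite -[ltRHS]expR0 ltr_expR oppr_lt0 !mulr_gt0 ?pi_gt0 ?invr_gt0.
pose c := 4 * M * rho / (1 - rho) * expR (pi * eps * `|t|%N%:R).
have c0 : 0 <= c.
  by rewrite !mulr_ge0 ?expR_ge0 ?(ltW r0) // invr_ge0 subr_ge0 ltW.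
have [N0 NP] := poly_geom_cvg 0 r0 r1 c0 ep.
exists (N0 + `|t| + `|t|)%N => j jP.
exists (N0 + `|t|)%N; split; first by rewrite leq_addl.
  by apply: leq_ltn_trans jP (ltn_expl _ _).
have := NP (N0 + `|t|)%N (leq_addr _ _); rewrite expr0 mul1r; apply: le_trans.
rewrite le_eqVlt; apply/orP; left; apply/eqP.
by rewrite /err -/rho /c exprS; ring.
Qed.

(** The threshold on [j] depends on [eps], [M], the frequency and the tolerance only, hence is
    uniform over all slices through points with the same imaginary part; this is what survives
    averaging over the grid. *)
Lemma nm_coef_twist v l T (eps M : R) (e : R) : near_bound (imv v) eps M -> 0 < e ->
  ev (fun j => forall w, imv w = imv v -> forall z0, `|Im z0| <= eps / 2 ->
    nm (avg j z0 (twist (slice w l) (T 0 l)) - coef (slice w l) (T 0 l)) <= e).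
Proof.
move=> nb ep.
have M0 : 0 <= M.
  case: nb => e0 /(_ v) [|_]; last by apply: le_trans; exact: nm_ge0.
  by move=> k; rewrite mxE subrr normr0 ltW.
have := err_small (T 0 l) (proj1 nb) M0 ep; apply: ev_impl => j [N [N1 N2 N3]] w wv z0 z0e.
rewrite -wv in nb; have [h1 h2 h3 h4] := slice_hyp l nb.
exact: le_trans (avg_twist_coef h1 h2 h3 h4 N1 N2 z0e) N3.
Qed.

Lemma bounded_mavg T v : Om (imv v) -> bounded_seq (fun j => mavg j v (twG T)).
Proof.
move=> /Gbnd[eps [M [e0 H]]]; exists (M * expR (2 * pi * dotR T (imv v))) => j.
apply: mavg_le => x; rewrite /twG nmM nm_ce_dot imvD imv_rv addr0.
rewrite ler_wpM2r ?expR_ge0 //; apply: (H _ _).2 => k.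
by rewrite !mxE cImD /= addr0 subrr normr0 ltW.
Qed.

(** Slice by slice, the averages through [0] and through [z0] approach the same coefficient of the
    slice, uniformly over the grid. *)
Lemma mavg_move T v l (eps M : R) z0 : near_bound (imv v) eps M -> `|Im z0| <= eps / 2 ->
  mlim T (v + z0 *: e_ l) = mlim T v.
Proof.
move=> nb z0e; have [e0 H] := nb.
have Ov : Om (imv v).
  by apply: (H _ _).1 => k; rewrite mxE subrr normr0 ltW.
have Oz : Om (imv (v + z0 *: e_ l)).
  apply: (H _ _).1 => k; rewrite mxE cImD [imv v 0 k]mxE addrAC subrr add0r.
  have := imvZev z0 l k; rewrite mxE => ->.
  by case: eqP => _; rewrite ?mulr1n // ?mulr0n ?normr0 ?(ltW e0) //; lra.
have b1 := bounded_mavg T Ov; have b2 := bounded_mavg T Oz.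
apply/eqP; rewrite /mlim -subr_eq0 -[X in _ - X]mul1r -mulNr -blimZ // -blimD //; last exact: bounded_seqZ.
apply/eqP/blim_eq; first by apply: bounded_seqD => //; exact: bounded_seqZ.
move=> e ep; set D := expR (2 * pi * dotR T (imv v)).
have D0 : 0 < D by exact: expR_gt0.
have [j0 jP] := @nm_coef_twist v l T eps M (e / 2 / D) nb ltac:(by rewrite !divr_gt0).
exists j0.+1 => j j1; have jp : (0 < j)%N by exact: leq_trans j1.
have {}jP := jP j (ltnW j1).
rewrite subr0 mulN1r (mavg_slice (v + _) _ l jp) (mavg_slice v _ l jp) -mulrBr -sumrB.
apply: mean_le => [|k]; first exact: ltW.
set vk := v + gp R (upd k l 0).
have imvk : imv vk = imv v by rewrite /vk imvD imv_gp addr0.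
have E1 : avg j 0 (fun u => twG T (v + z0 *: e_ l + gp R (upd k l 0) + u *: e_ l)) =
     ce (- dot T vk) * avg j z0 (twist (slice vk l) (T 0 l)).
  rewrite -avgZ -(avg_shift _ z0); apply: eq_avg => x.
  rewrite -twG_slice; congr (twG T _).
  have -> : v + z0 *: e_ l + gp R (upd k l 0) = vk + z0 *: e_ l by rewrite addrAC.
  by rewrite [in RHS]scalerDl addrA.
have E2 : avg j 0 (fun u => twG T (v + gp R (upd k l 0) + u *: e_ l)) =
     ce (- dot T vk) * avg j 0 (twist (slice vk l) (T 0 l)).
  by rewrite -avgZ; apply: eq_avg => x; rewrite -twG_slice.
rewrite E1 E2 -mulrBr nmM nm_ce_dot imvk -/D -ler_pdivlMl // mulrC.
have := jP vk imvk z0 z0e; have := jP vk imvk 0 _.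
rewrite /= normr0 => /(_ ltac:(lra)).
set a := avg _ _ _; set b := avg _ _ _; set c := coef _ _ => h1 h2.
have := nm_triangle b c a; rewrite [nm (c - a)]nmBC; lra.
Qed.

Lemma near_bound_shrink Y Y' (eps M : R) : near_bound Y eps M ->
  (forall k, `|Y' 0 k - Y 0 k| <= eps / 2) -> near_bound Y' (eps / 2) M.
Proof.
move=> [e0 H] YY; split; first by rewrite divr_gt0.
move=> v vY; apply: H => k.
have := vY k; have := YY k; rewrite !ler_norml; lra.
Qed.

(** One coordinate at a time: [mix r] takes its first [r] coordinates from [w]. *)
Lemma mavg_box T v w (eps M : R) : near_bound (imv v) eps M ->
  (forall k, `|imv w 0 k - imv v 0 k| <= eps / 4) ->
  mlim T w = mlim T v.
Proof.
move=> nb wv; have e0 := nb.1.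
pose mix (r : nat) : 'rV[C]_n := \row_k (if (k < r)%N then w 0 k else v 0 k).
have mixn : mix n = w by apply/rowP => k; rewrite mxE ltn_ord.
have mix0 : mix 0%N = v by apply/rowP => k; rewrite mxE ltn0.
suff H r : (r <= n)%N ->
   mlim T (mix r) = mlim T v.
  by rewrite -mixn H.
elim: r => [|r IH] rn; first by rewrite mix0.
rewrite -(IH (ltnW rn)); pose l := Ordinal rn.
have -> : mix r.+1 = mix r + (w 0 l - v 0 l) *: e_ l.
  apply/rowP => k; rewrite !mxE /=; case: (eqVneq k l) => [->|kl] /=.
    by rewrite ltnSn ltnn mulr1 addrC subrK.
  rewrite mulr0 addr0 ltnS leq_eqVlt.
  by rewrite (_ : (k == r :> nat) = false) //; apply/negP => /eqP kr; move/eqP: kl; apply; exact: val_inj.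
have nb' : near_bound (imv (mix r)) (eps / 2) M.
  apply: (near_bound_shrink nb) => k.
  rewrite !mxE; case: ifP => _; last by rewrite subrr normr0; lra.
  by have := wv k; rewrite !mxE; lra.
apply: (mavg_move T l nb').
by have := wv l; rewrite !mxE cImB; lra.
Qed.

Lemma mavg_const T v w : Om (imv v) -> Om (imv w) ->
  mlim T w = mlim T v.
Proof.
move=> Ov Ow; pose p (t : R) : 'rV[C]_n := (1 - t)%:C *: v + t%:C *: w.
have imp t : imv (p t) = (1 - t) *: imv v + t *: imv w.
  by apply/rowP => k; rewrite !mxE !(cImD, cImMR).
have p1 : p 1 = w by rewrite /p subrr scale0r add0r scale1r.
have p0 : p 0 = v by rewrite /p subr0 scale1r scale0r addr0.
rewrite -p1; apply: (@locally_constant_unit R (fun t =>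
  mlim T (p t) = mlim T v)).
  by rewrite p0.
move=> t t01; have [eps [M nb]] : exists eps M, near_bound (imv (p t)) eps M.
  by apply: Gbnd; rewrite imp; exact: Omconv.
have e0 := nb.1.
pose D := \sum_k `|imv w 0 k - imv v 0 k|.
have D0 : 0 <= D by apply: sumr_ge0.
exists (eps / 4 / (D + 1)); first by rewrite !divr_gt0 //; lra.
move=> s s01 st; suff -> : mlim T (p s) = mlim T (p t) by exact: iff_refl.
apply: (mavg_box _ nb) => k.
rewrite !imp !mxE.
have -> : (1 - s) * Im (v 0 k) + s * Im (w 0 k) - ((1 - t) * Im (v 0 k) + t * Im (w 0 k)) =
   (s - t) * (Im (w 0 k) - Im (v 0 k)) by ring.
rewrite normrM; have Dk : `|Im (w 0 k) - Im (v 0 k)| <= D + 1.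
  rewrite /D (bigD1 k) //= !mxE -addrA lerDl addr_ge0 //; exact: sumr_ge0.
apply: le_trans (_ : eps / 4 / (D + 1) * (D + 1) <= _).
  by rewrite ler_pM // ltW.
by rewrite divfK // lt0r_neq0 //; lra.
Qed.

Lemma mlim_le T v (B : R) : Om (imv v) -> (forall x, nm (G (v + rv x)) <= B) ->
  nm (mlim T v) <= B * expR (2 * pi * dotR T (imv v)).
Proof.
move=> Ov GB; apply: blim_le; first exact: bounded_mavg.
exists 0%N => j _; apply: mavg_le => x; rewrite /twG nmM nm_ce_dot imvD imv_rv addr0.
by rewrite ler_wpM2r ?expR_ge0.
Qed.

(** The coefficients of each slice decay by [coef_le] at a rate depending on the local bound only,
    and the grid average inherits it. *)
Lemma mlim_decay Y : Om Y -> exists B rho : R, [/\ 0 <= B, 0 < rho, rho < 1 &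
  forall T v l, imv v = Y ->
    nm (mlim T v) * expR (- (2 * pi * dotR T Y)) <= B * rho ^+ `|T 0 l|].
Proof.
move=> OY; have [eps [M nb]] := Gbnd OY; have [e0 H] := nb.
exists M, (expR (- (2 * pi * eps))); split; [|exact: expR_gt0| |].
- have /H[_ +] : forall k, `|Im ((map_mx (fun y : R => 0 +i* y) Y) 0 k) - Y 0 k| <= eps.
    by move=> k; rewrite mxE subrr normr0 ltW.
  by apply: le_trans; exact: nm_ge0.
- by rewrite -[ltRHS]expR0 ltr_expR oppr_lt0 !mulr_gt0 ?pi_gt0.
move=> T v l vY; rewrite expRN ler_pdivrMr ?expR_gt0 // -vY.
have nbv : near_bound (imv v) eps M by rewrite vY.
apply/ler_addgt0Pl => e ep; apply: blim_le; first by apply: bounded_mavg; rewrite vY.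
set D := expR (2 * pi * dotR T (imv v)).
have D0 : 0 < D by exact: expR_gt0.
have [j0 jP] := @nm_coef_twist v l T eps M (e / D) nbv ltac:(by rewrite divr_gt0).
exists j0.+1 => j j1; have jp : (0 < j)%N by exact: leq_trans j1.
rewrite (mavg_slice v _ l jp).
have M0 : 0 <= M * expR (- (2 * pi * eps)) ^+ `|T 0 l| * D.
  rewrite !mulr_ge0 ?exprn_ge0 ?expR_ge0 ?(ltW D0) //.
  by have [|_] := H v; [move=> k; rewrite -vY mxE subrr normr0 ltW|apply: le_trans; exact: nm_ge0].
apply: mean_le => [|k]; first by rewrite addr_ge0 // ltW.
set vk := v + gp R (upd k l 0).
have imvk : imv vk = imv v by rewrite /vk imvD imv_gp addr0.
have -> : avg j 0 (fun u => twG T (v + gp R (upd k l 0) + u *: e_ l)) =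
     ce (- dot T vk) * avg j 0 (twist (slice vk l) (T 0 l)).
  by rewrite -avgZ; apply: eq_avg => x; rewrite -twG_slice.
rewrite nmM nm_ce_dot imvk -/D.
have := jP j (ltnW j1) vk imvk 0; rewrite /= normr0 => /(_ ltac:(lra)) h.
have nbk : near_bound (imv vk) eps M by rewrite imvk.
have [h1 h2 h3 h4] := slice_hyp l nbk.
have := coef_le h1 h2 h3 h4 (T 0 l); set c := coef _ _; set a := avg _ _ _ in h *.
move=> cM; have := nmD (a - c) c; rewrite subrK => ac.
have -> : e + M * expR (- (2 * pi * eps)) ^+ `|T 0 l| * D =
   D * (e / D + M * expR (- (2 * pi * eps)) ^+ `|T 0 l|).
  by field; exact: lt0r_neq0.
rewrite ler_pM2l //; apply: le_trans ac (lerD _ cM).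
exact: h.
Qed.

(* The coordinates below r of the base point run over the grid, weighted by the
   Dirichlet kernel of order N. *)
Let dir N (x : C) : C := symsum N (fun t => ce ((- t)%:~R * x)).

Let mixv r v (w : 'rV[C]_n) : 'rV[C]_n := \row_k (if (k < r)%N then v 0 k + w 0 k else v 0 k).

Let part N j r v : C := #|{: 'rV['Z_(2 ^ j)]_n}|%:R^-1 *
  \sum_(k : 'rV['Z_(2 ^ j)]_n)
    (\prod_(l < n | (l < r)%N) dir N (gp R k 0 l)) * G (mixv r v (gp R k)).

Lemma nm_dir N (x : R) : nm (dir N x%:C) <= (N.*2.+1)%:R.
Proof.
rewrite /dir /symsum; apply: le_trans (nm_sum _ _ _) _.
rewrite (eq_bigr (fun _ => 1)); first by rewrite sumr_const card_ord.
by move=> k _; rewrite nm_ce cImMi /= mulr0 mulr0 oppr0 expR0.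
Qed.

(** Weighting coordinate [r] by the Dirichlet kernel produces the symmetric Fourier sum of the
    slice, which [laurent] compares with its value at the centre. The kernels already present cost
    at most [2 N + 1] each, a polynomial factor that the geometric decay beats. *)
Lemma part_step N v (eps M : R) r (e : R) : near_bound (imv v) eps M -> (r < n)%N -> 0 < e ->
  ev (fun j => nm (part N j r.+1 v - part N j r v) <=
    (N.*2.+1)%:R ^+ n * (4 * M * expR (- (pi * eps / 2)) ^+ N.+1 /
      (1 - expR (- (pi * eps / 2))) + e)).
Proof.
move=> nb rn ep; pose l := Ordinal rn.
have e0 := nb.1.
have evt : ev (fun j => forall t : 'I_N.*2.+1, forall w, imv w = imv v ->
    nm (avg j 0 (twist (slice w l) (t%:Z - N%:Z)) - coef (slice w l) (t%:Z - N%:Z)) <=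
    e / (N.*2.+1)%:R).
  have H (t : int) : ev (fun j => forall w, imv w = imv v ->
      nm (avg j 0 (twist (slice w l) t) - coef (slice w l) t) <= e / (N.*2.+1)%:R).
    have := @nm_coef_twist v l (t *: delta_mx 0 l) eps M (e / (N.*2.+1)%:R) nb.
    rewrite !mxE !eqxx mulr1 => /(_ ltac:(by rewrite divr_gt0 ?ltr0n)).
    by apply: ev_impl => j h w wv; apply: h => //=; rewrite normr0; lra.
  have /choice[jt jtP] := fun t : 'I_N.*2.+1 => H (t%:Z - N%:Z).
  exists (\max_t jt t)%N => j jj t; apply: jtP.
  exact: leq_trans (leq_bigmax t) jj.
have evj : ev (fun j => (0 < j)%N) by exists 1%N.
apply: ev_impl (ev_and evj evt) => j [jp {}evt].
rewrite /part -mulrBr -sumrB.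
pose W k := \prod_(i < n | (i < r)%N) dir N (@gp R n j k 0 i).
pose phi (m : 'Z_(2 ^ j)) (k : 'rV['Z_(2 ^ j)]_n) :=
  W k * (dir N ((val m)%:R / (2 ^ j)%:R) * slice (mixv r v (gp R k)) l ((val m)%:R / (2 ^ j)%:R)).
have Wupd k m : W (upd k l m) = W k.
  apply: eq_bigr => i ir; rewrite !mxE; case: eqP => [il|//].
  by move: ir; rewrite il /= ltnn.
have mixupd (k : 'rV['Z_(2 ^ j)]_n) m : mixv r v (gp R (upd k l m)) = mixv r v (gp R k).
  apply/rowP => i; rewrite !mxE; case: ifP => // ir; case: eqP => [il|//].
  by move: ir; rewrite il /= ltnn.
have S1 : \sum_(k : 'rV['Z_(2 ^ j)]_n) (\prod_(i < n | (i < r.+1)%N) dir N (gp R k 0 i)) * G (mixv r.+1 v (gp R k)) =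
   #|'Z_(2 ^ j)|%:R^-1 * \sum_k \sum_m phi m k.
  rewrite -(@sum_marginal R n j l phi); last by move=> m k m'; rewrite /phi Wupd mixupd.
  apply: eq_bigr => k _; rewrite /phi /W.
  rewrite (bigD1 l) //= mulrCA mulrA [gp R k 0 l]mxE; congr (_ * _ * _).
    apply: eq_bigl => i; rewrite ltnS leq_eqVlt.
    have -> : (i == l) = (i == r :> nat) by [].
    by case: eqP => [->|_] /=; rewrite ?ltnn ?andbT.
  rewrite /slice; congr G; apply/rowP => i; rewrite !mxE ltnS leq_eqVlt /=.
  have -> : (i == l) = (i == r :> nat) by [].
  by case: eqP => [ir|_] /=; rewrite ?mulr0 ?addr0 // ir ltnn mulr1 (_ : i = l) //; exact: val_inj.
rewrite sumrB S1 mulr_sumr -sumrB.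
set E := 4 * M * _ / _.
have M0 : 0 <= M.
  case: nb => _ /(_ v) [|_]; last by apply: le_trans; exact: nm_ge0.
  by move=> k; rewrite mxE subrr normr0 ltW.
have E0 : 0 <= E.
  rewrite /E !mulr_ge0 ?exprn_ge0 ?expR_ge0 // invr_ge0 subr_ge0.
  by rewrite -[leRHS]expR0 ler_expR oppr_le0 !mulr_ge0 ?pi_ge0 ?invr_ge0 ?(ltW e0).
apply: mean_le => [|k]; first by rewrite mulr_ge0 ?exprn_ge0 // addr_ge0 // ltW.
set w := mixv r v (gp R k).
have imw : imv w = imv v.
  apply/rowP => i; rewrite !mxE; case: ifP => // _; rewrite cImD.
  by have /rowP/(_ i) := @imv_gp R n j k; rewrite !mxE => ->; rewrite addr0.
have -> : #|'Z_(2 ^ j)|%:R^-1 * (\sum_m phi m k) =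
   W k * symsum N (fun t => avg j 0 (twist (slice w l) t)).
  rewrite /phi -mulr_sumr mulrCA; congr (_ * _).
  rewrite /symsum -avg_sum avg_Zp //; congr (_ * _); apply: eq_bigr => m _.
  rewrite add0r /twist -mulr_sumr mulrC; congr (_ * _).
rewrite -mulrBr nmM; apply: ler_pM; rewrite ?nm_ge0 //.
  rewrite /W nm_prod.
  apply: le_trans (_ : \prod_(i < n | (i < r)%N) (N.*2.+1)%:R <= _).
    apply: ler_prod => i _; rewrite nm_ge0 /=.
    have [x ->] := @gp_rv R n j k; rewrite mxE; exact: nm_dir.
  rewrite prodr_const ler_weXn2l ?ler1n //.
  by apply: leq_trans (max_card _) _; rewrite card_ord.
have nbw : near_bound (imv w) eps M by rewrite imw.
have [h1 h2 h3 h4] := slice_hyp l nbw.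
have := laurent h1 h2 h3 h4 N (w := 0); rewrite /= normr0 => /(_ ltac:(lra)).
rewrite -/E; set S := symsum _ _ => hS.
have -> : G w = slice w l 0 by rewrite /slice scale0r addr0.
have hd : nm (symsum N (fun t => avg j 0 (twist (slice w l) t)) - S) <= e.
  rewrite /S /symsum -sumrB; apply: le_trans (nm_sum _ _ _) _.
  apply: le_trans (_ : \sum_(t < N.*2.+1) e / (N.*2.+1)%:R <= _).
    apply: ler_sum => t _; rewrite mulr0 ce0 mulr1.
    exact: evt.
  by rewrite sumr_const card_ord -[X in X <= _]mulr_natr divfK // pnatr_eq0.
by have := nm_triangle (symsum N (fun t => avg j 0 (twist (slice w l) t))) S (slice w l 0);
   rewrite [nm (S - _)]nmBC; lra.
Qed.

Lemma part0 N j v : part N j 0 v = G v.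
Proof.
rewrite /part (eq_bigr (fun _ => G v)) => [|k _].
  by rewrite sumr_const -[G v *+ _]mulr_natl mulKf ?mavgE0.
by rewrite big1 ?mul1r // /mixv; congr G; apply/rowP => i; rewrite mxE.
Qed.

(** Expanding the product of Dirichlet kernels gives one character for each index in the box. *)
Lemma partn N j v : part N j n v =
  boxsum N (fun T => ce (dot T v) * mavg j v (twG T)).
Proof.
rewrite /boxsum /part /mavg.
under [RHS]eq_bigr do rewrite mulrCA mulr_sumr.
rewrite -mulr_sumr exchange_big /=; congr (_ * _); apply: eq_bigr => k _.
have -> : mixv n v (gp R k) = v + gp R k.
  by apply/rowP => i; rewrite !mxE ltn_ord.
under [RHS]eq_bigr => T _.
  rewrite /twG mulrCA dotD opprD ceD ceN mulVKf ?ce_neq0 //.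
  over.
rewrite -mulr_sumr mulrC; congr (_ * _).
rewrite (eq_bigl xpredT); last by move=> i; rewrite ltn_ord.
rewrite /dir /symsum bigA_distr_bigA /=; apply: eq_bigr => f _.
rewrite /dot -sumrN ce_sum; apply: eq_bigr => l _.
by rewrite [boxT f 0 l]mxE mulrNz mulNr.
Qed.

Lemma fourier_partial N v (eps M : R) : near_bound (imv v) eps M ->
  nm (G v - boxsum N (fun T => mlim T v * ce (dot T v))) <=
  n%:R * ((N.*2.+1)%:R ^+ n * (4 * M * expR (- (pi * eps / 2)) ^+ N.+1 /
      (1 - expR (- (pi * eps / 2))))).
Proof.
move=> nb; set E := 4 * M * _ / _.
have Ov : Om (imv v).
  by apply: (nb.2 _ _).1 => k; rewrite mxE subrr normr0 ltW // nb.1.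
have bnd T : bounded_seq (fun j => ce (dot T v) * mavg j v (twG T)).
  by apply: bounded_seqZ; exact: bounded_mavg.
have [b1 b2] := @blim_sum R _ (index_enum {ffun 'I_n -> 'I_(N.*2.+1)})
  (fun k j => ce (dot (boxT k) v) * mavg j v (twG (boxT k))) (fun k => bnd _).
have pb : bounded_seq (fun j => part N j n v).
  by under eq_fun do rewrite partn; exact: b1.
have -> : G v - boxsum N (fun T => mlim T v * ce (dot T v)) =
   blim (fun j => G v + -1 * part N j n v).
  rewrite blimD; [|exact: bounded_seq_cst|exact: bounded_seqZ].
  rewrite blim_cst blimZ //; under [X in blim X]eq_fun do rewrite partn.
  rewrite b2 mulN1r; congr (_ - _); apply: eq_bigr => k _.
  by rewrite [RHS]blimZ; [exact: mulrC|exact: bounded_mavg].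
apply/ler_addgt0Pl => e ep; apply: blim_le.
  by apply: bounded_seqD; [exact: bounded_seq_cst|exact: bounded_seqZ].
pose e' := e / (n%:R * (N.*2.+1)%:R ^+ n + 1).
have X0 : 0 <= n%:R * (N.*2.+1)%:R ^+ n :> R by rewrite mulr_ge0 ?exprn_ge0.
have ep' : 0 < e' by rewrite divr_gt0 //; lra.
have : ev (fun j => forall r, (r < n)%N -> nm (part N j r.+1 v - part N j r v) <=
    (N.*2.+1)%:R ^+ n * (E + e')).
  have /choice[jr jrP] := fun r : 'I_n => part_step N nb (ltn_ord r) ep'.
  exists (\max_r jr r)%N => j jj r rn; apply: (jrP (Ordinal rn)).
  exact: leq_trans (leq_bigmax _) jj.
apply: ev_impl => j H; rewrite mulN1r nmBC.
have {}H r : (r <= n)%N -> nm (part N j r v - G v) <= r%:R * ((N.*2.+1)%:R ^+ n * (E + e')).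
  elim: r => [|r IH] rn; first by rewrite part0 subrr nm0 mul0r.
  apply: le_trans (nm_triangle _ (part N j r v) _) _.
  by rewrite -natr1 mulrDl mul1r addrC; apply: lerD; [exact: IH (ltnW rn)|exact: H].
apply: le_trans (H n (leqnn _)) _.
rewrite !mulrDr addrC lerD2r mulrA.
have : (n%:R * (N.*2.+1)%:R ^+ n + 1) * e' = e.
  by rewrite mulrC divfK // lt0r_neq0 //; lra.
by set X := n%:R * _ in X0 *; lra.
Qed.

Lemma fourier_cvg v (e : R) : Om (imv v) -> 0 < e ->
  exists N0, forall N, (N0 <= N)%N ->
  nm (G v - boxsum N (fun T => mlim T v * ce (dot T v))) <= e.
Proof.
move=> /Gbnd[eps [M nb]] ep.
set rho := expR (- (pi * eps / 2)).
have r0 : 0 < rho by exact: expR_gt0.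
have r1 : rho < 1.
  by rewrite -[ltRHS]expR0 ltr_expR oppr_lt0 !mulr_gt0 ?pi_gt0 ?invr_gt0 ?nb.1.
have M0 : 0 <= M.
  case: nb => e0 /(_ v) [|_]; last by apply: le_trans; exact: nm_ge0.
  by move=> k; rewrite mxE subrr normr0 ltW.
pose c := n%:R * (4 * M * rho / (1 - rho)).
have c0 : 0 <= c by rewrite !mulr_ge0 ?(ltW r0) // invr_ge0 subr_ge0 ltW.
have [N0 NP] := poly_geom_cvg n r0 r1 c0 ep.
exists N0 => N N0N; apply: le_trans (fourier_partial N nb) _.
apply: le_trans (NP N N0N); rewrite le_eqVlt; apply/orP; left; apply/eqP.
by rewrite -/rho /c exprS; ring.
Qed.

End Fourier.

(** * Unconditional summation along finite subsets *)

Section FiniteSets.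

Lemma sum_fset_split (V : zmodType) (J : choiceType) (A0 A : {fset J}) (F : J -> V) :
  fsubset A0 A -> \sum_(j <- A) F j = \sum_(j <- A0) F j + \sum_(j <- A | j \notin A0) F j.
Proof.
move=> /fsubsetP sub; rewrite (bigID (mem A0)) /=; congr (_ + _).
rewrite -big_filter; apply: perm_big; apply: uniq_perm => [||j].
- by rewrite filter_uniq // fset_uniq.
- exact: fset_uniq.
by rewrite mem_filter andb_idr // => /sub.
Qed.

Lemma sum_fset_le (R : realType) (J : choiceType) (A0 A : {fset J}) (F : J -> R) :
  (forall j, 0 <= F j) -> fsubset A0 A -> \sum_(j <- A0) F j <= \sum_(j <- A) F j.
Proof. by move=> F0 /sum_fset_split ->; rewrite lerDl sumr_ge0. Qed.

Lemma sum_fsetM (V : zmodType) (J K : choiceType) (A : {fset J}) (B : {fset K})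
    (F : J * K -> V) :
  \sum_(p <- fsetM A B) F p = \sum_(j <- A) \sum_(k <- B) F (j, k).
Proof.
transitivity (\sum_(p <- [seq (j, k) | j <- A, k <- B]) F p); last exact: big_allpairs.
apply: perm_big; apply: uniq_perm; rewrite ?fset_uniq //.
  by apply: allpairs_uniq; rewrite ?fset_uniq // => -[a b] [c d] _ _ [-> ->].
move=> [j k]; rewrite in_fsetM /=; apply/andP/allpairsP => [[jA kB]|[[a b] /= [aA bB [-> ->]]]].
  by exists (j, k).
by [].
Qed.

End FiniteSets.

Section UnconditionalSums.
Variable R : realType.
Local Notation C := R[i].
Local Notation Re := (@complex.Re R).
Local Notation Im := (@complex.Im R).

(** Convergence along finite subsets, the mode of summation used in [analytic_at]. *)
Definition usum (J : choiceType) (u : J -> C) (s : C) := forall eps : R, 0 < eps ->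
  exists A0 : {fset J}, forall A, fsubset A0 A -> nm (\sum_(j <- A) u j - s) < eps.

Definition abs_bounded (J : choiceType) (u : J -> C) (M : R) :=
  forall A : {fset J}, \sum_(j <- A) nm (u j) <= M.

Lemma usum_unique (J : choiceType) (u : J -> C) s t : usum u s -> usum u t -> s = t.
Proof.
move=> us ut; apply/eqP; rewrite -subr_eq0 -nm_eq0; apply/eqP/le_anti.
rewrite nm_ge0 andbT; apply/ler_addgt0Pl => e e0; rewrite addr0.
have e2 : 0 < e / 2 by rewrite divr_gt0.
have [A AP] := us _ e2; have [B BP] := ut _ e2.
have := AP (fsetU A B) (fsubsetUl _ _); have := BP (fsetU A B) (fsubsetUr _ _).
by set S := \sum_(j <- _) _; have := nm_triangle s S t; rewrite [nm (s - S)]nmBC; lra.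
Qed.

Lemma usum_eq (J : choiceType) (u v : J -> C) s : u =1 v -> usum u s -> usum v s.
Proof.
by move=> uv us e /us[A AP]; exists A => B /AP; rewrite (eq_bigr v) // => j _; exact: uv.
Qed.

Lemma usumZ (J : choiceType) (u : J -> C) c s : usum u s -> usum (fun j => c * u j) (c * s).
Proof.
move=> us e e0; have c0 := nm_ge0 c.
have [|A AP] := us (e / (nm c + 1)); first by rewrite divr_gt0 //; lra.
exists A => B /AP h; rewrite -mulr_sumr -mulrBr nmM.
have : nm (\sum_(j <- B) u j - s) * (nm c + 1) < e by rewrite -ltr_pdivlMr //; lra.
by have := nm_ge0 (\sum_(j <- B) u j - s); nra.
Qed.

Lemma nonneg_sum (J : choiceType) (v : J -> R) (M : R) : (forall j, 0 <= v j) ->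
  (forall A : {fset J}, \sum_(j <- A) v j <= M) ->
  exists s : R, forall eps, 0 < eps -> exists A0 : {fset J}, forall A, fsubset A0 A ->
    `|\sum_(j <- A) v j - s| < eps.
Proof.
move=> v0 vM; pose S := [set x : R | exists A : {fset J}, x = \sum_(j <- A) v j].
have hS : has_sup S.
  by split; [exists (\sum_(j <- fset0) v j), fset0|exists M => _ [A ->]; exact: vM].
exists (sup S) => eps e0; have [_ [A0 ->] A0P] := sup_adherent e0 hS.
exists A0 => A AA; have h1 := sum_fset_le v0 AA.
have h2 : \sum_(j <- A) v j <= sup S by apply: sup_upper_bound => //; exists A.
by rewrite ltr_norml; lra.
Qed.

(** The real part is the difference of the nonnegative families [|u| + Re u] and [|u|], whose
    bounded finite sums have suprema; the imaginary part likewise. *)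
Lemma abs_bounded_sum (J : choiceType) (u : J -> C) (M : R) :
  abs_bounded u M -> exists s, usum u s.
Proof.
move=> uM.
have rsum (f : C -> R) : (forall z, `|f z| <= nm z) ->
    exists s : R, forall eps, 0 < eps -> exists A0 : {fset J}, forall A, fsubset A0 A ->
    `|\sum_(j <- A) f (u j) - s| < eps.
  move=> fn.
  have [||s sP] := @nonneg_sum J (fun j => nm (u j) + f (u j)) (2 * M).
  - by move=> j; have := fn (u j); rewrite ler_norml; lra.
  - move=> A; rewrite big_split /=.
    have : \sum_(j <- A) f (u j) <= \sum_(j <- A) nm (u j).
      by apply: ler_sum => j _; apply: le_trans (ler_norm _) (fn _).
    by have := uM A; lra.
  have [||t tP] := @nonneg_sum J (fun j => nm (u j)) M.
  - by move=> j; exact: nm_ge0.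
  - exact: uM.
  exists (s - t) => eps e0; have e2 : 0 < eps / 2 by rewrite divr_gt0.
  have [A AP] := sP _ e2; have [B BP] := tP _ e2.
  exists (fsetU A B) => D; rewrite fsubUset => /andP[/AP + /BP]; rewrite big_split /=.
  by rewrite !ltr_norml; lra.
have [s sP] := rsum Re (@nm_Re R); have [t tP] := rsum Im (@nm_Im R).
exists (s +i* t) => eps e0; have e2 : 0 < eps / 2 by rewrite divr_gt0.
have [A AP] := sP _ e2; have [B BP] := tP _ e2.
exists (fsetU A B) => D; rewrite fsubUset => /andP[/AP h1 /BP h2].
apply: le_lt_trans (nm_le_ReIm _) _; rewrite cReB cImB cRe_sum cIm_sum /=; lra.
Qed.

Lemma usum_common (J K : choiceType) (u : J -> K -> C) (r : J -> C) (s : seq J) (e : R) :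
  0 < e -> (forall j, usum (u j) (r j)) -> exists K0 : {fset K}, forall B, fsubset K0 B ->
  forall j, j \in s -> nm (\sum_(k <- B) u j k - r j) < e.
Proof.
move=> e0 ur; elim: s => [|j s [K1 IH]]; first by exists fset0.
have [K2 h] := ur j e e0; exists (fsetU K1 K2) => B; rewrite fsubUset => /andP[B1 B2] i.
by rewrite inE => /orP[/eqP -> |]; [exact: h|exact: IH].
Qed.

Lemma usum_rows (J K : choiceType) (u : J * K -> C) (r : J -> C) S :
  usum u S -> (forall j, usum (fun k => u (j, k)) (r j)) -> usum r S.
Proof.
move=> uS ur e e0; have e2 : 0 < e / 2 by rewrite divr_gt0.
have [A0 A0P] := uS _ e2.
exists [fset p.1 | p in A0]%fset => A AA.
pose d : R := e / 2 / (size A).+1%:R.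
have d0 : 0 < d by rewrite divr_gt0 // ltr0n.
have [K0 K0P] := @usum_common J K (fun j k => u (j, k)) r A d d0 ur.
pose B := fsetU K0 [fset p.2 | p in A0]%fset.
have sub : fsubset A0 (fsetM A B).
  apply/fsubsetP => p pA; rewrite in_fsetM; apply/andP; split.
    by apply: (fsubsetP AA); apply/imfsetP; exists p.
  by rewrite in_fsetU; apply/orP; right; apply/imfsetP; exists p.
have h1 := A0P _ sub; rewrite sum_fsetM in h1.
have h2 : nm (\sum_(j <- A) \sum_(k <- B) u (j, k) - \sum_(j <- A) r j) <= e / 2.
  rewrite -sumrB; apply: le_trans (nm_sum _ _ _) _.
  apply: le_trans (_ : \sum_(j <- A) d <= _).
    rewrite !big_seq; apply: ler_sum => j jA; apply/ltW/K0P => //; exact: fsubsetUl.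
  rewrite big_const_seq count_predT iter_addr addr0 /d; set h := e / 2 in e2 *.
  rewrite -[X in X <= _]mulr_natr mulrAC ler_pdivrMr ?ltr0n // ler_pM2l // ler_nat.
  exact: leqnSn.
set X := \sum_(j <- A) \sum_(k <- B) _ in h1 h2.
by have := nm_triangle (\sum_(j <- A) r j) X S; rewrite [nm (_ - X)]nmBC; lra.
Qed.

Lemma usum_swap (J K : choiceType) (u : J * K -> C) S :
  usum u S -> usum (fun p : K * J => u (p.2, p.1)) S.
Proof.
move=> uS e /uS[A0 A0P].
exists [fset (p.2, p.1) | p in A0]%fset => A AA.
have sub : fsubset A0 [fset (p.2, p.1) | p in A]%fset.
  apply/fsubsetP => -[j k] jk; apply/imfsetP; exists (k, j) => //=.
  by apply: (fsubsetP AA); apply/imfsetP; exists (j, k).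
have := A0P _ sub; rewrite big_imfset /=; first by [].
by move=> [a b] [c d] _ _ [-> ->].
Qed.

(** Absolute boundedness provides one sum over all pairs, to which both iterated sums are equal. *)
Lemma usum_fubini (J K : choiceType) (u : J * K -> C) (M : R) (r : J -> C) (c : K -> C) s :
  abs_bounded u M -> (forall j, usum (fun k => u (j, k)) (r j)) -> usum r s ->
  (forall k, usum (fun j => u (j, k)) (c k)) -> usum c s.
Proof.
move=> uM ur rs uc; have [S uS] := abs_bounded_sum uM.
rewrite (usum_unique rs (usum_rows uS ur)).
exact: usum_rows (usum_swap uS) uc.
Qed.

Lemma abs_bounded_pair (J K : choiceType) (u : J * K -> C) (b : J -> R) (M : R) :
  (forall j, abs_bounded (fun k => u (j, k)) (b j)) ->
  (forall A : {fset J}, \sum_(j <- A) b j <= M) -> abs_bounded u M.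
Proof.
move=> ub bM A.
pose A1 := [fset p.1 | p in A]%fset; pose A2 := [fset p.2 | p in A]%fset.
have sub : fsubset A (fsetM A1 A2).
  apply/fsubsetP => p pA; rewrite in_fsetM; apply/andP.
  by split; apply/imfsetP; exists p.
apply: le_trans (sum_fset_le (fun p => nm_ge0 (u p)) sub) _; rewrite sum_fsetM.
by apply: le_trans (bM A1); apply: ler_sum => j _; exact: ub.
Qed.

(** Links two modes of convergence: a family known to be summable has its sum identified along an
    exhausting sequence of finite sets, such as boxes. *)
Lemma usum_seq (J : choiceType) (u : J -> C) (B : nat -> {fset J}) s (t : nat -> C) S :
  usum u s -> (forall A : {fset J}, exists N0, forall N, (N0 <= N)%N -> fsubset A (B N)) ->
  (forall N, t N = \sum_(j <- B N) u j) ->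
  (forall eps : R, 0 < eps -> exists N0, forall N, (N0 <= N)%N -> nm (t N - S) <= eps) ->
  s = S.
Proof.
move=> us Bex tE tS; apply/eqP; rewrite -subr_eq0 -nm_eq0; apply/eqP/le_anti.
rewrite nm_ge0 andbT; apply/ler_addgt0Pl => e e0; rewrite addr0.
have e2 : 0 < e / 2 by rewrite divr_gt0.
have [A AP] := us _ e2; have [N1 BP] := Bex A; have [N2 h2] := tS _ e2.
have h1 := AP _ (BP (maxn N1 N2) (leq_maxl _ _)); rewrite -tE in h1.
have {}h2 := h2 _ (leq_maxr N1 N2).
by have := nm_triangle s (t (maxn N1 N2)) S; have := nmBC s (t (maxn N1 N2)); lra.
Qed.

Definition cseq (u : nat -> C) (l : C) := forall eps : R, 0 < eps ->
  exists N0, forall N, (N0 <= N)%N -> nm (u N - l) <= eps.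

Lemma cseq_cst c : cseq (fun=> c) c.
Proof. by move=> e e0; exists 0%N => N _; rewrite subrr nm0 ltW. Qed.

Lemma cseq_ext u v l : u =1 v -> cseq v l -> cseq u l.
Proof. by move=> uv vl e /vl[N0 h]; exists N0 => N; rewrite uv; exact: h. Qed.

Lemma cseqM u v a b : cseq u a -> cseq v b -> cseq (fun N => u N * v N) (a * b).
Proof.
move=> ua vb e e0; have a0 := nm_ge0 a; have b0 := nm_ge0 b.
pose d := Num.min 1 (e / (nm a + nm b + 1)).
have d0 : 0 < d by rewrite lt_min ltr01 divr_gt0 //; lra.
have d1 : d <= 1 by rewrite ge_min lexx.
have de : d * (nm a + nm b + 1) <= e.
  by rewrite -ler_pdivlMr; [rewrite ge_min lexx orbT|lra].
have [N1 h1] := ua d d0; have [N2 h2] := vb d d0.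
exists (maxn N1 N2) => N; rewrite geq_max => /andP[/h1 k1 /h2 k2].
have -> : u N * v N - a * b = (u N - a) * (v N - b) + a * (v N - b) + (u N - a) * b by ring.
have := nmD ((u N - a) * (v N - b) + a * (v N - b)) ((u N - a) * b).
have := nmD ((u N - a) * (v N - b)) (a * (v N - b)).
rewrite !nmM; move: k1 k2 (nm_ge0 (u N - a)) (nm_ge0 (v N - b)).
set x := nm (u N - a); set y := nm (v N - b) => k1 k2 x0 y0.
have : x * y <= d * 1 by rewrite ler_pM //; lra.
have : nm a * y <= nm a * d by rewrite ler_wpM2l.
have : x * nm b <= d * nm b by rewrite ler_wpM2r.
by lra.
Qed.

Section Products.
Variable m : nat.

Definition ffun_nat N (f : {ffun 'I_m -> 'I_N}) : {ffun 'I_m -> nat} :=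
  [ffun l => val (f l)].

Definition ffun_box N : {fset {ffun 'I_m -> nat}} :=
  [fset ffun_nat f | f in {ffun 'I_m -> 'I_N}]%fset.

Lemma in_ffun_box N (b : {ffun 'I_m -> nat}) :
  (b \in ffun_box N) = [forall l, (b l < N)%N].
Proof.
apply/imfsetP/forallP => [[f _ ->] l|bN]; first by rewrite ffunE ltn_ord.
by exists [ffun l => Ordinal (bN l)] => //=; apply/ffunP => l; rewrite !ffunE.
Qed.

Lemma sum_ffun_box (V : zmodType) N (F : {ffun 'I_m -> nat} -> V) :
  \sum_(b <- ffun_box N) F b = \sum_(f : {ffun 'I_m -> 'I_N}) F (ffun_nat f).
Proof.
rewrite /ffun_box big_imfset /=; first by rewrite big_enum.
move=> f g _ _ /ffunP fg; apply/ffunP => l; apply: val_inj.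
by have := fg l; rewrite !ffunE.
Qed.

Lemma ffun_box_exhaust (A : {fset {ffun 'I_m -> nat}}) :
  exists N0, forall N, (N0 <= N)%N -> fsubset A (ffun_box N).
Proof.
exists (\max_(b <- A) \max_(l < m) (b l)).+1%N => N NN; apply/fsubsetP => b bA.
rewrite in_ffun_box; apply/forallP => l; apply: leq_ltn_trans NN.
apply: leq_trans (leq_bigmax l) _.
by rewrite [leqRHS](big_rem b) //= leq_maxl.
Qed.

Lemma usum_prod (u : 'I_m -> nat -> C) (M : 'I_m -> R) (sg : 'I_m -> C) :
  (forall l N, \sum_(k < N) nm (u l k) <= M l) ->
  (forall l, cseq (fun N => \sum_(k < N) u l k) (sg l)) ->
  abs_bounded (fun b : {ffun 'I_m -> nat} => \prod_l u l (b l)) (\prod_l M l) /\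
  usum (fun b : {ffun 'I_m -> nat} => \prod_l u l (b l)) (\prod_l sg l).
Proof.
move=> uM usg.
have ab : abs_bounded (fun b : {ffun 'I_m -> nat} => \prod_l u l (b l)) (\prod_l M l).
  move=> A; have [N0 /(_ N0 (leqnn _)) sub] := ffun_box_exhaust A.
  apply: le_trans (sum_fset_le (fun b => nm_ge0 _) sub) _; rewrite sum_ffun_box.
  rewrite (eq_bigr (fun f : {ffun 'I_m -> 'I_N0} => \prod_l nm (u l (f l)))); last first.
    by move=> f _; rewrite nm_prod; apply: eq_bigr => l _; rewrite ffunE.
  rewrite -(bigA_distr_bigA (fun l (k : 'I_N0) => nm (u l k))).
  by apply: ler_prod => l _; rewrite uM sumr_ge0 // => k _; exact: nm_ge0.
split=> //; have [s us] := abs_bounded_sum ab.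
pose t N := \prod_l \sum_(k < N) u l k.
suff <- : s = \prod_l sg l by [].
apply: (usum_seq (t := t) us ffun_box_exhaust).
  move=> N; rewrite sum_ffun_box /t bigA_distr_bigA /=; apply: eq_bigr => f _.
  by apply: eq_bigr => l _; rewrite ffunE.
have tS r : cseq (fun N => \prod_(l <- r) \sum_(k < N) u l k) (\prod_(l <- r) sg l).
  elim: r => [|l r IH].
    rewrite big_nil; apply: (@cseq_ext _ (fun=> 1)) (cseq_cst _) => N.
    by rewrite big_nil.
  rewrite big_cons; apply: cseq_ext (cseqM (usg l) IH) => N.
  by rewrite big_cons.
exact: tS.
Qed.

End Products.

End UnconditionalSums.

(** * Real analyticity of power series in polar coordinates *)

Section RealAnalytic.
Variable R : realType.
Local Notation C := R[i].
Local Notation Re := (@complex.Re R).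
Local Notation Im := (@complex.Im R).

Lemma binomial_cseq (s h : R) (a : nat) (r : R) : `|h| <= r ->
  (forall N, \sum_(k < N) nm (('C(a, k)%:R * s%:C ^+ (a - k)) * h%:C ^+ k) <= (`|s| + r) ^+ a) /\
  cseq (fun N => \sum_(k < N) ('C(a, k)%:R * s%:C ^+ (a - k)) * h%:C ^+ k) ((s + h)%:C ^+ a).
Proof.
move=> hr.
have full (N : nat) (V : nmodType) (F : nat -> V) : (forall k, (a < k)%N -> F k = 0) ->
    (a < N)%N -> \sum_(k < N) F k = \sum_(k < a.+1) F k.
  move=> F0 aN; rewrite -!(big_mkord xpredT F) (big_cat_nat (n := a.+1)) //=.
  rewrite [X in _ + X]big_nat_cond [X in _ + X]big1 ?addr0 // => k; rewrite andbT => /andP[ak _].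
  exact: F0.
split=> [N|e e0]; last first.
  exists a.+1 => N aN; rewrite (full N _ (fun k => ('C(a, k)%:R * s%:C ^+ (a - k)) * h%:C ^+ k)); [|by move=> k ak; rewrite bin_small // !mul0r|by []].
  rewrite rmorphD exprDn -sumrB big1 ?nm0 ?(ltW e0) // => k _.
  by rewrite -[X in _ - X]mulr_natl mulrA subrr.
apply: le_trans (_ : \sum_(k < maxn N a.+1) nm (('C(a, k)%:R * s%:C ^+ (a - k)) * h%:C ^+ k) <= _).
  rewrite -!(big_mkord xpredT (fun k => nm (('C(a, k)%:R * s%:C ^+ (a - k)) * h%:C ^+ k))).
  rewrite [leRHS](big_cat_nat (n := N)) ?leq_maxl //= lerDl sumr_ge0 // => k _.
  exact: nm_ge0.
rewrite (full _ _ (fun k => nm (('C(a, k)%:R * s%:C ^+ (a - k)) * h%:C ^+ k))); [|by move=> k ak; rewrite bin_small // !mul0r nm0|by rewrite leq_max leqnn orbT].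
apply: le_trans (_ : (`|s| + `|h|) ^+ a <= _); last first.
  by rewrite lerXn2r ?nnegrE ?addr_ge0 // ?lerD2l // (le_trans _ hr).
rewrite exprDn; apply: ler_sum => k _.
by rewrite !nmM nm_nat !nmX !nmR -mulrA mulr_natl.
Qed.

Lemma expi_cseq (t r : R) : `|t| <= r ->
  (forall N, \sum_(k < N) nm ((0 +i* t) ^+ k / k`!%:R) <= expR r) /\
  cseq (fun N => \sum_(k < N) (0 +i* t) ^+ k / k`!%:R) (cos t +i* sin t).
Proof.
move=> tr; split=> [N|].
  apply: le_trans (_ : expR `|t| <= _); last by rewrite ler_expR.
  have := @exp_coeff_ge0 R.
  rewrite (eq_bigr (fun k : 'I_N => exp_coeff `|t| k)); last first.
    move=> k _; rewrite /exp_coeff /= nmM nmX nmV nm_nat; congr (_ ^+ _ / _).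
    by rewrite nmE /= expr0n add0r sqrtr_sqr.
  move=> ge0; have cv := is_cvg_series_exp_coeff `|t|.
  rewrite -(big_mkord xpredT (exp_coeff `|t|)).
  apply: (nondecreasing_cvgn_le _ cv).
  move=> p q pq; rewrite /series /= [leRHS](big_cat_nat (n := p)) //= lerDl sumr_ge0 // => k _.
  exact: ge0.
have rc : forall eps : R, 0 < eps -> exists N0, forall N, (N0 <= N)%N ->
    `|\sum_(k < N) cos_coeff t k - cos t| <= eps.
  move=> e e0; have : series (cos_coeff t) @ \oo --> cos t.
    by rewrite cos.unlock; exact: is_cvg_series_cos_coeff.
  move=> /cvgrPdist_le /(_ e e0) [N0 _ H]; exists N0 => N /H /=.
  by rewrite distrC /series /= big_mkord.
have rs : forall eps : R, 0 < eps -> exists N0, forall N, (N0 <= N)%N ->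
    `|\sum_(k < N) sin_coeff t k - sin t| <= eps.
  move=> e e0; have : series (sin_coeff t) @ \oo --> sin t.
    by rewrite sin.unlock; exact: is_cvg_series_sin_coeff.
  move=> /cvgrPdist_le /(_ e e0) [N0 _ H]; exists N0 => N /H /=.
  by rewrite distrC /series /= big_mkord.
have pw k : (0 +i* t : C) ^+ k = (t ^+ k)%:C * (('i%C) ^+ k).
  by rewrite rmorphXn -exprMn; congr (_ ^+ _); apply: complex_ext; rewrite !(cReM, cImM) /=; ring.
have iP k : ('i%C : C) ^+ k = if odd k then (0 +i* ((-1) ^+ k./2)) else ((-1) ^+ k./2)%:C.
  elim: k => [|k IH]; first by rewrite expr0.
  rewrite exprSr IH /= uphalf_half; case: (odd k); rewrite ?add0n ?add1n ?exprS /=;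
    by apply: complex_ext; rewrite !(cReM, cImM) /=; ring.
move=> e e0; have e2 : 0 < e / 2 by rewrite divr_gt0.
have [N1 h1] := rc _ e2; have [N2 h2] := rs _ e2.
exists (maxn N1 N2) => N; rewrite geq_max => /andP[/h1 k1 /h2 k2].
apply: le_trans (nm_le_ReIm _) _; rewrite cReB cImB cRe_sum cIm_sum /=.
have -> : \sum_(k < N) Re ((0 +i* t) ^+ k / k`!%:R) = \sum_(k < N) cos_coeff t k.
  apply: eq_bigr => k _; rewrite pw iP -(rmorph_nat (real_complex R)) -fmorphV.
  rewrite /cos_coeff /= -?exprnP; case: (odd k); rewrite !(cReM, cImM) /=; ring.
have -> : \sum_(k < N) Im ((0 +i* t) ^+ k / k`!%:R) = \sum_(k < N) sin_coeff t k.
  apply: eq_bigr => k _; rewrite pw iP -(rmorph_nat (real_complex R)) -fmorphV.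
  rewrite /sin_coeff /= -?exprnP; case ho: (odd k); rewrite !(cReM, cImM) /=; last by ring.
  by rewrite (_ : k.-1./2 = k./2); [ring|case: (nat_of_ord k) ho => //= n; lia].
lra.
Qed.

Section PowerSeries.
Variables (J : choiceType) (L : nat) (a : J -> C) (al : J -> 'I_L -> nat).
Hypothesis abs_conv : forall rho : 'I_L -> R, (forall l, 0 < rho l < 1) ->
  exists M : R, forall A : {fset J},
    \sum_(j <- A) nm (a j) * \prod_l rho l ^+ al j l <= M.

(* The first L variables are the moduli, the last L the arguments. *)
Definition polar_term (x : 'rV[R]_(L + L)) (j : J) : C :=
  a j * \prod_l ((x 0 (lshift L l))%:C ^+ al j l * ce ((al j l)%:R * (x 0 (rshift L l))%:C)).

(** [xget] returns 0 at the points where the series has no sum. *)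
Definition polar_sum (x : 'rV[R]_(L + L)) : C := xget 0 [set s | usum (polar_term x) s].

Lemma nm_polar_term x j : nm (polar_term x j) =
  nm (a j) * \prod_l `|x 0 (lshift L l)| ^+ al j l.
Proof.
rewrite /polar_term nmM nm_prod; congr (_ * _); apply: eq_bigr => l _.
by rewrite nmM nmX nmR nm_ce cImM cIm_nat /= mulr0 mul0r addr0 mulr0 oppr0 expR0 mulr1.
Qed.

Lemma polar_sumP (x : 'rV[R]_(L + L)) : (forall l, `|x 0 (lshift L l)| < 1) ->
  usum (polar_term x) (polar_sum x).
Proof.
move=> x1; suff [s us] : exists s, usum (polar_term x) s by exact: xgetI us.
pose rho l := (`|x 0 (lshift L l)| + 1) / 2.
have [l|M MP] := abs_conv (rho := rho).
  by rewrite /rho; have := x1 l; have := normr_ge0 (x 0 (lshift L l)); lra.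
apply: (@abs_bounded_sum _ _ _ M) => A; apply: le_trans (MP A).
apply: ler_sum => j _; rewrite nm_polar_term ler_wpM2l ?nm_ge0 //.
apply: ler_prod => l _; rewrite exprn_ge0 //= lerXn2r ?nnegrE //.
  by rewrite /rho divr_ge0 // addr_ge0.
by rewrite /rho; have := x1 l; lra.
Qed.

(** Taylor coefficient of order [k] at [x0] of the factor in coordinate [i]: binomial for a modulus,
    exponential for an argument. *)
Let cf (x0 : 'rV[R]_(L + L)) j (i : 'I_(L + L)) (k : nat) : C :=
  match fintype.split i with
  | inl l => 'C(al j l, k)%:R * (x0 0 i)%:C ^+ (al j l - k)
  | inr l => ce ((al j l)%:R * (x0 0 i)%:C) * ((0 +i* (2 * pi * (al j l)%:R)) ^+ k / k`!%:R)
  end.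

(** Each factor is expanded at [x0]. A displacement [r] raises a modulus to [|x0| + r] and costs
    [exp (2 pi r)] per unit of frequency in the argument, as if the radius were
    [(|x0| + r) exp (2 pi r)]. *)
Lemma polar_row (x0 x : 'rV[R]_(L + L)) (r : R) j : (forall i, `|x 0 i - x0 0 i| <= r) ->
  let u (b : {ffun 'I_(L + L) -> nat}) :=
    a j * \prod_i (cf x0 j i (b i) * ((x 0 i - x0 0 i)%:C ^+ b i)) in
  abs_bounded u (nm (a j) *
     \prod_l ((`|x0 0 (lshift L l)| + r) * expR (2 * pi * r)) ^+ al j l) /\
  usum u (polar_term x j).
Proof.
move=> xr u.
pose M (i : 'I_(L + L)) := match fintype.split i with
  | inl l => (`|x0 0 i| + r) ^+ al j l | inr l => expR (2 * pi * r) ^+ al j l end.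
pose sg (i : 'I_(L + L)) := match fintype.split i with
  | inl l => (x 0 i)%:C ^+ al j l | inr l => ce ((al j l)%:R * (x 0 i)%:C) end.
have key i : (forall N, \sum_(k < N) nm (cf x0 j i k * (x 0 i - x0 0 i)%:C ^+ k) <= M i) /\
    cseq (fun N => \sum_(k < N) cf x0 j i k * (x 0 i - x0 0 i)%:C ^+ k) (sg i).
  rewrite /cf /M /sg; case: fintype.split => l.
    by have := @binomial_cseq (x0 0 i) (x 0 i - x0 0 i) (al j l) r (xr i);
      rewrite [x0 0 i + _]addrC subrK.
  set n := al j l; set h := x 0 i - x0 0 i.
  have hb : `|2 * pi * n%:R * h| <= 2 * pi * n%:R * r.
    have t0 : 0 <= 2 * pi * n%:R :> R by rewrite mulr_ge0 ?ler0n // mulr_ge0 // pi_ge0.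
    rewrite normrM (ger0_norm t0); by apply: ler_wpM2l => //; exact: xr.
  have [h1 h2] := expi_cseq hb.
  have pw k : (0 +i* (2 * pi * n%:R)) ^+ k / k`!%:R * h%:C ^+ k =
      (0 +i* (2 * pi * n%:R * h) : C) ^+ k / k`!%:R.
    rewrite mulrAC -exprMn; congr (_ ^+ _ / _).
    by apply: complex_ext; rewrite !(cReM, cImM) /=; ring.
  have n1 : nm (ce (n%:R * (x0 0 i)%:C)) = 1.
    by rewrite nm_ce cImM cIm_nat /= mulr0 mul0r addr0 mulr0 oppr0 expR0.
  split=> [N|].
    rewrite (eq_bigr (fun k : 'I_N => nm ((0 +i* (2 * pi * n%:R * h) : C) ^+ k / k`!%:R))).
      apply: le_trans (h1 N) _; rewrite -expRM_natl ler_expR le_eqVlt; apply/orP; left.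
      by apply/eqP; ring.
    by move=> k _; rewrite -mulrA pw nmM n1 mul1r.
  have -> : ce (n%:R * (x 0 i)%:C) = ce (n%:R * (x0 0 i)%:C) *
      (cos (2 * pi * n%:R * h) +i* sin (2 * pi * n%:R * h)).
    have -> : n%:R * (x 0 i)%:C = n%:R * (x0 0 i)%:C + n%:R * h%:C.
      by rewrite -mulrDr -rmorphD /h addrC subrK.
    rewrite ceD; congr (_ * _); rewrite {1}/ce.
    have -> : Im (n%:R * h%:C) = 0 by rewrite cImM cIm_nat /=; ring.
    have -> : Re (n%:R * h%:C) = n%:R * h by rewrite cReM cIm_nat cRe_nat /=; ring.
    by rewrite mulr0 oppr0 expR0 mul1r !mulrA.
  apply: (cseq_ext _ (cseqM (cseq_cst _) h2)) => N.
  by rewrite mulr_sumr; apply: eq_bigr => k _; rewrite -mulrA pw.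
have [ab us] := @usum_prod _ _ (fun i k => cf x0 j i k * (x 0 i - x0 0 i)%:C ^+ k) M sg (fun i => (key i).1) (fun i => (key i).2).
split.
  move=> A; rewrite (eq_bigr (fun b : {ffun 'I_(L + L) -> nat} => nm (a j) *
     nm (\prod_i (cf x0 j i (b i) * ((x 0 i - x0 0 i)%:C ^+ b i))))); last first.
    by move=> b _; rewrite nmM.
  rewrite -mulr_sumr ler_wpM2l ?nm_ge0 //; apply: le_trans (ab A) _.
  rewrite big_split_ord /= le_eqVlt; apply/orP; left; apply/eqP.
  rewrite -big_split; apply: eq_bigr => l _ /=; rewrite /M.
  by rewrite (unsplitK (inl l)) (unsplitK (inr l)) exprMn.
have -> : polar_term x j = a j * \prod_i sg i.
  rewrite /polar_term big_split_ord /= -big_split; congr (_ * _); apply: eq_bigr => l _ /=.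
  by rewrite /sg (unsplitK (inl l)) (unsplitK (inr l)).
exact: usumZ.
Qed.

(** For small [r] the inflated radii of [polar_row] are still below 1, so the double series over [j]
    and the Taylor orders is absolutely bounded and [usum_fubini] exchanges the sums. *)
Lemma polar_sum_series (x0 : 'rV[R]_(L + L)) : (forall l, `|x0 0 (lshift L l)| < 1) ->
  exists (r : R) (c : {ffun 'I_(L + L) -> nat} -> C), 0 < r /\
  forall x : 'rV[R]_(L + L), (forall i, `|x 0 i - x0 0 i| < r) ->
    usum (fun b => c b * (monomial (x - x0) b)%:C) (polar_sum x).
Proof.
move=> x1.
have [r r0 rP] : exists2 r : R, 0 < r & forall l,
    0 < (`|x0 0 (lshift L l)| + r) * expR (2 * pi * r) < 1.
  have [q q0 qP] : exists2 q : R, 0 < q < 1 & forall l, `|x0 0 (lshift L l)| <= 1 - q.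
    have [q /andP[q0 q1] qP] : exists2 q : R, 0 < q < 1 &
        forall l, l \in enum 'I_L -> `|x0 0 (lshift L l)| <= 1 - q.
      elim: (enum 'I_L) => [|l s [q q0 IH]]; first by exists (2^-1) => //; lra.
      exists (Num.min q ((1 - `|x0 0 (lshift L l)|) / 2)).
        by rewrite lt_min gt_min; have := x1 l; lra.
      move=> i; rewrite inE => /orP[/eqP -> |/IH h].
        have : Num.min q ((1 - `|x0 0 (lshift L l)|) / 2) <= (1 - `|x0 0 (lshift L l)|) / 2.
          by rewrite ge_min lexx orbT.
        by have := x1 l; lra.
      have : Num.min q ((1 - `|x0 0 (lshift L l)|) / 2) <= q by rewrite ge_min lexx.
      by lra.
    by exists q => [|l]; [rewrite q0 q1|apply: qP; rewrite mem_enum].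
  have p0 := pi_gt0 R.
  have h : 0 < 2 * pi + 1 :> R by lra.
  (* With this [r], [|x0| + r < 1 - 2 pi r], and [exp (t) (1 - t) <= 1] at [t = 2 pi r]
     concludes. *)
  pose r := q / 2 / (2 * pi + 1); have r0 : 0 < r by rewrite /r !divr_gt0 //; lra.
  have rE : r * (2 * pi + 1) = q / 2 by rewrite /r divfK // lt0r_neq0.
  have pr : 0 < 2 * pi * r by rewrite mulr_gt0 // mulr_gt0.
  have rq : r < q / 2 by nra.
  exists r => // l; have e0 := expR_gt0 (2 * pi * r).
  have n0 := normr_ge0 (x0 0 (lshift L l)).
  rewrite mulr_gt0 ?ltr_wpDl //=.
  have eN : expR (2 * pi * r) * (1 - 2 * pi * r) <= 1.
    have : 1 - 2 * pi * r <= expR (- (2 * pi * r)) by have := expR_ge1Dx (- (2 * pi * r)); lra.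
    rewrite -(ler_pM2l e0) expRN mulfV ?lt0r_neq0 //.
  apply: lt_le_trans eN; rewrite [ltLHS]mulrC ltr_pM2l //.
  by have := qP l; lra.
pose rho l := (`|x0 0 (lshift L l)| + r) * expR (2 * pi * r).
have [M MP] := abs_conv rP.
have xr1 (x : 'rV[R]_(L + L)) : (forall i, `|x 0 i - x0 0 i| <= r) -> forall l, `|x 0 (lshift L l)| < 1.
  move=> xr l; have /andP[_ +] := rP l; apply: le_lt_trans.
  have e1 : 1 <= expR (2 * pi * r) by rewrite -[leLHS]expR0 ler_expR !mulr_ge0 ?pi_ge0 ?(ltW r0).
  have b : `|x 0 (lshift L l)| <= `|x0 0 (lshift L l)| + r.
    have := xr (lshift L l); have := ler_normD (x 0 (lshift L l) - x0 0 (lshift L l)) (x0 0 (lshift L l)).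
    by rewrite subrK; lra.
  have r1 := ltW r0; apply: le_trans b _; by rewrite ler_peMr // addr_ge0.
pose u (x : 'rV[R]_(L + L)) (p : J * {ffun 'I_(L + L) -> nat}) :=
  a p.1 * \prod_i (cf x0 p.1 i (p.2 i) * ((x 0 i - x0 0 i)%:C ^+ p.2 i)).
have ab (x : 'rV[R]_(L + L)) : (forall i, `|x 0 i - x0 0 i| <= r) -> abs_bounded (u x) M.
  move=> xr; apply: abs_bounded_pair (fun j => (polar_row j xr).1) _ => A.
  exact: MP.
have uE (x : 'rV[R]_(L + L)) p : u x p = (a p.1 * \prod_i cf x0 p.1 i (p.2 i)) * (monomial (x - x0) p.2)%:C.
  rewrite /u big_split /= mulrA; congr (_ * _); rewrite /monomial rmorph_prod.
  by apply: eq_bigr => i _; rewrite !mxE rmorphXn.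
(* The coefficient series of a fixed order [b] is extracted from the double series at a point all of
   whose displacements equal [r], where the monomial is nonzero. *)
have cex (b : {ffun 'I_(L + L) -> nat}) : exists c, usum (fun j => a j * \prod_i cf x0 j i (b i)) c.
  pose x := x0 + const_mx r.
  have xr i : `|x 0 i - x0 0 i| <= r by rewrite !mxE addrC addKr ger0_norm // ltW.
  have m0 : (monomial (x - x0) b)%:C != 0 :> C.
    rewrite fmorph_eq0; apply/prodf_neq0 => i _; rewrite expf_neq0 //.
    by rewrite !mxE addrC addKr lt0r_neq0.
  have [s us] : exists s, usum (fun j => u x (j, b)) s.
    apply: (@abs_bounded_sum _ _ _ M) => A.
    have := ab x xr (fsetM A [fset b]%fset); rewrite sum_fsetM; apply: le_trans.
    by apply: ler_sum => j _; rewrite big_seq_fset1.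
  exists ((monomial (x - x0) b)%:C^-1 * s); apply: usum_eq (usumZ _ us) => j.
  by rewrite uE /= mulrC mulfK.
have /choice[c cP] := cex.
exists r, c; split=> // x xr; have {}xr i : `|x 0 i - x0 0 i| <= r by rewrite ltW.
apply: (usum_fubini (ab x xr) (fun j => (polar_row j xr).2) (polar_sumP (xr1 x xr))) => b.
rewrite [c b * _]mulrC; apply: usum_eq (usumZ _ (cP b)) => j.
by rewrite uE mulrC.
Qed.

Lemma analytic_at_usum m (f : 'rV[R]_m -> R) (x0 : 'rV[R]_m) (r : R)
    (c : {ffun 'I_m -> nat} -> R) : 0 < r ->
  (forall x : 'rV[R]_m, (forall i, `|x 0 i - x0 0 i| < r) ->
    forall eps, 0 < eps -> exists A0 : {fset {ffun 'I_m -> nat}}, forall A,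
    fsubset A0 A -> `|\sum_(b <- A) c b * monomial (x - x0) b - f x| < eps) ->
  analytic_at f x0.
Proof.
move=> r0 H; exists c; apply/nbhs_ballP; exists r => // x xr.
have FF := @summability.totally_filter {ffun 'I_m -> nat}.
apply/(@cvgrPdist_lt _ _ _ _ FF) => eps e0; have [i|A0 A0P] := H x _ eps e0.
  by have := xr.2 0 i; rewrite -ball_normE /ball_ /= distrC.
exists A0 => // A /A0P; rewrite /summability.partial_sum distrC.
by rewrite (big_seq_fsetE _ _ xpredT (fun b => c b * monomial (x - x0) b)).
Qed.

Lemma analytic_Re_polar_sum (x0 : 'rV[R]_(L + L)) :
  (forall l, `|x0 0 (lshift L l)| < 1) -> analytic_at (fun x => Re (polar_sum x)) x0.
Proof.
move=> /polar_sum_series[r [c [r0 H]]].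
apply: (@analytic_at_usum _ _ _ r (fun b => Re (c b))) => // x xr eps e0.
have [A0 A0P] := H x xr eps e0; exists A0 => A /A0P; apply: le_lt_trans.
apply: le_trans (nm_Re _); rewrite cReB cRe_sum; rewrite le_eqVlt; apply/orP; left; apply/eqP.
by congr `|_ - _|; apply: eq_bigr => b _; rewrite [c b * _]mulrC cReMR mulrC.
Qed.

Lemma analytic_Im_polar_sum (x0 : 'rV[R]_(L + L)) :
  (forall l, `|x0 0 (lshift L l)| < 1) -> analytic_at (fun x => Im (polar_sum x)) x0.
Proof.
move=> /polar_sum_series[r [c [r0 H]]].
apply: (@analytic_at_usum _ _ _ r (fun b => Im (c b))) => // x xr eps e0.
have [A0 A0P] := H x xr eps e0; exists A0 => A /A0P; apply: le_lt_trans.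
apply: le_trans (nm_Im _); rewrite cImB cIm_sum; rewrite le_eqVlt; apply/orP; left; apply/eqP.
by congr `|_ - _|; apply: eq_bigr => b _; rewrite [c b * _]mulrC cImMR mulrC.
Qed.

End PowerSeries.

End RealAnalytic.

(** * Absolute convergence of Fourier series and passage to cone coordinates *)

Section IntegerSeries.
Variables (R : realType) (n : nat).
Local Notation C := R[i].
Local Notation Re := (@complex.Re R).
Local Notation Im := (@complex.Im R).

Definition boxTs N : {fset 'rV[int]_n} :=
  [fset boxT f | f in {ffun 'I_n -> 'I_(N.*2.+1)}]%fset.

Lemma boxT_inj N : injective (@boxT n N).
Proof.
move=> f h /rowP fh; apply/ffunP => l; apply: val_inj.
by have := fh l; rewrite !mxE => /addIr [].
Qed.

Lemma in_boxTs N (T : 'rV[int]_n) : (T \in boxTs N) = [forall l, (`|T 0%R l| <= N)%N].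
Proof.
apply/imfsetP/forallP => [[f _ ->] l|TN].
  rewrite mxE; case: (f l) => k kN /=; by lia.
have h l : (`|(T 0 l + N%:Z)%R| < N.*2.+1)%N by have := TN l; lia.
exists [ffun l => Ordinal (h l)] => //=; apply/rowP => l; rewrite !mxE ffunE /=.
by have := TN l; lia.
Qed.

Lemma sum_boxTs (V : zmodType) N (F : 'rV[int]_n -> V) :
  \sum_(T <- boxTs N) F T = boxsum N F.
Proof.
rewrite /boxTs big_imfset /=; first by rewrite big_enum.
by move=> f h _ _; exact: boxT_inj.
Qed.

Lemma boxTs_exhaust (A : {fset 'rV[int]_n}) :
  exists N0, forall N, (N0 <= N)%N -> fsubset A (boxTs N).
Proof.
exists (\max_(T <- A) \max_(l < n) `|T 0%R l|)%N => N NN; apply/fsubsetP => T TA.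
rewrite in_boxTs; apply/forallP => l; apply: leq_trans NN.
apply: leq_trans (_ : \max_(l < n) `|T 0%R l| <= _)%N; first exact: (leq_bigmax (F := fun l => `|T 0%R l|%N)).
by rewrite [leqRHS](big_rem T) //= leq_maxl.
Qed.

Lemma geom_sum_le (rho : R) N : 0 < rho -> rho < 1 ->
  \sum_(k < N) rho ^+ k <= (1 - rho)^-1.
Proof.
move=> r0 r1; rewrite -[leRHS]mul1r ler_pdivlMr; last by lra.
have := subrXX 1 rho N; rewrite expr1n => e.
have -> : (\sum_(k < N) rho ^+ k) * (1 - rho) = 1 - rho ^+ N.
  rewrite e mulrC; congr (_ * _); apply: eq_bigr => i _; by rewrite expr1n mul1r.
by have : 0 < rho ^+ N by [rewrite exprn_gt0]; lra.
Qed.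

Lemma two_sided_sum_le (rho : R) N : 0 < rho -> rho < 1 ->
  \sum_(k < N.*2.+1) rho ^+ `|(val k)%:Z - N%:Z| <= 2 / (1 - rho).
Proof.
move=> r0 r1; rewrite -(big_mkord xpredT (fun k : nat => rho ^+ `|k%:Z - N%:Z|)).
rewrite (big_cat_nat (n := N)) //=; last by lia.
have h : \sum_(N <= k < N.*2.+1) rho ^+ `|k%:Z - N%:Z| <= (1 - rho)^-1.
  rewrite -{1}[N]add0n big_addn; apply: le_trans (geom_sum_le (N.*2.+1 - N) r0 r1).
  rewrite big_mkord; apply: ler_sum => k _.
  by rewrite (_ : `|(k + N)%N%:Z - N%:Z|%N = k) //; lia.
have h' : \sum_(0 <= k < N) rho ^+ `|k%:Z - N%:Z| <= (1 - rho)^-1.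
  rewrite big_nat_rev /= add0n; apply: le_trans (geom_sum_le N r0 r1).
  rewrite big_mkord; apply: ler_sum => k _.
  have -> : `|(N - k.+1)%N%:Z - N%:Z|%N = k.+1 by have := ltn_ord k; lia.
  by rewrite exprS ler_piMl ?exprn_ge0 ?ltW.
lra.
Qed.

Lemma root_below1 (rho : R) : 0 < rho -> rho < 1 -> (0 < n)%N ->
  exists2 q : R, 0 < q < 1 & rho <= q ^+ n.
Proof.
move=> r0 r1 n0; have nR : 1 <= n%:R :> R by rewrite ler1n.
pose d := (1 - rho) / n%:R.
have dn : d * n%:R = 1 - rho by rewrite /d divfK // gt_eqF //; lra.
have d0 : 0 < d by rewrite divr_gt0 //; lra.
have d1 : d < 1 by rewrite ltr_pdivrMr ?mul1r; lra.
exists (1 - d); first lra.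
have bern m : 1 - d * m%:R <= (1 - d) ^+ m.
  elim: m => [|m IH]; first by rewrite mulr0 subr0 expr0.
  rewrite exprS -natr1 mulrDr mulr1.
  have : (1 - d) * (1 - d * m%:R) <= (1 - d) * (1 - d) ^+ m by rewrite ler_pM2l //; lra.
  have : 0 <= d * d * m%:R by rewrite mulr_ge0 // mulr_ge0 // ltW.
  lra.
by have := bern n; rewrite dn; lra.
Qed.

(** Decay in the largest [|T_l|] alone is shared among the [n] coordinates by replacing [rho] with
    [q ^ n], after which the sum over a box factors into geometric series. *)
Lemma decay_abs_bounded (u : 'rV[int]_n -> C) (B rho : R) : (0 < n)%N -> 0 <= B ->
  0 < rho -> rho < 1 -> (forall T l, nm (u T) <= B * rho ^+ `|T 0 l|) ->
  exists M, abs_bounded u M.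
Proof.
move=> n0 B0 r0 r1 ub; have [q /andP[q0 q1] qn] := root_below1 r0 r1 n0.
have uq T : nm (u T) <= B * \prod_l q ^+ `|T 0 l|.
  have [l0 _ l0P] := @arg_maxnP 'I_n (Ordinal n0) xpredT (fun l => `|T 0%R l|%N) isT.
  apply: le_trans (ub T l0) _; rewrite ler_wpM2l //.
  apply: le_trans (_ : (q ^+ n) ^+ `|T 0 l0| <= _).
    by apply: lerXn2r => //; rewrite ?nnegrE ?exprn_ge0 // ltW.
  rewrite -exprM mulnC exprM.
  have -> : (q ^+ `|T 0 l0|) ^+ n = \prod_(l < n) q ^+ `|T 0 l0| by rewrite prodr_const card_ord.
  apply: ler_prod => l _.
  rewrite exprn_ge0 ?(ltW q0) //=; apply: ler_wiXn2l (l0P l isT); exact: ltW.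
exists (B * (2 / (1 - q)) ^+ n) => A; have [N0 /(_ N0 (leqnn _)) sub] := boxTs_exhaust A.
apply: le_trans (sum_fset_le (fun T => nm_ge0 _) sub) _; rewrite sum_boxTs.
apply: le_trans (_ : \sum_f B * \prod_l q ^+ `|@boxT n N0 f 0 l| <= _).
  by apply: ler_sum => f _; exact: uq.
rewrite -mulr_sumr ler_wpM2l //.
rewrite (eq_bigr (fun f : {ffun 'I_n -> 'I_(N0.*2.+1)} =>
   \prod_l q ^+ `|(val (f l))%:Z - N0%:Z|)); last first.
  by move=> f _; apply: eq_bigr => l _; rewrite mxE.
rewrite -(bigA_distr_bigA (fun (l : 'I_n) (k : 'I_(N0.*2.+1)) => q ^+ `|(val k)%:Z - N0%:Z|)).
rewrite -[n in leRHS]card_ord -prodr_const; apply: ler_prod => l _.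
by rewrite two_sided_sum_le // sumr_ge0 // => k _; rewrite exprn_ge0 ?ltW.
Qed.

Lemma nm_ce_dotR T (v : 'rV[C]_n) : nm (ce (dot T v)) = expR (- (2 * pi * dotR T (imv v))).
Proof. by rewrite nm_ce Im_dot. Qed.

Section Expansion.
Variables (G : 'rV[C]_n -> C) (Om : 'rV[R]_n -> Prop).
Hypothesis n_gt0 : (0 < n)%N.
Hypothesis Gper : forall v l, G (v + ev_ R l) = G v.
Hypothesis Gdif : forall v l (u : C), Om (imv (v + u *: ev_ R l)) ->
  differentiable (fun u : C => G (v + u *: ev_ R l)) u.
Hypothesis Gbnd : forall Y, Om Y -> exists eps M : R, 0 < eps /\
  forall v : 'rV[C]_n, (forall k, `|Im (v 0 k) - Y 0 k| <= eps) -> Om (imv v) /\ nm (G v) <= M.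
Hypothesis Omconv : forall Y Y' (t : R), Om Y -> Om Y' -> 0 <= t <= 1 ->
  Om ((1 - t) *: Y + t *: Y').
Variable v0 : 'rV[C]_n.
Hypothesis Ov0 : Om (imv v0).

Definition fcoef T : C := mlim G T v0.

Lemma fourier_abs v : Om (imv v) -> exists M, abs_bounded (fun T => fcoef T * ce (dot T v)) M.
Proof.
move=> Ov; have [B [rho [B0 r0 r1 H]]] := mlim_decay Gper Gdif Gbnd Ov.
apply: (decay_abs_bounded n_gt0 B0 r0 r1) => T l.
rewrite nmM nm_ce_dotR /fcoef -(mavg_const Gper Gdif Gbnd Omconv T Ov0 Ov).
exact: H.
Qed.

Lemma fourier_usum v : Om (imv v) -> usum (fun T => fcoef T * ce (dot T v)) (G v).
Proof.
move=> Ov; have [M ab] := fourier_abs Ov; have [s us] := abs_bounded_sum ab.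
suff <- : s = G v by [].
apply: (usum_seq us boxTs_exhaust (fun N => erefl)) => e e0.
have [N0 h] := fourier_cvg Gper Gdif Gbnd Ov e0; exists N0 => N /h.
rewrite nmBC sum_boxTs.
suff -> : boxsum N (fun T => mlim G T v * ce (dot T v)) =
  boxsum N (fun T => fcoef T * ce (dot T v)) by move=> h'; exact: h'.
apply: eq_bigr => k _; rewrite /fcoef.
by rewrite -(mavg_const Gper Gdif Gbnd Omconv (boxT k) Ov0 Ov).
Qed.

Variables (L : nat) (B : 'I_L -> 'rV[R]_n) (beta : 'rV[int]_n -> 'I_L -> int).
Hypothesis OmB : forall y : 'I_L -> R, (forall l, 0 < y l) -> Om (\sum_l y l *: B l).
Hypothesis betaE : forall T l, dotR T (B l) = (beta T l)%:~R.
Hypothesis beta_ge0 : forall T l, fcoef T != 0 -> 0 <= beta T l.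

(** Taking absolute values changes nothing where it matters: [beta] is nonnegative at every index
    with nonzero coefficient. *)
Definition cone_exp T (l : 'I_L) : nat := `|beta T l|%N.

Definition cone_pt (z : 'I_L -> C) : 'rV[C]_n := \sum_l z l *: rv (B l).

Lemma imv_cone_pt z : imv (cone_pt z) = \sum_l Im (z l) *: B l.
Proof.
apply/rowP => k; rewrite !(mxE, summxE) cIm_sum; apply: eq_bigr => l _.
by rewrite !mxE mulrC cImMR mulrC.
Qed.

Lemma cone_term T z : fcoef T * ce (dot T (cone_pt z)) =
  fcoef T * \prod_l ce ((cone_exp T l)%:R * z l).
Proof.
have [->|aT] := eqVneq (fcoef T) 0; first by rewrite !mul0r.
congr (_ * _); rewrite -ce_sum; congr ce.
have -> : dot T (cone_pt z) = \sum_l z l * (dotR T (B l))%:C.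
  rewrite /cone_pt (big_morph (dot T) (dotD T) (_ : dot T 0 = 0)).
    apply: eq_bigr => l _; rewrite dotZ; congr (_ * _).
    by rewrite /dotR rmorph_sum; apply: eq_bigr => k _; rewrite !mxE rmorphM /= rmorph_int.
  by rewrite /dot big1 // => k _; rewrite mxE mulr0.
apply: eq_bigr => l _; rewrite betaE mulrC; congr (_ * _).
rewrite /cone_exp rmorph_int; have := beta_ge0 l aT; by case: (beta T l).
Qed.

(** Radii below 1 are the moduli of [ce (z_l)] at a point with positive imaginary coordinates; this
    point lies in the tube, where the Fourier series converges absolutely. *)
Lemma cone_abs_conv (rho : 'I_L -> R) : (forall l, 0 < rho l < 1) ->
  exists M : R, forall A : {fset 'rV[int]_n},
    \sum_(T <- A) nm (fcoef T) * \prod_l rho l ^+ cone_exp T l <= M.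
Proof.
move=> rP; pose y l := - ln (rho l) / (2 * pi).
have p0 : 0 < 2 * pi :> R by rewrite mulr_gt0 // pi_gt0.
have y0 l : 0 < y l.
  by have /andP[a b] := rP l; rewrite /y divr_gt0 // oppr_gt0 ln_lt0.
pose z l : C := 0 +i* y l.
have [|M MP] := @fourier_abs (cone_pt z).
  by rewrite imv_cone_pt; exact: OmB.
exists M => A; apply: le_trans (MP A); apply: ler_sum => T _.
rewrite cone_term nmM nm_prod ler_wpM2l ?nm_ge0 // le_eqVlt; apply/orP; left; apply/eqP.
apply: eq_bigr => l _; rewrite nm_ce cImM cRe_nat cIm_nat /= mul0r addr0.
have /andP[a b] := rP l.
rewrite -[in LHS](lnK (x := rho l)) ?posrE // -expRM_natl; congr expR.
by rewrite /y mulrCA [2 * pi * _]mulrC divfK ?(gt_eqF p0) // mulrN opprK.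
Qed.

Lemma cone_usum z : (forall l, 0 < Im (z l)) ->
  usum (fun T => fcoef T * \prod_l ce ((cone_exp T l)%:R * z l)) (G (cone_pt z)).
Proof.
move=> z0; apply: usum_eq (fun T => cone_term T z) (fourier_usum _).
by rewrite imv_cone_pt; exact: OmB.
Qed.

End Expansion.

End IntegerSeries.

(** * Terms and definable sets in complex variables *)

Section Definability.
Variables (R : realType) (m : nat).
Local Notation C := R[i].
Local Notation Re := (@complex.Re R).
Local Notation Im := (@complex.Im R).
Implicit Types (f h : 'rV[C]_m -> R) (p q : 'rV[C]_m -> C) (X Y : set 'rV[C]_m).

Definition rterm f := exists t : term R (m + m), forall x, eval x t = f (complex_vec x).

Definition cterm p := rterm (fun w => Re (p w)) /\ rterm (fun w => Im (p w)).

Lemma rterm_ext f h : f =1 h -> rterm f -> rterm h.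
Proof. by move=> fh [t tP]; exists t => x; rewrite tP fh. Qed.

Lemma cterm_ext p q : p =1 q -> cterm p -> cterm q.
Proof. by move=> pq [h1 h2]; split; [apply: rterm_ext h1|apply: rterm_ext h2] => w; rewrite pq. Qed.

Lemma rterm_cst (c : R) : rterm (fun=> c).
Proof. by exists (TCst _ c). Qed.

Lemma rtermN f : rterm f -> rterm (fun w => - f w).
Proof. by move=> [t tP]; exists (TOpp t) => x /=; rewrite tP. Qed.

Lemma rtermD f h : rterm f -> rterm h -> rterm (fun w => f w + h w).
Proof. by move=> [t tP] [s sP]; exists (TAdd t s) => x /=; rewrite tP sP. Qed.

Lemma rtermM f h : rterm f -> rterm h -> rterm (fun w => f w * h w).
Proof. by move=> [t tP] [s sP]; exists (TMul t s) => x /=; rewrite tP sP. Qed.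

Lemma rterm_exp f : rterm f -> rterm (fun w => expR (f w)).
Proof. by move=> [t tP]; exists (TExp t) => x /=; rewrite tP. Qed.

Lemma rterm_an k (ra : restricted_analytic R k) (fs : 'I_k -> 'rV[C]_m -> R) :
  (forall j, rterm (fs j)) -> rterm (fun w => ra_eval ra (\row_j fs j w)).
Proof.
move=> /choice[t tP]; exists (TAn ra t) => x /=.
by congr ra_eval; apply/rowP => j; rewrite !mxE tP.
Qed.

Lemma cterm_var j : cterm (fun w => w 0 j).
Proof.
by split; [exists (TVar R (lshift m j))|exists (TVar R (rshift m j))] => x /=; rewrite mxE.
Qed.

Lemma cterm_cst (c : C) : cterm (fun=> c).
Proof. by split; exact: rterm_cst. Qed.

Lemma ctermD p q : cterm p -> cterm q -> cterm (fun w => p w + q w).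
Proof.
move=> [p1 p2] [q1 q2]; split.
  by apply: rterm_ext (rtermD p1 q1) => w; rewrite cReD.
by apply: rterm_ext (rtermD p2 q2) => w; rewrite cImD.
Qed.

Lemma ctermM p q : cterm p -> cterm q -> cterm (fun w => p w * q w).
Proof.
move=> [p1 p2] [q1 q2]; split.
  by apply: rterm_ext (rtermD (rtermM p1 q1) (rtermN (rtermM p2 q2))) => w; rewrite cReM.
by apply: rterm_ext (rtermD (rtermM p1 q2) (rtermM p2 q1)) => w; rewrite cImM.
Qed.

Lemma cterm_sum (I : Type) (r : seq I) (p : I -> 'rV[C]_m -> C) :
  (forall i, cterm (p i)) -> cterm (fun w => \sum_(i <- r) p i w).
Proof.
move=> pc; elim: r => [|i r IH].
  by apply: cterm_ext (cterm_cst 0) => w; rewrite big_nil.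
by apply: cterm_ext (ctermD (pc i) IH) => w; rewrite big_cons.
Qed.

Lemma definableC_lt f h : rterm f -> rterm h -> definableC [set w | f w < h w].
Proof.
move=> [t tP] [s sP]; exists (FLt t s); apply/seteqP; split=> x /=; by rewrite tP sP.
Qed.

Lemma definableC_eq f h : rterm f -> rterm h -> definableC [set w | f w = h w].
Proof.
move=> [t tP] [s sP]; exists (FEq t s); apply/seteqP; split=> x /=; by rewrite tP sP.
Qed.

Lemma definableC_not X : definableC X -> definableC (~` X).
Proof.
move=> [t tP]; exists (FNot t); apply/seteqP; split=> x /=.
  by move=> h k; apply: h; have : [set y | holds t y] x by []; rewrite -tP.
by move=> h k; apply: h; have : (@complex_vec R m @^-1` X) x by []; rewrite tP.
Qed.

Lemma definableC_and X Y : definableC X -> definableC Y -> definableC (X `&` Y).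
Proof.
move=> [t tP] [s sP]; exists (FAnd t s).
by rewrite preimage_setI tP sP.
Qed.

Lemma definableC_ext X Y : (forall w, X w <-> Y w) -> definableC X -> definableC Y.
Proof. by move=> XY; rewrite (_ : X = Y) //; apply/seteqP; split=> w /XY. Qed.

Lemma definableCT : definableC [set: 'rV[C]_m].
Proof. by apply: definableC_ext (definableC_eq (rterm_cst 0) (rterm_cst 0)). Qed.

Lemma definableC_all (I : finType) (X : I -> set 'rV[C]_m) :
  (forall i, definableC (X i)) -> definableC [set w | forall i, X i w].
Proof.
move=> dX; suff H (r : seq I) : definableC [set w | forall i, i \in r -> X i w].
  apply: definableC_ext (H (enum I)) => w; split=> h i; first by apply: h; rewrite mem_enum.
  by move=> _; exact: h.
elim: r => [|i r IH]; first by apply: definableC_ext definableCT.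
apply: definableC_ext (definableC_and (dX i) IH) => w; split=> [[h1 h2] j|h].
  by rewrite inE => /orP[/eqP -> //|]; exact: h2.
by split=> [|j jr]; apply: h; rewrite inE ?eqxx ?jr ?orbT.
Qed.

Lemma definableC_ex (I : finType) (X : I -> set 'rV[C]_m) :
  (forall i, definableC (X i)) -> definableC [set w | exists i, X i w].
Proof.
move=> dX; have := definableC_not (definableC_all (fun i => definableC_not (dX i))).
apply: definableC_ext => w; split=> [h|[i Xi] h]; last exact: (h i).
by apply/not_existsP => k; apply: h => i; exact: k.
Qed.

Lemma definableC_ceq p q : cterm p -> cterm q -> definableC [set w | p w = q w].
Proof.
move=> [p1 p2] [q1 q2].
apply: definableC_ext (definableC_and (definableC_eq p1 q1) (definableC_eq p2 q2)) => w.
by split=> [[h1 h2]|/= ->//]; exact: complex_ext.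
Qed.

(* A series in the exponentials of [z_l] converges on all polydiscs of radii
   smaller than 1, so it is a restricted analytic function of the polar
   coordinates of [ce (z_l)] where [Im z_l] is bounded below. *)
Lemma cterm_series (J : choiceType) (L : nat) (a : J -> C) (al : J -> 'I_L -> nat)
    (z : 'I_L -> 'rV[C]_m -> C) (A c : R) : 0 < c ->
  (forall rho : 'I_L -> R, (forall l, 0 < rho l < 1) -> exists M : R,
    forall B : {fset J}, \sum_(j <- B) nm (a j) * \prod_l rho l ^+ al j l <= M) ->
  (forall l, cterm (z l)) ->
  exists2 p : 'rV[C]_m -> C, cterm p & forall w,
    (forall l, `|Re (z l w)| <= A /\ c <= Im (z l w)) ->
    usum (fun j => a j * \prod_l ce ((al j l)%:R * z l w)) (p w).
Proof.
move=> c0 abs_conv zc.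
(* Modulus 0 belongs to the box: it is the limit of heights tending to infinity, so one compact box
   serves an unbounded range of [Im (z_l)]. *)
pose lo : 'rV[R]_(L + L) := \row_i (if fintype.split i is inl _ then 0 else - A).
pose hi : 'rV[R]_(L + L) := \row_i
  (if fintype.split i is inl _ then expR (- (2 * pi * c)) else A).
have p0 := pi_gt0 R.
have e1 : expR (- (2 * pi * c)) < 1.
  by rewrite -[ltRHS](@expR0 R) ltr_expR oppr_lt0 mulr_gt0 // mulr_gt0.
pose U := [set x : 'rV[R]_(L + L) | forall l, `|x 0 (lshift L l)| < 1].
have oU : open U.
  rewrite openE => x xU.
  have [d d0 dP] : exists2 d : R, 0 < d & forall l, `|x 0 (lshift L l)| + d <= 1.
    have [d d0 dP] : exists2 d : R, 0 < d &
        forall l, l \in enum 'I_L -> `|x 0 (lshift L l)| + d <= 1.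
      elim: (enum 'I_L) => [|l s [d d0 IH]]; first by exists 1.
      exists (Num.min d (1 - `|x 0 (lshift L l)|)).
        by rewrite lt_min d0 /=; have := xU l; lra.
      move=> i; rewrite inE => /orP[/eqP -> |/IH h].
        have : Num.min d (1 - `|x 0 (lshift L l)|) <= 1 - `|x 0 (lshift L l)|.
          by rewrite ge_min lexx orbT.
        lra.
      have : Num.min d (1 - `|x 0 (lshift L l)|) <= d by rewrite ge_min lexx.
      lra.
    by exists d => // l; apply: dP; rewrite mem_enum.
  apply/nbhs_ballP; exists d => // y xy l.
  have := xy.2 0 (lshift L l); rewrite -ball_normE /ball_ /= => h.
  have := ler_normB (x 0 (lshift L l)) (x 0 (lshift L l) - y 0 (lshift L l)).
  rewrite subKr; have := dP l; lra.
have bU : box lo hi `<=` U.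
  move=> x bx l; have := bx (lshift L l); rewrite !mxE (unsplitK (inl l)) => /andP[h1 h2].
  by rewrite ger0_norm //; lra.
pose raR := @RestrictedAnalytic R _ (fun x => Re (polar_sum a al x)) lo hi
  (ex_intro _ U (And3 oU bU (fun x => analytic_Re_polar_sum abs_conv (x0 := x)))).
pose raI := @RestrictedAnalytic R _ (fun x => Im (polar_sum a al x)) lo hi
  (ex_intro _ U (And3 oU bU (fun x => analytic_Im_polar_sum abs_conv (x0 := x)))).
pose fs (i : 'I_(L + L)) (w : 'rV[C]_m) : R :=
  match fintype.split i with
  | inl l => expR (- (2 * pi * Im (z l w)))
  | inr l => Re (z l w) end.
have fsc i : rterm (fs i).
  rewrite /fs; case: fintype.split => l; last exact: (zc l).1.
  by apply/rterm_exp/rtermN/rtermM; [exact: rterm_cst|exact: (zc l).2].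
exists (fun w => ra_eval raR (\row_j fs j w) +i* ra_eval raI (\row_j fs j w)).
  by split; exact: rterm_an.
move=> w zw; set x := \row_j fs j w.
have bx : box lo hi x.
  move=> i; rewrite !mxE /fs; case: fintype.split => l; have [h1 h2] := zw l.
    rewrite expR_ge0 ler_expR lerN2 ler_pM2l //; by rewrite mulr_gt0.
  by rewrite -ler_norml.
rewrite /ra_eval /= !asboolT //.
have <- : polar_sum a al x = Re (polar_sum a al x) +i* Im (polar_sum a al x).
  by case: (polar_sum a al x).
apply: usum_eq (polar_sumP abs_conv (bU _ bx)) => j.
rewrite /polar_term; congr (_ * _); apply: eq_bigr => l _; rewrite !mxE /fs.
rewrite (unsplitK (inl l)) (unsplitK (inr l)) !ceMn -exprMn; congr (_ ^+ _).
rewrite /ce /= mulr0 oppr0 expR0 mul1r; by [].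
Qed.

End Definability.

(** * Graphs in the standard charts of projective space *)

Section ProjectiveGraph.
Variables (R : realType) (N : nat).
Local Notation C := R[i].

Lemma affine_chartP (p : projective_space R N) (v : 'rV[C]_N.+1) i (z : 'rV[C]_N) :
  \val p = <[v]>%VS ->
  p = affine_chart i z <-> v 0 i != 0 /\ forall k, v 0 (lift i k) = z 0 k * v 0 i.
Proof.
move=> pv.
have ai : affine_vec i z 0 i = 1 by rewrite mxE unlift_none.
have ak k : affine_vec i z 0 (lift i k) = z 0 k by rewrite mxE liftK.
split=> [pE|[vi vk]].
  have : affine_vec i z \in <[v]>%VS by rewrite -pv pE /= memv_line.
  move=> /vlineP[c cE].
  have cv : c * v 0 i = 1 by rewrite -ai cE mxE.
  have vi : v 0 i != 0.
    by apply/eqP => v0; move: cv; rewrite v0 mulr0 => /esym/eqP; rewrite oner_eq0.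
  split=> // k; rewrite -(ak k) cE mxE mulrAC cv mul1r //.
apply: val_inj; rewrite pv /=.
have vE : v = v 0 i *: affine_vec i z.
  apply/rowP => j; rewrite mxE; have [k ->|->] := unliftP i j; last by rewrite ai mulr1.
  by rewrite ak vk mulrC.
apply/eqP; rewrite eqEsubv -!memvE; apply/andP; split; apply/vlineP.
  by exists (v 0 i).
by exists (v 0 i)^-1; rewrite {2}vE scalerA mulVf // scale1r.
Qed.

(** In the chart [i] the graph is cut out by [p_i <> 0] and equations [p_k = z_k p_i], free of
    quotients. *)
Lemma definableC_graph m (W : set 'rV[C]_m) (F : 'rV[C]_m -> projective_space R N)
    (z : 'I_N -> 'rV[C]_m -> C) (p : 'I_N.+1 -> 'rV[C]_m -> C) (i : 'I_N.+1) :
  definableC W -> (forall k, cterm (z k)) -> (forall k, cterm (p k)) ->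
  (forall w, W w -> \val (F w) = <[\row_k p k w]>%VS) ->
  definableC [set w | W w /\ F w = affine_chart i (\row_k z k w)].
Proof.
move=> dW zc pc Fp.
have d1 := definableC_not (definableC_ceq (pc i) (cterm_cst _ 0)).
have d2 := definableC_all (fun k => definableC_ceq (pc (lift i k)) (ctermM (zc k) (pc i))).
apply: definableC_ext (definableC_and dW (definableC_and d1 d2)) => w.
split=> [[Ww [h1 h2]]|[Ww Fw]]; split=> //.
  apply/(affine_chartP _ _ (Fp w Ww)); split=> [|k]; rewrite !mxE; last exact: h2.
  by apply/eqP.
have [h1 h2] := (affine_chartP _ _ (Fp w Ww)).1 Fw.
split=> [|k] /=; first by move: h1; rewrite mxE => /eqP.
by have := h2 k; rewrite !mxE.
Qed.

End ProjectiveGraph.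

(** * Completion of squares, rounding and Diophantine approximation *)

Section TriangularForms.
Variable R : realType.

Definition upper_unipotent g (U : 'M[R]_g) :=
  (forall i, U i i = 1) /\ forall i j : 'I_g, (j < i)%N -> U i j = 0.

Definition qform g (Y : 'M[R]_g) (x : 'cV[R]_g) : R := (x^T *m Y *m x) 0 0.

Lemma qformE g (Y : 'M[R]_g) x : qform Y x = \sum_i \sum_j x i 0 * Y i j * x j 0.
Proof.
rewrite /qform mxE exchange_big /=; apply: eq_bigr => j _.
by rewrite mxE mulr_suml; apply: eq_bigr => i _; rewrite mxE.
Qed.

(* Completing squares as long as the pivots are positive: [k] is the number of
   positive pivots before the first nonpositive one. *)
Lemma square_completion g (Y : 'M[R]_g) : Y^T = Y ->
  exists (d : 'I_g -> R) (U : 'M[R]_g) (k : nat),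
  [/\ (k <= g)%N, upper_unipotent U, (forall i : 'I_g, (i < k)%N -> 0 < d i),
      (forall i : 'I_g, i = k :> nat -> d i <= 0) &
      (forall i j : 'I_g, (i <= k)%N -> (j <= k)%N ->
        Y i j = \sum_l d l * U l i * U l j)] /\
  ((k < g)%N -> exists2 x, x != 0 & qform Y x <= 0).
Proof.
elim: g Y => [|g IH] Y symY.
  exists (fun=> 0), 0, 0%N; split=> //; split=> //; try by case.
  by split=> -[].
pose a := Y 0 0.
(* A nonpositive first pivot stops the process at [k = 0], with the first basis vector as
   witness. *)
have [a0|a0] := lerP a 0.
  exists (fun i => if i == 0 then a else 0), 1%:M, 0%N; split; first split=> //.
  - split=> [i|i j ji]; rewrite mxE ?eqxx //; case: eqP => // ij; by rewrite ij ltnn in ji.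
  - by move=> i i0; rewrite (_ : i = 0) ?eqxx //; apply: val_inj.
  - move=> i j; rewrite !leqn0 => /eqP i0 /eqP j0.
    have -> : i = 0 by apply: val_inj.
    have -> : j = 0 by apply: val_inj.
    rewrite (bigD1 0) //= !mxE !mulr1 big1 ?addr0 // => l l0.
    by rewrite (negbTE l0) !mul0r.
  move=> _; exists (delta_mx 0 0); first by apply/eqP => /matrixP/(_ 0 0)/eqP; rewrite !mxE oner_eq0.
  rewrite qformE (bigD1 0) //= (bigD1 0) //= !mxE /= mul1r mulr1.
  rewrite [X in _ + X + _]big1 ?addr0; last by move=> j j0; rewrite !mxE (negbTE j0) mulr0.
  rewrite big1 ?addr0 // => i i0; rewrite big1 // => j _.
  by rewrite !mxE (negbTE i0) !mul0r.
pose S : 'M[R]_g := \matrix_(i, j) (Y (lift 0 i) (lift 0 j) - Y 0 (lift 0 i) * Y 0 (lift 0 j) / a).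
have Ysym i j : Y i j = Y j i by rewrite -{1}symY mxE.
have symS : S^T = S.
  by apply/matrixP => i j; rewrite !mxE Ysym; congr (_ - _ / _); rewrite mulrC.
have [d [U [k [[kg [U1 U0] dpos dk YE] bad]]]] := IH S symS.
pose d' i := if unlift 0 i is Some l then d l else a.
pose U' : 'M[R]_g.+1 := \matrix_(i, j) match unlift 0 i, unlift 0 j with
  | Some i', Some j' => U i' j' | Some _, None => 0 | None, _ => Y 0 j / a end.
have an : a != 0 by rewrite gt_eqF.
have d'0 : d' 0 = a by rewrite /d' unlift_none.
have d'S l : d' (lift 0 l) = d l by rewrite /d' liftK.
have U'0 j : U' 0 j = Y 0 j / a by rewrite mxE unlift_none.
have U'S0 i : U' (lift 0 i) 0 = 0 by rewrite mxE liftK unlift_none.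
have U'SS i j : U' (lift 0 i) (lift 0 j) = U i j by rewrite mxE !liftK.
exists d', U', k.+1; split; first split=> //.
- split=> [i|i j].
    by have [i' ->|->] := unliftP 0 i; rewrite ?U'SS ?U1 // U'0 divff.
  have [i' ->|->] := unliftP 0 i; last by [].
  by have [j' -> /= h|-> _] := unliftP 0 j; rewrite ?U'SS ?U'S0 // U0.
- move=> i; have [i' -> /= h|-> _] := unliftP 0 i; last by rewrite d'0.
  by rewrite d'S dpos.
- move=> i; have [i' -> /= [h]|->] := unliftP 0 i; last by [].
  by rewrite d'S dk.
- move=> i j ik jk; rewrite big_ord_recl d'0 !U'0.
  rewrite (eq_bigr (fun l => d l * U' (lift 0 l) i * U' (lift 0 l) j)); last by move=> l _; rewrite d'S.
  move: ik jk; have [i' -> /= ik|-> _] := unliftP 0 i; last first.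
    move=> _; rewrite big1 ?addr0; last by move=> l _; rewrite U'S0 mulr0 mul0r.
    by rewrite -/a; field.
  have [j' -> /= jk|-> _] := unliftP 0 j; last first.
    rewrite big1 ?addr0; last by move=> l _; rewrite U'S0 mulr0.
    by rewrite -/a [LHS]Ysym; field.
  rewrite (eq_bigr (fun l => d l * U l i' * U l j')); last by move=> l _; rewrite !U'SS.
  by rewrite -YE // mxE; field.
rewrite ltnS => /bad[x xn xS].
(* The first coordinate of the witness is chosen to make the first square vanish. *)
pose b := \sum_j Y 0 (lift 0 j) * x j 0.
pose x' : 'cV[R]_g.+1 := \col_i if unlift 0 i is Some l then x l 0 else - b / a.
have x'0 : x' 0 0 = - b / a by rewrite mxE unlift_none.
have x'S l : x' (lift 0 l) 0 = x l 0 by rewrite mxE liftK.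
exists x'.
  apply: contraNneq xn => x'z; apply/eqP/colP => l.
  by have /matrixP/(_ (lift 0 l) 0) := x'z; rewrite x'S !mxE.
suff -> : qform Y x' = qform S x by [].
rewrite !qformE big_ord_recl big_ord_recl /= x'0.
have -> : \sum_(j < g) - b / a * Y 0 (lift 0 j) * x' (lift 0 j) 0 = - b / a * b.
  by rewrite mulr_sumr; apply: eq_bigr => j _; rewrite x'S mulrA.
have -> : \sum_(i < g) \sum_j x' (lift 0 i) 0 * Y (lift 0 i) j * x' j 0 =
    b * (- b / a) + \sum_(i < g) \sum_(j < g) x i 0 * Y (lift 0 i) (lift 0 j) * x j 0.
  rewrite {1}/b mulr_suml -big_split; apply: eq_bigr => i _ /=.
  rewrite big_ord_recl x'0 x'S [Y (lift 0 i) 0]Ysym; congr (_ + _); first by rewrite [x i 0 * _]mulrC.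
  by apply: eq_bigr => j _; rewrite x'S.
have -> : \sum_i \sum_j x i 0 * S i j * x j 0 =
    \sum_(i < g) \sum_(j < g) x i 0 * Y (lift 0 i) (lift 0 j) * x j 0 - b * b / a.
  rewrite {1}/b mulr_suml mulr_suml -sumrB; apply: eq_bigr => i _.
  rewrite /b mulr_sumr mulr_suml -sumrB; apply: eq_bigr => j _; rewrite mxE; ring.
by rewrite -/a; field.
Qed.

Lemma posdef_completion g (Y : 'M[R]_g) : Y^T = Y -> posdef Y ->
  exists (d : 'I_g -> R) (U : 'M[R]_g), [/\ upper_unipotent U, (forall i, 0 < d i) &
    forall i j, Y i j = \sum_l d l * U l i * U l j].
Proof.
move=> symY pY; have [d [U [k [[kg UU dpos _ YE] bad]]]] := square_completion symY.
have kE : k = g.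
  apply/eqP; move: kg; rewrite leq_eqVlt => /orP[//|/bad[x xn]].
  by rewrite leNgt pY.
by exists d, U; split=> // [i|i j]; [apply: dpos|apply: YE]; rewrite kE // ltnW.
Qed.

Definition lin g (U : 'M[R]_g) (a : 'cV[int]_g) (i : 'I_g) : R :=
  \sum_j U i j * (a j 0)%:~R.

Lemma qform_squares g (Y U : 'M[R]_g) d (k : nat) (x : 'cV[R]_g) :
  (forall i j : 'I_g, (i <= k)%N -> (j <= k)%N -> Y i j = \sum_l d l * U l i * U l j) ->
  (forall i : 'I_g, (k < i)%N -> x i 0 = 0) ->
  qform Y x = \sum_l d l * (\sum_j U l j * x j 0) ^+ 2.
Proof.
move=> YE xk; rewrite qformE.
transitivity (\sum_i \sum_j \sum_l d l * (U l i * x i 0) * (U l j * x j 0)).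
  apply: eq_bigr => i _; apply: eq_bigr => j _.
  have [ik|ki] := leqP i k; last first.
    by rewrite xk // !mul0r big1 // => l _; rewrite mulr0 mulr0 mul0r.
  have [jk|kj] := leqP j k; last first.
    by rewrite (xk j) // !mulr0 big1 // => l _; rewrite !mulr0.
  by rewrite YE // mulr_sumr mulr_suml; apply: eq_bigr => l _; ring.
rewrite (eq_bigr (fun i => \sum_l d l * (U l i * x i 0) * \sum_j (U l j * x j 0))); last first.
  by move=> i _; rewrite exchange_big; apply: eq_bigr => l _; rewrite mulr_sumr.
rewrite exchange_big; apply: eq_bigr => l _.
by rewrite -mulr_suml -mulr_sumr expr2 mulrA.
Qed.

Lemma qform_lin g (Y U : 'M[R]_g) d (k : nat) (a : 'cV[int]_g) :
  (forall i j : 'I_g, (i <= k)%N -> (j <= k)%N -> Y i j = \sum_l d l * U l i * U l j) ->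
  (forall i : 'I_g, (k < i)%N -> a i 0 = 0) ->
  qform Y (map_mx intr a) = \sum_l d l * (lin U a l) ^+ 2.
Proof.
move=> YE ak; rewrite (qform_squares YE); last by move=> i /ak; rewrite mxE => ->.
by apply: eq_bigr => l _; congr (_ * _ ^+ 2); apply: eq_bigr => j _; rewrite mxE.
Qed.

(** Back substitution: adding an integer to coordinate [k] shifts row [k] by that integer and, [U]
    being upper triangular, leaves the rows of larger index alone. *)
Lemma rounding g (U : 'M[R]_g) (t : R) (m : nat) (a0 : 'cV[int]_g) : upper_unipotent U ->
  exists a : 'cV[int]_g, (forall j : 'I_g, (m <= j)%N -> a j 0 = a0 j 0) /\
    forall i : 'I_g, (i < m)%N -> t <= lin U a i < t + 1.
Proof.
move=> [U1 U0]; elim: m a0 => [|m IH] a0; first by exists a0.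
have [mg|gm] := ltnP m g; last first.
  have [a [aE aP]] := IH a0; exists a; split=> [j mj|i _]; first by apply: aE; apply: ltnW.
  by apply: aP; apply: leq_trans (ltn_ord i) gm.
pose k := Ordinal mg.
pose r := lin U a0 k - (a0 k 0)%:~R.
pose c := - Num.floor (r - t).
pose a1 : 'cV[int]_g := \col_j if j == k then c else a0 j 0.
have [a [aE aP]] := IH a1; exists a; split=> [j mj|i].
  rewrite aE ?(ltnW mj) // mxE ifF //; apply/negbTE; apply: contraTneq mj => ->.
  by rewrite -leqNgt.
rewrite ltnS leq_eqVlt => /orP[/eqP im|]; last exact: aP.
have -> : i = k by apply: val_inj.
have -> : lin U a k = r + c%:~R.
  rewrite /r /lin (bigD1 k) //= [in RHS](bigD1 k) //= !U1 !mul1r.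
  rewrite aE // mxE eqxx [RHS]addrC addrAC subrr add0r; congr (_ + _).
  apply: eq_bigr => j jk; have [mj|jm] := leqP m j; last by rewrite U0 // !mul0r.
  by rewrite aE // mxE (negbTE jk).
have /andP[h1 h2] := floor_itv (r - t).
by rewrite /c rmorphN /= intrD in h2 *; rewrite mulr1z in h2; lra.
Qed.

Lemma linB g (U : 'M[R]_g) a b i : lin U (a - b) i = lin U a i - lin U b i.
Proof.
by rewrite /lin -sumrB; apply: eq_bigr => j _; rewrite !mxE intrB mulrBr.
Qed.

(** Pigeonhole: the [n ^ g + 1] vectors with top coordinate [q], rounded into the unit cube, fall
    into [n ^ g] cells of side [1 / n]; two vectors in the same cell are subtracted. *)
Lemma dirichlet g (U : 'M[R]_g) (k : 'I_g) (n : nat) : upper_unipotent U -> (0 < n)%N ->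
  exists a : 'cV[int]_g, [/\ 0 < a k 0, a k 0 <= (n ^ g)%N%:Z,
    forall j : 'I_g, (k < j)%N -> a j 0 = 0 &
    forall i : 'I_g, (i < k)%N -> `|lin U a i| <= n%:R^-1].
Proof.
move=> UU n0; have nR : 0 < n%:R :> R by rewrite ltr0n.
have /choice[f fP] (q : 'I_((n ^ g).+1)) : exists a : 'cV[int]_g,
    (forall j : 'I_g, (k <= j)%N -> a j 0 = if j == k then (val q)%:Z else 0) /\
    forall i : 'I_g, (i < k)%N -> 0 <= lin U a i < 1.
  have [a [aE aP]] := rounding 0 k (\col_j if j == k then (val q)%:Z else 0) UU.
  by exists a; split=> [j kj|i ik]; [rewrite aE // mxE|have := aP i ik; rewrite add0r].
have n1 : (n.-1.+1 = n)%N by rewrite prednK.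
pose F (q : 'I_((n ^ g).+1)) : {ffun 'I_g -> 'I_n.-1.+1} :=
  [ffun i => inord `|Num.floor (n%:R * lin U (f q) i)|%N].
have [inj|] := boolP (injectiveb F).
  have := leq_card F (injectiveP _ inj).
  by rewrite card_ffun !card_ord n1 ltnn.
move=> /injectivePn[q1 [q2 q12 Fq]].
wlog lt12 : q1 q2 q12 Fq / (q1 < q2)%N.
  move=> W; have [|h|h] := ltngtP q1 q2; first exact: W q12 Fq.
    by apply: (W q2 q1) => //; rewrite eq_sym.
  by move/val_inj: h q12 => ->; rewrite eqxx.
have Ek (q : 'I_((n ^ g).+1)) : f q k 0 = (nat_of_ord q)%:Z by rewrite (fP q).1 // eqxx.
exists (f q2 - f q1); split.
- by rewrite mxE [(- f q1) k 0]mxE !Ek subr_gt0 ltz_nat.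
- by rewrite mxE [(- f q1) k 0]mxE !Ek lerBlDr -PoszD lez_nat; have := ltn_ord q2; lia.
- move=> j kj; have jk : (j == k) = false by apply/negbTE; apply: contraTneq kj => ->; rewrite ltnn.
  by rewrite !mxE !(fP _).1 ?(ltnW kj) // jk.
move=> i ik; rewrite linB.
have /andP[a1 b1] := (fP q1).2 i ik; have /andP[a2 b2] := (fP q2).2 i ik.
have fl (x : R) : 0 <= x < 1 -> (`|Num.floor (n%:R * x)| < n)%N /\ 0 <= Num.floor (n%:R * x).
  move=> /andP[x0 x1]; have h : 0 <= Num.floor (n%:R * x) by rewrite floor_ge0 mulr_ge0 // ltW.
  split=> //; have : Num.floor (n%:R * x) < n%:Z.
    by rewrite floor_lt_int -pmulrn -[ltRHS]mulr1 ltr_pM2l.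
  by lia.
have [c1 e1] := fl _ ((fP q1).2 i ik).
have [c2 e2] := fl _ ((fP q2).2 i ik).
have /ffunP/(_ i) := Fq; rewrite !ffunE => /(congr1 (@nat_of_ord _)); rewrite !inordK ?n1 // => E.
have {}E : Num.floor (n%:R * lin U (f q1) i) = Num.floor (n%:R * lin U (f q2) i) by lia.
have /andP[h1 h2] := floor_itv (n%:R * lin U (f q1) i).
have /andP[h3 h4] := floor_itv (n%:R * lin U (f q2) i).
rewrite E intrD mulr1z in h1 h2; rewrite intrD mulr1z in h4.
rewrite -(ler_pM2l nR) mulfV ?gt_eqF // -[X in X * `|_|]ger0_norm ?(ltW nR) // -normrM mulrBr.
by rewrite ler_norml; lra.
Qed.

Lemma big_gcdz_dvd (I : finType) (P : pred I) (a : I -> int) i : P i ->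
  (\big[gcdz/0]_(i | P i) a i %| a i)%Z.
Proof.
move=> Pi; have : i \in index_enum I by rewrite mem_index_enum.
elim: (index_enum I) => // j s IH; rewrite inE big_cons => /orP[/eqP <-|/IH h].
  by rewrite Pi dvdz_gcdl.
by case: ifP => // _; apply: dvdz_trans (dvdz_gcdr _ _) h.
Qed.

Lemma big_gcdz_scale (I : finType) (P : pred I) (a : I -> int) (c : int) : 0 <= c ->
  \big[gcdz/0]_(i | P i) (c * a i) = c * \big[gcdz/0]_(i | P i) a i.
Proof.
move=> c0; rewrite (big_morph (fun x => c * x) (id1 := 0) (op1 := gcdz)) ?mulr0 // => x y.
by rewrite -mulz_gcdr gez0_abs.
Qed.

Lemma big_gcdz_ge0 (I : finType) (P : pred I) (a : I -> int) :
  0 <= \big[gcdz/0]_(i | P i) a i.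
Proof. by elim: (index_enum I) => [|j s IH]; rewrite ?big_nil // big_cons; case: ifP. Qed.

(* Condition (II) of Minkowski for the form [sum_l d_l (lin U x l)^2]. *)
Definition minkowski_II g (d : 'I_g -> R) (U : 'M[R]_g) (K : nat) :=
  forall (k : 'I_g) (a : 'cV[int]_g), (k <= K)%N ->
    (forall i : 'I_g, (K < i)%N -> a i 0 = 0) ->
    \big[gcdz/0]_(i < g | (k <= i)%N) a i 0 = 1 ->
    \sum_l d l * U l k ^+ 2 <= \sum_l d l * (lin U a l) ^+ 2.

(* Dividing the coordinates from [m] on by their gcd keeps the residuals
   there small, and the lower ones are rounded again. *)
Lemma primitive_approx g (U : 'M[R]_g) (m k : 'I_g) (a : 'cV[int]_g) (e : R) :
  upper_unipotent U -> (m <= k)%N -> 0 < a k 0 ->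
  (forall j : 'I_g, (k < j)%N -> a j 0 = 0) ->
  (forall i : 'I_g, (m <= i)%N -> (i < k)%N -> `|lin U a i| <= e) ->
  exists b : 'cV[int]_g, [/\ \big[gcdz/0]_(i < g | (m <= i)%N) b i 0 = 1,
    0 < b k 0 <= a k 0, forall j : 'I_g, (k < j)%N -> b j 0 = 0,
    (forall i : 'I_g, (i < m)%N -> `|lin U b i| <= 2^-1) &
    forall i : 'I_g, (m <= i)%N -> (i < k)%N -> `|lin U b i| <= e].
Proof.
move=> UU mk ak0 aj ae; pose G := \big[gcdz/0]_(i < g | (m <= i)%N) a i 0.
have Gk : (G %| a k 0%R)%Z by exact: (@big_gcdz_dvd _ (fun i : 'I_g => (m <= i)%N) (fun i => a i 0%R) k mk).
have G0 : 0 < G.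
  have := big_gcdz_ge0 (fun i : 'I_g => (m <= i)%N) (fun i => a i 0%R); rewrite -/G le_eqVlt.
  move=> /orP[/eqP G0|//]; move: Gk; rewrite -G0 dvd0z => /eqP ak; by rewrite ak in ak0.
pose a1 : 'cV[int]_g := \col_j (a j 0%R %/ G)%Z.
have aE (j : 'I_g) : (m <= j)%N -> a j 0 = G * a1 j 0.
  move=> mj; rewrite mxE mulrC divzK //.
  exact: (@big_gcdz_dvd _ (fun i : 'I_g => (m <= i)%N) (fun i => a i 0%R) j mj).
have [b [bE bP]] := rounding (- 2^-1) m a1 UU.
have abE (j : 'I_g) : (m <= j)%N -> a j 0 = G * b j 0 by move=> mj; rewrite bE // aE.
have linE (i : 'I_g) : (m <= i)%N -> lin U a i = G%:~R * lin U b i.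
  move=> mi; rewrite /lin mulr_sumr; apply: eq_bigr => j _.
  have [ij|ji] := leqP i j; last by rewrite UU.2 // !mul0r mulr0.
  by rewrite abE ?(leq_trans mi) // intrM mulrCA.
have GR : 1 <= G%:~R :> R by rewrite -[leLHS](mulr1z) ler_int; lia.
exists b; split.
- apply: (mulfI (lt0r_neq0 G0)); rewrite mulr1 -big_gcdz_scale ?(ltW G0) // {2}/G.
  by apply: eq_bigr => i mi; rewrite -abE.
- have := abE k mk; move: ak0 => /[swap] ->; nia.
- move=> j kj; have mj : (m <= j)%N by apply: leq_trans mk (ltnW kj).
  have := abE j mj; rewrite (aj j kj) => /esym/eqP; rewrite mulf_eq0 gt_eqF //=.
  by move=> /eqP.
- by move=> i /bP; rewrite ler_norml; lra.
move=> i mi ik; have := ae i mi ik; rewrite linE // normrM ger0_norm; last lra.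
by have := normr_ge0 (lin U b i); nra.
Qed.

Lemma lin_delta g (U : 'M[R]_g) k l : lin U (delta_mx k 0) l = U l k.
Proof.
rewrite /lin (bigD1 k) //= mxE !eqxx mulr1z mulr1 big1 ?addr0 // => j jk.
by rewrite mxE (negbTE jk) mulr0.
Qed.

Lemma lin_top g (U : 'M[R]_g) (a : 'cV[int]_g) (k : 'I_g) : upper_unipotent U ->
  (forall j : 'I_g, (k < j)%N -> a j 0 = 0) -> lin U a k = (a k 0)%:~R.
Proof.
move=> [U1 U0] aj; rewrite /lin (bigD1 k) //= U1 mul1r big1 ?addr0 // => j jk.
have [h|h|/val_inj h] := ltngtP j k; first by rewrite U0 // mul0r.
  by rewrite aj // mulr0.
by rewrite h eqxx in jk.
Qed.

Lemma lin_above g (U : 'M[R]_g) (a : 'cV[int]_g) (k l : 'I_g) : upper_unipotent U ->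
  (forall j : 'I_g, (k < j)%N -> a j 0 = 0) -> (k < l)%N -> lin U a l = 0.
Proof.
move=> [U1 U0] aj kl; rewrite /lin big1 // => j _.
have [h|h] := ltnP j l; first by rewrite U0 // mul0r.
by rewrite aj ?mulr0 // (leq_trans kl).
Qed.

End TriangularForms.

(** * Minkowski reduced forms lie in a Siegel set *)

Section Reduction.
Variable R : realType.

Lemma fin_lower (I : finType) (f : I -> R) : (forall i, 0 < f i) ->
  exists2 c : R, 0 < c & forall i, c <= f i.
Proof.
move=> f0; suff [c c0 cP] : exists2 c : R, 0 < c & forall i, i \in enum I -> c <= f i.
  by exists c => // i; apply: cP; rewrite mem_enum.
elim: (enum I) => [|j s [c c0 IH]]; first by exists 1.
exists (Num.min c (f j)) => [|i]; first by rewrite lt_min c0 f0.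
by rewrite inE => /orP[/eqP -> |/IH h]; rewrite ge_min ?lexx ?h ?orbT.
Qed.

Lemma big_gcdz_unit g (a : 'cV[int]_g) (m k : 'I_g) : (m <= k)%N -> a k 0 = 1 ->
  \big[gcdz/0]_(i < g | (m <= i)%N) a i 0 = 1.
Proof.
move=> mk ak; have := @big_gcdz_dvd _ (fun i : 'I_g => (m <= i)%N) (fun i => a i 0%R) k mk.
have := big_gcdz_ge0 (fun i : 'I_g => (m <= i)%N) (fun i => a i 0%R).
rewrite ak dvdz1; set G := \big[_/_]_(_ | _) _ => G0 /eqP; lia.
Qed.

Lemma pow_sum_le (m g : nat) : (m <= g)%N -> \sum_(l < g | (l < m)%N) (2 : R) ^+ l <= 2 ^+ m.
Proof.
move=> mg; rewrite -(big_ord_widen g (fun l => (2 : R) ^+ l) mg).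
elim: m {mg} => [|m IH]; first by rewrite big_ord0 expr0.
by rewrite big_ord_recr /= exprS; lra.
Qed.

(** Let [M] be the largest pivot before [k]. An integer vector supported up to [k] and almost
    annihilated by the rows before [k] is made primitive from a suitable [m] on and tested against
    condition (II) at [m]. This bounds [d m] by a quarter of the sum of the pivots before [m], plus
    [g M / n], plus [E ^ 2 d k], which forces [d k] to be comparable with [M]. *)
Lemma pivot_ratio g : exists2 Lam : R, 1 <= Lam & forall (d : 'I_g -> R) (U : 'M[R]_g),
  upper_unipotent U -> (forall i, 0 < d i) -> minkowski_II d U g ->
  forall i k : 'I_g, (i < k)%N -> d i <= Lam * d k.
Proof.
have [->|g0] := posnP g; first by exists 1 => // d U _ _ _ [].
(* With this [n] the term [g M / n] is [M / (4 2^g)]; [E] bounds the top coordinate of the vector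
   from [dirichlet]. *)
pose n := (4 * g * 2 ^ g)%N; have n0 : (0 < n)%N by rewrite !muln_gt0 g0 expn_gt0.
pose E : R := (n ^ g)%N%:R; have E1 : 1 <= E by rewrite ler1n expn_gt0 n0.
have p1 j : 1 <= (2 : R) ^+ j by rewrite exprn_ege1 // ler1n.
have nR : 1 <= n%:R :> R by rewrite ler1n.
have nE : n%:R = 4 * g%:R * 2 ^+ g :> R by rewrite !natrM natrX.
exists (2 ^+ g * 2 * E ^+ 2) => [|d U UU d0 MII i k ik].
  by have := p1 g; have : 1 <= E ^+ 2 by [rewrite exprn_ege1]; nra.
have [i0 i0k i0P] : exists2 i0 : 'I_g, (i0 < k)%N & forall j : 'I_g, (j < k)%N -> d j <= d i0.
  case: (@arg_maxP _ _ _ i (fun j : 'I_g => (j < k)%N) d ik) => i0 h1 h2.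
  by exists i0.
set M := d i0 in i0P; have M0 : 0 < M by exact: d0.
(* The least [m] with [d m >= 2^(m - g) M] is taken: an earlier pivot [d l] lies below
   [2^(l - g) M], and these thresholds sum to at most [2^(m - g) M], so rounding costs at most a
   quarter of [d m]. *)
pose P (m : 'I_g) := (m < k)%N && (2 ^+ m * M <= 2 ^+ g * d m).
have Pi0 : P i0.
  by rewrite /P i0k ler_pM2r //; apply: ler_weXn2l; [rewrite ler1n|apply: ltnW].
case: (@arg_minnP _ i0 P val Pi0) => m /andP[mk mM] mP.
have low (l : 'I_g) : (l < m)%N -> 2 ^+ g * d l <= 2 ^+ l * M.
  move=> lm; rewrite leNgt; apply/negP => h; have : P l by rewrite /P (ltn_trans lm mk) ltW.
  by move=> /mP /=; rewrite leqNgt lm.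
have [a [ak0 akE aj ae]] := dirichlet k UU n0.
have [b [b1 /andP[bk0 bka] bj blow bmid]] := primitive_approx UU (ltnW mk) ak0 aj
  (fun i _ => ae i).
have H : \sum_l d l * U l m ^+ 2 <= \sum_l d l * lin U b l ^+ 2.
  by apply: MII b1 => [|j]; rewrite ?(ltnW (ltn_ord m)) // ltnNge (ltnW (ltn_ord j)).
have L : d m <= \sum_l d l * U l m ^+ 2.
  rewrite (bigD1 m) //= UU.1 expr1n mulr1 lerDl sumr_ge0 // => l _.
  by rewrite mulr_ge0 ?sqr_ge0 // ltW.
have bkE : (b k 0)%:~R <= E.
  by rewrite /E -[(n ^ g)%N%:R]/((n ^ g)%N%:Z%:~R) ler_int (le_trans bka).
have bk0R : 0 <= (b k 0)%:~R :> R by rewrite ler0z ltW.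
have n20 : 0 < n%:R^-1 :> R by rewrite invr_gt0; lra.
have T (l : 'I_g) : d l * lin U b l ^+ 2 <=
    (if (l < m)%N then d l / 4 else 0) + M * n%:R^-1 + (if l == k then d k * E ^+ 2 else 0).
  have dl := d0 l; have Mn : 0 < M * n%:R^-1 by rewrite mulr_gt0.
  have [lk|kl|/val_inj ->] := ltngtP l k; last first.
  - rewrite eqxx ltnNge (ltnW mk) /= add0r lin_top //.
    have : d k * (b k 0)%:~R ^+ 2 <= d k * E ^+ 2.
      by rewrite ler_pM2l // lerXn2r ?nnegrE //; lra.
    lra.
  - rewrite (lin_above UU bj) // expr0n mulr0; apply: addr_ge0; [apply: addr_ge0|]; [|exact: ltW|].
      by case: ifP => // _; rewrite divr_ge0 // ltW.
    by case: ifP => // _; rewrite mulr_ge0 ?sqr_ge0 // ltW.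
  rewrite (_ : (l == k) = false) ?addr0; last by apply/negbTE; rewrite neq_ltn lk.
  have [lm|ml] := ltnP l m.
    have := blow l lm; rewrite ler_norml => /andP[h1 h2].
    have : lin U b l ^+ 2 <= 4^-1 by nra.
    nra.
  rewrite add0r; have h := bmid l ml lk.
  have : lin U b l ^+ 2 <= n%:R^-1.
    have : n%:R^-1 <= 1 :> R by rewrite invf_le1 //; lra.
    by move: h; rewrite ler_norml => /andP[]; nra.
  have := i0P l lk; have := sqr_ge0 (lin U b l); nra.
have S : \sum_l d l * lin U b l ^+ 2 <=
    (\sum_(l < g | (l < m)%N) d l) / 4 + g%:R * (M * n%:R^-1) + d k * E ^+ 2.
  apply: le_trans (ler_sum _ (fun l _ => T l)) _; rewrite !big_split /=.
  rewrite -big_mkcond -mulr_suml -[X in _ + _ + X]big_mkcond big_pred1_eq.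
  by rewrite sumr_const card_ord -[X in _ + X + _]mulr_natl.
have S1 : 2 ^+ g * (\sum_(l < g | (l < m)%N) d l) <= 2 ^+ m * M.
  rewrite mulr_sumr; apply: le_trans (ler_sum _ low) _.
  by rewrite -mulr_suml ler_pM2r // pow_sum_le // ltnW.
have S2 : 2 ^+ g * (g%:R * (M * n%:R^-1)) = M / 4.
  have g1 : g%:R != 0 :> R by rewrite pnatr_eq0 -lt0n.
  by rewrite nE; field; rewrite g1 /= expf_neq0 // pnatr_eq0.
have dE : 0 < d k * E ^+ 2 by rewrite mulr_gt0 // exprn_gt0 //; lra.
have := p1 m; have := p1 g; have := i0P i ik.
have : 2 ^+ g * d m <= 2 ^+ g * ((\sum_(l < g | (l < m)%N) d l) / 4 +
    g%:R * (M * n%:R^-1) + d k * E ^+ 2).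
  by rewrite ler_pM2l ?exprn_gt0 //; lra.
rewrite !mulrDr S2; move: (\sum_(l < g | _) _) S1 => Sg.
move: mM; set G := (2 : R) ^+ g; set Q := (2 : R) ^+ m; set X := d k * E ^+ 2 in dE *.
rewrite (_ : _ * E ^+ 2 * d k = 2 * (G * X)); last by rewrite /X; ring.
by move=> h1 h2 h3 h4 h5 h6; nra.
Qed.

Definition gram g (d : 'I_g -> R) (U : 'M[R]_g) (i j : 'I_g) : R :=
  \sum_l d l * U l i * U l j.

Lemma gram_diag g (d : 'I_g -> R) U i : gram d U i i = \sum_l d l * U l i ^+ 2.
Proof. by apply: eq_bigr => l _; rewrite -mulrA -expr2. Qed.

Lemma gram_ge g (d : 'I_g -> R) U i : upper_unipotent U -> (forall i, 0 < d i) ->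
  d i <= gram d U i i.
Proof.
move=> [U1 _] d0; rewrite gram_diag (bigD1 i) //= U1 expr1n mulr1 lerDl.
by rewrite sumr_ge0 // => l _; rewrite mulr_ge0 ?sqr_ge0 // ltW.
Qed.

(** Condition (II) at the vectors [e_j + e_i] and [e_j - e_i], whose entry at [j] is 1. *)
Lemma minkowski_offdiag g (d : 'I_g -> R) U (i j : 'I_g) : minkowski_II d U g -> (i < j)%N ->
  `|gram d U i j| <= gram d U i i / 2.
Proof.
move=> MII ij.
have key (s : int) : s * s = 1 ->
    gram d U j j <= gram d U j j + 2 * s%:~R * gram d U i j + gram d U i i.
  move=> s1; pose a : 'cV[int]_g := delta_mx j 0 + s *: delta_mx i 0.
  have nij : (j == i) = false by apply/negbTE; rewrite neq_ltn ij orbT.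
  have aj : a j 0 = 1 by rewrite !mxE !eqxx nij mulr0 addr0.
  have := MII j a (ltnW (ltn_ord j)) _ (big_gcdz_unit (leqnn j) aj).
  move=> /(_ _)/le_trans; rewrite -gram_diag => h; apply: h => [l|].
    by rewrite ltnNge (ltnW (ltn_ord l)).
  rewrite le_eqVlt; apply/orP; left; apply/eqP; rewrite !gram_diag /gram mulr_sumr -!big_split /=.
  apply: eq_bigr => l _.
  have -> : lin U a l = U l j + s%:~R * U l i.
    rewrite /a /lin -(lin_delta U j) -(lin_delta U i) /lin mulr_sumr -big_split /=.
    by apply: eq_bigr => p _; rewrite !mxE intrD intrM mulrDr mulrCA.
  have sR : s%:~R * s%:~R = 1 :> R by rewrite -intrM s1.
  have -> : (U l j + s%:~R * U l i) ^+ 2 =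
      U l j ^+ 2 + 2 * s%:~R * U l i * U l j + s%:~R * s%:~R * U l i ^+ 2 by ring.
  rewrite sR; ring.
have := key 1 (mulr1 1); have := key (-1) (mulrNN 1 1).
by rewrite mulr1z rmorphN /= mulr1z ler_norml; lra.
Qed.

(** The test vector for condition (II) is [e_k] with its lower coordinates rounded, so that each
    earlier square contributes at most [d l]. *)
Lemma gram_diag_le g (Lam : R) (d : 'I_g -> R) U : 1 <= Lam ->
  upper_unipotent U -> (forall i, 0 < d i) ->
  minkowski_II d U g -> (forall i k : 'I_g, (i < k)%N -> d i <= Lam * d k) ->
  forall k, gram d U k k <= (1 + g%:R * Lam) * d k.
Proof.
move=> L1 UU d0 MII rat k.
have [a [aE aP]] := rounding (- 2^-1) k (delta_mx k 0) UU.
have ak : a k 0 = 1 by rewrite aE // mxE !eqxx.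
have aj (j : 'I_g) : (k < j)%N -> a j 0 = 0.
  by move=> kj; rewrite aE ?(ltnW kj) // mxE; case: eqP => // e; rewrite e ltnn in kj.
have := MII k a (ltnW (ltn_ord k)) _ (big_gcdz_unit (leqnn k) ak).
move=> /(_ _)/le_trans; rewrite -gram_diag => h; apply: h => [l|].
  by rewrite ltnNge (ltnW (ltn_ord l)).
have T (l : 'I_g) : d l * lin U a l ^+ 2 <= (if l == k then d k else 0) + Lam * d k.
  have dk := d0 k; have dl := d0 l.
  have Ld : 0 <= Lam * d k by rewrite mulr_ge0 ?(ltW dk) //; lra.
  have [lk|kl|/val_inj ->] := ltngtP l k; last first.
  - by rewrite eqxx lin_top // ak mulr1z expr1n mulr1; lra.
  - by rewrite (lin_above UU aj) // expr0n mulr0; case: ifP => _; lra.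
  have := aP l lk; rewrite (_ : (l == k) = false); last by apply/negbTE; rewrite neq_ltn lk.
  move=> /andP[h1 h2]; have : lin U a l ^+ 2 <= 1 by nra.
  have := rat l k lk; nra.
apply: le_trans (ler_sum _ (fun l _ => T l)) _; rewrite big_split /=.
rewrite -big_mkcond big_pred1_eq sumr_const card_ord -[X in _ + X]mulr_natl.
by rewrite mulrDl mul1r mulrA.
Qed.

(** Induction on rows: [d i * U i j] is the entry of the form minus terms from rows [l < i], which
    are already bounded, with [d l <= Lam * d i]. *)
Lemma unipotent_bound g (Lam c : R) : 1 <= Lam -> 0 <= c ->
  exists2 K : R, 1 <= K & forall (d : 'I_g -> R) U, upper_unipotent U ->
  (forall i, 0 < d i) -> (forall i k : 'I_g, (i < k)%N -> d i <= Lam * d k) ->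
  (forall i j : 'I_g, (i < j)%N -> `|gram d U i j| <= c * d i) ->
  forall i j, `|U i j| <= K.
Proof.
move=> L1 c0.
have H n : exists2 K : R, 1 <= K & forall (d : 'I_g -> R) U, upper_unipotent U ->
    (forall i, 0 < d i) -> (forall i k : 'I_g, (i < k)%N -> d i <= Lam * d k) ->
    (forall i j : 'I_g, (i < j)%N -> `|gram d U i j| <= c * d i) ->
    forall i j : 'I_g, (i < n)%N -> `|U i j| <= K; last first.
  have [K K1 KP] := H g.
  by exists K => // d U UU d0 rat off i j; apply: (KP d U) => //.
elim: n => [|n [K K1 IH]]; first by exists 1.
have gR : 0 <= g%:R :> R by [].
exists (K + c + g%:R * Lam * K ^+ 2).
  have : 0 <= g%:R * Lam * K ^+ 2 by rewrite mulr_ge0 ?sqr_ge0 // mulr_ge0 //; lra.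
  lra.
move=> d U UU d0 rat off i j; rewrite ltnS => ile.
have gLK : 0 <= g%:R * Lam * K ^+ 2 by rewrite mulr_ge0 ?sqr_ge0 // mulr_ge0 //; lra.
have {IH}IH := IH d U UU d0 rat off.
have [ij|ji|/val_inj ->] := ltngtP i j; last first.
- by rewrite UU.1 normr1; lra.
- by rewrite UU.2 // normr0; lra.
have di := d0 i; rewrite -(ler_pM2l di) -[X in X * `|_|]ger0_norm ?(ltW di) // -normrM.
have -> : d i * U i j = gram d U i j - \sum_(l < g | l != i) d l * U l i * U l j.
  by rewrite /gram (bigD1 i) //= UU.1 mulr1 addrK.
apply: le_trans (ler_normB _ _) _.
have h : `|\sum_(l < g | l != i) d l * U l i * U l j| <= d i * (g%:R * Lam * K ^+ 2).
  apply: le_trans (ler_norm_sum _ _ _) _.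
  apply: le_trans (_ : \sum_(l < g) d i * (Lam * K ^+ 2) <= _); last first.
    by rewrite sumr_const card_ord -[leLHS]mulr_natl; rewrite !mulrA [g%:R * d i]mulrC.
  rewrite big_mkcond /=; apply: ler_sum => l _.
  have nn : 0 <= d i * (Lam * K ^+ 2) by rewrite mulr_ge0 ?(ltW di) // mulr_ge0 ?sqr_ge0 //; lra.
  case: ifP => // li; have [h1|h1|/val_inj h1] := ltngtP l i; last by rewrite h1 eqxx in li.
    rewrite !normrM (ger0_norm (ltW (d0 l))) -mulrA.
    have ll : (l < n)%N by apply: leq_trans h1 ile.
    have k1 := IH l i ll; have k2 := IH l j ll.
    have kk : `|U l i| * `|U l j| <= K ^+ 2 by rewrite expr2 ler_pM.
    apply: le_trans (_ : (Lam * d i) * K ^+ 2 <= _); last by rewrite mulrA [d i * _]mulrC.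
    by apply: ler_pM => //; rewrite ?(ltW (d0 l)) ?mulr_ge0 // rat.
  by rewrite UU.2 // mulr0 mul0r normr0.
have := off i j ij; have : 0 <= d i * K by rewrite mulr_ge0 ?(ltW di) //; lra.
lra.
Qed.

Lemma siegel_bounds g : exists2 K : R, 1 <= K & forall (d : 'I_g -> R) (U : 'M[R]_g),
  upper_unipotent U -> (forall i, 0 < d i) -> minkowski_II d U g ->
  (forall i k : 'I_g, (i < k)%N -> d i <= K * d k) /\ forall i j, `|U i j| <= K.
Proof.
have [Lam L1 LP] := pivot_ratio g.
have c0 : 0 <= (1 + g%:R * Lam) / 2 :> R.
  by have : 0 <= g%:R * Lam by [rewrite mulr_ge0 //; lra]; lra.
have [K K1 KP] := @unipotent_bound g Lam _ L1 c0.
exists (Lam + K) => [|d U UU d0 MII]; first lra.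
have rat := LP d U UU d0 MII; split=> [i k ik|i j].
  by apply: le_trans (rat i k ik) _; rewrite ler_pM2r //; lra.
apply: le_trans (KP d U UU d0 rat _ i j) _; last lra.
move=> i' j' ij; apply: le_trans (minkowski_offdiag MII ij) _.
by have := gram_diag_le L1 UU d0 MII rat i'; lra.
Qed.

Lemma squares_pos g (d : 'I_g -> R) (U : 'M[R]_g) (x : 'cV[R]_g) (k : 'I_g) :
  upper_unipotent U -> (forall i, 0 < d i) -> (forall j : 'I_g, (k < j)%N -> x j 0 = 0) ->
  d k * x k 0 ^+ 2 <= \sum_l d l * (\sum_j U l j * x j 0) ^+ 2.
Proof.
move=> [U1 U0] d0 xk; rewrite (bigD1 k) //=.
have -> : \sum_j U k j * x j 0 = x k 0; last first.
  by rewrite lerDl sumr_ge0 // => l _; rewrite mulr_ge0 ?sqr_ge0 // ltW.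
rewrite (bigD1 k) //= U1 mul1r big1 ?addr0 // => j jk.
have [h|h|/val_inj h] := ltngtP j k; first by rewrite U0 // mul0r.
  by rewrite xk // mulr0.
by rewrite h eqxx in jk.
Qed.

Lemma top_coord (T : nmodType) g (x : 'cV[T]_g) : x != 0 ->
  exists2 k : 'I_g, x k 0 != 0 & forall j : 'I_g, (k < j)%N -> x j 0 = 0.
Proof.
move=> xn; have [i xi] : exists i, x i 0 != 0.
  apply/existsP; apply: contraNT xn; rewrite negb_exists => /forallP h.
  by apply/eqP/colP => i; rewrite mxE; apply/eqP; have := h i; rewrite negbK.
case: (@arg_maxnP _ i (fun i => x i 0 != 0) val xi) => k kn kP; exists k => // j kj.
by apply/eqP; apply: contraTT kj => /kP /=; rewrite -leqNgt.
Qed.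

Lemma gram_posdef g (Y U : 'M[R]_g) (d : 'I_g -> R) : upper_unipotent U -> (forall i, 0 < d i) ->
  (forall i j, Y i j = \sum_l d l * U l i * U l j) -> posdef Y.
Proof.
move=> UU d0 YE x /top_coord[k xk kP].
have -> : (x^T *m Y *m x) 0 0 = \sum_l d l * (\sum_j U l j * x j 0) ^+ 2.
  apply: (@qform_squares _ _ Y U d g x) => [i j _ _|i]; first exact: YE.
  by rewrite ltnNge (ltnW (ltn_ord i)).
apply: lt_le_trans (squares_pos UU d0 kP).
by rewrite mulr_gt0 // exprn_even_gt0.
Qed.

(** If the pivot at [k] were nonpositive, a primitive integer vector with tiny rows before [k] would
    get no positive contribution from row [k]; its value falls below [Y 0 0], against condition (II)
    for the first index. *)
Lemma minkowski_posdef g (Y : 'M[R]_g) : minkowski_reduced Y -> posdef Y.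
Proof.
move=> [symY Y00 MII _].
have [d [U [k [[kg UU dpos dk YE] _]]]] := square_completion symY.
move: kg; rewrite leq_eqVlt => /orP[/eqP kE|kg].
  apply: (@gram_posdef _ Y U d) => // [i|i j]; first by apply: dpos; rewrite kE.
  by apply: YE; rewrite kE ltnW.
have g0 : (0 < g)%N by apply: leq_ltn_trans kg.
pose o := Ordinal g0; pose q := Ordinal kg.
have y0 : 0 < Y o o by exact: Y00.
pose D := \sum_(l < g | (l < k)%N) d l.
have D0 : 0 <= D by rewrite sumr_ge0 // => l lk; rewrite ltW // dpos.
(* The squares before [k] add up to at most [D / n], which must be below [Y o o]. *)
have [n nP] : exists n : nat, D / Y o o < n%:R.
  by exists (Num.trunc (D / Y o o)).+1; exact: truncnS_gt.
have n0 : (0 < n)%N.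
  by rewrite -(ltr0n R); apply: le_lt_trans nP; rewrite divr_ge0 // ltW.
have nR : 1 <= n%:R :> R by rewrite ler1n.
have [a [ak0 akE aj ae]] := dirichlet q UU n0.
have [b [b1 _ bj _ bmid]] := @primitive_approx _ _ U o q a _ UU (leq0n _) ak0 aj (fun i _ => ae i).
have := MII o b b1; rewrite -[X in _ <= X]/(qform Y (map_mx intr b)) (qform_lin YE) //.
rewrite leNgt => /negP[]; apply: le_lt_trans (_ : D * n%:R^-1 < _); last first.
  by move: nP; rewrite ltr_pdivrMr // ltr_pdivrMr ?[_ * Y o o]mulrC //; lra.
rewrite /D mulr_suml [leRHS]big_mkcond /=; apply: ler_sum => l _.
have [lk|kl|lk] := ltngtP l k.
- have dl := dpos l lk; rewrite ler_pM2l //; have h := bmid l (leq0n _) lk.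
  have : n%:R^-1 <= 1 :> R by rewrite invf_le1 //; lra.
  have : 0 < n%:R^-1 :> R by rewrite invr_gt0; lra.
  by move: h; rewrite ler_norml => /andP[]; nra.
- by rewrite (lin_above UU bj) // expr0n mulr0.
by have := dk l lk; have := sqr_ge0 (lin U b l); nra.
Qed.

Lemma int_form_lower g (d : 'I_g -> R) (U : 'M[R]_g) : upper_unipotent U ->
  (forall i, 0 < d i) ->
  exists2 c : R, 0 < c & forall a : 'cV[int]_g, a != 0 ->
    c <= \sum_l d l * lin U a l ^+ 2.
Proof.
move=> UU d0; have [c c0 cd] := fin_lower d0; exists c => // a /top_coord[k ak aj].
rewrite (bigD1 k) //= lin_top //.
have : 0 <= \sum_(l < g | l != k) d l * lin U a l ^+ 2.
  by rewrite sumr_ge0 // => l _; rewrite mulr_ge0 ?sqr_ge0 // ltW.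
have : 1 <= (a k 0)%:~R ^+ 2 :> R.
  have -> : (a k 0)%:~R ^+ 2 = (a k 0 * a k 0)%:~R :> R by rewrite intrM expr2.
  by rewrite -[leLHS](mulr1z 1) ler_int; move: (a k 0) ak => z; nia.
by have := cd k; have := d0 k; nra.
Qed.

End Reduction.

(** * Hermite reduction of positive definite forms *)

Section LatticeReduction.
Variable R : realType.
Local Notation mr := (map_mx (intr : int -> R)).

Lemma qformZ g (Y : 'M[R]_g) (c : R) x : qform Y (c *: x) = c ^+ 2 * qform Y x.
Proof. rewrite !qformE mulr_sumr; apply: eq_bigr => i _; rewrite mulr_sumr; apply: eq_bigr => j _.
by rewrite !mxE; ring. Qed.

Lemma qform_conj g (Y A : 'M[R]_g) x : qform (A^T *m Y *m A) x = qform Y (A *m x).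
Proof. by rewrite /qform trmx_mul !mulmxA. Qed.

Lemma posdef_conj g (Y A : 'M[R]_g) : A \in unitmx -> posdef Y -> posdef (A^T *m Y *m A).
Proof.
move=> uA pY x xn; have -> : (x^T *m (A^T *m Y *m A) *m x) 0 0 = qform Y (A *m x).
  exact: qform_conj.
apply: pY; apply: contraNneq xn => Ax; by rewrite -(mulKmx uA x) Ax mulmx0.
Qed.

Lemma unit_mr g (A : 'M[int]_g) : A \in unitmx -> mr A \in unitmx.
Proof. move=> /mulmxV E; have := map_mxM (intr : int -> R) A (invmx A).
by rewrite E map_mx1 => /esym/mulmx1_unit[]. Qed.

Lemma posdef_int_lower g (Y : 'M[R]_g) : Y^T = Y -> posdef Y ->
  exists2 c : R, 0 < c & forall a : 'cV[int]_g, a != 0 -> c <= qform Y (mr a).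
Proof.
move=> symY pY; have [d [U [UU d0 YE]]] := posdef_completion symY pY.
have [c c0 cP] := int_form_lower UU d0; exists c => // a an.
rewrite (@qform_lin _ _ Y U d g) // => [|i]; first exact: cP.
by rewrite ltnNge (ltnW (ltn_ord i)).
Qed.

(** The infimum over nonzero integer vectors is only approached, within a factor [4/3]. The Smith
    normal form writes such a vector as an integer multiple of a column of a unimodular matrix, and
    dividing by that integer does not raise the value. *)
Lemma approx_min_vector g (Y : 'M[R]_g.+1) : Y^T = Y -> posdef Y ->
  exists (mu : R) (V : 'M[int]_g.+1), [/\ 0 < mu, V \in unitmx,
    (forall a : 'cV[int]_g.+1, a != 0 -> mu <= qform Y (mr a)) &
    qform Y (mr (col 0 V)) <= 4 / 3 * mu].
Proof.
move=> symY pY; have [c c0 cP] := posdef_int_lower symY pY.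
pose S := [set x : R | exists2 a : 'cV[int]_g.+1, a != 0 & x = qform Y (mr a)].
have e0n : delta_mx 0 0 != 0 :> 'cV[int]_g.+1.
  by apply/eqP => /matrixP/(_ 0 0)/eqP; rewrite !mxE.
have hS : has_inf S.
  split; first by exists (qform Y (mr (delta_mx 0 0))), (delta_mx 0 0).
  by exists c => _ [a an ->]; exact: cP.
have mu_low a : a != 0 -> inf S <= qform Y (mr a).
  by move=> an; apply: ge_inf; [exact: hS.2|exists a].
have mu0 : 0 < inf S.
  by apply: lt_le_trans c0 _; apply: lb_le_inf hS.1 _ => _ [a an ->]; exact: cP.
have mu3 : 0 < inf S / 3 by rewrite divr_gt0.
have [_ [v vn ->] vS] := inf_adherent mu3 hS.
have [L uL [P uP [d _ vE]]] := int_Smith_normal_form v.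
pose s := P 0 0; pose k := d`_0 * s.
have {}vE : v = k *: col 0 L.
  rewrite vE; apply/colP => i; rewrite mxE big_ord1 !mxE (bigD1 0) //= mxE eqxx mulr1n.
  rewrite big1 ?addr0 => [|j j0]; last first.
    by rewrite mxE (_ : (_ == _) = false) ?mulr0n ?mulr0 //; apply/negbTE.
  by rewrite /k /s; ring.
have kn : k != 0 by apply: contraNneq vn => k0; rewrite vE k0 scale0r.
exists (inf S), L; split=> //.
have : qform Y (mr (col 0 L)) <= qform Y (mr v).
  have -> : mr v = k%:~R *: mr (col 0 L) by rewrite vE map_mxZ.
  rewrite qformZ.
  have k1 : 1 <= k%:~R ^+ 2 :> R.
    have -> : k%:~R ^+ 2 = (k * k)%:~R :> R by rewrite intrM expr2.
    by rewrite -[leLHS](mulr1z 1) ler_int; move: kn; nia.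
  have : inf S <= qform Y (mr (col 0 L)).
    apply: mu_low; apply: contraNneq vn => L0; by rewrite vE L0 scaler0.
  nra.
lra.
Qed.

Lemma upper_unipotent_block g (w : 'rV[R]_g) (U : 'M[R]_g) : upper_unipotent U ->
  upper_unipotent (block_mx 1%:M w 0 U : 'M[R]_(1 + g)).
Proof.
move=> [U1 U0]; split=> [i|i j].
  by case: (fintype.splitP i) => k ik; [have -> : i = lshift g k by exact: val_inj|
    have -> : i = rshift 1 k by exact: val_inj];
    rewrite ?block_mxEul ?block_mxEdr ?U1 // mxE eqxx.
case: (fintype.splitP i) => k ik; first by rewrite ik ord1.
have -> : i = rshift 1 k by exact: val_inj.
case: (fintype.splitP j) => l jl.
  by have -> : j = lshift g l by [exact: val_inj]; rewrite block_mxEdl mxE.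
have -> : j = rshift 1 l by exact: val_inj.
by rewrite block_mxEdr /= => h; rewrite U0.
Qed.

(** Splitting off the first square: [Y - b^T b / a] is the Schur complement, and [w] the first row
    of the new unipotent factor. *)
Lemma block_completion g (a : R) (b r : 'rV[R]_g) (Y A : 'M[R]_g) : a != 0 ->
  let T : 'M[R]_(1 + g) := block_mx 1%:M r 0 A in
  let w := a^-1 *: (b *m A) + r in
  T^T *m block_mx a%:M b b^T Y *m T =
  block_mx a%:M (a *: w) (a *: w^T)
    (A^T *m (Y - a^-1 *: (b^T *m b)) *m A + a *: (w^T *m w)).
Proof.
move=> an T w; pose c := b *m A; have wE : w = a^-1 *: c + r by [].
clearbody w.
have aw : a *: w = c + a *: r by rewrite wE scalerDr scalerA divff // scale1r.
have awT : a *: w^T = c^T + a *: r^T by rewrite -linearZ /= aw linearD /= linearZ.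
have cT : c^T = A^T *m b^T by rewrite /c trmx_mul.
rewrite /T tr_block_mx !mulmx_block !trmx1 !trmx0 !mul1mx !mul0mx !mulmx0 !addr0 !mulmx1.
rewrite mul_scalar_mx mul_mx_scalar -/c [a *: r + c]addrC -aw; congr block_mx.
  by rewrite awT addrC cT.
rewrite mulmxBr mulmxBl -scalemxAr -scalemxAl !mulmxA -cT -[c^T *m b *m A]mulmxA -/c.
rewrite !mulmxDl -[r^T *m b *m A]mulmxA -/c -scalemxAl cT -cT.
have -> : a *: (w^T *m w) = a^-1 *: (c^T *m c) + c^T *m r + r^T *m c + a *: (r^T *m r).
  rewrite wE; clearbody c; apply/matrixP => i j; rewrite !mxE !big_ord1 !mxE; by field.
apply/matrixP => i j; rewrite !(mxE, big_ord1); ring.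
Qed.

(* Hermite reduction: a nearly minimal vector is split off, the orthogonal
   projection is reduced by induction, and the first row is size-reduced. *)
Lemma hermite_reduction g (Y : 'M[R]_g) : Y^T = Y -> posdef Y ->
  exists (A : 'M[int]_g) (d : 'rV[R]_g) (U : 'M[R]_g),
  [/\ A \in unitmx, upper_unipotent U, (forall i j, i != j -> `|U i j| <= 2^-1),
      (forall i, 0 < d 0 i) &
      (forall i k : 'I_g, (i <= k)%N -> d 0 i <= 2 ^+ (k - i) * d 0 k)] /\
  (mr A)^T *m Y *m mr A = U^T *m diag_mx d *m U.
Proof.
elim: g Y => [|g IH] Y symY pY.
  exists 1%:M, 0, 1%:M; split; last by apply/matrixP => -[].
  by split=> //; rewrite ?unitmx1 //; try (by case); split=> -[].
have [mu [V [mu0 uV mulow Vmin]]] := approx_min_vector symY pY.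
pose Y1 : 'M[R]_(1 + g) := (mr V)^T *m Y *m mr V.
have uVR := unit_mr uV.
have symY1 : Y1^T = Y1 by rewrite /Y1 !trmx_mul trmxK symY mulmxA.
have pY1 : posdef Y1 by exact: posdef_conj.
have aE0 : Y1 0 0 = qform Y (mr (col 0 V)).
  rewrite /Y1 qformE mxE; under eq_bigr do rewrite mxE mulr_suml.
  rewrite exchange_big /=; apply: eq_bigr => i _; apply: eq_bigr => j _.
  by rewrite !mxE.
have Y1def : Y1 = (mr V)^T *m Y *m mr V by [].
clearbody Y1.
pose a := Y1 0 0; pose b := ursubmx Y1; pose Y' := drsubmx Y1.
have Y1E : Y1 = block_mx a%:M b b^T Y'.
  rewrite -[LHS]submxK; congr block_mx.
    rewrite [LHS]mx11_scalar; congr (_%:M); rewrite mxE [LHS]mxE /a.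
    by congr (Y1 _ _); exact: val_inj.
  by rewrite /b trmx_ursub symY1.
have symY' : Y'^T = Y' by rewrite /Y' trmx_drsub symY1.
have aE : a = qform Y (mr (col 0 V)) by [].
have c0n : col 0 V != 0.
  apply: contraTneq uV => c0; rewrite unitmxE (expand_det_col V 0) big1 ?unitr0 // => i _.
  by have /colP/(_ i) := c0; rewrite !mxE => ->; rewrite mul0r.
have a0 : 0 < a by rewrite aE; apply: lt_le_trans mu0 (mulow _ c0n).
have an : a != 0 by rewrite gt_eqF.
have amu : a <= 4 / 3 * mu by rewrite aE.
pose S := Y' - a^-1 *: (b^T *m b).
have symS : S^T = S by rewrite /S linearB /= linearZ /= trmx_mul trmxK symY'.
have pS : posdef S.
  move=> x xn; pose T0 : 'M[R]_(1 + g) := block_mx 1%:M (- a^-1 *: b) 0 1%:M.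
  have uT0 : T0 \in unitmx by rewrite unitmxE /T0 det_ublock !det1 mulr1 unitr1.
  have := block_completion b (- a^-1 *: b) Y' 1%:M an.
  rewrite /= mulmx1 scaleNr subrr trmx0 !scaler0 mul0mx scaler0 addr0 trmx1 mul1mx mulmx1.
  rewrite -/S -scaleNr -/T0 -Y1E => TE.
  have := posdef_conj uT0 pY1; rewrite TE => /(_ (col_mx 0 x)).
  rewrite tr_col_mx mul_row_block mul_row_col trmx0 !mul0mx !mulmx0 !add0r; apply.
  by apply: contraNneq xn => z0; rewrite -(col_mxKd (0 : 'cV[R]_1) x) z0 linear0.
have [A' [d' [U' [[uA' UU' U'b d'0 d'r] E]]]] := IH S symS pS.
pose t := a^-1 *: (b *m mr A').
pose r : 'rV[int]_g := \row_j - Num.floor (t 0 j + 2^-1).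
pose w := t + mr r.
have wb j : `|w 0 j| <= 2^-1.
  rewrite /w !mxE rmorphN /=; have /andP[h1 h2] := floor_itv (t 0 j + 2^-1).
  by rewrite intrD mulr1z in h2; rewrite !mxE in h1 h2 *; rewrite ler_norml; lra.
pose T : 'M[int]_(1 + g) := block_mx 1%:M r 0 A'.
pose d : 'rV[R]_(1 + g) := row_mx a%:M d'.
pose U : 'M[R]_(1 + g) := block_mx 1%:M w 0 U'.
have uT : T \in unitmx by rewrite unitmxE /T det_ublock det1 mul1r -unitmxE.
have dl k : d 0 (lshift g k) = a by rewrite row_mxEl !ord1 mxE eqxx.
have dr k : d 0 (rshift 1 k) = d' 0 k by rewrite row_mxEr.
have mT : mr T = block_mx 1%:M (mr r) 0 (mr A') by rewrite /T map_block_mx map_mx1 map_mx0.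
have EE : (mr (V *m T))^T *m Y *m mr (V *m T) = U^T *m diag_mx d *m U.
  have -> : (mr (V *m T))^T *m Y *m mr (V *m T) = (mr T)^T *m Y1 *m mr T.
    by rewrite map_mxM trmx_mul Y1def !mulmxA.
  rewrite mT Y1E block_completion // -/w -/S E /U /d.
  rewrite tr_block_mx diag_mx_row !mulmx_block !trmx1 !trmx0 !mul1mx !mul0mx !mulmx0 !addr0 !add0r.
  rewrite !mulmx1; have -> : diag_mx (a%:M : 'rV[R]_1) = a%:M.
    by apply/matrixP => i j; rewrite !ord1 !mxE eqxx !mulr1n.
  rewrite mul_scalar_mx mul_mx_scalar; congr block_mx.
    by rewrite mul0mx addr0.
  by rewrite addrC scalemxAl.
exists (V *m T), d, U; split=> //; split.
- by rewrite unitmx_mul uV uT.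
- exact: upper_unipotent_block.
- change (forall i j : 'I_(1 + g), i != j -> `|U i j| <= 2^-1).
  move=> i j; case: (fintype.splitP i) => k ik.
    have -> : i = lshift g k by exact: val_inj.
    case: (fintype.splitP j) => l jl.
      by have -> : j = lshift g l by [exact: val_inj]; rewrite !ord1 eqxx.
    have -> : j = rshift 1 l by exact: val_inj.
    by rewrite /U block_mxEur !ord1.
  have -> : i = rshift 1 k by exact: val_inj.
  case: (fintype.splitP j) => l jl.
    have -> : j = lshift g l by exact: val_inj.
    by rewrite /U block_mxEdl mxE normr0 invr_ge0.
  have -> : j = rshift 1 l by exact: val_inj.
  by rewrite /U block_mxEdr => kl; apply: U'b; apply: contra_neq kl => ->.
- change (forall i : 'I_(1 + g), 0 < d 0 i).
  move=> i; case: (fintype.splitP i) => k ik.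
    by have -> : i = lshift g k by [exact: val_inj]; rewrite dl.
  by have -> : i = rshift 1 k by [exact: val_inj]; rewrite dr.
change (forall i k : 'I_(1 + g), (i <= k)%N -> d 0 i <= 2 ^+ (k - i) * d 0 k).
move=> i j; case: (fintype.splitP j) => l jl.
  have -> : j = lshift g l by exact: val_inj.
  case: (fintype.splitP i) => k ik; last by rewrite ik /= ord1.
  have -> : i = lshift g k by exact: val_inj.
  by rewrite !dl /= !ord1 subnn expr0 mul1r.
have -> : j = rshift 1 l by exact: val_inj.
case: (fintype.splitP i) => k ik; last first.
  have -> : i = rshift 1 k by exact: val_inj.
  by rewrite !dr /= => h; rewrite subnDl; apply: d'r.
have -> : i = lshift g k by exact: val_inj.
rewrite dl dr ord1 /= => _; have g0 : (0 < g)%N by apply: leq_ltn_trans (ltn_ord l).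
pose o := Ordinal g0; have h := d'r o l (leq0n _).
(* The second basis vector has value at most [a / 4 + d' 0 o], and near-minimality makes it at least
   [3 a / 4]; here the factor [4/3] and the rounding to [1/2] meet. *)
suff : a <= 2 * d' 0 o.
  rewrite subn0 add1n exprS -mulrA => h'; apply: le_trans h' _; rewrite ler_pM2l //.
  by move: h; rewrite subn0.
pose e : 'cV[int]_(1 + g) := delta_mx (rshift 1 o) 0.
have en : (V *m T) *m e != 0.
  have ue : (V *m T) \in unitmx by rewrite unitmx_mul uV uT.
  apply/eqP => h0; have : e = 0 by rewrite -(mulKmx ue e) h0 mulmx0.
  by move=> /matrixP/(_ (rshift 1 o) 0)/eqP; rewrite !mxE !eqxx.
have := mulow _ en; rewrite map_mxM -qform_conj EE.
have -> : qform (U^T *m diag_mx d *m U) (mr e) = a * w 0 o ^+ 2 + d' 0 o.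
  have -> : mr e = delta_mx (rshift 1 o) 0 by rewrite map_delta_mx.
  have Ue : U *m delta_mx (rshift 1 o) 0 = col_mx (w 0 o)%:M (U' *m delta_mx o 0).
    have -> : delta_mx (rshift 1 o) 0 = col_mx 0 (delta_mx o 0) :> 'cV[R]_(1 + g).
      apply/colP => i1; case: (fintype.splitP i1) => k1 ik1.
        have -> : i1 = lshift g k1 by exact: val_inj.
        by rewrite col_mxEu !mxE eq_lrshift.
      have -> : i1 = rshift 1 k1 by exact: val_inj.
      by rewrite col_mxEd !mxE eq_rshift.
    rewrite /U mul_block_col !mulmx0 !add0r; congr col_mx.
    by apply/matrixP => i1 j1; rewrite !ord1 -colE !mxE eqxx.
  rewrite qform_conj Ue /qform /d diag_mx_row tr_col_mx mul_row_block mul_row_col.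
  rewrite !mulmx0 !addr0 !add0r mxE; congr (_ + _).
    by rewrite !(mxE, big_ord1) !eqxx !mulr1n; ring.
  have -> : ((U' *m (delta_mx o 0 : 'cV[R]_g))^T *m diag_mx d' *m
      (U' *m (delta_mx o 0 : 'cV[R]_g))) 0 0 = \sum_l d' 0 l * U' l o ^+ 2.
    rewrite mxE; apply: eq_bigr => l1 _; rewrite mul_mx_diag mxE -!colE !mxE; ring.
  rewrite (bigD1 o) //= UU'.1 expr1n mulr1 big1 ?addr0 // => l1 lo.
  by rewrite UU'.2 ?expr0n ?mulr0 // lt0n.
have := wb o; rewrite ler_norml => /andP[h1 h2].
have : w 0 o ^+ 2 <= 4^-1 by nra.
nra.
Qed.

End LatticeReduction.

(** * Finitely many nearly diagonal pieces and their cone coordinates *)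

Section Pieces.
Variable R : realType.
Local Notation mr := (map_mx (intr : int -> R)).

(** [U] is rounded to a rational matrix [V = P^T / q] with [q] fixed in advance, so that [P] is
    integral of bounded size; then [X = U V^-1] is close to the identity. *)
Lemma unipotent_approx g (K e : R) : 1 <= K -> 0 < e ->
  exists q B : nat, (0 < q)%N /\ forall U : 'M[R]_g, upper_unipotent U ->
  (forall i j, `|U i j| <= K) -> exists (P : 'M[int]_g) (X : 'M[R]_g),
  [/\ forall i j, (`|P i j| <= B)%N, mr P \in unitmx, upper_unipotent X,
      (forall i j, i != j -> `|X i j| <= e) & q%:R *: U = X *m (mr P)^T].
Proof.
(* Rounding errors [1 / q] accumulate from column to column by the factor [1 + (K + 1) = s], so
   [q > s^g / e] suffices. *)
move=> K1 e0; pose s := K + 2.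
have s1 : 1 <= s by rewrite /s; lra.
pose q := (Num.trunc (s ^+ g / e)).+1.
have qP : s ^+ g / e < q%:R by exact: truncnS_gt.
have q0 : 0 < q%:R :> R by rewrite ltr0n.
have q1 : 1 <= q%:R :> R by rewrite ler1n.
have qn : q%:R != 0 :> R by rewrite gt_eqF.
have qe : q%:R^-1 * s ^+ g <= e.
  by rewrite mulrC ler_pdivrMr // ltW // mulrC -ltr_pdivrMr.
pose B := (Num.trunc (q%:R * K) + q).+1.
exists q, B; split=> // U [U1 U0] UK.
pose P : 'M[int]_g := \matrix_(j, i) (if i == j then q%:Z else
  if (i < j)%N then Num.floor (q%:R * U i j) else 0).
pose V : 'M[R]_g := q%:R^-1 *: (mr P)^T.
have VE : (mr P)^T = q%:R *: V by rewrite /V scalerA divff // scale1r.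
have V1 i : V i i = 1 by rewrite !mxE eqxx /= -pmulrn mulVf.
have V0 (i j : 'I_g) : (j < i)%N -> V i j = 0.
  move=> ji; rewrite !mxE ifF; last by apply/negbTE; rewrite neq_ltn ji orbT.
  by rewrite ltnNge (ltnW ji) /= mulr0.
have UV i j : `|U i j - V i j| <= q%:R^-1.
  have [ij|ji|/val_inj <-] := ltngtP i j; last first.
  - by rewrite U1 V1 subrr normr0 invr_ge0 ltW.
  - by rewrite U0 // V0 // subrr normr0 invr_ge0 ltW.
  have -> : V i j = q%:R^-1 * (Num.floor (q%:R * U i j))%:~R.
    by rewrite !mxE ifF ?ij //; apply/negbTE; rewrite neq_ltn ij.
  have /andP[h1 h2] := floor_itv (q%:R * U i j); rewrite intrD mulr1z in h2.
  rewrite -(ler_pM2l q0) mulfV // -[X in X * `|_|]ger0_norm ?(ltW q0) // -normrM mulrBr mulrA mulfV //.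
  by rewrite mul1r ler_norml; lra.
have VK i j : `|V i j| <= K + 1.
  have -> : V i j = U i j - (U i j - V i j) by ring.
  apply: le_trans (ler_normB _ _) _; have := UK i j; have := UV i j.
  have : q%:R^-1 <= 1 :> R by rewrite invf_le1.
  lra.
have uP : mr P \in unitmx.
  have tP : is_trig_mx (mr P).
    apply/is_trig_mxP => i j ij; rewrite !mxE ifF; last by apply/negbTE; rewrite neq_ltn ij orbT.
    by rewrite ltnNge (ltnW ij).
  rewrite unitmxE det_trig // unitfE; apply/prodf_neq0 => i _.
  by rewrite !mxE eqxx.
have uV : V \in unitmx by rewrite /V unitmxZ ?unitmx_tr // unitfE invr_neq0.
pose X := U *m invmx V; have XV : X *m V = U by rewrite /X mulmxKV.
pose E := X - 1%:M; have EV : E *m V = U - V by rewrite /E mulmxBl XV mul1mx.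
have Erec (i j : 'I_g) : E i j = (U i j - V i j) - \sum_(l < g | (l < j)%N) E i l * V l j.
  have -> : U i j - V i j = \sum_l E i l * V l j.
    by have /matrixP/(_ i j) := EV; rewrite [X in X = _]mxE => ->; rewrite !mxE.
  rewrite (bigD1 j) //= V1 mulr1 [X in _ + X - _](bigID (fun l : 'I_g => (l < j)%N)) /=.
  rewrite [X in _ + (_ + X)]big1 ?addr0; last first.
    move=> l /andP[lj]; rewrite -leqNgt => jl; rewrite V0 ?mulr0 //.
    by rewrite ltn_neqAle jl andbT eq_sym.
  rewrite (eq_bigl (fun l : 'I_g => (l < j)%N)) ?addrK // => l.
  by rewrite andb_idl // => lj; rewrite neq_ltn lj.
have E0 n : forall i j : 'I_g, (j < n)%N -> (j <= i)%N -> E i j = 0.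
  elim: n => // n IH i j; rewrite ltnS => jn ji; rewrite Erec big1 ?subr0.
    have [h|h|/val_inj ->] := ltngtP j i; first by rewrite U0 // V0 // subr0.
      by rewrite leqNgt h in ji.
    by rewrite U1 V1 subrr.
  by move=> l lj; rewrite IH ?mul0r ?(leq_trans lj) // (leq_trans (ltnW lj)).
have Eb n : forall i j : 'I_g, (j < n)%N -> `|E i j| <= q%:R^-1 * s ^+ j.
  elim: n => // n IH i j; rewrite ltnS => jn; rewrite Erec.
  apply: le_trans (ler_normB _ _) _.
  apply: le_trans (_ : q%:R^-1 + \sum_(l < g | (l < j)%N) q%:R^-1 * s ^+ l * (K + 1) <= _).
    rewrite lerD ?UV //; apply: le_trans (ler_norm_sum _ _ _) _; apply: ler_sum => l lj.
    by rewrite normrM ler_pM // ?IH // (leq_trans lj).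
  have sumE : \sum_(l < g | (l < j)%N) q%:R^-1 * s ^+ l * (K + 1) = q%:R^-1 * (s ^+ j - 1).
    rewrite -(big_ord_widen g (fun l => q%:R^-1 * s ^+ l * (K + 1)) (ltnW (ltn_ord j))).
    rewrite subrX1 mulrA mulr_sumr /s; apply: eq_bigr => l _; ring.
  by rewrite sumE mulrBr mulr1; lra.
have XE i j : X i j = E i j + (i == j)%:R by rewrite /E !mxE subrK.
exists P, X; split=> //.
- move=> i j; rewrite mxE /B; case: eqP => [_|_]; first by clear; lia.
  case: ifP => // ji; suff : `|Num.floor (q%:R * U j i)| <= (Num.trunc (q%:R * K)).+1%:Z by clear; lia.
  have qK0 : 0 <= q%:R * K by rewrite mulr_ge0 ?(ltW q0) //; lra.
  have tK := truncnS_gt (q%:R * K).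
  have ub : `|q%:R * U j i| <= q%:R * K by rewrite normrM (ger0_norm (ltW q0)) ler_pM2l.
  move: ub; rewrite !ler_norml => /andP[h1 h2]; apply/andP; split.
    by rewrite floor_ge_int rmorphN /= -pmulrn; lra.
  have := floor_le (q%:R * U j i) => fl.
  by rewrite -(ler_int R) -[leRHS]pmulrn; lra.
- split=> [i|i j ji]; first by rewrite XE (E0 g) // eqxx add0r.
  rewrite XE (E0 g) ?(ltnW ji) // (_ : (i == j) = false) ?addr0 //.
  by apply/negbTE; rewrite neq_ltn ji orbT.
- move=> i j ij; rewrite XE (negbTE ij) addr0; apply: le_trans (Eb g i j (ltn_ord j)) _.
  apply: le_trans qe; rewrite ler_pM2l ?invr_gt0 //.
  by apply: ler_weXn2l => //; exact: ltnW.
by rewrite VE -scalemxAr XV.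
Qed.

(** Strict inequalities throughout, so that the pieces they define are open. *)
Definition cone_cond g (C delta c : R) (Y : 'M[R]_g) : Prop :=
  [/\ forall i j : 'I_g, (i < j)%N -> `|Y i j| < delta * Y i i,
      forall i j : 'I_g, (i < j)%N -> Y i i < C * Y j j &
      forall i, c < Y i i].

(** A Siegel set. The lower bound is put on the first pivot only; the ratios carry it to the
    others. *)
Definition siegel_form g (K c0 : R) (Y : 'M[R]_g) : Prop :=
  exists (d : 'I_g -> R) (U : 'M[R]_g),
  [/\ upper_unipotent U, (forall i, 0 < d i),
      (forall i k : 'I_g, (i < k)%N -> d i <= K * d k) & (forall i j, `|U i j| <= K)] /\
  (forall i : 'I_g, i = 0%N :> nat -> c0 <= d i) /\ forall i j, Y i j = gram d U i j.

Lemma gram_conj g (d : 'I_g -> R) (U : 'M[R]_g) :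
  \matrix_(i, j) gram d U i j = U^T *m diag_mx (\row_i d i) *m U.
Proof.
apply/matrixP => i j; rewrite !mxE; apply: eq_bigr => l _.
by rewrite mul_mx_diag !mxE; ring.
Qed.

(** Conjugation by the rational approximation of [U] replaces [U] by [X], near the identity: the
    form becomes nearly diagonal while the pivots keep their ratios. Bounded entries leave finitely
    many [P]. *)
Lemma siegel_cover g (K c0 : R) : (0 < g)%N -> 1 <= K -> 0 < c0 ->
  exists (C c : R) (B : nat), [/\ 1 <= C, 0 < c & forall Y : 'M[R]_g, siegel_form K c0 Y ->
  exists P : 'M[int]_g, [/\ forall i j, (`|P i j| <= B)%N, mr P \in unitmx &
    cone_cond C (4 * g%:R * C)^-1 c (invmx (mr P) *m Y *m (invmx (mr P))^T)]].
Proof.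
move=> g0 K1 c00; have gR : 1 <= g%:R :> R by rewrite ler1n.
(* Before scaling, diagonal entries lie between [d i] and [(1 + g K) d i]; the added 1 makes the
   comparison strict. *)
pose C := (1 + g%:R * K) * K + 1; pose delta := (4 * g%:R * C)^-1.
have gK : 1 <= g%:R * K by nra.
have C1 : 1 <= C by rewrite /C; nra.
have d0 : 0 < delta by rewrite invr_gt0 !mulr_gt0 //; lra.
pose e := Num.min 1 (delta / (2 * (1 + g%:R * K))).
have e0 : 0 < e by rewrite lt_min ltr01 divr_gt0 //; lra.
have e1 : e <= 1 by rewrite ge_min lexx.
have eD : e * (1 + g%:R * K) < delta.
  have : e <= delta / (2 * (1 + g%:R * K)) by rewrite ge_min lexx orbT.
  by rewrite ler_pdivlMr; nra.
have [q [B [q0 H]]] := @unipotent_approx g K e K1 e0.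
have qR : 0 < q%:R :> R by rewrite ltr0n.
have q2 : 0 < q%:R ^+ 2 :> R by rewrite exprn_gt0.
(* [K] is lost from the first pivot to the others, 2 buys strictness, and [q^2] comes from the
   scaling of [P]. *)
exists C, (c0 / (2 * K) / q%:R ^+ 2), B; split=> //.
  by rewrite !divr_gt0 //; lra.
move=> Y [d [U [[UU dpos rat UK] [dc YE]]]].
have [P [X [PB uP UX Xe qU]]] := H U UU UK; exists P; split=> //.
have -> : invmx (mr P) *m Y *m (invmx (mr P))^T =
    (q%:R ^+ 2)^-1 *: \matrix_(i, j) gram d X i j.
  have -> : Y = \matrix_(i, j) gram d U i j by apply/matrixP => i j; rewrite YE mxE.
  have UE : U = q%:R^-1 *: (X *m (mr P)^T) by rewrite -qU scalerA mulVf ?scale1r // gt_eqF.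
  rewrite !gram_conj UE [(_ *: _)^T]linearZ /= [(X *m _)^T]trmx_mul trmxK -!scalemxAl -!scalemxAr -!scalemxAl.
  rewrite scalerA -expr2 exprVn; congr (_ *: _); rewrite !mulmxA mulVmx // mul1mx.
  by rewrite -[X in X = _]mulmxA -trmx_mul mulVmx // trmx1 mulmx1.
have dX i : d i <= gram d X i i by exact: gram_ge.
have Xl (l i : 'I_g) : (l < i)%N -> `|X l i| <= e by move=> li; apply: Xe; rewrite neq_ltn li.
have low (i j : 'I_g) : (i <= j)%N ->
    `|\sum_(l < g | (l < i)%N) d l * X l i * X l j| <= d i * (g%:R * K * e ^+ 2).
  move=> ij; apply: le_trans (ler_norm_sum _ _ _) _.
  apply: le_trans (_ : \sum_(l < g) d i * (K * e ^+ 2) <= _); last first.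
    by rewrite sumr_const card_ord -[leLHS]mulr_natl !mulrA [g%:R * d i]mulrC.
  rewrite big_mkcond; apply: ler_sum => l _; case: ifP => li; last first.
    by rewrite mulr_ge0 ?(ltW (dpos i)) // mulr_ge0 ?sqr_ge0 //; lra.
  rewrite !normrM (ger0_norm (ltW (dpos l))) -mulrA.
  have kk : `|X l i| * `|X l j| <= e ^+ 2 by rewrite expr2 ler_pM // Xl // (leq_trans li).
  apply: le_trans (_ : (K * d i) * e ^+ 2 <= _); last by rewrite mulrA [d i * _]mulrC.
  by apply: ler_pM => //; rewrite ?(ltW (dpos l)) ?mulr_ge0 // rat.
have split (i j : 'I_g) : (i <= j)%N -> gram d X i j = d i * X i j +
    \sum_(l < g | (l < i)%N) d l * X l i * X l j.
  move=> ij; rewrite /gram (bigD1 i) //= UX.1 mulr1; congr (_ + _).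
  rewrite (bigID (fun l : 'I_g => (l < i)%N)) /= [X in _ + X]big1 ?addr0; last first.
    move=> l /andP[li]; rewrite -leqNgt => il; rewrite UX.2 ?mulr0 ?mul0r //.
    by rewrite ltn_neqAle il andbT eq_sym.
  by apply: eq_bigl => l; rewrite andb_idl // => li; rewrite neq_ltn li.
have off (i j : 'I_g) : (i < j)%N -> `|gram d X i j| < delta * gram d X i i.
  move=> ij; rewrite split ?(ltnW ij) //; apply: le_lt_trans (ler_normD _ _) _.
  have h1 := low i j (ltnW ij); have h2 := Xl i j ij; have di := dpos i.
  have h3 : `|d i * X i j| <= d i * e by rewrite normrM (ger0_norm (ltW di)) ler_pM2l.
  have h4 : d i * (g%:R * K * e ^+ 2) <= d i * (g%:R * K * e).
    rewrite ler_pM2l // ler_pM2l; last lra.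
    by rewrite expr2 ler_piMl // ltW.
  have h5 : d i * (e * (1 + g%:R * K)) < d i * delta by rewrite ltr_pM2l.
  have h6 : d i * delta <= delta * gram d X i i by rewrite mulrC ler_pM2l.
  lra.
have up i : gram d X i i <= (1 + g%:R * K) * d i.
  rewrite split // UX.1 mulr1; have := low i i (leqnn i); have di := dpos i.
  have : d i * (g%:R * K * e ^+ 2) <= d i * (g%:R * K).
    rewrite ler_pM2l // ler_piMr; [by []|lra|].
    by rewrite expr2; nra.
  by rewrite ler_norml => h1 /andP[h2 h3]; lra.
have rt (i j : 'I_g) : (i < j)%N -> gram d X i i < C * gram d X j j.
  move=> ij; have := up i; have := rat i j ij; have := dX j; have := dpos j; have := dpos i.
  rewrite /C; move: (gram d X i i) (gram d X j j) => x y; set t := 1 + g%:R * K.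
  have t1 : 1 <= t by rewrite /t; lra.
  move=> h1 h2 h3 h4 h5.
  have : t * d i <= t * (K * d j) by rewrite ler_pM2l //; lra.
  have : t * K * d j <= t * K * y by rewrite ler_pM2l // mulr_gt0 //; lra.
  lra.
have iq : 0 < (q%:R ^+ 2)^-1 :> R by rewrite invr_gt0.
split=> [i j ij|i j ij|i]; rewrite !mxE.
- by rewrite normrM (ger0_norm (ltW iq)) mulrCA ltr_pM2l //; exact: off.
- by rewrite mulrCA ltr_pM2l //; exact: rt.
rewrite mulrC ltr_pM2l //; apply: lt_le_trans (dX i).
pose o := Ordinal g0; have co : c0 <= d o by exact: dc.
have : c0 <= K * d i.
  have [io|io] := posnP i.
    have -> : i = o by exact: val_inj.
    by have := dpos o; nra.
  exact: le_trans co (rat o i io).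
rewrite ltr_pdivrMr; last lra.
nra.
Qed.

Section ConeCoordinates.
Variables (F : numFieldType) (g : nat) (delta : F).
Implicit Types A : 'M[F]_g.

(** The order of the pair carries the sign: [i < j] stands for [e_i + e_j], and [i > j] for
    [e_j - e_i]. *)
Definition cone_vec (i j : 'I_g) : 'cV[int]_g :=
  if i == j then delta_mx i 0 else
  if (i < j)%N then delta_mx i 0 + delta_mx j 0 else delta_mx j 0 - delta_mx i 0.

Definition omin (i j : 'I_g) : 'I_g := if (i < j)%N then i else j.

(** An off-diagonal entry is split evenly between the sum and the difference vector, and [delta]
    times the diagonal entry of smaller index is lent to both to make them positive; the diagonal
    coefficients pay it back, [2 delta] for each other index. *)
Definition cone_coord A (i j : 'I_g) : F :=
  if i == j then A i i - \sum_(k | k != i) 2 * delta * A (omin i k) (omin i k) else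
  if (i < j)%N then A i j / 2 + delta * A i i else - A i j / 2 + delta * A j j.

Lemma cone_vecM (i j a b : 'I_g) :
  (cone_vec i j a 0)%:~R * (cone_vec i j b 0)%:~R =
  if i == j then ((a == i) && (b == i))%:R else
  ((a == i) && (b == i))%:R + ((a == j) && (b == j))%:R +
  (if (i < j)%N then 1 else -1) * (((a == i) && (b == j))%:R + ((a == j) && (b == i))%:R) :> F.
Proof.
rewrite /cone_vec; case: (eqVneq i j) => [_|ij].
  by rewrite !mxE !andbT; case: (a == i); case: (b == i); rewrite /= ?mulr1z ?mulr0z ?mulr1 ?mulr0.
by case: ifP => _; rewrite !mxE !andbT; case: (a == i); case: (a == j); case: (b == i);
  case: (b == j); rewrite /= ?subrr ?addr0 ?subr0 ?sub0r ?rmorphN ?mulr1z ?mulr0z /=; ring.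
Qed.

Lemma sum_pair_delta (f : 'I_g -> 'I_g -> F) (a b : 'I_g) :
  \sum_i \sum_j f i j * ((a == i) && (b == j))%:R = f a b.
Proof.
rewrite (bigD1 a) //= (bigD1 b) //= !eqxx mulr1 big1 ?addr0 => [|j jb]; last first.
  by rewrite eq_sym (negbTE jb) mulr0.
rewrite big1 ?addr0 // => i ia; rewrite big1 // => j _.
by rewrite eq_sym (negbTE ia) mulr0.
Qed.

Lemma cone_coord_sum A : A^T = A ->
  A = \sum_i \sum_j cone_coord A i j *:
        (map_mx intr (cone_vec i j) *m (map_mx intr (cone_vec i j))^T).
Proof.
move=> symA; have Asym i j : A i j = A j i by rewrite -{1}symA mxE.
apply/matrixP => a b; rewrite summxE.
transitivity (\sum_i \sum_j cone_coord A i j *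
    ((cone_vec i j a 0)%:~R * (cone_vec i j b 0)%:~R)); last first.
  apply: eq_bigr => i _; rewrite summxE; apply: eq_bigr => j _.
  by rewrite !mxE big_ord1 !mxE.
have two : (2 : F) != 0 by rewrite pnatr_eq0.
have [<-|ab] := eqVneq a b.
  transitivity (\sum_i \sum_j cone_coord A i j * (if i == j then (a == i)%:R else
      (a == i)%:R + (a == j)%:R)); last first.
    apply: eq_bigr => i _; apply: eq_bigr => j _; rewrite cone_vecM; congr (_ * _).
    case: (eqVneq i j) => [_|ij]; first by rewrite andbb.
    rewrite !andbb; case: (eqVneq a i) => [->|ai]; last by rewrite /= andbF addr0 mulr0 addr0.
    by rewrite (negbTE ij) /= !addr0 mulr0 addr0.
  transitivity (cone_coord A a a + \sum_(k | k != a) (cone_coord A a k + cone_coord A k a)).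
    rewrite {1}/cone_coord eqxx -[LHS]addr0 -addrA; congr (_ + _).
    rewrite addrC -sumrN -big_split /= big1 // => k ka; rewrite /cone_coord /omin.
    rewrite [a == k]eq_sym (negbTE ka).
    have [h|h|/val_inj h] := ltngtP a k; last by rewrite h eqxx in ka.
      by rewrite [A k a]Asym; field.
    by rewrite [A k a]Asym; field.
  rewrite [RHS](bigD1 a) //= [X in _ = X + _](bigD1 a) //= !eqxx mulr1 -addrA; congr (_ + _).
  rewrite big_split /=; congr (_ + _).
    apply: eq_bigr => k ka; rewrite eq_sym (negbTE ka) addr0 mulr1 //.
  apply: eq_bigr => k ka; rewrite (bigD1 a) //= (negbTE ka) eqxx [a == k]eq_sym (negbTE ka).
  rewrite add0r mulr1 big1 ?addr0 // => j ja.
  by rewrite [a == j]eq_sym (negbTE ja) addr0; case: ifP; rewrite mulr0.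
transitivity (\sum_i \sum_j (if i == j then 0 else cone_coord A i j *
    (if (i < j)%N then 1 else -1)) * ((a == i) && (b == j))%:R +
    \sum_i \sum_j (if i == j then 0 else cone_coord A i j *
    (if (i < j)%N then 1 else -1)) * ((b == i) && (a == j))%:R).
  rewrite !sum_pair_delta (negbTE ab) eq_sym (negbTE ab) /cone_coord (negbTE ab) eq_sym (negbTE ab).
  have [h|h|/val_inj h] := ltngtP a b; last by rewrite h eqxx in ab.
    by rewrite [A b a]Asym; field.
  by rewrite [A b a]Asym; field.
rewrite -big_split; apply: eq_bigr => i _; rewrite -big_split; apply: eq_bigr => j _ /=.
rewrite cone_vecM.
have d0 k : (a == k) && (b == k) = false.
  by apply/negbTE; apply: contra ab => /andP[/eqP -> /eqP ->].
rewrite !d0; case: (eqVneq i j) => [_|ij]; first by rewrite !mul0r mulr0 addr0.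
by rewrite !add0r [(b == i) && _]andbC -mulrDr mulrA.
Qed.

End ConeCoordinates.

(** The value [delta = 1 / (4 g C)] is chosen so that what is taken from a diagonal coefficient, at
    most [2 delta g C Y_ii], is half of [Y_ii]. *)
Lemma cone_coord_ge g (C c : R) (Y : 'M[R]_g) : (0 < g)%N -> 1 <= C -> 0 < c ->
  let delta := (4 * g%:R * C)^-1 in cone_cond C delta c Y -> Y^T = Y ->
  forall i j, delta * c / 2 <= cone_coord delta Y i j.
Proof.
move=> g0 C1 c0 delta [off rat low] symY i j.
have gR : 1 <= g%:R :> R by rewrite ler1n.
have gC : 1 <= g%:R * C by nra.
have D : 0 < 4 * g%:R * C by rewrite mulr_gt0 //; lra.
have d0 : 0 < delta by rewrite invr_gt0.
have dE : delta * (4 * (g%:R * C)) = 1 by rewrite mulrA mulVf // gt_eqF.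
have Ysym i' j' : Y i' j' = Y j' i' by rewrite -{1}symY mxE.
have yi := low i; have yj := low j.
rewrite /cone_coord; case: (eqVneq i j) => [_|ij]; last first.
  have [h|h|/val_inj h] := ltngtP i j; last by rewrite h eqxx in ij.
    by have := off i j h; rewrite ltr_norml => /andP[h1 h2]; nra.
  by have := off j i h; rewrite [Y j i]Ysym ltr_norml => /andP[h1 h2]; nra.
have S : \sum_(k | k != i) 2 * delta * Y (omin i k) (omin i k) <=
    \sum_(k < g) 2 * delta * (C * Y i i).
  rewrite [leLHS]big_mkcond; apply: ler_sum => k _.
  have Ci : 0 < C * Y i i by rewrite mulr_gt0 //; lra.
  have nn : 0 <= 2 * delta * (C * Y i i) by rewrite mulr_ge0 ?(ltW Ci) //; lra.
  case: ifP => // ki; rewrite ler_pM2l; last lra.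
  rewrite /omin; case: ifP => ik; first by nra.
  have {}ki : (k < i)%N by rewrite ltn_neqAle ki leqNgt ik.
  by apply/ltW/rat.
have : \sum_(k < g) 2 * delta * (C * Y i i) = Y i i / 2.
  rewrite sumr_const card_ord -[LHS]mulr_natl.
  have -> : g%:R * (2 * delta * (C * Y i i)) = delta * (4 * (g%:R * C)) * (Y i i / 2) by field.
  by rewrite dE mul1r.
have : delta <= 1 by nra.
by nra.
Qed.

End Pieces.

(** * The symplectic action on the Siegel space *)

Section Symplectic.
Variables (R : realType) (g : nat).
Local Notation C := R[i].
Local Notation Re := (@complex.Re R).
Local Notation Im := (@complex.Im R).
Local Notation mc := (map_mx (intr : int -> C)).
Local Notation mr := (map_mx (intr : int -> R)).
Local Notation rc := (map_mx (real_complex R)).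
Local Notation cj := (map_mx (@conjc R)).
Local Notation J := (symplectic_form g).
Implicit Types (tau : 'M[C]_g) (M : 'M[int]_(g + g)).

Lemma sp_formM : J *m J = - 1%:M.
Proof.
rewrite /symplectic_form mulmx_block !mulmx0 !mul0mx !mul1mx !mulmx1 !add0r addr0.
by apply: oppr_inj; rewrite opprK opp_block_mx !opprK !oppr0 -scalar_mx_block.
Qed.

Lemma sp_unit M : M *m J *m M^T = J -> M *m (J *m M^T *m - J) = 1%:M.
Proof. by move=> E; rewrite !mulmxA E mulmxN sp_formM opprK. Qed.

(** [J M^T (- J)] is a right inverse of [M], hence a left inverse. *)
Lemma sp_tr M : SpZ M -> M^T *m J *m M = J.
Proof.
move=> [_ /sp_unit/mulmx1C E].
have : - J *m (J *m M^T *m - J *m M) = - J by rewrite E mulmx1.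
rewrite !mulmxA mulNmx sp_formM opprK mul1mx mulmxN mulNmx => /oppr_inj; by [].
Qed.

Lemma SpZ_block (a b c d : 'M[int]_g) : a *m b^T = b *m a^T -> c *m d^T = d *m c^T ->
  a *m d^T - b *m c^T = 1%:M -> SpZ (block_mx a b c d).
Proof.
move=> ab cd ad.
have E : block_mx a b c d *m J *m (block_mx a b c d)^T = J.
  rewrite /symplectic_form tr_block_mx !mulmx_block !mulmx0 !mulmx1 !mulmxN !mulmx1 !add0r !addr0 !mulNmx.
  congr block_mx.
  - by rewrite addrC ab subrr.
  - by rewrite addrC.
  - have := congr1 trmx ad; rewrite linearB /= !trmx_mul !trmxK trmx1 => <-.
    by rewrite opprB addrC.
  - by rewrite addrC cd subrr.
by split=> //; have /mulmx1_unit[] := sp_unit E.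
Qed.

Lemma num_den M tau : col_mx (num_mx M tau) (den_mx M tau) = mc M *m col_mx tau 1%:M.
Proof.
rewrite /num_mx /den_mx -{5}[M]submxK map_block_mx mul_block_col !mulmx1; by [].
Qed.

(** Numerator over denominator is [M] applied to [tau] over the identity, so this is the invariance
    of the form [J]. With [tau2 = tau1] it yields the symmetry of the image point, with [tau2] the
    conjugate it yields the imaginary part. *)
Lemma sp_pairing M tau1 tau2 : SpZ M ->
  (num_mx M tau1)^T *m den_mx M tau2 - (den_mx M tau1)^T *m num_mx M tau2 = tau1^T - tau2.
Proof.
move=> /sp_tr MJ.
have JP (n1 N1 n2 N2 : 'M[C]_g) :
    (col_mx n1 N1)^T *m mc J *m col_mx n2 N2 = n1^T *m N2 - N1^T *m n2.
  rewrite tr_col_mx /symplectic_form map_block_mx !map_mx0 map_mxN map_mx1.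
  rewrite mul_row_block !mulmx0 mulmx1 add0r addr0 mulmxN mulmx1 mul_row_col mulNmx addrC.
  by [].
have key : (mc M)^T *m mc J *m mc M = mc J.
  have -> : (mc M)^T = mc M^T by apply/matrixP => i j; rewrite !mxE.
  by rewrite -!map_mxM MJ.
transitivity ((col_mx tau1 1%:M)^T *m ((mc M)^T *m mc J *m mc M) *m col_mx tau2 1%:M).
  by rewrite -JP !num_den trmx_mul !mulmxA.
by rewrite key JP mulmx1 trmx1 mul1mx.
Qed.

Lemma conj_num_den M tau : cj (num_mx M tau) = num_mx M (cj tau) /\
  cj (den_mx M tau) = den_mx M (cj tau).
Proof.
have E (A : 'M[int]_g) : cj (mc A) = mc A.
  by apply/matrixP => i j; rewrite !mxE rmorph_int.
by rewrite /num_mx /den_mx !map_mxD !map_mxM !E.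
Qed.

Lemma hermitian_form (Y : 'M[R]_g) (w : 'cV[C]_g) : Y^T = Y ->
  (w^T *m rc Y *m cj w) 0 0 = (qform Y (map_mx Re w) + qform Y (map_mx Im w))%:C.
Proof.
move=> symY; pose a := map_mx Re w; pose b := map_mx Im w.
have -> : (w^T *m rc Y *m cj w) 0 0 =
    \sum_i \sum_j w i 0 * (Y i j)%:C * (w j 0)^*%C.
  rewrite mxE exchange_big /=; apply: eq_bigr => j _.
  by rewrite !mxE mulr_suml; apply: eq_bigr => i _; rewrite !mxE.
rewrite !qformE -big_split /=.
have Ysym i j : Y i j = Y j i by rewrite -{1}symY mxE.
apply: complex_ext.
  rewrite cRe_sum /=; apply: eq_bigr => i _; rewrite cRe_sum -big_split /=.
  apply: eq_bigr => j _; rewrite !mxE; case: (w i 0) => x1 x2; case: (w j 0) => y1 y2 /=; ring.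
rewrite cIm_sum /=.
pose f i j := Im (w i 0) * Y i j * Re (w j 0).
transitivity (\sum_i \sum_j f i j - \sum_i \sum_j f j i); last first.
  by rewrite [X in _ - X]exchange_big subrr.
rewrite -sumrB; apply: eq_bigr => i _; rewrite cIm_sum -sumrB; apply: eq_bigr => j _.
by rewrite /f [Y j i]Ysym; case: (w i 0) => x1 x2; case: (w j 0) => y1 y2 /=; ring.
Qed.

Lemma Im_sym tau : tau^T = tau -> (map_mx Im tau)^T = map_mx Im tau.
Proof.
move=> symt; apply/matrixP => i j; rewrite !mxE; congr complex.Im.
by have /matrixP/(_ i j) := symt; rewrite mxE.
Qed.

Lemma Im_cj tau : tau - cj tau = (2 * 'i%C) *: rc (map_mx Im tau).
Proof.
apply/matrixP => i j; rewrite !mxE; case: (tau i j) => x y /=.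
by apply: complex_ext; rewrite ?(cReB, cImB, cReM, cImM) /=; ring.
Qed.

Lemma cplx_neq0 (w : 'cV[C]_g) : w != 0 -> map_mx Re w != 0 \/ map_mx Im w != 0.
Proof.
move=> wn; have [a0|] := eqVneq (map_mx Re w) 0; last by left.
right; apply: contra_neq wn => b0; apply/colP => i; rewrite mxE.
have /colP/(_ i) := a0; have /colP/(_ i) := b0; rewrite !mxE => h1 h2.
exact: complex_ext.
Qed.

Lemma posdef_ge0 (Y : 'M[R]_g) x : posdef Y -> 0 <= qform Y x.
Proof.
move=> pY; have [->|xn] := eqVneq x 0; last exact/ltW/pY.
by rewrite /qform trmx0 !mul0mx mxE.
Qed.

Lemma hermitian_gt0 (Y : 'M[R]_g) (w : 'cV[C]_g) : posdef Y -> w != 0 ->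
  0 < qform Y (map_mx Re w) + qform Y (map_mx Im w).
Proof.
move=> pY /cplx_neq0[/pY|/pY] h.
  by apply: ltr_wpDr => //; exact: posdef_ge0.
by apply: ltr_wpDl => //; exact: posdef_ge0.
Qed.

(** A kernel vector of the denominator would be isotropic for the hermitian form of [Im tau], by
    [sp_pairing] with the conjugate point. *)
Lemma den_unit M tau : SpZ M -> siegel_space tau -> den_mx M tau \in unitmx.
Proof.
move=> SM [symt pY]; set N := den_mx M tau; set n := num_mx M tau.
rewrite -unitmx_tr -row_free_unit -kermx_eq0; apply/eqP/row_matrixP => i.
pose w := (row i (kermx N^T))^T.
have Nw : N *m w = 0.
  by apply: trmx_inj; rewrite trmx_mul trmxK -row_mul mulmx_ker row0 trmx0.
have [w0|wn] := eqVneq w 0; first by rewrite -[LHS]trmxK -/w w0 trmx0 row0.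
have := hermitian_gt0 pY wn; set s := (X in 0 < X) => s0.
have := sp_pairing tau (cj tau) SM; have [cn cN] := conj_num_den M tau; rewrite -cn -cN symt -/n -/N.
move=> /(congr1 (fun A => (w^T *m A *m cj w) 0 0)).
have -> : w^T *m (n^T *m cj N - N^T *m cj n) *m cj w = 0.
  rewrite mulmxBr mulmxBl !mulmxA -[_ *m cj N *m cj w]mulmxA -map_mxM Nw map_mx0 mulmx0 sub0r.
  by rewrite -trmx_mul Nw trmx0 !mul0mx oppr0.
rewrite Im_cj -scalemxAr -scalemxAl mxE [X in _ = X]mxE hermitian_form; last first.
  exact: Im_sym.
rewrite -/s => /eqP; rewrite eq_sym mulf_eq0 fmorph_eq0 (gt_eqF s0) orbF mulf_eq0 pnatr_eq0 /=.
by move=> /eqP/(congr1 Im)/=/eqP; rewrite oner_eq0.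
Qed.

Lemma sp_Im M tau : SpZ M -> siegel_space tau ->
  (siegel_act M tau)^T = siegel_act M tau /\
  (den_mx M tau)^T *m rc (map_mx Im (siegel_act M tau)) *m cj (den_mx M tau) =
  rc (map_mx Im tau).
Proof.
move=> SM Ht; have uN := den_unit SM Ht; have [symt _] := Ht.
set N := den_mx M tau in uN *; set n := num_mx M tau; set t' := siegel_act M tau.
have nE : n = t' *m N by rewrite /t' /siegel_act -/n -/N mulmxKV.
have sym : t'^T = t'.
  have := sp_pairing tau tau SM; rewrite symt subrr -/n -/N => /eqP; rewrite subr_eq0 => /eqP E.
  have uT : N^T \in unitmx by rewrite unitmx_tr.
  have : N^T *m t'^T *m N = N^T *m t' *m N by rewrite -trmx_mul -nE E nE mulmxA.
  by move=> /(can_inj (mulmxK uN)) /(can_inj (mulKmx uT)).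
split=> //; have [cn cN] := conj_num_den M tau.
have := sp_pairing tau (cj tau) SM; rewrite -cn -cN symt -/n -/N nE Im_cj.
rewrite trmx_mul sym map_mxM -!mulmxA -mulmxBr mulmxA -mulmxBl mulmxA.
rewrite (_ : t' - cj t' = (2 * 'i%C) *: rc (map_mx Im t')); last exact: Im_cj.
rewrite -scalemxAr -scalemxAl => E.
have i2 : 2 * 'i%C != 0 :> C.
  rewrite mulf_neq0 ?pnatr_eq0 //; apply/eqP => /(congr1 Im)/=/eqP; by rewrite oner_eq0.
by have := congr1 (fun A => (2 * 'i%C)^-1 *: A) E; rewrite !scalerA mulVf // !scale1r mulmxA.
Qed.

Lemma siegel_act_space M tau : SpZ M -> siegel_space tau -> siegel_space (siegel_act M tau).
Proof.
move=> SM Ht; have [sym E] := sp_Im SM Ht; have uN := den_unit SM Ht; split=> // x xn.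
set Y' := map_mx Im (siegel_act M tau) in E *.
set N := den_mx M tau in E uN; pose w := invmx N *m rc x.
have xw : rc x = N *m w by rewrite /w mulKVmx.
have wn : w != 0.
  apply: contra_neq xn => w0; have := xw; rewrite w0 mulmx0 => /colP h; apply/colP => i.
  by have := h i; rewrite !mxE => /(congr1 Re).
have cx : cj (rc x) = rc x by apply/matrixP => i j; rewrite !mxE; apply: complex_ext; rewrite /= ?oppr0.
have := hermitian_gt0 Ht.2 wn.
have symY := Im_sym Ht.1.
suff -> : (x^T *m Y' *m x) 0 0 = qform (map_mx Im tau) (map_mx Re w) +
   qform (map_mx Im tau) (map_mx Im w) by [].
have := hermitian_form w symY; rewrite -E => /(congr1 Re) /= <-.
have xT : (rc x)^T = rc x^T by apply/matrixP => i j; rewrite !mxE.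
rewrite !mulmxA -trmx_mul -xw -[_ *m cj N *m cj w]mulmxA -map_mxM -xw cx xT -!map_mxM.
by rewrite [RHS]/= [in RHS]mxE.
Qed.

Lemma det_Im M tau : SpZ M -> siegel_space tau ->
  nm (\det (den_mx M tau)) ^+ 2 * \det (map_mx Im (siegel_act M tau)) = \det (map_mx Im tau).
Proof.
move=> SM Ht; have [_ /(congr1 determinant)] := sp_Im SM Ht.
rewrite !det_mulmx det_tr !det_map_mx; set D := \det (den_mx M tau).
set x := \det _; set y := \det _ => E.
have : (D * D^*%C) * x%:C = y%:C by rewrite -E; ring.
have -> : D * D^*%C = (nm D ^+ 2)%:C.
  rewrite nm_sqr; case: D {E} => a b; apply: complex_ext; rewrite ?(cReM, cImM) /=; ring.
by rewrite -rmorphM => /(congr1 Re).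
Qed.

Lemma GL_move (A : 'M[int]_g) tau : A \in unitmx ->
  exists2 M, SpZ M & siegel_act M tau = mc A *m tau *m (mc A)^T /\
    den_mx M tau = mc (invmx A)^T.
Proof.
move=> uA; exists (block_mx A 0 0 (invmx A)^T).
  apply: SpZ_block; rewrite ?trmx0 ?mulmx0 ?mul0mx // trmxK subr0; exact: mulmxV.
have dE : den_mx (block_mx A 0 0 (invmx A)^T) tau = mc (invmx A)^T.
  by rewrite /den_mx block_mxKdl block_mxKdr map_mx0 mul0mx add0r.
split=> //; rewrite /siegel_act dE /num_mx block_mxKul block_mxKur map_mx0 addr0; congr (_ *m _).
have E : mc (invmx A)^T *m (mc A)^T = 1%:M.
  have -> : (mc A)^T = mc A^T by apply/matrixP => i j; rewrite !mxE.
  by rewrite -map_mxM -trmx_mul mulmxV // trmx1 map_mx1.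
have [u1 _] := mulmx1_unit E.
by rewrite -[RHS]mul1mx -(mulVmx u1) -mulmxA E mulmx1.
Qed.

Lemma translation_move (B : 'M[int]_g) tau : B^T = B ->
  exists2 M, SpZ M & siegel_act M tau = tau + mc B /\ den_mx M tau = 1%:M.
Proof.
move=> symB; exists (block_mx 1%:M B 0 1%:M).
  by apply: SpZ_block; rewrite ?trmx0 ?trmx1 ?mulmx0 ?mul0mx ?mulmx1 ?mul1mx ?subr0 // symB.
have dE : den_mx (block_mx 1%:M B 0 1%:M) tau = 1%:M.
  by rewrite /den_mx block_mxKdl block_mxKdr map_mx0 mul0mx add0r map_mx1.
split=> //; rewrite /siegel_act dE invmx1 mulmx1 /num_mx block_mxKul block_mxKur map_mx1.
by rewrite mul1mx.
Qed.

(** The inversion of [SL_2] placed in the first coordinate: its denominator is the identity except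
    in row [o], which is that row of [tau]. *)
Lemma inversion_move (o : 'I_g) : o = 0%N :> nat ->
  exists2 M, SpZ M & forall tau, \det (den_mx M tau) = tau o o.
Proof.
move=> o0; pose E : 'M[int]_g := delta_mx o o.
have EE : E *m E = E by rewrite mul_delta_mx.
have ET : E^T = E by rewrite trmx_delta.
exists (block_mx (1%:M - E) (- E) E (1%:M - E)).
  have T1 : (1%:M - E)^T = 1%:M - E by rewrite linearB /= trmx1 ET.
  have T2 : (- E)^T = - E by rewrite linearN /= ET.
  apply: SpZ_block; rewrite ?T1 ?T2 ?ET.
  - by rewrite mulmxN mulNmx mulmxBl mulmxBr mulmx1 mul1mx.
  - by rewrite mulmxBl mulmxBr mulmx1 mul1mx.
  by rewrite mulNmx opprK mulmxBl !mulmxBr !mulmx1 !mul1mx EE subrr subr0 subrK.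
move=> tau; rewrite /den_mx block_mxKdl block_mxKdr.
set D := _ + _; have DE i j : D i j = if i == o then tau o j else (i == j)%:R.
  rewrite /D map_mxB map_mx1 map_delta_mx !mxE (bigD1 o) //= !mxE eqxx andbT big1 ?addr0; last first.
    by move=> k ko; rewrite mxE (negbTE ko) andbF mul0r.
  case: (eqVneq i o) => [->|io] /=; last by rewrite mul0r add0r subr0.
  by rewrite mul1r [j == o]eq_sym subrr addr0.
rewrite -det_tr det_trig; last first.
  apply/is_trig_mxP => i j ij; rewrite mxE DE; case: eqP => [jo|_].
    by rewrite jo o0 in ij.
  by rewrite (_ : (j == i) = false) //; apply/negbTE; rewrite neq_ltn ij orbT.
rewrite (bigD1 o) //= mxE DE eqxx big1 ?mulr1 // => i io.
by rewrite mxE DE (negbTE io) eqxx.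
Qed.

End Symplectic.

(** * Reduced representatives of orbits *)

Section OrbitReduction.
Variables (R : realType) (g : nat).
Local Notation C := R[i].
Local Notation Re := (@complex.Re R).
Local Notation Im := (@complex.Im R).
Local Notation mc := (map_mx (intr : int -> C)).
Local Notation mr := (map_mx (intr : int -> R)).
Local Notation rc := (map_mx (real_complex R)).
Local Notation cj := (map_mx (@conjc R)).
Implicit Types (tau : 'M[C]_g) (M : 'M[int]_(g + g)).

Lemma det_upper_unipotent (U : 'M[R]_g) : upper_unipotent U -> \det U = 1.
Proof.
move=> [U1 U0]; rewrite -det_tr det_trig; last first.
  by apply/is_trig_mxP => i j ij; rewrite mxE U0.
by rewrite big1 // => i _; rewrite mxE U1.
Qed.

Lemma det_gram (d : 'I_g -> R) (U : 'M[R]_g) (Y : 'M[R]_g) : upper_unipotent U ->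
  (forall i j, Y i j = gram d U i j) -> \det Y = \prod_i d i.
Proof.
move=> UU YE; have -> : Y = \matrix_(i, j) gram d U i j by apply/matrixP => i j; rewrite YE mxE.
rewrite gram_conj !det_mulmx det_tr det_upper_unipotent // mul1r mulr1 det_diag.
by apply: eq_bigr => i _; rewrite mxE.
Qed.

Lemma posdef_det_gt0 (Y : 'M[R]_g) : Y^T = Y -> posdef Y -> 0 < \det Y.
Proof.
move=> symY pY; have [d [U [UU d0 YE]]] := posdef_completion symY pY.
by rewrite (det_gram UU YE) prodr_gt0.
Qed.

Lemma posdef_unit (Y : 'M[R]_g) : Y^T = Y -> posdef Y -> Y \in unitmx.
Proof. by move=> symY pY; rewrite unitmxE unitfE gt_eqF // posdef_det_gt0. Qed.

Lemma posdef_inv (Y : 'M[R]_g) : Y^T = Y -> posdef Y -> posdef (invmx Y).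
Proof.
move=> symY pY; have uY := posdef_unit symY pY.
have -> : invmx Y = (invmx Y)^T *m Y *m invmx Y.
  by rewrite trmx_inv symY mulVmx // mul1mx.
by apply: posdef_conj; rewrite ?unitmx_inv.
Qed.

(** Let [r] be the last row of the denominator [N] and [s] its value under the hermitian form of
    [(Im tau)^-1]. The vector [x = N w], with [w] proportional to [(Im tau)^-1] times the conjugate
    of [r], has last coordinate 1 and value [1 / s] under the new imaginary part, so the last pivot
    is at most [1 / s]. And [s] is bounded below because the last row of [M] is a nonzero integer
    vector. *)
Lemma orbit_pivot_bound tau : (0 < g)%N -> siegel_space tau ->
  exists Lam : R, forall M d (U : 'M[R]_g), SpZ M -> upper_unipotent U ->
  (forall i, 0 < d i) ->
  (forall i j, map_mx Im (siegel_act M tau) i j = gram d U i j) ->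
  forall o : 'I_g, o.+1 = g -> d o <= Lam.
Proof.
move=> g0 Ht; have [symt pY] := Ht; have symY := Im_sym symt.
set Y := map_mx Im tau in pY symY; pose X := map_mx Re tau.
have uY := posdef_unit symY pY; pose Yi := invmx Y.
have symYi : Yi^T = Yi by rewrite /Yi trmx_inv symY.
have pYi : posdef Yi by exact: posdef_inv.
have [l1 l10 l1P] := posdef_int_lower symY pY.
have [l2 l20 l2P] := posdef_int_lower symYi pYi.
exists ((Num.min l1 l2)^-1) => M d U SM UU d0 YE o og.
have [_ E] := sp_Im SM Ht; set Y' := map_mx Im (siegel_act M tau) in YE E.
set N := den_mx M tau in E.
have symY' : Y'^T = Y' by apply: Im_sym; exact: (siegel_act_space SM Ht).1.
pose c : 'rV[int]_g := row o (dlsubmx M); pose e : 'rV[int]_g := row o (drsubmx M).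
pose r : 'rV[C]_g := row o N.
have rE : r = mc c *m tau + mc e.
  by rewrite /r /N /den_mx linearD /= row_mul !map_row.
have rdef : r = row o N by [].
clearbody r.
pose s := qform Yi (map_mx Re r^T) + qform Yi (map_mx Im r^T).
have herm : r *m rc Yi *m (cj r)^T = s%:C%:M.
  rewrite [LHS]mx11_scalar; congr (_%:M); rewrite -(hermitian_form r^T symYi) trmxK.
  by congr ((_ *m _) 0 0); apply/matrixP => i j; rewrite !mxE.
have Rer : map_mx Re r^T = (mr c *m X + mr e)^T.
  rewrite rE; apply/matrixP => i j; rewrite !mxE cReD cRe_int cRe_sum; congr (_ + _).
  by apply: eq_bigr => k _; rewrite !mxE cReMi.
have Imr : map_mx Im r^T = (mr c *m Y)^T.
  rewrite rE; apply/matrixP => i j; rewrite !mxE cImD cIm_int addr0 cIm_sum.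
  by apply: eq_bigr => k _; rewrite !mxE cImMi.
have ImQ : qform Yi (map_mx Im r^T) = qform Y (mr c^T).
  rewrite Imr trmx_mul symY -qform_conj symY /Yi mulmxV // mul1mx.
  by congr qform; apply/matrixP => i j; rewrite !mxE.
(* With [r = c tau + e], the imaginary part of [r] contributes the value of [Im tau] at [c]; if
   [c = 0], then [r = e] is nonzero because [M] is invertible. *)
have lams : Num.min l1 l2 <= s.
  have [cz|cn] := eqVneq c 0; last first.
    have : l1 <= qform Y (mr c^T).
      apply: l1P; apply: contra_neq cn => cT0; by rewrite -[c]trmxK cT0 trmx0.
    have := posdef_ge0 (map_mx Re r^T) pYi; rewrite /s ImQ.
    have : Num.min l1 l2 <= l1 by rewrite ge_min lexx.
    lra.
  have en : e != 0.
    apply/eqP => e0; have := SM.1; rewrite unitmxE (expand_det_row _ (rshift g o)) big1 ?unitr0 // => j _.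
    suff -> : M (rshift g o) j = 0 by rewrite mul0r.
    have /rowP cz' := cz; have /rowP ez' := e0.
    case: (fintype.splitP j) => k jk.
      have -> : j = lshift g k by exact: val_inj.
      by have := cz' k; rewrite !mxE.
    have -> : j = rshift g k by exact: val_inj.
    by have := ez' k; rewrite !mxE.
  have : l2 <= qform Yi (mr e^T).
    apply: l2P; apply: contra_neq en => eT0; by rewrite -[e]trmxK eT0 trmx0.
  have -> : mr e^T = map_mx Re r^T.
    rewrite Rer cz; apply/matrixP => i j; rewrite !mxE big1 ?add0r // => k _.
    by rewrite !mxE mul0r.
  have := posdef_ge0 (map_mx Im r^T) pYi; rewrite /s.
  have : Num.min l1 l2 <= l2 by rewrite ge_min lexx orbT.
  lra.
have m0 : 0 < Num.min l1 l2 by rewrite lt_min l10.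
have s0 : 0 < s by apply: lt_le_trans lams.
have sn : s%:C != 0 by rewrite fmorph_eq0 gt_eqF.
pose w : 'cV[C]_g := s%:C^-1 *: (rc Yi *m (cj r)^T).
have rw : r *m w = 1%:M.
  by rewrite /w -scalemxAr mulmxA herm scale_scalar_mx mulVf.
have rcYi : (rc Yi)^T = rc Yi by apply/matrixP => i j; rewrite !mxE -[in LHS]symYi mxE.
have hw : (w^T *m rc Y *m cj w) 0 0 = s%:C^-1.
  have wE : rc Y *m cj w = s%:C^-1 *: r^T.
    have -> : cj w = s%:C^-1 *: (rc Yi *m r^T).
      have c1 : conjc (s%:C^-1) = s%:C^-1 by rewrite -fmorphV conjc_real.
      have c2 : cj (rc Yi) = rc Yi.
        by apply/matrixP => i j; rewrite !mxE; apply: complex_ext; rewrite /= ?oppr0.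
      have c3 : cj ((cj r)^T) = r^T by apply/matrixP => i j; rewrite !mxE conjcK.
      have -> : cj w = conjc (s%:C^-1) *: cj (rc Yi *m (cj r)^T).
        by apply/matrixP => i j; rewrite mxE [in RHS]mxE [(cj (_ *m _)) i j]mxE -rmorphM mxE.
      by rewrite c1 map_mxM c2 c3.
    have YYi : Y *m Yi = 1%:M by exact: mulmxV.
    by rewrite -scalemxAr mulmxA -map_mxM YYi map_mx1 mul1mx.
  rewrite -mulmxA wE -scalemxAr mxE -[w^T *m r^T]trmx_mul rw trmx1 mxE mulr1 //.
pose x : 'cV[C]_g := N *m w.
have xo : x o 0 = 1.
  have -> : x o 0 = (r *m w) 0 0 by rewrite rdef -row_mul [in RHS]mxE.
  by rewrite rw mxE.
have hx : qform Y' (map_mx Re x) + qform Y' (map_mx Im x) = s^-1.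
  have := hermitian_form x symY'; rewrite /x map_mxM trmx_mul !mulmxA.
  rewrite -[w^T *m _ *m _ *m cj N]mulmxA -[w^T *m _ *m _]mulmxA [N^T *m _]mulmxA E hw.
  by move=> /(congr1 Re); rewrite -fmorphV /= => <-.
have pY' : posdef Y' by exact: (siegel_act_space SM Ht).2.
have h1 := posdef_ge0 (map_mx Im x) pY'.
have h2 : d o <= qform Y' (map_mx Re x).
  rewrite (@qform_squares _ _ Y' U d g) => [|i j _ _|i]; [|exact: YE|by rewrite ltnNge (ltnW (ltn_ord i))].
  apply: le_trans (squares_pos (k := o) UU d0 _).
    by rewrite mxE xo /= expr1n mulr1.
  by move=> j oj; have := ltn_ord j; rewrite -{2}og ltnS leqNgt oj.
apply: le_trans (_ : s^-1 <= _); first lra.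
by rewrite lef_pV2 ?posrE.
Qed.

Lemma round_half (x : R) : exists k : int, `|x + k%:~R| <= 2^-1.
Proof.
exists (- Num.floor (x + 2^-1)); have /andP[h1 h2] := floor_itv (x + 2^-1).
by rewrite intrD mulr1z in h2; rewrite rmorphN /= ler_norml; lra.
Qed.

Section Embedding.
Variables (T : Type) (F : 'M[C]_g -> T).
Hypothesis Forb : forall tau tau', siegel_space tau -> siegel_space tau' ->
  (F tau = F tau' <-> same_orbit tau tau').

Lemma orbit_move M tau : SpZ M -> siegel_space tau ->
  siegel_space (siegel_act M tau) /\ F (siegel_act M tau) = F tau.
Proof.
move=> SM Ht; have H' := siegel_act_space SM Ht; split=> //.
by apply/esym/Forb => //; exists M.
Qed.

Lemma hermite_move tau : siegel_space tau -> exists tau' (d : 'I_g -> R) (U : 'M[R]_g),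
  [/\ siegel_space tau', F tau' = F tau, upper_unipotent U, (forall i, 0 < d i) &
      forall i j, `|U i j| <= 1] /\
  [/\ (forall i k : 'I_g, (i < k)%N -> d i <= 2 ^+ g * d k),
      (forall i j, map_mx Im tau' i j = gram d U i j) &
      \det (map_mx Im tau') = \det (map_mx Im tau)].
Proof.
move=> Ht; have [symt pY] := Ht; have symY := Im_sym symt.
have [A [d [U [[uA UU Ub d0 dr] E]]]] := hermite_reduction symY pY.
have uAT : A^T \in unitmx by rewrite unitmx_tr.
have [M SM [actE denE]] := GL_move tau uAT.
have [H' F'] := orbit_move SM Ht.
exists (siegel_act M tau), (fun i => d 0 i), U.
have ImE : map_mx Im (siegel_act M tau) = (mr A)^T *m map_mx Im tau *m mr A.
  rewrite actE; apply/matrixP => i j; rewrite !mxE cIm_sum; apply: eq_bigr => k _.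
  rewrite !mxE mulrC cImMi mulrC; congr (_ * _).
  by rewrite cIm_sum; apply: eq_bigr => l _; rewrite !mxE cImMi.
split; split=> //.
- move=> i j; have [->|ij] := eqVneq i j; first by rewrite UU.1 normr1.
  by apply: le_trans (Ub i j ij) _; rewrite invf_le1 // ler1n.
- move=> i k ik; apply: le_trans (dr i k (ltnW ik)) _; rewrite ler_pM2r //.
  by apply: ler_weXn2l; [rewrite ler1n|apply: leq_trans (leq_subr _ _) (ltnW (ltn_ord k))].
- move=> i j; rewrite ImE E mxE; apply: eq_bigr => l _.
  by rewrite mul_mx_diag !mxE; ring.
rewrite ImE !det_mulmx det_tr det_map_mx mulrAC -rmorphM.
have -> : \det A * \det A = 1.
  move: uA; rewrite unitmxE => /unitrP[y [h _]].
  have : (`|y| * `|\det A| = 1)%N by rewrite -abszM h.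
  move=> /eqP; rewrite muln_eq1 => /andP[_ /eqP]; move: (\det A) => x; nia.
by rewrite mul1r.
Qed.

(** After Hermite reduction every pivot is at most [2^g] times the last one, which is bounded on the
    orbit; the determinant is their product. *)
Lemma det_bounded tau : (0 < g)%N -> siegel_space tau ->
  exists D : R, forall tau', siegel_space tau' -> F tau' = F tau ->
    \det (map_mx Im tau') <= D.
Proof.
move=> g0 Ht; have [Lam LP] := orbit_pivot_bound g0 Ht.
exists ((2 ^+ g * Lam) ^+ g) => t1 H1 F1.
have [t2 [d [U [[H2 F2 UU d0 _] [dr YE <-]]]]] := hermite_move H1.
have [M SM t2E] : same_orbit tau t2 by apply/Forb => //; rewrite F2.
have go : (g.-1 < g)%N by rewrite prednK.
pose q := Ordinal go.
have dq : d q <= Lam.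
  by apply: (LP M d U SM UU d0) => [i j|]; rewrite -?t2E ?YE //= prednK.
have -> : (2 ^+ g * Lam) ^+ g = \prod_(i < g) (2 ^+ g * Lam) by rewrite prodr_const card_ord.
rewrite (det_gram UU YE); apply: ler_prod => i _.
rewrite (ltW (d0 i)) /=.
have p1 : 1 <= 2 ^+ g :> R by rewrite exprn_ege1 // ler1n.
have := d0 q; have [iq|iq|/val_inj ->] := ltngtP i q.
- by have := dr i q iq; nra.
- by move: iq; rewrite /= -ltnS prednK // ltnNge ltn_ord.
by nra.
Qed.

(** A point with [det (Im tau)] nearly maximal on its orbit is taken; Hermite reduction and integer
    translation keep the determinant, and the inversion cannot enlarge it much, which bounds the
    first pivot below. *)
Lemma orbit_reduced tau : (0 < g)%N -> siegel_space tau ->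
  exists tau', [/\ siegel_space tau', F tau' = F tau,
    (forall i j, `|Re (tau' i j)| < 1) & siegel_form (2 ^+ g) (4 / 5) (map_mx Im tau')].
Proof.
move=> g0 Ht; have [D DP] := det_bounded g0 Ht.
pose S := [set x : R | exists t, [/\ siegel_space t, F t = F tau & x = \det (map_mx Im t)]].
have hS : has_sup S.
  by split; [exists (\det (map_mx Im tau)), tau|exists D => _ [t [H1 H2 ->]]; exact: DP].
have up t : siegel_space t -> F t = F tau -> \det (map_mx Im t) <= sup S.
  by move=> h1 h2; apply: sup_upper_bound => //; exists t.
have S0 : 0 < sup S.
  apply: lt_le_trans (up tau Ht erefl); apply: posdef_det_gt0; [exact: Im_sym Ht.1|exact: Ht.2].
(* Within one tenth of the supremum: then [|tau_00|^2 >= 9/10], and [|Re| <= 1/2] leaves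
   [Im^2 >= 9/10 - 1/4], above [(4/5)^2]. *)
have S10 : 0 < sup S / 10 by rewrite divr_gt0.
have [_ [t1 [H1 F1 ->]] big] := sup_adherent S10 hS.
have [t2 [d [U [[H2 F2 UU d0 Ub] [dr YE detE]]]]] := hermite_move H1.
have /choice[b bP] (ij : 'I_g * 'I_g) : exists k : int, `|Re (t2 ij.1 ij.2) + k%:~R| <= 2^-1.
  exact: round_half.
pose B : 'M[int]_g := \matrix_(i, j) (if (i <= j)%N then b (i, j) else b (j, i)).
have symB : B^T = B.
  by apply/matrixP => i j; rewrite !mxE; case: ltngtP => // /val_inj ->.
have t2s i j : t2 i j = t2 j i by rewrite -{1}H2.1 mxE.
have [M SM [actE _]] := translation_move t2 symB; have [H3 F3] := orbit_move SM H2.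
pose t3 := t2 + mc B; rewrite actE -/t3 in H3 F3.
have Re3 i j : `|Re (t3 i j)| <= 2^-1.
  rewrite !mxE cReD cRe_int; case: ifP => _; first exact: (bP (i, j)).
  by rewrite t2s; exact: (bP (j, i)).
have Im3 : map_mx Im t3 = map_mx Im t2.
  by apply/matrixP => i j; rewrite !mxE cImD cIm_int addr0.
exists t3; split=> //; first by rewrite F3 F2.
  by move=> i j; apply: le_lt_trans (Re3 i j) _; rewrite invf_lt1 // ltr1n.
have p1 : 1 <= 2 ^+ g :> R by rewrite exprn_ege1 // ler1n.
exists d, U; split; first by split=> // i j; apply: le_trans (Ub i j) _.
split; last by move=> i j; rewrite Im3 YE.
move=> o o0.
have [M' SM' detN] := inversion_move R o0; have [H4 F4] := orbit_move SM' H3.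
have := det_Im SM' H3; rewrite detN Im3 detE => dd.
have h4 : \det (map_mx Im (siegel_act M' t3)) <= sup S by apply: up; rewrite // F4 F3 F2.
have d4 : 0 < \det (map_mx Im (siegel_act M' t3)).
  by apply: posdef_det_gt0; [exact: Im_sym H4.1|exact: H4.2].
have n9 : 9 / 10 <= nm (t3 o o) ^+ 2 by nra.
have yo : Im (t3 o o) = d o.
  have := YE o o; rewrite -Im3 mxE => ->; rewrite gram_diag (bigD1 o) //= UU.1 expr1n mulr1.
  by rewrite big1 ?addr0 // => l lo; rewrite UU.2 ?expr0n ?mulr0 // o0 lt0n -o0.
have := Re3 o o; rewrite nm_sqr yo ler_norml in n9 * => /andP[r1 r2].
have := d0 o; nra.
Qed.

End Embedding.

(** The first pivot is [Im tau_00]. The inversion gives [|tau_00| >= 1], and [|Re| <= 1/2] leaves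
    [Im^2 >= 3/4], above [(4/5)^2]. *)
Lemma fundamental_reduced : exists2 K : R, 1 <= K & forall tau, siegel_fundamental_set tau ->
  [/\ siegel_space tau, (forall i j, `|Re (tau i j)| < 1) &
      siegel_form K (4 / 5) (map_mx Im tau)].
Proof.
have [K K1 KP] := siegel_bounds R g; exists K => // tau [symt mink re den].
have pY := minkowski_posdef mink; have symY := Im_sym symt.
have Ht : siegel_space tau by split.
have [d [U [UU d0 YE]]] := posdef_completion symY pY.
have MII : minkowski_II d U g.
  move=> k a _ ak a1; have [_ _ II _] := mink; have := II k a a1.
  rewrite -[X in _ <= X]/(qform (map_mx Im tau) (mr a)) (@qform_lin _ _ _ U d g) //.
  rewrite YE; apply: le_trans; rewrite le_eqVlt; apply/orP; left; apply/eqP.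
  by apply: eq_bigr => l _; rewrite -mulrA -expr2.
have [rat Ub] := KP d U UU d0 MII.
split=> //; first by move=> i j; apply: le_lt_trans (re i j) _; rewrite invf_lt1 // ltr1n.
exists d, U; split=> //; split=> // o o0.
have [M SM detN] := inversion_move R o0.
have n1 : 1 <= nm (tau o o).
  by have := den M SM; rewrite detN normE -[1]/(1%:C) lecR.
have yo : Im (tau o o) = d o.
  have := YE o o; rewrite mxE => ->; rewrite (bigD1 o) //= UU.1 !mulr1.
  by rewrite big1 ?addr0 // => l lo; rewrite UU.2 ?mulr0 // o0 lt0n -o0.
have n2 : 1 <= nm (tau o o) ^+ 2 by rewrite exprn_ege1.
have := re o o; rewrite nm_sqr yo ler_norml in n2 * => /andP[r1 r2].
have := d0 o; nra.
Qed.

End OrbitReduction.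

(** * Neighbourhoods and compact rectangles in the complex plane *)

Section ComplexTopology.
Variable R : realType.
Local Notation C := R[i].
Local Notation Re := (@complex.Re R).
Local Notation Im := (@complex.Im R).

Lemma nbhs_nm (z : C) (P : set C) :
  nbhs z P <-> exists2 e : R, 0 < e & forall w, nm (z - w) < e -> P w.
Proof.
split=> [/nbhs_ballP[_ /= /gt0_complexP[e e0 ->] H]|[e e0 H]].
  by exists e => // w zw; apply: H; rewrite -ball_normE /ball_ /= nm_lt_norm.
apply/nbhs_ballP; exists e%:C => /=; first by rewrite ltcR.
by move=> w; rewrite -ball_normE /ball_ /= nm_lt_norm => /H.
Qed.

Lemma nbhs_nm_rV n (v : 'rV[C]_n) (P : set 'rV[C]_n) :
  nbhs v P <-> exists2 e : R, 0 < e & forall w : 'rV[C]_n, (forall k, nm (v 0 k - w 0 k) < e) -> P w.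
Proof.
split=> [/nbhs_ballP[_ /= /gt0_complexP[e e0 ->] H]|[e e0 H]].
  exists e => // w zw; apply: H; split=> [|i j]; first by rewrite ltcR.
  by rewrite !ord1 -ball_normE /ball_ /= nm_lt_norm.
apply/nbhs_ballP; exists e%:C => /=; first by rewrite ltcR.
move=> w [_ vw]; apply: H => k; have := vw 0 k.
by rewrite -ball_normE /ball_ /= nm_lt_norm.
Qed.

Lemma nbhs_real (x : R) (P : set R) :
  nbhs x P <-> exists2 e : R, 0 < e & forall y, `|x - y| < e -> P y.
Proof.
split=> [/nbhs_ballP[e /= e0 H]|[e e0 H]].
  by exists e => // y xy; apply: H; rewrite -ball_normE.
by apply/nbhs_ballP; exists e => //= y; rewrite -ball_normE => /H.
Qed.

Lemma nm_exp_unit (z : C) (k : int) : nm z = 1 -> nm (z ^ k) = 1.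
Proof.
case: k => m z1; first by rewrite -exprnP nmX z1 expr1n.
by change (nm ((z ^+ m.+1)^-1) = 1); rewrite nmV nmX z1 expr1n invr1.
Qed.

Lemma continuous_nm : continuous (@nm R).
Proof.
move=> z P /nbhs_real[e e0 H]; apply/nbhs_nm; exists e => // w zw; apply: H; move: zw.
by apply: le_lt_trans; rewrite ler_norml; have := le_nmB z w; have := le_nmB w z; rewrite [nm (w - z)]nmBC; lra.
Qed.

Lemma continuous_Re : continuous Re.
Proof.
move=> z P /nbhs_real[e e0 H]; apply/nbhs_nm; exists e => // w zw; apply: H; move: zw.
by apply: le_lt_trans; rewrite -cReB nm_Re.
Qed.

Lemma continuous_Im : continuous Im.
Proof.
move=> z P /nbhs_real[e e0 H]; apply/nbhs_nm; exists e => // w zw; apply: H; move: zw.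
by apply: le_lt_trans; rewrite -cImB nm_Im.
Qed.

Lemma compact_rectangle (a b c d : R) :
  compact [set z : C | a <= Re z <= b /\ c <= Im z <= d].
Proof.
have -> : [set z : C | a <= Re z <= b /\ c <= Im z <= d] =
    (fun p : R * R => p.1 +i* p.2) @` (`[a, b] `*` `[c, d]).
  apply/seteqP; split=> [[x y] /= [h1 h2]|_ [[x y] [/= h1 h2] <-]].
    by exists (x, y) => //; split; rewrite /= in_itv.
  by move: h1 h2; rewrite !in_itv /=.
apply: continuous_compact; last by apply: compact_setX; exact: segment_compact.
apply: continuous_subspaceT => -[x y] P /nbhs_nm[e e0 H].
have e2 : 0 < e / 2 by rewrite divr_gt0.
exists (ball x (e / 2), ball y (e / 2)); first by split; exact: nbhsx_ballx.
move=> [x' y'] [/=]; rewrite -!ball_normE /ball_ /= => h1 h2; apply: H.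
by apply: le_lt_trans (nm_le_ReIm _) _; rewrite cReB cImB /=; lra.
Qed.

End ComplexTopology.

(** * Fourier coefficients of Siegel modular forms and Koecher's principle *)

Section SiegelFourier.
Variables (R : realType) (g : nat).
Local Notation C := R[i].
Local Notation Re := (@complex.Re R).
Local Notation Im := (@complex.Im R).
Local Notation mc := (map_mx (intr : int -> C)).
Local Notation mr := (map_mx (intr : int -> R)).
Local Notation rc := (map_mx (real_complex R)).
Local Notation n := (sym_dim g).

Definition coords (T : Type) (A : 'M[T]_g) : 'rV[T]_n :=
  \row_k A (val (enum_val k)).1 (val (enum_val k)).2.

Lemma coordsK (T : Type) (v : 'rV[T]_n) : coords (sym_mx v) = v.
Proof.
apply/rowP => k; rewrite !mxE; congr (v 0 _); rewrite -[RHS]enum_valK; congr enum_rank.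
by apply: val_inj => /=; have := valP (enum_val k) => /= ->; case: (val _).
Qed.

Lemma sym_mxK (T : Type) (A : 'M[T]_g) : A^T = A -> sym_mx (coords A) = A.
Proof. by move=> /sym_mx_onto[v ->]; rewrite coordsK. Qed.

Lemma sym_mx_map (T U : Type) (f : T -> U) (v : 'rV[T]_n) : sym_mx (map_mx f v) = map_mx f (sym_mx v).
Proof. by apply/matrixP => i j; rewrite !mxE. Qed.

Lemma sym_mxD (V : nmodType) (v w : 'rV[V]_n) : sym_mx (v + w) = sym_mx v + sym_mx w.
Proof. by apply/matrixP => i j; rewrite !mxE. Qed.

Lemma sym_mxZ (T : pzRingType) (c : T) (v : 'rV[T]_n) : sym_mx (c *: v) = c *: sym_mx v.
Proof. by apply/matrixP => i j; rewrite !mxE. Qed.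

Definition Om (Y : 'rV[R]_n) : Prop := posdef (sym_mx Y).

Lemma Om_space (v : 'rV[C]_n) : Om (imv v) <-> siegel_space (sym_mx v).
Proof.
rewrite /Om /imv sym_mx_map; split=> [h|[]//]; split=> //; exact: tr_sym_mx.
Qed.

(** In the coordinates [y = U x] the form is at least [m t^2], with [t] the largest [|y_l|], and a
    perturbation by [eps] changes it by at most [eps (a t)^2]. *)
Lemma posdef_open (Y : 'M[R]_g) : Y^T = Y -> posdef Y -> exists2 eps : R, 0 < eps &
  forall Y' : 'M[R]_g, (forall i j, `|Y' i j - Y i j| <= eps) -> posdef Y'.
Proof.
move=> symY pY; have [d [U [UU d0 YE]]] := posdef_completion symY pY.
have [m m0 mP] := fin_lower d0.
have uU : U \in unitmx by rewrite unitmxE det_upper_unipotent // unitr1.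
pose V := invmx U; pose a := \sum_i \sum_l `|V i l|.
have a0 : 0 <= a by rewrite sumr_ge0 // => i _; rewrite sumr_ge0.
pose eps := m / (2 * (a ^+ 2 + 1)).
have a2 : 0 <= a ^+ 2 by exact: sqr_ge0.
have e0 : 0 < eps by rewrite divr_gt0 //; lra.
have ea : eps * a ^+ 2 < m.
  have : eps * (2 * (a ^+ 2 + 1)) = m by rewrite divfK // gt_eqF //; lra.
  nra.
exists eps => // Y' YY' x xn.
pose y := U *m x; have xE : x = V *m y by rewrite /y /V mulKmx.
have [k0 _] := top_coord xn.
case: (@arg_maxP _ _ _ k0 xpredT (fun l => `|y l 0|) isT) => l0 _ l0P.
set t := `|y l0 0| in l0P.
have t0 : 0 < t.
  rewrite lt_def normr_ge0 andbT; apply: contraNneq xn => tz; rewrite xE.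
  suff -> : y = 0 by rewrite mulmx0.
  apply/colP => l; rewrite [RHS]mxE; apply/eqP; rewrite -normr_le0 -tz; exact: l0P.
have xa i : `|x i 0| <= (\sum_l `|V i l|) * t.
  rewrite xE mxE; apply: le_trans (ler_norm_sum _ _ _) _; rewrite mulr_suml.
  by apply: ler_sum => l _; rewrite normrM; apply: ler_wpM2l => //; exact: l0P.
have Q : m * t ^+ 2 <= qform Y x.
  rewrite (@qform_squares _ _ Y U d g x) => [|i j _ _|i]; [|exact: YE|by rewrite ltnNge (ltnW (ltn_ord i))].
  have -> : \sum_l d l * (\sum_j U l j * x j 0) ^+ 2 = \sum_l d l * y l 0 ^+ 2.
    by apply: eq_bigr => l _; rewrite /y mxE.
  rewrite (bigD1 l0) //=; apply: ler_wpDr.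
    by rewrite sumr_ge0 // => l _; rewrite mulr_ge0 ?sqr_ge0 // ltW.
  by rewrite /t -normrX ger0_norm ?sqr_ge0 // ler_wpM2r ?sqr_ge0.
have Dq : `|qform Y' x - qform Y x| <= eps * (a * t) ^+ 2.
  rewrite !qformE -sumrB; apply: le_trans (ler_norm_sum _ _ _) _.
  apply: le_trans (_ : \sum_i \sum_j eps * (`|x i 0| * `|x j 0|) <= _).
    apply: ler_sum => i _; rewrite -sumrB; apply: le_trans (ler_norm_sum _ _ _) _.
    apply: ler_sum => j _; rewrite -mulrBl -mulrBr !normrM.
    rewrite mulrAC [leLHS]mulrC; apply: ler_wpM2r; [by rewrite mulr_ge0|exact: YY'].
  rewrite (eq_bigr (fun i => eps * (`|x i 0| * \sum_j `|x j 0|))); last first.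
    by move=> i _; rewrite !mulr_sumr.
  rewrite -mulr_sumr -mulr_suml ler_pM2l // expr2.
  have xs : \sum_i `|x i 0| <= a * t by rewrite /a mulr_suml; apply: ler_sum => i _; exact: xa.
  by rewrite ler_pM // sumr_ge0.
move: Dq; rewrite ler_norml => /andP[h1 h2].
have t2 : 0 < t ^+ 2 by rewrite exprn_gt0.
move=> _; change (0 < qform Y' x); rewrite exprMn in h1; nra.
Qed.

Lemma Om_open Y : Om Y -> exists2 eps : R, 0 < eps &
  forall Y' : 'rV[R]_n, (forall k, `|Y' 0 k - Y 0 k| <= eps) -> Om Y'.
Proof.
move=> OY; have [eps e0 H] := posdef_open (tr_sym_mx Y) OY; exists eps => // Y' YY'.
by apply: H => i j; rewrite !mxE.
Qed.

Lemma qformD (A B : 'M[R]_g) x : qform (A + B) x = qform A x + qform B x.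
Proof. by rewrite /qform mulmxDr mulmxDl mxE. Qed.

Lemma qformZl (A : 'M[R]_g) c x : qform (c *: A) x = c * qform A x.
Proof. by rewrite /qform -scalemxAr -scalemxAl mxE. Qed.

Lemma Om_conv Y Y' (t : R) : Om Y -> Om Y' -> 0 <= t <= 1 -> Om ((1 - t) *: Y + t *: Y').
Proof.
move=> O1 O2 /andP[t0 t1] x xn; rewrite sym_mxD !sym_mxZ.
change (0 < qform ((1 - t) *: sym_mx Y + t *: sym_mx Y') x); rewrite qformD !qformZl.
have h1 : 0 < qform (sym_mx Y) x := O1 x xn.
have h2 : 0 < qform (sym_mx Y') x := O2 x xn.
by nra.
Qed.

Variables (k : int) (phi : 'M[C]_g -> C).
Hypothesis phi_mod : modular_form k phi.

(** Extension by 0 off the tube, so that periodicity holds at every point, as the Fourier expansion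
    asks. *)
Definition tubefun (v : 'rV[C]_n) : C := if `[< Om (imv v) >] then phi (sym_mx v) else 0.

Lemma tubefunE v : Om (imv v) -> tubefun v = phi (sym_mx v).
Proof. by move=> O; rewrite /tubefun asboolT. Qed.

Lemma tubefun_int v (a : 'rV[int]_n) : tubefun (v + map_mx intr a) = tubefun v.
Proof.
have imE : imv (v + map_mx intr a) = imv v.
  by apply/rowP => l; rewrite !mxE cImD cIm_int addr0.
rewrite /tubefun imE; case: asboolP => // /Om_space H.
have [M SM [actE denE]] := translation_move (sym_mx v) (tr_sym_mx a).
by rewrite sym_mxD sym_mx_map -actE (phi_mod.2 _ _ SM H) denE det1 exp1rz mul1r.
Qed.

Lemma tubefun_per v l : tubefun (v + ev_ R l) = tubefun v.
Proof.
have -> : ev_ R l = map_mx intr (delta_mx 0 l : 'rV[int]_n) by rewrite map_delta_mx.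
exact: tubefun_int.
Qed.

Lemma imv_near (v : 'rV[C]_n) : Om (imv v) -> exists2 e : R, 0 < e &
  forall w : 'rV[C]_n, (forall l, nm (v 0 l - w 0 l) < e) -> Om (imv w).
Proof.
move=> /Om_open[e e0 H]; exists e => // w vw; apply: H => l; rewrite !mxE -cImB.
by apply: le_trans (nm_Im _) _; rewrite nmBC ltW.
Qed.

Lemma tubefun_dif v l (u : C) : Om (imv (v + u *: ev_ R l)) ->
  differentiable (fun u : C => tubefun (v + u *: ev_ R l)) u.
Proof.
move=> O; pose f := phi \o @sym_mx g C.
have df : differentiable f (v + u *: ev_ R l) by apply: phi_mod.1; apply/Om_space.
have dl : differentiable (fun u : C => f (v + u *: ev_ R l)) u.
  apply/derivable1_diffP; have /cvg_ex[d D] := @diff_derivable _ _ _ f _ (ev_ R l) df.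
  apply/cvg_ex; exists d; apply: cvg_trans D; apply: near_eq_cvg; apply: nearW => h /=.
  congr (_ *: (f _ - _)); rewrite scalerDl addrCA; congr (_ + (_ *: _ + _)).
  by rewrite /GRing.scale /= mulr1.
have [d dP] := differentiable_nm dl.
have [e1 e10 H1] := imv_near O.
apply: (@nm_differentiable _ _ _ d) => eps /dP[del d0 H].
exists (Num.min del e1) => [|w]; first by rewrite lt_min d0.
rewrite lt_min => /andP[w1 w2].
suff Ow : Om (imv (v + (u + w) *: ev_ R l)) by rewrite (tubefunE Ow) (tubefunE O); exact: H.
apply: H1 => j; rewrite !mxE; set c : C := _%:R.
have -> : v 0 j + u * c - (v 0 j + (u + w) * c) = - (w * c) by ring.
by rewrite nmN nmM /c nm_nat; case: (_ && _); rewrite /= ?mulr1 ?mulr0.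
Qed.

(** Integer translations bring the real parts into [[0, 1]], and the remaining box is compact. *)
Lemma tubefun_bnd Y : Om Y -> exists eps M : R, 0 < eps /\
  forall v : 'rV[C]_n, (forall l, `|Im (v 0 l) - Y 0 l| <= eps) ->
    Om (imv v) /\ nm (tubefun v) <= M.
Proof.
move=> /Om_open[eps e0 H]; pose f := phi \o @sym_mx g C.
pose K := [set v : 'rV[C]_n | forall l, [set z : C | 0 <= Re z <= 1 /\
  Y 0 l - eps <= Im z <= Y 0 l + eps] (v 0 l)].
have KO v : K v -> Om (imv v).
  move=> Kv; apply: H => l; rewrite mxE; have [_] := Kv l.
  by rewrite ler_norml => /andP[h1 h2]; lra.
have cK : compact K.
  apply: (@rV_compact C n (fun l => [set z : C | 0 <= Re z <= 1 /\
    Y 0 l - eps <= Im z <= Y 0 l + eps])) => l; exact: compact_rectangle.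
have [|||c _ cP] := @compact_EVT_max _ R (fun v => nm (f v)) K.
- exists (\row_l (0 +i* Y 0 l)) => l; rewrite !mxE /=; split; first by rewrite lexx ler01.
  by lra.
- exact: cK.
- apply: continuous_in_subspaceT => v; rewrite inE => /KO/Om_space Hv.
  have := differentiable_continuous (phi_mod.1 v Hv) => cf.
  exact: (continuous_comp cf (@continuous_nm R _)).
exists eps, (nm (f c)); split=> // v vY.
have Ov : Om (imv v) by apply: H => l; rewrite mxE.
split=> //.
pose a : 'rV[int]_n := \row_l - Num.floor (Re (v 0 l)).
rewrite -(tubefun_int v a) tubefunE; last first.
  rewrite (_ : imv _ = imv v) //; apply/rowP => l; by rewrite !mxE cImD cIm_int addr0.
apply: cP; rewrite inE => l; rewrite !mxE; split.
  rewrite cReD cRe_int rmorphN /=; have /andP[h1 h2] := floor_itv (Re (v 0 l)).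
  by rewrite intrD mulr1z in h2; lra.
by rewrite cImD cIm_int addr0; have := vY l; rewrite ler_norml => /andP[h1 h2]; lra.
Qed.

Definition base_pt : 'rV[C]_n := coords (0 +i* 1)%:M.

Lemma imv_base : imv base_pt = coords 1%:M.
Proof. by apply/rowP => l; rewrite !mxE; case: eqP. Qed.

Lemma posdef1 : posdef (1%:M : 'M[R]_g).
Proof.
apply: (@gram_posdef _ _ _ 1%:M (fun=> 1)) => [|i|i j]; last 1 first.
- rewrite (bigD1 i) //= mul1r !mxE eqxx mul1r big1 ?addr0 // => l li.
  by rewrite !mxE (negbTE li) mul1r mul0r.
- split=> [i|i j ji]; rewrite mxE ?eqxx //; case: eqP => // ij; by rewrite ij ltnn in ji.
exact: ltr01.
Qed.

Lemma Om_base : Om (imv base_pt).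
Proof. by rewrite /Om imv_base sym_mxK ?trmx1 //; exact: posdef1. Qed.

(** The pairing of [T] with the symmetric matrix [b b^T]: the value at [b] of the integral quadratic
    form with coefficients [T]. *)
Definition qT (T : 'rV[int]_n) (b : 'cV[int]_g) : int :=
  \sum_l T 0 l * (b (val (enum_val l)).1 0 * b (val (enum_val l)).2 0).

Lemma dotR_rank1 T b : dotR T (coords (mr b *m (mr b)^T)) = (qT T b)%:~R.
Proof.
rewrite /dotR /qT rmorph_sum; apply: eq_bigr => l _; rewrite !mxE big_ord1 !mxE.
by rewrite !rmorphM.
Qed.

Lemma coordsD (A B : 'M[R]_g) : coords (A + B) = coords A + coords B.
Proof. by apply/rowP => l; rewrite !mxE. Qed.

Lemma coordsZ c (A : 'M[R]_g) : coords (c *: A) = c *: coords A.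
Proof. by apply/rowP => l; rewrite !mxE. Qed.

Lemma dotRD T (y y' : 'rV[R]_n) : dotR T (y + y') = dotR T y + dotR T y'.
Proof. by rewrite /dotR -big_split; apply: eq_bigr => l _; rewrite mxE mulrDr. Qed.

Lemma dotRZ T c (y : 'rV[R]_n) : dotR T (c *: y) = c * dotR T y.
Proof. by rewrite /dotR mulr_sumr; apply: eq_bigr => l _; rewrite mxE mulrCA. Qed.

Definition scoef T : C := fcoef tubefun base_pt T.

(** The coefficient can be read at height [A A^T], which [A^-1] carries to the identity; the
    automorphy factor has modulus 1, so one bound at the identity serves all [A]. *)
Lemma unimodular_bound T : exists2 B : R, 0 <= B & forall A : 'M[int]_g, A \in unitmx ->
  nm (scoef T) <= B * expR (2 * pi * dotR T (coords (mr A *m (mr A)^T))).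
Proof.
have [eps [B [e0 HB]]] := tubefun_bnd Om_base.
have B0 : 0 <= B.
  have [|_] := HB base_pt; first by move=> l; rewrite [imv _ 0 l]mxE subrr normr0 ltW.
  by apply: le_trans; exact: nm_ge0.
exists B => // A uA.
have uAR := unit_mr R uA.
pose v : 'rV[C]_n := coords ((0 +i* 1) *: rc (mr A *m (mr A)^T)).
have symAA : (mr A *m (mr A)^T)^T = mr A *m (mr A)^T by rewrite trmx_mul trmxK.
have iv : imv v = coords (mr A *m (mr A)^T).
  by apply/rowP => l; rewrite !mxE cImM /= mul0r add0r mul1r.
have Ov : Om (imv v).
  rewrite /Om iv sym_mxK //.
  have -> : mr A *m (mr A)^T = (mr A)^T^T *m 1%:M *m (mr A)^T by rewrite trmxK mulmx1.
  by apply: posdef_conj; [rewrite unitmx_tr|exact: posdef1].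
rewrite /scoef /fcoef -(mavg_const tubefun_per tubefun_dif tubefun_bnd Om_conv T Om_base Ov).
rewrite -iv; apply: (mlim_le tubefun_bnd) => // x.
have Ovx : Om (imv (v + rv x)) by rewrite imvD imv_rv addr0.

pose t := sym_mx (v + rv x); have Ht : siegel_space t by apply/Om_space.
have uAi : invmx A \in unitmx by rewrite unitmx_inv.
have [M SM [actE denE]] := GL_move t uAi.
have := phi_mod.2 M t SM Ht; rewrite denE actE invmxK det_map_mx det_tr => E.
have nE : nm (phi t) = nm (phi (mc (invmx A) *m t *m (mc (invmx A))^T)).
  rewrite E nmM; suff -> : nm (((\det A)%:~R : C) ^ k) = 1 by rewrite mul1r.
  have dA : `|\det A|%N = 1%N.
    move: uA; rewrite unitmxE => /unitrP[y [h _]].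
    have : (`|y| * `|\det A| = 1)%N by rewrite -abszM h.
    by move=> /eqP; rewrite muln_eq1 => /andP[_ /eqP].
  have nd : nm ((\det A)%:~R : C) = 1.
    have : \det A = 1 \/ \det A = -1 by move: (\det A) dA => z; lia.
    by case=> ->; [rewrite nm1|rewrite -[(-1)%:~R]/(-1 : C) nmN nm1].
  exact: nm_exp_unit.
rewrite tubefunE // nE.
have [w wE] : exists w : 'rV[C]_n, sym_mx w = mc (invmx A) *m t *m (mc (invmx A))^T.
  exists (coords (mc (invmx A) *m t *m (mc (invmx A))^T)); apply: sym_mxK.
  by rewrite !trmx_mul trmxK mulmxA Ht.1.
have Imw : map_mx Im (sym_mx w) = 1%:M.
  have Imt : map_mx Im t = mr A *m (mr A)^T.
    by rewrite /t -sym_mx_map -/(imv _) imvD imv_rv addr0 iv sym_mxK.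
  have -> : map_mx Im (sym_mx w) = mr (invmx A) *m map_mx Im t *m (mr (invmx A))^T.
    rewrite wE; apply/matrixP => i j; rewrite !mxE cIm_sum; apply: eq_bigr => p _.
    rewrite !mxE mulrC cImMi mulrC; congr (_ * _).
    by rewrite cIm_sum; apply: eq_bigr => q _; rewrite !mxE cImMi.
  rewrite Imt !mulmxA -map_mxM mulVmx // map_mx1 mul1mx -trmx_mul -map_mxM mulVmx //.
  by rewrite map_mx1 trmx1.
have [l|Ow] := HB w.
  have iw : imv w = coords (map_mx Im (sym_mx w)) by rewrite -sym_mx_map coordsK.
  have -> : Im (w 0 l) = imv w 0 l by rewrite mxE.
  by rewrite iw Imw imv_base subrr normr0 ltW.
by rewrite tubefunE // wE.
Qed.

(** The negative leading coefficient wins for large [m]. Koecher's principle and the vanishing of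
    negative frequencies at a puncture or a cusp share this estimate. *)
Lemma quadratic_exp (B a b c e : R) : 0 <= B -> c < 0 -> 0 < e ->
  exists m : nat, B * expR (2 * pi * (a + m%:R * b + m%:R ^+ 2 * c)) <= e.
Proof.
move=> B0 c0 e0; pose q := (`|b| + `|a| + 1) / - c.
pose m := ((Num.trunc q).+1 + (Num.trunc (B / e)).+1)%N.
exists m; have q0 : 0 < - c by rewrite oppr_gt0.
have mq : q <= m%:R.
  by rewrite natrD; have := truncnS_gt q; have : 0 <= (Num.trunc (B / e)).+1%:R :> R by []; lra.
have mB : B / e < m%:R.
  by rewrite natrD; have := truncnS_gt (B / e); have : 0 <= (Num.trunc q).+1%:R :> R by []; lra.
have m1 : 1 <= m%:R :> R by rewrite ler1n.
have h1 : `|b| + `|a| + 1 <= m%:R * - c by rewrite -ler_pdivrMr.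
have h2 : a + m%:R * b + m%:R ^+ 2 * c <= - m%:R.
  have := ler_norm a; have := ler_norm b; have := normr_ge0 a; move: h1.
  move: `|a| `|b| => a' b'; nra.
have p1 : 1 <= 2 * pi :> R by have := pi_ge2 R; lra.
have h3 : expR (2 * pi * (a + m%:R * b + m%:R ^+ 2 * c)) <= m%:R^-1.
  apply: le_trans (_ : expR (- m%:R) <= _); first by rewrite ler_expR; nra.
  rewrite expRN lef_pV2 ?posrE ?expR_gt0 //.
  by have := expR_ge1Dx (m%:R : R); lra.
apply: le_trans (ler_wpM2l B0 h3) _; rewrite ler_pdivrMr; last lra.
by rewrite mulrC -ler_pdivrMr // ltW.
Qed.

Lemma orthogonal_vector (b : 'cV[int]_g) : (1 < g)%N ->
  exists2 w : 'cV[int]_g, w != 0 & (w^T *m b) 0 0 = 0.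
Proof.
move=> g1; have g0 : (0 < g)%N by apply: ltnW.
pose o := Ordinal g0; pose q := Ordinal g1.
have oq : (q == o) = false by [].
have dE (i : 'I_g) : ((delta_mx i 0 : 'cV[int]_g)^T *m b) 0 0 = b i 0.
  by rewrite trmx_delta -rowE mxE.
have dn (i : 'I_g) : delta_mx i 0 != 0 :> 'cV[int]_g.
  by apply/eqP => /matrixP/(_ i 0)/eqP; rewrite !mxE !eqxx.
have [b0|bn] := eqVneq (b o 0) 0.
  by exists (delta_mx o 0); rewrite ?dE.
exists (b q 0 *: delta_mx o 0 - b o 0 *: delta_mx q 0).
  apply/eqP => /matrixP/(_ q 0)/eqP; rewrite !mxE oq !eqxx mulr0 sub0r mulr1 oppr_eq0.
  by rewrite (negbTE bn).
rewrite [(_ - _)^T]linearB /= ![(_ *: _)^T]linearZ /= mulmxBl -!scalemxAl.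
by rewrite mxE [X in X + _]mxE dE [X in _ + X]mxE [X in _ - X]mxE dE mulrC subrr.
Qed.

(* Koecher: conjugating by the unipotent matrices I + m b w^T sends the
   imaginary part I to infinity in the direction b b^T. *)
Lemma koecher T : (1 < g)%N -> scoef T != 0 -> forall b, 0 <= qT T b.
Proof.
move=> g1 aT b; rewrite leNgt; apply/negP => qb.
have [w wn wb] := orthogonal_vector b g1.
have [B B0 HB] := unimodular_bound T.
have bw0 : w^T *m b = 0 by apply/matrixP => i j; rewrite !ord1 wb mxE.
(* [w^T b = 0] makes [b w^T] of square zero, so [A m] is unimodular; [T] pairs with [A A^T] in a
   quadratic polynomial in [m], of leading coefficient [c < 0]. *)
pose A (m : nat) : 'M[int]_g := 1%:M + m%:Z *: (b *m w^T).
have uA m : A m \in unitmx.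
  have : A m *m (1%:M - m%:Z *: (b *m w^T)) = 1%:M.
    rewrite /A mulmxBr mulmx1 mulmxDl mul1mx -!scalemxAl -!scalemxAr.
    rewrite [b *m w^T *m (b *m w^T)]mulmxA -[b *m w^T *m b]mulmxA bw0 mulmx0 mul0mx !scaler0 addr0.
    by rewrite addrK.
  by move=> /mulmx1_unit[].
pose c : R := (qT T b)%:~R * \sum_i (mr w i 0) ^+ 2.
have c0 : c < 0.
  rewrite /c nmulr_rlt0 ?ltrz0 //; have [i wi _] := top_coord wn.
  rewrite (bigD1 i) //=; apply: ltr_wpDr; first by rewrite sumr_ge0 // => j _; exact: sqr_ge0.
  by rewrite mxE exprn_even_gt0 //= intr_eq0.
pose X : 'M[R]_g := mr b *m (mr w)^T.
have mrA m : mr (A m) = 1%:M + m%:R *: X.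
  rewrite /A map_mxD map_mx1 map_mxZ map_mxM; congr (_ + _ *: (_ *m _)).
  by apply/matrixP => i j; rewrite !mxE.
pose a0 := dotR T (coords (1%:M : 'M[R]_g)); pose b0 := dotR T (coords (X + X^T)).
have E m : dotR T (coords (mr (A m) *m (mr (A m))^T)) = a0 + m%:R * b0 + m%:R ^+ 2 * c.
  have -> : mr (A m) *m (mr (A m))^T = 1%:M + m%:R *: (X + X^T) + m%:R ^+ 2 *: (X *m X^T).
    rewrite mrA linearD /= linearZ /= trmx1 mulmxDr !mulmxDl !mul1mx mulmx1.
    rewrite -!scalemxAl -!scalemxAr scalerA -expr2 scalerDr !addrA; congr (_ + _).
  rewrite !coordsD !coordsZ !dotRD !dotRZ; congr (_ + _ * _).
  have -> : X *m X^T = (\sum_i (mr w i 0) ^+ 2) *: (mr b *m (mr b)^T).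
    rewrite /X trmx_mul trmxK !mulmxA -[mr b *m _ *m mr w]mulmxA [(mr w)^T *m _]mx11_scalar.
    rewrite mul_mx_scalar -scalemxAl; congr (_ *: _); rewrite mxE; apply: eq_bigr => i _.
    by rewrite mxE expr2.
  by rewrite coordsZ dotRZ dotR_rank1 /c mulrC.
have : nm (scoef T) <= 0.
  apply/ler_addgt0Pl => e e0; rewrite addr0.
  have [m mP] := quadratic_exp a0 b0 B0 c0 e0.
  by apply: le_trans (HB _ (uA m)) _; rewrite E.
by rewrite leNgt nm_gt0 aT.
Qed.

End SiegelFourier.

(** * Open definable sets *)

Section GoodFunctions.
Variables (R : realType) (m : nat).
Local Notation C := R[i].
Local Notation Re := (@complex.Re R).
Local Notation Im := (@complex.Im R).
Implicit Types (f h : 'rV[C]_m -> R).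

(** A term need not be continuous, restricted functions being cut off at their box, so continuity is
    carried along to obtain openness. *)
Definition cont_term f := rterm f /\ continuous f.

Lemma cont_term_ext f h : f =1 h -> cont_term f -> cont_term h.
Proof. by move=> /funext ->. Qed.

Lemma cont_term_cst c : cont_term (fun=> c).
Proof.
split; first exact: rterm_cst.
by move=> x P /nbhs_singleton Pc; apply/nbhs_nm_rV; exists 1 => // w _; exact: Pc.
Qed.

Lemma cont_termD f h : cont_term f -> cont_term h -> cont_term (fun w => f w + h w).
Proof.
by move=> [f1 f2] [h1 h2]; split; [exact: rtermD|move=> x; exact: cvgD (f2 x) (h2 x)].
Qed.

Lemma cont_termM f h : cont_term f -> cont_term h -> cont_term (fun w => f w * h w).
Proof.
by move=> [f1 f2] [h1 h2]; split; [exact: rtermM|move=> x; exact: cvgM (f2 x) (h2 x)].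
Qed.

Lemma cont_term_sum (I : Type) (r : seq I) (f : I -> 'rV[C]_m -> R) :
  (forall i, cont_term (f i)) -> cont_term (fun w => \sum_(i <- r) f i w).
Proof.
move=> fc; elim: r => [|i r IH].
  by apply: cont_term_ext (cont_term_cst 0) => w; rewrite big_nil.
by apply: cont_term_ext (cont_termD (fc i) IH) => w; rewrite big_cons.
Qed.

Lemma cont_termN f : cont_term f -> cont_term (fun w => - f w).
Proof.
by move=> /(cont_termM (cont_term_cst (-1))); apply: cont_term_ext => w; rewrite mulN1r.
Qed.

Definition def_open (X : set 'rV[C]_m) := definableC X /\ open X.

Lemma def_open_lt f h : cont_term f -> cont_term h -> def_open [set w | f w < h w].
Proof.
move=> [f1 f2] [h1 h2]; split; first exact: definableC_lt.
have -> : [set w | f w < h w] = (fun w => h w - f w) @^-1` [set x | 0 < x].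
  by apply/seteqP; split=> w /=; rewrite subr_gt0.
by apply: open_comp; [move=> x _; exact: cvgB (h2 x) (f2 x)|exact: open_gt].
Qed.

Lemma def_open_abs f h : cont_term f -> cont_term h -> def_open [set w | `|f w| < h w].
Proof.
move=> cf ch; have [d1 o1] := def_open_lt (cont_termN ch) cf; have [d2 o2] := def_open_lt cf ch.
have E : [set w | - h w < f w] `&` [set w | f w < h w] = [set w | `|f w| < h w].
  by apply/seteqP; split=> w /=; rewrite ltr_norml; [move=> [-> ->]|move=> /andP[]].
by split; rewrite -E; [exact: definableC_and|exact: openI].
Qed.

Lemma def_open_and (X Y : set 'rV[C]_m) : def_open X -> def_open Y -> def_open (X `&` Y).
Proof. by move=> [d1 o1] [d2 o2]; split; [exact: definableC_and|exact: openI]. Qed.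

Lemma def_open_ext (X Y : set 'rV[C]_m) : (forall w, X w <-> Y w) -> def_open X -> def_open Y.
Proof. by move=> XY; rewrite (_ : X = Y) //; apply/seteqP; split=> w /XY. Qed.

Lemma def_openT : def_open [set: 'rV[C]_m].
Proof. by split; [exact: definableCT|exact: openT]. Qed.

Lemma def_open_all (I : finType) (X : I -> set 'rV[C]_m) :
  (forall i, def_open (X i)) -> def_open [set w | forall i, X i w].
Proof.
move=> dX; suff H (r : seq I) : def_open [set w | forall i, i \in r -> X i w].
  apply: def_open_ext (H (enum I)) => w; split=> h i; first by apply: h; rewrite mem_enum.
  by move=> _; exact: h.
elim: r => [|i r IH]; first by apply: def_open_ext def_openT.
apply: def_open_ext (def_open_and (dX i) IH) => w; split=> [[h1 h2] j|h].
  by rewrite inE => /orP[/eqP -> //|]; exact: h2.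
by split=> [|j jr]; apply: h; rewrite inE ?eqxx ?jr ?orbT.
Qed.

Lemma def_open_imp (P : Prop) X : (P -> def_open X) -> def_open [set w | P -> X w].
Proof.
move=> dX; have [p|np] := pselect P.
  by apply: def_open_ext (dX p) => w; split=> [h _ //|]; exact.
by apply: def_open_ext def_openT => w; split=> // _ /np.
Qed.

Lemma cont_term_var j : cont_term (fun w => Re (w 0 j)) /\ cont_term (fun w => Im (w 0 j)).
Proof.
have [h1 h2] := @cterm_var R m j.
have cj : continuous (fun w : 'rV[C]_m => w 0 j) by move=> x; exact: coord_continuous.
split; split=> // x.
  exact: (continuous_comp (cj x) (@continuous_Re R _)).
exact: (continuous_comp (cj x) (@continuous_Im R _)).
Qed.

End GoodFunctions.

(** * Modular forms as terms on the pieces *)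

Section ConePieces.
Variables (R : realType) (g : nat).
Local Notation C := R[i].
Local Notation Re := (@complex.Re R).
Local Notation Im := (@complex.Im R).
Local Notation mc := (map_mx (intr : int -> C)).
Local Notation mr := (map_mx (intr : int -> R)).
Local Notation rc := (map_mx (real_complex R)).
Hypothesis g_gt0 : (0 < g)%N.
Variables (K c : R).
Hypothesis K_ge1 : 1 <= K.
Hypothesis c_gt0 : 0 < c.
Let delta : R := (4 * g%:R * K)^-1.

Definition piece (P : 'M[int]_g) : set 'M[C]_g := [set tau |
  [/\ tau^T = tau, forall i j, `|Re (tau i j)| < 1 &
  cone_cond K delta c (invmx (mr P) *m map_mx Im tau *m (invmx (mr P))^T)]].

Lemma conj_entry (Q X : 'M[R]_g) i j : (Q *m X *m Q^T) i j = \sum_a \sum_b Q i a * Q j b * X a b.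
Proof.
rewrite mxE exchange_big /=; apply: eq_bigr => b _; rewrite !mxE mulr_suml.
by apply: eq_bigr => a _; ring.
Qed.

(** Stated for a matrix-valued [pr] because a piece is read both in the coordinates of [tau] and in
    the larger space that holds the graph. *)
Lemma def_open_piece m (pr : 'rV[C]_m -> 'M[C]_g) P :
  (forall w, (pr w)^T = pr w) ->
  (forall i j, cont_term (fun w => Re (pr w i j)) /\ cont_term (fun w => Im (pr w i j))) ->
  def_open (pr @^-1` piece P).
Proof.
move=> prs prc.
pose Y w := invmx (mr P) *m map_mx Im (pr w) *m (invmx (mr P))^T.
have Yc i j : cont_term (fun w => Y w i j).
  apply: (@cont_term_ext _ _ (fun w => \sum_a \sum_b
      invmx (mr P) i a * invmx (mr P) j b * Im (pr w a b))).
    by move=> w; rewrite conj_entry; apply: eq_bigr => a _; apply: eq_bigr => b _; rewrite [in RHS]mxE.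
  apply: cont_term_sum => a; apply: cont_term_sum => b.
  by apply: cont_termM; [exact: cont_term_cst|exact: (prc a b).2].
have d1 := def_open_all (fun i => def_open_all (fun j =>
  def_open_abs (prc i j).1 (cont_term_cst _ 1))).
have d2 := def_open_all (fun i : 'I_g => def_open_all (fun j : 'I_g =>
  def_open_imp (P := (i < j)%N) (fun _ => def_open_abs (Yc i j)
    (cont_termM (cont_term_cst _ delta) (Yc i i))))).
have d3 := def_open_all (fun i : 'I_g => def_open_all (fun j : 'I_g =>
  def_open_imp (P := (i < j)%N) (fun _ => def_open_lt (Yc i i)
    (cont_termM (cont_term_cst _ K) (Yc j j))))).
have d4 := def_open_all (fun i : 'I_g => def_open_lt (cont_term_cst _ c) (Yc i i)).
apply: def_open_ext (def_open_and d1 (def_open_and d2 (def_open_and d3 d4))) => w.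
by split=> [[h1 [h2 [h3 h4]]]|[_ h1 [h2 h3 h4]]] /=; split=> //; split=> //; split.
Qed.

Let L := #|{: 'I_g * 'I_g}|.

(** [P] is invertible only over the rationals; the integrality of [P b] is what makes the exponents
    integers. *)
Definition pvec (P : 'M[int]_g) (l : 'I_L) : 'cV[int]_g :=
  P *m cone_vec (enum_val l).1 (enum_val l).2.

Definition pdir P l : 'rV[R]_(sym_dim g) := coords (mr (pvec P l) *m (mr (pvec P l))^T).

Definition pcoord (F : numFieldType) (de : F) (A : 'M[F]_g) (l : 'I_L) : F :=
  cone_coord de A (enum_val l).1 (enum_val l).2.

Lemma pcoord_sum (F : numFieldType) (de : F) (P : 'M[int]_g) (A : 'M[F]_g) :
  let Q := map_mx (intr : int -> F) P in Q \in unitmx -> A^T = A ->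
  A = \sum_l pcoord de (invmx Q *m A *m (invmx Q)^T) l *:
    (map_mx (intr : int -> F) (pvec P l) *m (map_mx (intr : int -> F) (pvec P l))^T).
Proof.
move=> Q uQ symA; set B := invmx Q *m A *m (invmx Q)^T.
have symB : B^T = B by rewrite /B !trmx_mul trmxK symA mulmxA.
have AE : A = Q *m B *m Q^T.
  rewrite /B !mulmxA mulmxV // mul1mx -mulmxA -trmx_mul mulmxV // trmx1 mulmx1 //.
rewrite {1}AE {1}(cone_coord_sum de symB) pair_big /=.
rewrite mulmx_sumr mulmx_suml.
rewrite (reindex (enum_val : 'I_L -> _)) /=; last first.
  by exists enum_rank => x _; [exact: enum_valK|exact: enum_rankK].
apply: eq_bigr => l _; rewrite /pcoord -scalemxAr -scalemxAl; congr (_ *: _).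
by rewrite /pvec map_mxM trmx_mul !mulmxA.
Qed.

Lemma qform_rank1 (b x : 'cV[R]_g) : qform (b *m b^T) x = ((b^T *m x) 0 0) ^+ 2.
Proof.
rewrite /qform mulmxA -mulmxA [x^T *m b]mx11_scalar mul_scalar_mx mxE expr2; congr (_ * _).
by rewrite !mxE; apply: eq_bigr => i _; rewrite !mxE mulrC.
Qed.

(** The diagonal directions give strict positivity: some column of [P] pairs nontrivially with a
    nonzero [x]. *)
Lemma Om_pdir P (y : 'I_L -> R) : mr P \in unitmx -> (forall l, 0 < y l) ->
  Om (\sum_l y l *: pdir P l).
Proof.
move=> uP y0; have -> : \sum_l y l *: pdir P l =
    coords (\sum_l y l *: (mr (pvec P l) *m (mr (pvec P l))^T)).
  apply/rowP => q; rewrite summxE [in RHS]mxE summxE; apply: eq_bigr => l _.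
  by rewrite !mxE.
rewrite /Om sym_mxK; last first.
  rewrite linear_sum; apply: eq_bigr => l _; rewrite linearZ /=.
  by rewrite trmx_mul trmxK.
move=> x xn; change (0 < qform (\sum_l y l *: (mr (pvec P l) *m (mr (pvec P l))^T)) x).
rewrite (big_morph (fun A => qform A x) (id1 := 0) (op1 := +%R)); last 2 first.
- by move=> A B; exact: qformD.
- by rewrite /qform mulmx0 mul0mx mxE.
have tn l : 0 <= qform (y l *: (mr (pvec P l) *m (mr (pvec P l))^T)) x.
  by rewrite qformZl qform_rank1 mulr_ge0 ?sqr_ge0 // ltW.
have zn : (mr P)^T *m x != 0.
  apply: contra_neq xn => z0; have uT : (mr P)^T \in unitmx by rewrite unitmx_tr.
  by rewrite -(mulKmx uT x) z0 mulmx0.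
have [i zi _] := top_coord zn.
pose l := enum_rank (i, i).
rewrite (bigD1 l) //=; apply: ltr_wpDr; first by rewrite sumr_ge0.
rewrite qformZl qform_rank1 mulr_gt0 // exprn_even_gt0 //=.
suff -> : ((mr (pvec P l))^T *m x) 0 0 = ((mr P)^T *m x) i 0 by [].
rewrite /pvec /l enum_rankK /cone_vec /= eqxx map_mxM map_delta_mx trmx_mul trmx_delta -mulmxA.
by rewrite -rowE mxE.
Qed.

Lemma Im_pcoord P tau l : Im (pcoord delta%:C (rc (invmx (mr P)) *m tau *m (rc (invmx (mr P)))^T) l) =
  pcoord delta (invmx (mr P) *m map_mx Im tau *m (invmx (mr P))^T) l.
Proof.
have E i j : Im ((rc (invmx (mr P)) *m tau *m (rc (invmx (mr P)))^T) i j) =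
    (invmx (mr P) *m map_mx Im tau *m (invmx (mr P))^T) i j.
  rewrite [in RHS]mxE mxE cIm_sum; apply: eq_bigr => b _; rewrite [(rc _)^T b j]mxE [rc _ j b]mxE.
  rewrite mulrC cImMR mulrC [(invmx _)^T b j]mxE; congr (_ * _).
  by rewrite [in RHS]mxE mxE cIm_sum; apply: eq_bigr => a _; rewrite !mxE cImMR.
rewrite /pcoord /cone_coord; case: ifP => _; last case: ifP => _.
- rewrite cImB cIm_sum E; congr (_ - _); apply: eq_bigr => p _.
  have -> : 2 * delta%:C = (2 * delta)%:C :> C by rewrite rmorphM rmorph_nat.
  by rewrite cImMR E.
- rewrite cImD cImMR E; congr (_ + _).
  by rewrite mulrC -[2]/(2%:R) -(rmorph_nat (real_complex R)) -fmorphV cImMR E mulrC.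
rewrite cImD cImMR E; congr (_ + _).
by rewrite mulrC -[2]/(2%:R) -(rmorph_nat (real_complex R)) -fmorphV cImMR cImN E mulrC.
Qed.

Lemma Re_pcoord P tau l : Re (pcoord delta%:C (rc (invmx (mr P)) *m tau *m (rc (invmx (mr P)))^T) l) =
  pcoord delta (invmx (mr P) *m map_mx Re tau *m (invmx (mr P))^T) l.
Proof.
have E i j : Re ((rc (invmx (mr P)) *m tau *m (rc (invmx (mr P)))^T) i j) =
    (invmx (mr P) *m map_mx Re tau *m (invmx (mr P))^T) i j.
  rewrite [in RHS]mxE mxE cRe_sum; apply: eq_bigr => b _; rewrite [(rc _)^T b j]mxE [rc _ j b]mxE.
  rewrite mulrC cReMR mulrC [(invmx _)^T b j]mxE; congr (_ * _).
  by rewrite [in RHS]mxE mxE cRe_sum; apply: eq_bigr => a _; rewrite !mxE cReMR.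
rewrite /pcoord /cone_coord; case: ifP => _; last case: ifP => _.
- rewrite cReB cRe_sum E; congr (_ - _); apply: eq_bigr => p _.
  have -> : 2 * delta%:C = (2 * delta)%:C :> C by rewrite rmorphM rmorph_nat.
  by rewrite cReMR E.
- rewrite cReD cReMR E; congr (_ + _).
  by rewrite mulrC -[2]/(2%:R) -(rmorph_nat (real_complex R)) -fmorphV cReMR E mulrC.
rewrite cReD cReMR E; congr (_ + _).
by rewrite mulrC -[2]/(2%:R) -(rmorph_nat (real_complex R)) -fmorphV cReMR cReN E mulrC.
Qed.

Lemma piece_pcoord P tau l : piece P tau ->
  delta * c / 2 <= pcoord delta (invmx (mr P) *m map_mx Im tau *m (invmx (mr P))^T) l.
Proof.
move=> [symt _ cc]; apply: (cone_coord_ge g_gt0 K_ge1 c_gt0 cc).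
by rewrite !trmx_mul trmxK (Im_sym symt) mulmxA.
Qed.

Lemma delta_gt0 : 0 < delta.
Proof.
have k0 : 0 < K by exact: lt_le_trans ltr01 K_ge1.
by rewrite invr_gt0 mulr_gt0 // mulr_gt0 // ltr0n.
Qed.

Lemma piece_space P tau : mr P \in unitmx -> piece P tau -> siegel_space tau.
Proof.
move=> uP pt; have [symt _ _] := pt; split=> //.
have symY := Im_sym symt.
pose y l := pcoord delta (invmx (mr P) *m map_mx Im tau *m (invmx (mr P))^T) l.
have y0 l : 0 < y l.
  apply: lt_le_trans (piece_pcoord l pt); have := delta_gt0 => d0.
  by rewrite divr_gt0 // mulr_gt0.
have := Om_pdir uP y0; rewrite /Om.
suff -> : \sum_l y l *: pdir P l = coords (map_mx Im tau) by rewrite sym_mxK.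
rewrite [in RHS](pcoord_sum delta uP symY); apply/rowP => q; rewrite summxE [in RHS]mxE summxE.
by apply: eq_bigr => l _; rewrite !mxE.
Qed.

Lemma pcoord_bound P : exists A : R, forall X : 'M[R]_g, (forall i j, `|X i j| < 1) ->
  forall l, `|pcoord delta (invmx (mr P) *m X *m (invmx (mr P))^T) l| <= A.
Proof.
pose Q := invmx (mr P); pose a := \sum_i \sum_j \sum_p \sum_q `|Q i p * Q j q|.
have d0 := delta_gt0.
have a0 : 0 <= a by do 4 (apply: sumr_ge0 => ? _).
exists (a + \sum_(k < g) 2 * delta * a + delta * a) => X X1 l.
have E i j : `|(Q *m X *m Q^T) i j| <= a.
  rewrite conj_entry; apply: le_trans (ler_norm_sum _ _ _) _.
  apply: le_trans (_ : \sum_p \sum_q `|Q i p * Q j q| <= _).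
    apply: ler_sum => p _; apply: le_trans (ler_norm_sum _ _ _) _; apply: ler_sum => q _.
    by rewrite normrM ler_piMr // ltW.
  set s := (X in X <= _); rewrite /a (bigD1 i) //= (bigD1 j) //= -/s -addrA lerDl addr_ge0 //.
    by do 3 (apply: sumr_ge0 => ? _).
  by do 4 (apply: sumr_ge0 => ? _).
have S0 : 0 <= \sum_(k < g) 2 * delta * a.
  by apply: sumr_ge0 => p _; rewrite mulr_ge0 // mulr_ge0 // ltW.
have da : 0 <= delta * a by rewrite mulr_ge0 // ltW.
have dE i j : `|delta * (Q *m X *m Q^T) i j| <= delta * a.
  by rewrite normrM (ger0_norm (ltW d0)) ler_pM2l.
have hE i j : `|(Q *m X *m Q^T) i j / 2| <= a.
  have h2 : `|2^-1 : R| = 2^-1 by rewrite ger0_norm // invr_ge0.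
  by rewrite normrM h2; have := E i j; lra.
rewrite /pcoord /cone_coord -/Q; case: ifP => _; last case: ifP => _.
- apply: le_trans (ler_normB _ _) _; rewrite -addrA lerD //.
  apply: ler_wpDr => //; apply: le_trans (ler_norm_sum _ _ _) _.
  rewrite big_mkcond; apply: ler_sum => p _; case: ifP => _; last first.
    by rewrite mulr_ge0 // mulr_ge0 // ltW.
  by rewrite -!mulrA normrM ger0_norm // ler_pM2l // dE.
- apply: le_trans (ler_normD _ _) _.
  by have := hE (enum_val l).1 (enum_val l).2; have := dE (enum_val l).1 (enum_val l).1; lra.
apply: le_trans (ler_normD _ _) _; rewrite mulNr normrN.
by have := hE (enum_val l).1 (enum_val l).2; have := dE (enum_val l).2 (enum_val l).2; lra.
Qed.

(** Koecher's principle at the integer vectors [pvec P l] makes the exponents nonnegative, and on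
    the piece the coordinates [z_l] have bounded real part and imaginary part at least
    [delta c / 2], as [cterm_series] asks. *)
Lemma piece_term (k : int) (phi : 'M[C]_g -> C) m (pr : 'rV[C]_m -> 'M[C]_g) P :
  (1 < g)%N -> modular_form k phi -> mr P \in unitmx ->
  (forall i j, cterm (fun w => pr w i j)) ->
  exists2 p : 'rV[C]_m -> C, cterm p & forall w, piece P (pr w) -> p w = phi (pr w).
Proof.
move=> g1 phim uP prc.
have n0 : (0 < sym_dim g)%N.
  by rewrite /sym_dim; apply/card_gt0P; exists (sym_pair (Ordinal g_gt0) (Ordinal g_gt0)).
pose beta (T : 'rV[int]_(sym_dim g)) (l : 'I_L) : int := qT T (pvec P l).
have betaE T l : dotR T (pdir P l) = (beta T l)%:~R by exact: dotR_rank1.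
have beta0 T l : fcoef (tubefun phi) (base_pt R g) T != 0 -> 0 <= beta T l.
  by move=> /(koecher phim g1); apply.
have abs := cone_abs_conv n0 (tubefun_per phim) (tubefun_dif phim) (tubefun_bnd phim)
  (@Om_conv R g) (@Om_base R g) (fun y => Om_pdir uP (y := y)) betaE beta0.
pose z (l : 'I_L) (w : 'rV[C]_m) : C :=
  pcoord delta%:C (rc (invmx (mr P)) *m pr w *m (rc (invmx (mr P)))^T) l.
have entc i j : cterm (fun w => (rc (invmx (mr P)) *m pr w *m (rc (invmx (mr P)))^T) i j).
  apply: (@cterm_ext _ _ (fun w => \sum_b \sum_a
      (invmx (mr P) i a)%:C * (invmx (mr P) j b)%:C * pr w a b)).
    move=> w; rewrite mxE; apply: eq_bigr => b _; rewrite [in RHS]mxE mulr_suml.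
    by apply: eq_bigr => a _; rewrite !mxE; ring.
  apply: cterm_sum => b; apply: cterm_sum => a; apply: ctermM; [exact: cterm_cst|exact: prc].
have zc l : cterm (z l).
  rewrite /z /pcoord /cone_coord; case: ((enum_val l).1 == (enum_val l).2);
    last case: ((enum_val l).1 < (enum_val l).2)%N.
  - apply: (@cterm_ext _ _ (fun w => (rc (invmx (mr P)) *m pr w *m (rc (invmx (mr P)))^T)
      (enum_val l).1 (enum_val l).1 + \sum_(p <- enum [pred p | p != (enum_val l).1])
      (- (2 * delta%:C)) * (rc (invmx (mr P)) *m pr w *m (rc (invmx (mr P)))^T)
        (omin (enum_val l).1 p) (omin (enum_val l).1 p))).
      move=> w; congr (_ + _); rewrite big_enum /= -sumrN; apply: eq_bigr => p _.
      by rewrite mulNr.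
    apply: ctermD => //; apply: cterm_sum => p; apply: ctermM => //; exact: cterm_cst.
  - by apply: ctermD; apply: ctermM => //; exact: cterm_cst.
  apply: ctermD; apply: ctermM => //; try exact: cterm_cst.
  by apply: (cterm_ext _ (ctermM (cterm_cst _ (-1)) (entc _ _))) => w; rewrite mulN1r.
have [A AP] := pcoord_bound P.
have d0 := delta_gt0.
have c0 : 0 < delta * c / 2 by rewrite divr_gt0 // mulr_gt0.
have [p pc pP] := cterm_series A c0 abs zc; exists p => // w pw.
have zA l : `|Re (z l w)| <= A /\ delta * c / 2 <= Im (z l w).
  split; last by rewrite /z Im_pcoord; exact: piece_pcoord.
  by rewrite /z Re_pcoord; apply: AP => i j; rewrite mxE; have [_ h _] := pw.
have us1 := pP w zA.
have us2 := cone_usum n0 (tubefun_per phim) (tubefun_dif phim) (tubefun_bnd phim)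
  (@Om_conv R g) (@Om_base R g) (fun y => Om_pdir uP (y := y)) betaE beta0
  (z := fun l => z l w) (fun l => lt_le_trans c0 (zA l).2).
rewrite (usum_unique us1 us2).
have symw : (pr w)^T = pr w by have [] := pw.
have -> : cone_pt (pdir P) (fun l => z l w) = coords (pr w).
  have uPc : mc P \in unitmx.
    have := uP; rewrite !unitmxE !det_map_mx !unitfE !intr_eq0; by [].
  have iE : invmx (mc P) = rc (invmx (mr P)).
    have mcE : mc P = rc (mr P) by apply/matrixP => i j; rewrite !mxE rmorph_int.
    by rewrite mcE map_invmx.
  rewrite [in RHS](pcoord_sum delta%:C uPc symw) iE; apply/rowP => q.
  rewrite summxE [in RHS]mxE summxE; apply: eq_bigr => l _; rewrite !mxE big_ord1; congr (_ * _).
  rewrite !mxE !big_ord1 !mxE rmorphM /= !rmorph_int; by [].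
have Hw := piece_space uP pw.
have Oc : Om (imv (coords (pr w))) by apply/Om_space; rewrite sym_mxK.
by rewrite tubefunE // sym_mxK.
Qed.

End ConePieces.

(** * One-variable function theory: maximum principle, open mapping, identity theorem *)

Section OneVariable.
Variable R : realType.
Local Notation C := R[i].
Local Notation Re := (@complex.Re R).
Local Notation Im := (@complex.Im R).
Implicit Types (f : C -> C) (z w u c : C).

Lemma unit_circle (x y : R) : x ^+ 2 + y ^+ 2 = 1 -> exists t : R, cos t = x /\ sin t = y.
Proof.
move=> xy; have x1 : -1 <= x <= 1 by have := sqr_ge0 y; nra.
have cx : cos (acos x) = x by apply: acosK; rewrite in_itv.
have sx : sin (acos x) = Num.sqrt (1 - x ^+ 2) by exact: sin_acos.
have ys : Num.sqrt (1 - x ^+ 2) = `|y|.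
  by rewrite (_ : 1 - x ^+ 2 = y ^+ 2) ?sqrtr_sqr // -xy; ring.
have [y0|y0] := leP 0 y.
  by exists (acos x); rewrite sx ys ger0_norm.
exists (- acos x); rewrite cosN sinN sx ys ltr0_norm // opprK //.
Qed.

Lemma ce_surj z : z != 0 -> exists u, ce u = z.
Proof.
move=> zn; have n0 : 0 < nm z by rewrite nm_gt0.
have nn : nm z != 0 by rewrite gt_eqF.
have [t [ct st]] := @unit_circle (Re z / nm z) (Im z / nm z) ltac:(
  by rewrite !expr_div_n -mulrDl -nm_sqr divff // expf_neq0).
have p0 : 2 * pi != 0 :> R by rewrite gt_eqF // mulr_gt0 // pi_gt0.
exists ((t / (2 * pi)) +i* (- ln (nm z) / (2 * pi))).
have e1 : 2 * pi * (t / (2 * pi)) = t by rewrite mulrC divfK.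
have e2 : - (2 * pi * (- ln (nm z) / (2 * pi))) = ln (nm z).
  by rewrite mulNr mulrN opprK mulrC divfK.
rewrite /ce /= e1 e2 lnK ?posrE // ct st.
by apply: complex_ext; rewrite ?(cReM, cImM) /= mul0r ?subr0 ?addr0 mulrC divfK.
Qed.

Lemma two_pi_gt0 : 0 < 2 * pi :> R.
Proof. by rewrite mulr_gt0 // pi_gt0. Qed.

Lemma nm_ce_le1 u : (nm (ce u) <= 1) = (0 <= Im u).
Proof.
by rewrite nm_ce -[X in _ <= X](@expR0 R) ler_expR oppr_le0 pmulr_rge0 // two_pi_gt0.
Qed.

Lemma nm_ce_lt1 u : (nm (ce u) < 1) = (0 < Im u).
Proof.
by rewrite nm_ce -[X in _ < X](@expR0 R) ltr_expR oppr_lt0 pmulr_rgt0 // two_pi_gt0.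
Qed.

Lemma compact_disc (s : R) : compact [set w : C | nm w <= s].
Proof.
have -> : [set w : C | nm w <= s] =
    [set w : C | - s <= Re w <= s /\ - s <= Im w <= s] `&` [set w : C | nm w <= s].
  apply/seteqP; split=> [w ws|w []//]; split=> //=.
  by rewrite -!ler_norml; split; apply: le_trans ws; rewrite ?nm_Re ?nm_Im.
apply: compact_closedI; first exact: compact_rectangle.
apply: (@closed_comp _ _ (@nm R) [set x : R | x <= s]); first by move=> x _; exact: continuous_nm.
exact: closed_le.
Qed.

Definition holo_disc f z0 (r : R) := forall z, nm (z - z0) < r -> differentiable f z.

Lemma disc_bound f z0 (r s : R) : 0 <= s -> s < r -> holo_disc f z0 r ->
  exists2 B : R, 0 <= B & forall w, nm w <= s -> nm (f (z0 + w)) <= B.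
Proof.
move=> s0 sr fh.
have [|||c _ cP] := @compact_EVT_max _ R (fun w => nm (f (z0 + w))) [set w : C | nm w <= s].
- by exists (0 : C); change (nm (0 : C) <= s); rewrite nm0.
- exact: compact_disc.
- apply: continuous_in_subspaceT => w; rewrite inE /= => ws P /nbhs_real[e e0 H].
  have [|d d0 D] := differentiable_cont (fh (z0 + w) _) e0.
    by rewrite addrC addKr; apply: le_lt_trans ws sr.
  apply/nbhs_nm; exists d => // w' ww'; apply: H; apply: le_lt_trans (D (z0 + w') _).
    have := le_nmB (f (z0 + w)) (f (z0 + w')); have := le_nmB (f (z0 + w')) (f (z0 + w)).
    by rewrite [nm (f (z0 + w) - _)]nmBC ler_norml; lra.
  by rewrite opprD addrACA subrr add0r nmBC.
exists (nm (f (z0 + c))) => [|w ws]; first exact: nm_ge0.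
by apply: cP; rewrite inE.
Qed.

Lemma half_line_convex (y a b t : R) : y < a -> y < b -> 0 <= t -> t <= 1 -> y < (1 - t) * a + t * b.
Proof.
move=> ya yb t0 t1; have [->|tn] := eqVneq t 1; first by rewrite subrr mul0r add0r mul1r.
have t1' : t < 1 by rewrite lt_neqAle tn.
have h1 : 0 < (1 - t) * (a - y) by rewrite mulr_gt0 ?subr_gt0.
have h2 : 0 <= t * (b - y) by rewrite mulr_ge0 ?subr_ge0 // ltW.
by move: h1 h2; lra.
Qed.

Section Disc.
Variables (f : C -> C) (z0 : C) (r s : R).
Hypothesis s_gt0 : 0 < s.
Hypothesis s_lt : s < r.
Hypothesis fh : holo_disc f z0 r.

Let s' := (s + r) / 2.
(** The height at which [s |ce u|] equals the radius [s'] between [s] and [r]; it is negative, so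
    the circle of radius [s] is interior to the half-plane. *)
Let ylow : R := - ln (s' / s) / (2 * pi).
Let OmD (Y : 'rV[R]_1) : Prop := ylow < Y 0 0.
(** The substitution [w = s ce u] turns a punctured disc into a half-plane and [f] into a periodic
    function. *)
Let GD (v : 'rV[C]_1) : C := f (z0 + s%:C * ce (v 0 0)).

Lemma disc_ratio_gt1 : 1 < s' / s.
Proof. by rewrite ltr_pdivlMr // mul1r /s'; have := s_lt; lra. Qed.

Lemma disc_ylow_lt0 : ylow < 0.
Proof. by rewrite /ylow mulNr oppr_lt0 divr_gt0 ?ln_gt0 ?two_pi_gt0 // disc_ratio_gt1. Qed.

Lemma disc_rad u : ylow < Im u -> nm (s%:C * ce u) <= s'.
Proof.
move=> yu; rewrite nmM nmR ger0_norm ?(ltW s_gt0) // nm_ce.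
have -> : s' = s * (s' / s) by rewrite mulrC divfK // gt_eqF.
rewrite ler_pM2l // -[s' / s in leRHS]lnK; last by rewrite posrE; have := disc_ratio_gt1; lra.
rewrite ler_expR; move: yu; rewrite /ylow ltr_pdivrMr ?two_pi_gt0 // => h.
by move: h; lra.
Qed.

Lemma disc_per v l : GD (v + ev_ R l) = GD v.
Proof.
rewrite /GD mxE; have -> : ev_ R l 0 0 = 1 by rewrite !mxE !ord1.
by rewrite ceD ce1 mulr1.
Qed.

Lemma disc_dif v l (u : C) : OmD (imv (v + u *: ev_ R l)) ->
  differentiable (fun u : C => GD (v + u *: ev_ R l)) u.
Proof.
rewrite /OmD mxE => Ou.
have E (t : C) : (v + t *: ev_ R l) 0 0 = v 0 0 + t by rewrite !mxE !ord1 eqxx mulr1.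
have -> : (fun u : C => GD (v + u *: ev_ R l)) = f \o (fun t : C => z0 + ce (v 0 0 + t) * s%:C).
  by apply/funext => t; rewrite /GD /= E mulrC.
rewrite E in Ou; apply: differentiable_comp.
  have d1 : differentiable (fun t : C => ce (v 0 0 + t)) u.
    have d2 : differentiable (fun t : C => v 0 0 + t * 1) u by exact: differentiable_affine.
    have := differentiable_comp d2 (differentiable_ce _).
    rewrite (_ : _ \o _ = (fun t : C => ce (v 0 0 + t))) //.
    by apply/funext => t /=; rewrite mulr1.
  exact: (differentiable_comp d1 (@differentiable_affine R z0 s%:C _)).
apply: fh => /=; rewrite addrC addKr mulrC; apply: le_lt_trans (disc_rad Ou) _.
by rewrite /s'; have := s_lt; lra.
Qed.

Lemma disc_unif_bound : exists2 B : R, 0 <= B & forall v, OmD (imv v) -> nm (GD v) <= B.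
Proof.
have [||B B0 H] := @disc_bound f z0 r s' _ _ fh.
- by rewrite /s'; have := s_gt0; have := s_lt; lra.
- by rewrite /s'; have := s_lt; lra.
by exists B => // v; rewrite /OmD mxE => Ov; apply: H; exact: disc_rad.
Qed.

Lemma disc_bnd Y : OmD Y -> exists eps M : R, 0 < eps /\
  forall v : 'rV[C]_1, (forall k, `|Im (v 0 k) - Y 0 k| <= eps) -> OmD (imv v) /\ nm (GD v) <= M.
Proof.
rewrite /OmD => OY; have [B B0 H] := disc_unif_bound; exists ((Y 0 0 - ylow) / 2), B; split=> [|v vY].
  by rewrite divr_gt0 // subr_gt0.
have Ov : OmD (imv v) by rewrite /OmD mxE; have := vY 0; rewrite ler_norml => /andP[h1 h2]; lra.
by split=> //; exact: H.
Qed.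

Lemma disc_conv Y Y' (t : R) : OmD Y -> OmD Y' -> 0 <= t <= 1 -> OmD ((1 - t) *: Y + t *: Y').
Proof. by rewrite /OmD !mxE => h1 h2 /andP[t0 t1]; exact: half_line_convex. Qed.

Let v0 : 'rV[C]_1 := const_mx 0.
Lemma disc_base : OmD (imv v0). Proof. by rewrite /OmD !mxE; exact: disc_ylow_lt0. Qed.

Let a (T : 'rV[int]_1) : C := fcoef GD v0 T.
Let one_gt0 : (0 < 1)%N := isT.

Lemma dot_row1 (T : 'rV[int]_1) (v : 'rV[C]_1) : dot T v = (T 0 0)%:~R * v 0 0.
Proof. by rewrite /dot big_ord1. Qed.

Lemma disc_coef_neg (T : 'rV[int]_1) : T 0 0 < 0 -> a T = 0.
Proof.
move=> T0; have [B B0 HB] := disc_unif_bound.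
have bnd (y : R) : 0 <= y -> nm (a T) <= B * expR (2 * pi * ((T 0 0)%:~R * y)).
  move=> y0; pose v : 'rV[C]_1 := const_mx (0 +i* y).
  have Ov : OmD (imv v) by rewrite /OmD !mxE /=; apply: lt_le_trans disc_ylow_lt0 y0.
  rewrite /a /fcoef -(mavg_const disc_per disc_dif disc_bnd disc_conv T disc_base Ov).
  have -> : (T 0 0)%:~R * y = dotR T (imv v) by rewrite /dotR big_ord1 !mxE.
  apply: (mlim_le disc_bnd) => // x; apply: HB.
  by rewrite /OmD imvD imv_rv addr0.
apply/eqP; rewrite -nm_eq0; apply/eqP/le_anti; rewrite nm_ge0 andbT.
apply/ler_addgt0Pl => e e0; rewrite addr0.
have c0 : (T 0 0)%:~R < 0 :> R by rewrite ltrz0.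
have [m mP] := quadratic_exp 0 0 B0 c0 e0.
apply: le_trans (bnd (m%:R ^+ 2) _) _; first exact: sqr_ge0.
by apply: le_trans mP; rewrite mulr0 !add0r [_ * (T 0 0)%:~R]mulrC.
Qed.

Let aN (m : nat) : C := a (const_mx m%:Z).

(** All frequencies are nonnegative and their coefficients are summable at height 0, so the terms
    beyond frequency [m] are dominated by [|ce u| ^ (m + 1)]. *)
Lemma disc_leading : exists2 M : R, 0 <= M & forall m : nat,
  (forall j, (j < m)%N -> aN j = 0) -> forall u, 0 <= Im u ->
  nm (f (z0 + s%:C * ce u) - aN m * ce u ^+ m) <= M * nm (ce u) ^+ m.+1.
Proof.
have [M MP] := fourier_abs one_gt0 disc_per disc_dif disc_bnd disc_conv disc_base disc_base.
have MP' (A : {fset 'rV[int]_1}) : \sum_(T <- A) nm (a T) <= M.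
  apply: le_trans (MP A); apply: ler_sum => T _; rewrite nmM.
  by rewrite dot_row1 [v0 0 0]mxE mulr0 ce0 nm1 mulr1.
exists M => [|m am u u0].
  by apply: le_trans (MP' fset0); rewrite big_seq_fset0.
pose v : 'rV[C]_1 := const_mx u.
have Ov : OmD (imv v) by rewrite /OmD !mxE; apply: lt_le_trans disc_ylow_lt0 u0.
have us := fourier_usum one_gt0 disc_per disc_dif disc_bnd disc_conv disc_base Ov.
have GE : GD v = f (z0 + s%:C * ce u) by rewrite /GD mxE.
have q1 : nm (ce u) <= 1.
  by rewrite nm_ce_le1.
pose Tm : 'rV[int]_1 := const_mx m%:Z.

apply/ler_addgt0Pl => e e0.
have [A0 A0P] := us e e0; pose A := fsetU A0 [fset Tm]%fset.
have := A0P A (fsubsetUl _ _); rewrite GE => h1.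
have TmA : Tm \in A by rewrite in_fsetU in_fset1 eqxx orbT.
have h2 : nm (\sum_(T <- A) fcoef GD v0 T * ce (dot T v) - aN m * ce u ^+ m) <=
    M * nm (ce u) ^+ m.+1.
  rewrite (big_fsetD1 Tm) // -/(a Tm) -/(aN m) dot_row1 [v 0 0]mxE.
  have -> : ce ((Tm 0 0)%:~R * u) = ce u ^+ m by rewrite mxE -ceMn.
  rewrite addrAC subrr add0r; apply: le_trans (nm_sum _ _ _) _.
  apply: le_trans (_ : \sum_(T <- fsetD A [fset Tm]%fset) nm (a T) * nm (ce u) ^+ m.+1 <= _); last first.
    by rewrite -mulr_suml ler_wpM2r ?exprn_ge0 ?nm_ge0 // MP'.
  rewrite !big_seq; apply: ler_sum => T; rewrite in_fsetD1 => /andP[TTm _].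
  rewrite nmM -/(a T) dot_row1 [v 0 0]mxE.
  have [Tneg|Tpos] := ltP (T 0 0) 0; first by rewrite disc_coef_neg // nm0 !mul0r.
  have TE : T = const_mx (`|T 0%R 0%R|%N)%:Z.
    by apply/rowP => j; rewrite !ord1 mxE gez0_abs.
  set k := (`|T 0%R 0%R|%N) in TE.
  have [km|mk|km] := ltngtP k m.
  - by rewrite TE -/(aN k) am // nm0 !mul0r.
  - rewrite ler_wpM2l ?nm_ge0 // TE mxE -pmulrn ceMn nmX.
    by apply: ler_wiXn2l => //; exact: nm_ge0.
  by move: TTm; rewrite TE km eqxx.
have := nm_triangle (f (z0 + s%:C * ce u)) (\sum_(T <- A) fcoef GD v0 T * ce (dot T v)) (aN m * ce u ^+ m).
by rewrite [nm (f _ - \sum_(_ <- _) _)]nmBC; lra.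
Qed.

(** The centre is not of the form [z0 + s ce u]; it is approached as the height tends to infinity,
    by continuity of [f]. *)
Lemma disc_center : f z0 = aN 0.
Proof.
have [M M0 MP] := disc_leading.
apply/eqP; rewrite -subr_eq0 -nm_eq0; apply/eqP/le_anti; rewrite nm_ge0 andbT.
apply/ler_addgt0Pl => e e0; rewrite addr0.
have e2 : 0 < e / 2 by rewrite divr_gt0.
have [|d d0 D] := differentiable_cont (fh (z := z0) _) e2.
  by rewrite subrr nm0; have := s_gt0; have := s_lt; lra.
pose q := Num.min (1 / 2) (Num.min (d / (2 * s)) (e / (2 * (M + 1)))).
have q0 : 0 < q by rewrite !lt_min !divr_gt0 // ?mulr_gt0 //; lra.
have qq : q%:C != 0 by rewrite fmorph_eq0 gt_eqF.
have [u uq] := ce_surj qq.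
have nq : nm (ce u) = q by rewrite uq nmR ger0_norm // ltW.
have u0 : 0 <= Im u.
  have : q <= 1 by apply: le_trans (_ : 1 / 2 <= _); [rewrite ge_min lexx|lra].
  by rewrite -nq nm_ce_le1.
have h := MP 0%N _ u u0; rewrite expr0 mulr1 expr1 nq in h.
have {}h : nm (f (z0 + s%:C * ce u) - aN 0) <= M * q by apply: h.
have qs : q * s < d.
  have : q <= d / (2 * s) by rewrite !ge_min lexx !orbT.
  rewrite ler_pdivlMr ?mulr_gt0 //; have : 0 < q * s by rewrite mulr_gt0.
  lra.
have qM : M * q <= e / 2.
  have : q <= e / (2 * (M + 1)) by rewrite !ge_min lexx !orbT.
  rewrite ler_pdivlMr; last lra.
  by have := q0; nra.
have := D (z0 + s%:C * ce u); rewrite addrC addKr nmM nq nmR ger0_norm ?(ltW s_gt0) // mulrC => /(_ qs) h2.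
have h3 := nm_triangle (f z0) (f (z0 + s%:C * ce u)) (aN 0).
have h4 := nmBC (f z0) (f (z0 + s%:C * ce u)).
have h5 := nmBC (f z0) (aN 0).
by move: h2 h h3 h4 h5 qM; lra.
Qed.

(** The value at the centre is the coefficient of frequency 0, a limit of averages over the
    circle. *)
Lemma disc_max (B : R) : (forall w, nm w = s -> nm (f (z0 + w)) <= B) -> nm (f z0) <= B.
Proof.
move=> fB; rewrite disc_center /aN /a /fcoef.
have := @mlim_le R 1 GD OmD disc_bnd (const_mx 0) v0 B disc_base.
have -> : 2 * pi * dotR (const_mx 0 : 'rV[int]_1) (imv v0) = 0.
  by rewrite /dotR big_ord1 !mxE mulr0 mulr0.
rewrite expR0 mulr1; apply=> x; apply: fB.
by rewrite nmM nmR ger0_norm ?(ltW s_gt0) // nm_ce !mxE /= addr0 mulr0 oppr0 expR0 mulr1.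
Qed.

Lemma disc_zero_or_isolated :
  (forall w, nm w <= s -> f (z0 + w) = 0) \/
  exists2 t : R, 0 < t & forall w, 0 < nm w -> nm w < t -> f (z0 + w) != 0.
Proof.
have [M M0 MP] := disc_leading.
have para w : 0 < nm w -> nm w <= s -> exists2 u, 0 <= Im u & w = s%:C * ce u.
  move=> w0 ws; have sn : s%:C != 0 :> C by rewrite fmorph_eq0 gt_eqF.
  have wn : w / s%:C != 0 by rewrite mulf_neq0 ?invr_neq0 // -nm_gt0.
  have [u uE] := ce_surj wn; exists u; last by rewrite uE mulrC divfK.
  have : nm (ce u) <= 1.
    by rewrite uE nmM nmV nmR ger0_norm ?(ltW s_gt0) // ler_pdivrMr // mul1r.
  by rewrite nm_ce_le1.
have [all0|] := pselect (forall j, aN j = 0).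
  left=> w ws; have [w0|w0] := eqVneq w 0.
    by rewrite w0 addr0 disc_center all0.
  have [u u0 ->] := para w ltac:(by rewrite nm_gt0) ws.
  have q1 : nm (ce u) <= 1.
    by rewrite nm_ce_le1.
  move: w0 ws => _ _.
  (* The boundary case |ce u| = 1 is reached as a limit. *)
  have lt1 u' : 0 < Im u' -> f (z0 + s%:C * ce u') = 0.
    move=> u'0; have q1' : nm (ce u') < 1.
      by rewrite nm_ce_lt1.
    have q0' : 0 < nm (ce u') by rewrite nm_gt0 ce_neq0.
    apply/eqP; rewrite -nm_eq0; apply/eqP/le_anti; rewrite nm_ge0 andbT.
    apply/ler_addgt0Pl => e e0; rewrite addr0.
    have [N0 /(_ N0 (leqnn _)) h] := poly_geom_cvg 0 q0' q1' M0 e0.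
    have := MP N0 (fun j _ => all0 j) u' (ltW u'0); rewrite all0 mul0r subr0 => h2.
    apply: le_trans h2 _; apply: le_trans _ h; rewrite expr0 mul1r ler_wpM2l //.
    by rewrite exprS ler_piMl ?exprn_ge0 // ltW.
  have [uz|] := ltP 0 (Im u); first exact: lt1.
  move=> u0'; have uz : Im u = 0 by apply/le_anti; rewrite u0 u0'.
  apply/eqP; rewrite -nm_eq0; apply/eqP/le_anti; rewrite nm_ge0 andbT.
  apply/ler_addgt0Pl => e e0; rewrite addr0.
  have rr : nm (z0 + s%:C * ce u - z0) < r.
    rewrite addrC addKr; apply: le_lt_trans (disc_rad _) _; first by rewrite uz; exact: disc_ylow_lt0.
    by rewrite /s'; have := s_lt; lra.
  have [d d0 D] := differentiable_cont (fh rr) e0.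
  have ds : 0 < d / s by rewrite divr_gt0.
  have [d1 d10 D1] := differentiable_cont (@differentiable_ce R u) ds.
  pose u' := u + (0 +i* (d1 / 2)).
  have := D (z0 + s%:C * ce u'); rewrite lt1 ?sub0r ?nmN; last first.
    by rewrite /u' cImD uz /= add0r divr_gt0.
  move=> h; apply/ltW/h; rewrite opprD addrACA subrr add0r -mulrBr nmM nmR ger0_norm ?(ltW s_gt0) //.
  rewrite mulrC -ltr_pdivlMr //; apply: D1; rewrite /u' addrC addKr.
  by rewrite nmE /= expr0n add0r sqrtr_sqr ger0_norm ?divr_ge0 ?(ltW d10) //; lra.
move=> /existsNP[j0 j0n]; right.
have ex : exists j, aN j != 0 by exists j0; apply/eqP.
pose m := ex_minn ex; have [mn mmin] : aN m != 0 /\ forall j, (j < m)%N -> aN j = 0.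
  rewrite /m; case: ex_minnP => k kn kP; split=> // j jk; apply/eqP; apply: contraTT jk => /kP.
  by rewrite -leqNgt.
have b0 : 0 < nm (aN m) by rewrite nm_gt0.
pose t := Num.min s (s * nm (aN m) / (M + 1)).
have t0 : 0 < t by rewrite lt_min s_gt0 divr_gt0 ?mulr_gt0 //; lra.
exists t => // w w0 wt; have ws : nm w <= s by apply/ltW/(lt_le_trans wt); rewrite ge_min lexx.
have [u u0 wE] := para w w0 ws.
have h := MP m mmin u u0; apply/eqP => fz; move: h; rewrite -wE fz sub0r nmN nmM nmX.
rewrite exprS mulrA ler_pM2r ?exprn_gt0 ?nm_gt0 ?ce_neq0 // => h.
have : nm w < s * nm (aN m) / (M + 1) by apply: lt_le_trans wt _; rewrite ge_min lexx orbT.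
rewrite ltr_pdivlMr; last lra.
rewrite wE nmM nmR ger0_norm ?(ltW s_gt0) // -mulrA ltr_pM2l // => h3.
have := nm_ge0 (ce u); nra.
Qed.

End Disc.

Definition locally_zero f z := exists2 t : R, 0 < t & forall w, nm w < t -> f (z + w) = 0.

Lemma zero_or_isolated f z0 (r : R) : 0 < r -> holo_disc f z0 r -> locally_zero f z0 \/
  exists2 t : R, 0 < t & forall w, 0 < nm w -> nm w < t -> f (z0 + w) != 0.
Proof.
move=> r0 fh; have s0 : 0 < r / 2 by rewrite divr_gt0.
have sr : r / 2 < r by lra.
have [h|h] := disc_zero_or_isolated s0 sr fh; [left|by right].
by exists (r / 2) => // w /ltW; exact: h.
Qed.

Lemma holo_disc_sub f z0 (r : R) (c : C) : holo_disc f z0 r -> holo_disc (fun z => f z - c) z0 r.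
Proof. by move=> fh z /fh df; apply: differentiableB => //; exact: differentiable_cst. Qed.

(** If [c] were omitted, [1 / (f - c)] would break the maximum principle: on a small circle
    [|f - f z0| >= mu], hence [|f - c| >= mu / 2], whereas [|f z0 - c| < mu / 2] at the centre. *)
Lemma open_mapping f z0 (r s : R) : 0 < r -> 0 < s -> holo_disc f z0 r ->
  ~ locally_zero (fun z => f z - f z0) z0 ->
  exists2 d : R, 0 < d & forall c, nm (c - f z0) < d -> exists2 w, nm w < s & f (z0 + w) = c.
Proof.
move=> r0 s0 fh nz; have fh' := @holo_disc_sub f z0 r (f z0) fh.
have [//|[t t0 tP]] := zero_or_isolated r0 fh'.
pose q := Num.min r (Num.min s t); have q0 : 0 < q by rewrite !lt_min r0 s0 t0.
have qr : q <= r by rewrite ge_min lexx.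
have qs : q <= s by rewrite !ge_min lexx !orbT.
have qt : q <= t by rewrite !ge_min lexx !orbT.
pose h := q / 2; have h0 : 0 < h by rewrite divr_gt0.
have hq : h < q by rewrite /h; lra.
have circ : compact [set w : C | nm w = h].
  have -> : [set w : C | nm w = h] = [set w : C | nm w <= h] `&` [set w : C | h <= nm w].
    by apply/seteqP; split=> w /=; [move=> ->; rewrite lexx|move=> [h1 h2]; apply/le_anti/andP].
  apply: compact_closedI; first exact: compact_disc.
  apply: (@closed_comp _ _ (@nm R) [set x : R | h <= x]); first by move=> x _; exact: continuous_nm.
  exact: closed_ge.
have [|||w0 w0P wmin] := @compact_EVT_min _ R (fun w => nm (f (z0 + w) - f z0)) [set w : C | nm w = h].
- exists h%:C => /=; have := nmR h; rewrite (ger0_norm (ltW h0)); exact.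
- exact: circ.
- apply: continuous_in_subspaceT => w; rewrite inE /= => ws P /nbhs_real[e e0 H].
  have [|d d0 D] := differentiable_cont (fh (z0 + w) _) e0.
    by rewrite addrC addKr ws; apply: lt_le_trans hq qr.
  apply/nbhs_nm; exists d => // w' ww'; apply: H.
  apply: le_lt_trans (D (z0 + w') _); last by rewrite opprD addrACA subrr add0r nmBC.
  have := le_nmB (f (z0 + w) - f z0) (f (z0 + w') - f z0).
  have := le_nmB (f (z0 + w') - f z0) (f (z0 + w) - f z0).
  have -> : f (z0 + w') - f z0 - (f (z0 + w) - f z0) = f (z0 + w') - f (z0 + w) by ring.
  have -> : f (z0 + w) - f z0 - (f (z0 + w') - f z0) = - (f (z0 + w') - f (z0 + w)) by ring.
  by rewrite nmN ler_norml; lra.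
set mu := nm (f (z0 + w0) - f z0) in wmin.
have mu0 : 0 < mu.
  move: w0P; rewrite inE /= => w0h; rewrite nm_gt0; apply: tP; rewrite w0h //.
  by apply: lt_le_trans hq qt.
exists (mu / 2) => [|c cf]; first by rewrite divr_gt0.
apply: contrapT => none.
have nc w : nm w < q -> f (z0 + w) - c != 0.
  move=> wq; apply/negP => /eqP/subr0_eq E; apply: none; exists w => //.
  exact: lt_le_trans wq qs.
have gh : holo_disc (fun z => (f z - c)^-1) z0 q.
  move=> z zq; have df : differentiable (fun z => f z - c) z.
    apply: differentiableB; last exact: differentiable_cst.
    by apply: fh; apply: lt_le_trans zq qr.
  apply: differentiableV => //; by have := nc (z - z0) zq; rewrite [z0 + _]addrC subrK.
have : nm ((f z0 - c)^-1) <= (mu / 2)^-1.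
  apply: (disc_max h0 hq gh) => w wh; rewrite nmV lef_pV2 ?posrE ?divr_gt0 //; last first.
    by rewrite nm_gt0 nc // wh.
  have := wmin w; rewrite inE /= => /(_ wh) hm.
  have := nm_triangle (f (z0 + w)) c (f z0); rewrite nmBC; rewrite nmBC in hm.
  have := nmBC (f z0) (f (z0 + w)); have := nmBC c (f (z0 + w)); lra.
have n0 : 0 < nm (f z0 - c) by rewrite nm_gt0; have := nc 0; rewrite nm0 addr0; apply.
rewrite nmV lef_pV2 ?posrE ?divr_gt0 // leNgt => /negP; apply.
by rewrite nmBC.
Qed.

(** A point is coded by an integer [N] measuring its isolation and by its cell in the grid of side
    [1 / (N + 1)]; two points with the same code are too close to be distinct. *)
Lemma countable_isolated (Z : set C) :
  (forall z, Z z -> exists2 t : R, 0 < t & forall w, 0 < nm w -> nm w < t -> ~ Z (z + w)) ->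
  countable Z.
Proof.
move=> iso; apply/countable_injP.
have /choice[N NP] z : exists n : nat, Z z -> forall w, 0 < nm w -> nm w < 2 / n.+1%:R -> ~ Z (z + w).
  have [Zz|nZ] := pselect (Z z); last by exists 0%N.
  have [t t0 tP] := iso z Zz; exists (Num.trunc (2 / t)) => _ w w0 wt; apply: tP => //.
  apply: lt_trans wt _; have := truncnS_gt (2 / t).
  by rewrite ltr_pdivrMr // ltr_pdivrMr ?ltr0n // mulrC.
pose code z : nat * (int * int) :=
  (N z, (Num.floor ((N z).+1%:R * Re z), Num.floor ((N z).+1%:R * Im z))).
exists (choice.pickle \o code) => z z'; rewrite !inE => Zz Zz' /= /(pcan_inj choice.pickleK) [EN ER EI].
apply/eqP; rewrite -subr_eq0; apply/negP => /negP zz'.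
have n0 : 0 < (N z).+1%:R :> R by rewrite ltr0n.
rewrite -EN in ER EI.
have fl (x y : R) : Num.floor ((N z).+1%:R * x) = Num.floor ((N z).+1%:R * y) ->
    `|x - y| < (N z).+1%:R^-1.
  move=> E; have /andP[h1 h2] := floor_itv ((N z).+1%:R * x).
  have /andP[h3 h4] := floor_itv ((N z).+1%:R * y).
  rewrite E intrD mulr1z in h1 h2; rewrite intrD mulr1z in h4.
  rewrite -(ltr_pM2l n0) mulfV ?gt_eqF // -[X in X * `|_|]ger0_norm ?(ltW n0) // -normrM mulrBr.
  by rewrite ltr_norml; lra.
have := NP z Zz (z' - z); rewrite [z + _]addrC subrK; apply=> //.
  by rewrite nm_gt0 subr_eq0 eq_sym -subr_eq0.
apply: le_lt_trans (nm_le_ReIm _) _; rewrite cReB cImB.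
have h1 := fl _ _ ER; have h2 := fl _ _ EI; rewrite distrC in h1; rewrite distrC in h2.
set k := (N z).+1%:R^-1 in h1 h2 *; lra.
Qed.

(* Vanishing near the points of the segment [z1, z2] is an open and closed
   condition. *)
Lemma half_plane_identity f (Y : R) z1 z2 : (forall z, Y < Im z -> differentiable f z) ->
  Y < Im z1 -> Y < Im z2 -> locally_zero f z1 -> locally_zero f z2.
Proof.
move=> fh Y1 Y2 lz1; pose p (t : R) : C := (1 - t)%:C * z1 + t%:C * z2.
have pY t : 0 <= t <= 1 -> Y < Im (p t).
  move=> /andP[t0 t1]; rewrite /p cImD !cImMR; exact: half_line_convex.
have disc z : Y < Im z -> holo_disc f z (Im z - Y).
  move=> zY w wz; apply: fh; have := nm_Im (w - z); rewrite cImB ler_norml => /andP[h _].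
  by have := wz; lra.
have p1 : p 1 = z2 by rewrite /p subrr mul0r add0r mul1r.
have p0' : p 0 = z1 by rewrite /p subr0 mul0r addr0 mul1r.
rewrite -p1; apply: (@locally_constant_unit R (fun t => locally_zero f (p t))); rewrite ?p0' //.
move=> t t01; have zY := pY t t01.
have r0 : 0 < Im (p t) - Y by rewrite subr_gt0.
have D0 : 0 < nm (z2 - z1) + 1 by have := nm_ge0 (z2 - z1); lra.
have pst s : p s - p t = (s - t)%:C * (z2 - z1) by rewrite /p !rmorphB /= rmorph1; ring.
have near (e : R) : 0 < e -> exists2 d : R, 0 < d & forall s, `|s - t| < d -> nm (p s - p t) < e.
  move=> e0; exists (e / (nm (z2 - z1) + 1)); first by rewrite divr_gt0.
  move=> s; rewrite ltr_pdivlMr // pst nmM nmR => h.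
  by have := normr_ge0 (s - t); have := nm_ge0 (z2 - z1); nra.
have [[e e0 eP]|[e e0 eP]] := zero_or_isolated r0 (disc _ zY).
  have [d d0 dP] := near (e / 2) ltac:(by rewrite divr_gt0).
  exists d => // s s01 /dP h; split=> _; first by exists e.
  exists (e / 2); first by rewrite divr_gt0.
  move=> w we; have -> : p s + w = p t + (p s - p t + w) by ring.
  by apply: eP; apply: le_lt_trans (nmD _ _) _; lra.
have [d d0 dP] := near e e0.
have nlz s : `|s - t| < d -> ~ locally_zero f (p s).
  move=> /dP st [t' t'0 t'P].
  have sn := nm_ge0 (p s - p t).
  pose q := Num.min (t' / 2) ((e - nm (p s - p t)) / 2).
  have q0 : 0 < q by rewrite lt_min !divr_gt0 // subr_gt0.
  have q1 : q < t' by apply: le_lt_trans (_ : t' / 2 < _); [rewrite ge_min lexx|lra].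
  have q2 : q <= (e - nm (p s - p t)) / 2 by rewrite ge_min lexx orbT.
  have key (w : C) : nm w <= q -> p s - p t + w != 0 -> False.
    move=> wq wn; have h1 : f (p s + w) = 0 by apply: t'P; lra.
    have := eP (p s - p t + w); rewrite nm_gt0 wn => /(_ isT).
    have -> : p t + (p s - p t + w) = p s + w by ring.
    rewrite h1 eqxx => H; suff : false by []; apply: H; apply: le_lt_trans (nmD _ _) _; lra.
  have [ps|ps] := eqVneq (p s - p t) 0; last by apply: (key 0); rewrite ?nm0 ?addr0 ?(ltW q0).
  apply: (key q%:C); first by rewrite nmR ger0_norm // ltW.
  by rewrite ps add0r fmorph_eq0 gt_eqF.
exists d => // s _ st; split=> [/(nlz s st)//|].
by move=> h; case: (nlz t) => //; rewrite subrr normr0.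
Qed.

End OneVariable.

(** * Constructible sets over the complex numbers *)

Section Constructible.
Variable R : realType.
Local Notation C := R[i].
Implicit Types (t : seq C -> C) (P : seq C -> Prop).

Definition alg_term t := exists2 T : GRing.term C, GRing.rterm T & forall e, GRing.eval e T = t e.

Definition constructible P :=
  exists2 f : GRing.formula C, GRing.rformula f & forall e, GRing.holds e f <-> P e.

Lemma alg_term_var i : alg_term (fun e => e`_i).
Proof. by exists (GRing.Var C i). Qed.

Lemma alg_term_cst c : alg_term (fun=> c).
Proof. by exists (GRing.Const c). Qed.

Lemma alg_termD t1 t2 : alg_term t1 -> alg_term t2 -> alg_term (fun e => t1 e + t2 e).
Proof.
by move=> [T1 r1 E1] [T2 r2 E2]; exists (GRing.Add T1 T2) => [|e] /=; rewrite ?r1 ?E1 ?E2.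
Qed.

Lemma alg_termM t1 t2 : alg_term t1 -> alg_term t2 -> alg_term (fun e => t1 e * t2 e).
Proof.
by move=> [T1 r1 E1] [T2 r2 E2]; exists (GRing.Mul T1 T2) => [|e] /=; rewrite ?r1 ?E1 ?E2.
Qed.

Lemma alg_termX t k : alg_term t -> alg_term (fun e => t e ^+ k).
Proof. by move=> [T r E]; exists (GRing.Exp T k) => //= e; rewrite E. Qed.

Lemma alg_term_ext t1 t2 : t1 =1 t2 -> alg_term t1 -> alg_term t2.
Proof. by move=> E [T r H]; exists T => // e; rewrite H E. Qed.

Lemma alg_term_sum (I : Type) (r : seq I) (t : I -> seq C -> C) :
  (forall i, alg_term (t i)) -> alg_term (fun e => \sum_(i <- r) t i e).
Proof.
move=> tP; elim: r => [|i r IH].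
  by apply: alg_term_ext (alg_term_cst 0) => e; rewrite big_nil.
by apply: alg_term_ext (alg_termD (tP i) IH) => e; rewrite big_cons.
Qed.

Lemma alg_term_prod (I : Type) (r : seq I) (t : I -> seq C -> C) :
  (forall i, alg_term (t i)) -> alg_term (fun e => \prod_(i <- r) t i e).
Proof.
move=> tP; elim: r => [|i r IH].
  by apply: alg_term_ext (alg_term_cst 1) => e; rewrite big_nil.
by apply: alg_term_ext (alg_termM (tP i) IH) => e; rewrite big_cons.
Qed.

Lemma constructible_ext P Q : (forall e, P e <-> Q e) -> constructible P -> constructible Q.
Proof. by move=> E [f r H]; exists f => // e; rewrite H E. Qed.

Lemma constructible_eq t1 t2 : alg_term t1 -> alg_term t2 -> constructible (fun e => t1 e = t2 e).
Proof.
by move=> [T1 r1 E1] [T2 r2 E2]; exists (GRing.Equal T1 T2) => [|e] /=; rewrite ?r1 ?E1 ?E2.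
Qed.

Lemma constructible_and P Q : constructible P -> constructible Q -> constructible (fun e => P e /\ Q e).
Proof.
by move=> [f1 r1 E1] [f2 r2 E2]; exists (GRing.And f1 f2) => [|e] /=; rewrite ?r1 ?E1 ?E2.
Qed.

Lemma constructible_not P : constructible P -> constructible (fun e => ~ P e).
Proof. by move=> [f1 r1 E1]; exists (GRing.Not f1) => //= e; rewrite E1. Qed.

Lemma constructible_all (T : eqType) (s : seq T) (P : T -> seq C -> Prop) :
  (forall p, constructible (P p)) -> constructible (fun e => forall p, p \in s -> P p e).
Proof.
move=> PP; elim: s => [|p s IH]; first by exists (GRing.Bool true).
apply: constructible_ext (constructible_and (PP p) IH) => e; split=> [[h1 h2] q|h].
  by rewrite inE => /orP[/eqP->|/h2].
by split=> [|q qs]; apply: h; rewrite inE ?eqxx ?qs ?orbT.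
Qed.

(** [e'] may differ from [e] only in the variables listed in [I]: this is existential quantification
    over them. *)
Lemma constructible_ex (I : seq nat) P : constructible P ->
  constructible (fun e => exists2 e', {in [predC I], GRing.same_env e e'} & P e').
Proof.
move=> [f r E]; exists (foldr (@GRing.Exists C) f I); first by elim: I.
by move=> e; rewrite -GRing.foldExistsP; split=> -[e' h1 h2]; exists e' => //; apply/E.
Qed.

Lemma alg_term_poly t k : alg_term t -> exists q : {poly C}, forall x, t (set_nth 0 [::] k x) = q.[x].
Proof.
move=> [T + E]; suff H : GRing.rterm T -> exists q : {poly C},
    forall x, GRing.eval (set_nth 0 [::] k x) T = q.[x].
  by move=> /H[q qP]; exists q => x; rewrite -E.
elim: T {t E} => //=.
- move=> i _; exists (if i == k then 'X else 0) => x; rewrite nth_set_nth /=.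
  by case: eqP; rewrite ?hornerX ?horner0 ?nth_nil.
- by move=> c _; exists c%:P => x; rewrite hornerC.
- by move=> n _; exists n%:R => x; rewrite hornerMn hornerC.
- by move=> T1 IH1 T2 IH2 /andP[/IH1[q1 E1] /IH2[q2 E2]]; exists (q1 + q2) => x; rewrite E1 E2 hornerD.
- by move=> T1 IH1 /IH1[q1 E1]; exists (- q1) => x; rewrite E1 hornerN.
- by move=> T1 IH1 n /IH1[q1 E1]; exists (q1 *+ n) => x; rewrite E1 hornerMn.
- by move=> T1 IH1 T2 IH2 /andP[/IH1[q1 E1] /IH2[q2 E2]]; exists (q1 * q2) => x; rewrite E1 E2 hornerM.
by move=> T1 IH1 n /IH1[q1 E1]; exists (q1 ^+ n) => x; rewrite E1 horner_exp.
Qed.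

(* Quantifier elimination for algebraically closed fields: a constructible
   subset of the line is finite or cofinite. *)
Lemma constructible_line P k : constructible P -> exists2 q : {poly C}, q != 0 &
  exists b : bool, forall x, q.[x] != 0 -> (P (set_nth 0 [::] k x) <-> b).
Proof.
move=> [f fr E].
have wf := @ClosedFieldQE.wf_ex_elim C.
have ho := ClosedFieldQE.holds_ex_elim (@complex_acf_axiom R).
have := GRing.quantifier_elim_wf wf fr; set h := GRing.quantifier_elim _ f => /andP[hq hr].
suff [q q0 [b qb]] : exists2 q : {poly C}, q != 0 & exists b : bool, forall x, q.[x] != 0 ->
    GRing.qf_eval (set_nth 0 [::] k x) h = b.
  exists q => //; exists b => x /qb hx; rewrite -E -hx.
  by split=> /(GRing.quantifier_elim_rformP wf ho _ fr).
have two (op : bool -> bool -> bool) f1 f2 :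
    (exists2 q : {poly C}, q != 0 & exists b : bool, forall x, q.[x] != 0 ->
      GRing.qf_eval (set_nth 0 [::] k x) f1 = b) ->
    (exists2 q : {poly C}, q != 0 & exists b : bool, forall x, q.[x] != 0 ->
      GRing.qf_eval (set_nth 0 [::] k x) f2 = b) ->
    exists2 q : {poly C}, q != 0 & exists b : bool, forall x, q.[x] != 0 ->
      op (GRing.qf_eval (set_nth 0 [::] k x) f1) (GRing.qf_eval (set_nth 0 [::] k x) f2) = b.
  move=> [q1 n1 [b1 P1]] [q2 n2 [b2 P2]]; exists (q1 * q2); first by rewrite mulf_neq0.
  by exists (op b1 b2) => x; rewrite hornerM mulf_eq0 negb_or => /andP[/P1-> /P2->].
elim: h hq hr => //=.
- by move=> b _ _; exists 1; [exact: oner_neq0|exists b].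
- move=> T1 T2 _ /andP[r1 r2].
  have [q1 E1] := @alg_term_poly (fun e => GRing.eval e T1) k (ex_intro2 _ _ T1 r1 (fun=> erefl)).
  have [q2 E2] := @alg_term_poly (fun e => GRing.eval e T2) k (ex_intro2 _ _ T2 r2 (fun=> erefl)).
  have [q12|q12] := eqVneq q1 q2.
    by exists 1; [exact: oner_neq0|exists true => x _; rewrite E1 E2 q12 eqxx].
  exists (q1 - q2); first by rewrite subr_eq0.
  by exists false => x; rewrite hornerD hornerN subr_eq0 E1 E2 => /negbTE.
- by move=> f1 IH1 f2 IH2 /andP[q1 q2] /andP[r1 r2]; exact: (two andb _ _ (IH1 q1 r1) (IH2 q2 r2)).
- by move=> f1 IH1 f2 IH2 /andP[q1 q2] /andP[r1 r2]; exact: (two orb _ _ (IH1 q1 r1) (IH2 q2 r2)).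
- by move=> f1 IH1 f2 IH2 /andP[q1 q2] /andP[r1 r2]; exact: (two implb _ _ (IH1 q1 r1) (IH2 q2 r2)).
- by move=> f1 IH1 q1 r1; exact: (two (fun b _ => ~~ b) _ _ (IH1 q1 r1) (IH1 q1 r1)).
Qed.

Lemma subset_countable (T : Type) (A B : set T) : A `<=` B -> countable B -> countable A.
Proof. by move=> AB; apply: sub_countable; exact: subset_card_le. Qed.

Lemma image_countable (T U : Type) (f : T -> U) (A : set T) : countable A -> countable (f @` A).
Proof. by apply: sub_countable; exact: card_image_le. Qed.

Lemma countableU (T : Type) (A B : set T) : countable A -> countable B -> countable (A `|` B).
Proof.
move=> cA cB; have : countable (\bigcup_(b in [set: bool]) if b then A else B).
  by apply: bigcup_countable => [|[]].
by apply: subset_countable => x [Ax|Bx]; [exists true|exists false].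
Qed.

(** Otherwise [[0, 1]], a set of real parts, would be countable and of Lebesgue measure 0. *)
Lemma uncountable_complex : ~ countable [set: C].
Proof.
move=> cC; have : countable (`[0, 1]%classic : set R).
  by apply: (@subset_countable _ _ (@complex.Re R @` [set: C]) _ (image_countable _ cC)) => x _; exists (x +i* 0).
move=> /countable_lebesgue_measure0; rewrite lebesgue_measure_itv /= lte_fin ltr01 oppr0 adde0.
by move=> /eqP; rewrite eqe oner_eq0.
Qed.

(** In the cofinite case the finitely many exceptions and the countable set would together exhaust
    the complex numbers. *)
Lemma countable_constructible_line P k : constructible P ->
  countable [set x | P (set_nth 0 [::] k x)] ->
  exists r : seq C, forall x, P (set_nth 0 [::] k x) -> x \in r.
Proof.
move=> /(constructible_line k)[q q0 [b qb]] cP.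
have qroots : exists r : seq C, forall x, root q x -> x \in r.
  have [r rE] := closed_field_poly_normal q; exists r => x; rewrite rE rootZ ?lead_coef_eq0 //.
  by rewrite root_prod_XsubC.
have [r rP] := qroots; exists r => x Px; apply: (rP); apply: contraT => /qb[] /(_ Px) bt _.
case: uncountable_complex; rewrite bt in qb.
have : countable ([set x | P (set_nth 0 [::] k x)] `|` [set` r]).
  by apply: countableU => //; apply: finite_set_countable; exact: finite_seq.
apply: subset_countable => y _ /=.
have [/rP|/qb h] := boolP (root q y); first by right.
by left; apply/h.
Qed.

End Constructible.

(** * Countable constructible subsets of projective space *)

Section CountableProjective.
Import -(notations) mpoly.
Variables (R : realType) (N : nat).
Local Notation C := R[i].
Implicit Types V Z X : set (projective_space R N).

Lemma affine_cover (x : projective_space R N) : exists l z, x = affine_chart l z.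
Proof.
have [v xv] : exists v : 'rV[C]_N.+1, \val x = <[v]>%VS.
  have /eqP d1 := valP x; exists (vpick (\val x)); apply/eqP.
  rewrite eq_sym eqEdim -memvE memv_pick dim_vline d1 vpick0 -dimv_eq0 d1; by [].
have v0 : v != 0.
  by apply: contraTneq (valP x) => v0; rewrite xv v0 dim_vline eqxx.
have [l vl] : exists l, v 0 l != 0.
  apply: contrapT => /forallNP h; move/eqP: v0; apply; apply/rowP => l; rewrite mxE.
  by apply/eqP; apply: contraT => /h.
exists l, (\row_k (v 0 (lift l k) / v 0 l)); apply/(affine_chartP _ _ xv); split=> // k.
by rewrite mxE divfK.
Qed.

Lemma affine_chart_inj l : injective (@affine_chart R N l).
Proof.
move=> z z' E; have [h1 h2] := (affine_chartP l z' (erefl (\val (affine_chart l z)))).1 E.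
apply/rowP => k; have := h2 k; rewrite !mxE liftK unlift_none mulr1; by [].
Qed.

Lemma meval_homog (p : mpoly N.+1 C) d (c : C) (v : 'I_N.+1 -> C) : p \is ishomog1 d (@mdeg N.+1) ->
  meval (fun i => c * v i) p = c ^+ d * meval v p.
Proof.
move=> /allP hp; rewrite !mevalE mulr_sumr big_seq [RHS]big_seq; apply: eq_bigr => m /hp /eqP md.
under eq_bigr do rewrite exprMn.
by rewrite big_split /= prodrXr -mdegE md mulrCA.
Qed.

Lemma variety_chart (ps : seq (mpoly N.+1 C)) l z :
  (forall p, p \in ps -> exists d, p \is ishomog1 d (@mdeg N.+1)) ->
  (forall p (v : 'rV[C]_N.+1), p \in ps -> \val (affine_chart l z) = <[v]>%VS ->
           meval (fun i => v 0 i) p = 0) <->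
  forall p, p \in ps -> meval (fun i => affine_vec l z 0 i) p = 0.
Proof.
move=> hom; split=> [h p pps|h p v pps vE]; first exact: h.
have [c cE] : exists c, v = c *: affine_vec l z.
  by apply/vlineP; rewrite (_ : <[_]>%VS = <[v]>%VS) ?memv_line // -vE.
have [d pd] := hom p pps.
have -> : (fun i => v 0 i) = fun i => c * affine_vec l z 0 i by apply/funext => i; rewrite cE mxE.
by rewrite (meval_homog _ _ pd) h // mulr0.
Qed.

Definition hyperplane (a : 'I_N.+1 -> C) : set (projective_space R N) :=
  [set x | exists2 v : 'rV[C]_N.+1, \val x = <[v]>%VS & \sum_i a i * v 0 i = 0].

Lemma hyperplane_chart a l z : hyperplane a (affine_chart l z) <->
  \sum_i a i * affine_vec l z 0 i = 0.
Proof.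
split=> [[v vE av]|h]; last by exists (affine_vec l z).
have /vlineP[c cE] : affine_vec l z \in <[v]>%VS by rewrite -vE memv_line.
transitivity (c * \sum_i a i * v 0 i); last by rewrite av mulr0.
rewrite mulr_sumr; apply: eq_bigr => i _.
by rewrite cE mxE mulrCA.
Qed.

(* The coordinates of a countable constructible subset of affine space are
   constructible and countable subsets of the line, hence finite. *)
Lemma countable_hyperplane_section V X a : projective_variety V -> zariski_open_in V X ->
  countable (X `&` hyperplane a) -> finite_set (X `&` hyperplane a).
Proof.
move=> [ps [hps ->]] [_ [qs [hqs ->]] ->]; set E := (X in countable X) => cE.
pose ez (e : seq C) : 'rV[C]_N := \row_k e`_k.
have affT l i : alg_term (fun e => affine_vec l (ez e) 0 i).
  case: (unliftP l i) => [k ->|->].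
    by apply: alg_term_ext (alg_term_var R k) => e; rewrite !mxE liftK mxE.
  by apply: alg_term_ext (alg_term_cst 1) => e; rewrite !mxE unlift_none.
have mev l p : alg_term (fun e => meval (fun i => affine_vec l (ez e) 0 i) p).
  apply: (@alg_term_ext _ (fun e => \sum_(m <- msupp p) mcoeff m p *
    \prod_(i <- index_enum _) (affine_vec l (ez e) 0 i) ^+ fun_of_multinom m i)).
    by move=> e; rewrite mevalE.
  apply: alg_term_sum => m; apply: alg_termM; first exact: alg_term_cst.
  by apply: alg_term_prod => i; apply: alg_termX.
have Ecd l : constructible (fun e => E (affine_chart l (ez e))).
  have c1 ps' := constructible_all ps' (fun p => constructible_eq (mev l p) (alg_term_cst 0)).
  have c3 : constructible (fun e => \sum_i a i * affine_vec l (ez e) 0 i = 0).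
    apply: constructible_eq (alg_term_cst 0); apply: alg_term_sum => i.
    by apply: alg_termM => //; exact: alg_term_cst.
  apply: constructible_ext (constructible_and (constructible_and (c1 ps) (constructible_not (c1 qs))) c3).
  move=> e; rewrite /E /= -hyperplane_chart -(variety_chart l _ hps) -(variety_chart l _ hqs).
  by split=> -[[h1 h2] h3].
(* The coordinates of a point in the chart [l], with default 0 outside its image; they transport
   countability to the line. *)
pose co l (k : 'I_N) (x : projective_space R N) : C := xget 0 [set z | x = affine_chart l z] 0 k.
have fin l (k : 'I_N) : exists r : seq C, forall z, E (affine_chart l z) -> z 0 k \in r.
  (* Projection to coordinate [k]: the variables below [N] are quantified, and the free variable [N]
     holds the value. *)
  pose P e := (exists2 e', {in [predC iota 0 N], GRing.same_env e e'} &
      E (affine_chart l (ez e')) /\ e'`_k = e'`_N).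
  have PE x : P (set_nth 0 [::] N x) <-> exists2 z, E (affine_chart l z) & z 0 k = x.
    split=> [[e' ee' [Ee' ek]]|[z Ez zx]].
      exists (ez e') => //; rewrite mxE ek -ee' ?nth_set_nth /= ?eqxx //.
      by rewrite inE /= mem_iota add0n ltnn.
    pose e' := rcons [seq z 0 i | i <- enum 'I_N] x; exists e'.
      move=> i; rewrite inE /= mem_iota /= add0n -leqNgt => Ni.
      rewrite nth_set_nth /= nth_rcons size_map size_enum_ord ltnNge Ni /=.
      by case: eqP; rewrite ?nth_nil.
    have e'k (i : 'I_N) : e'`_i = z 0 i.
      by rewrite nth_rcons size_map size_enum_ord ltn_ord (nth_map i) ?size_enum_ord // nth_ord_enum.
    have -> : ez e' = z by apply/rowP => i; rewrite mxE e'k.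
    by rewrite e'k nth_rcons size_map size_enum_ord ltnn eqxx.
  have cP : constructible P.
    apply: constructible_ex; apply: constructible_and => //.
    by apply: constructible_eq; exact: alg_term_var.
  have [|r rP] := countable_constructible_line (k := N) cP.
    apply: subset_countable (image_countable (co l k) cE) => x /= /PE[z Ez zx].
    exists (affine_chart l z) => //; rewrite /co -zx; congr ((_ : 'rV_N) 0 k).
    apply: xget_unique => //= z' /affine_chart_inj; by [].
  by exists r => z Ez; apply/rP/PE; exists z.
have /choice[r' r'P] (lk : 'I_N.+1 * 'I_N) : exists r : seq C,
    forall z, E (affine_chart lk.1 z) -> z 0 lk.2 \in r by exact: fin.
(* A point is recovered from a chart and, for each coordinate, a position in a finite list of
   possible values, so the candidates are finitely many. *)
pose gen (t : 'I_N.+1 * {ffun 'I_N -> 'I_(\max_(lk : 'I_N.+1 * 'I_N) size (r' lk)).+1}) :=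
  affine_chart t.1 (\row_k (r' (t.1, k))`_(t.2 k)).
apply: (@sub_finite_set _ _ (gen @` setT)); last by apply: finite_image; exact: finite_finset.
move=> x Ex; have [l [z xE]] := affine_cover x; rewrite xE in Ex *.
exists (l, [ffun k => inord (index (z 0 k) (r' (l, k)))]) => //.
rewrite /gen /=; congr affine_chart; apply/rowP => k; rewrite mxE ffunE.
have zr := r'P (l, k) z Ex; rewrite inordK ?nth_index //.
by rewrite ltnS; apply: leq_trans (leq_bigmax (F := fun lk => size (r' lk)) (l, k)); rewrite index_size.
Qed.

End CountableProjective.

(** * Fourier series on the half-plane, as terms on strips and at the cusp *)

Section HalfPlaneSeries.
Variable R : realType.
Local Notation C := R[i].
Local Notation Re := (@complex.Re R).
Local Notation Im := (@complex.Im R).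

(** Zero off the half-plane, so that periodicity holds at every point. *)
Definition upper (f : C -> C) (z : C) : C := if 0 < Im z then f z else 0.

Lemma upperE f z : 0 < Im z -> upper f z = f z.
Proof. by rewrite /upper => ->. Qed.

Lemma upper_per f : (forall z, 0 < Im z -> f (z + 1) = f z) ->
  forall z, upper f (z + 1) = upper f z.
Proof. by move=> per z; rewrite /upper cImD /= addr0; case: ifP => // /per. Qed.

Lemma upper_dif f z : 0 < Im z -> differentiable f z -> differentiable (upper f) z.
Proof.
move=> z0 /differentiable_nm[d dP]; apply: (@nm_differentiable _ _ _ d) => eps /dP[del d0 H].
exists (Num.min del (Im z)) => [|h]; first by rewrite lt_min d0.
rewrite lt_min => /andP[h1 h2]; rewrite !upperE //; first exact: H.
by rewrite cImD; have := nm_Im h; rewrite ler_norml => /andP[h3 h4]; lra.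
Qed.

Variable f : C -> C.
Hypothesis f_per : forall z, f (z + 1) = f z.
Hypothesis f_dif : forall z, 0 < Im z -> differentiable f z.

Lemma per_int z (m : int) : f (z + m%:~R) = f z.
Proof.
have pn (n : nat) w : f (w + n%:R) = f w.
  by elim: n => [|n IH]; rewrite ?addr0 // -natr1 addrA f_per.
case: m => n; first exact: pn.
by rewrite NegzE mulrNz -[in RHS](subrK (n.+1)%:R z) pn.
Qed.

Let G (v : 'rV[C]_1) : C := f (v 0 0).
Let Om (Y : 'rV[R]_1) : Prop := 0 < Y 0 0.
Let v0 : 'rV[C]_1 := const_mx (0 +i* 1).
Let one_gt0 : (0 < 1)%N := isT.

Lemma half_per v l : G (v + ev_ R l) = G v.
Proof. by rewrite /G !mxE ord1 !eqxx /= f_per. Qed.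

Lemma half_dif v l (u : C) : Om (imv (v + u *: ev_ R l)) ->
  differentiable (fun u : C => G (v + u *: ev_ R l)) u.
Proof.
rewrite /Om !mxE [l]ord1 !eqxx /= => O.
have -> : (fun u : C => G (v + u *: ev_ R 0)) = f \o (fun u => v 0 0 + u * 1).
  by apply/funext => w; rewrite /G /= !mxE !eqxx.
by apply: differentiable_comp; [exact: differentiable_affine|exact: f_dif].
Qed.

Lemma half_bnd Y : Om Y -> exists eps M : R, 0 < eps /\
  forall v : 'rV[C]_1, (forall k, `|Im (v 0 k) - Y 0 k| <= eps) -> Om (imv v) /\ nm (G v) <= M.
Proof.
rewrite /Om; set y := Y 0 0 => y0.
pose K := [set z : C | 0 <= Re z <= 1 /\ y / 2 <= Im z <= 3 * y / 2].
have [|||c _ cP] := @compact_EVT_max _ R (fun z => nm (f z)) K.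
- by exists (0 +i* y); split=> /=; [rewrite lexx ler01|lra].
- exact: compact_rectangle.
- apply: continuous_in_subspaceT => z; rewrite inE => -[_ /= zy].
  have z0 : 0 < Im z by lra.
  exact: (continuous_comp (differentiable_continuous (f_dif z0)) (@continuous_nm R _)).
exists (y / 2), (nm (f c)); split=> [|v /(_ 0)]; first by rewrite divr_gt0.
rewrite -/y ler_norml => /andP[h1 h2]; split; first by rewrite mxE; lra.
rewrite /G -(per_int _ (- Num.floor (Re (v 0 0)))); apply: cP; rewrite inE; split.
  rewrite cReD cRe_int rmorphN /=; have /andP[h3 h4] := floor_itv (Re (v 0 0)).
  by rewrite intrD mulr1z in h4; lra.
by rewrite cImD cIm_int addr0; lra.
Qed.

Lemma half_conv Y Y' (t : R) : Om Y -> Om Y' -> 0 <= t <= 1 -> Om ((1 - t) *: Y + t *: Y').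
Proof. by rewrite /Om !mxE => h1 h2 /andP[t0 t1]; exact: half_line_convex. Qed.

Lemma half_base : Om (imv v0). Proof. by rewrite /Om !mxE /=. Qed.

Let coef (T : 'rV[int]_1) : C := fcoef G v0 T.

Lemma half_abs (y : R) : 0 < y -> exists M, forall A : {fset 'rV[int]_1},
  \sum_(T <- A) nm (coef T) * expR (- (2 * pi * ((T 0 0)%:~R * y))) <= M.
Proof.
move=> y0; pose v : 'rV[C]_1 := const_mx (0 +i* y).
have Ov : Om (imv v) by rewrite /Om !mxE.
have [M MP] := fourier_abs one_gt0 half_per half_dif half_bnd half_conv half_base Ov.
exists M => A; apply: le_trans (MP A); apply: ler_sum => T _.
by rewrite nmM nm_ce_dotR /dotR big_ord1 !mxE.
Qed.

Lemma half_usum z : 0 < Im z -> usum (fun T => coef T * ce ((T 0 0)%:~R * z)) (f z).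
Proof.
move=> z0; pose v : 'rV[C]_1 := const_mx z.
have Ov : Om (imv v) by rewrite /Om !mxE.
have := fourier_usum one_gt0 half_per half_dif half_bnd half_conv half_base Ov.
rewrite /G mxE; apply: usum_eq => T; by rewrite dot_row1 mxE.
Qed.

Lemma cusp_coef B (T : 'rV[int]_1) : (forall z, 0 < Im z -> nm (f z) <= B) -> T 0 0 < 0 -> coef T = 0.
Proof.
move=> f_bnd T0; have B0 : 0 <= B by exact: le_trans (nm_ge0 _) (f_bnd (0 +i* 1) ltr01).
have bnd (y : R) : 0 < y -> nm (coef T) <= B * expR (2 * pi * ((T 0 0)%:~R * y)).
  move=> y0; pose v : 'rV[C]_1 := const_mx (0 +i* y).
  have Ov : Om (imv v) by rewrite /Om !mxE.
  rewrite /coef /fcoef -(mavg_const half_per half_dif half_bnd half_conv T half_base Ov).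
  have -> : (T 0 0)%:~R * y = dotR T (imv v) by rewrite /dotR big_ord1 !mxE.
  apply: (mlim_le half_bnd) => // x; apply: f_bnd.
  by rewrite !mxE cImD /= addr0.
apply/eqP; rewrite -nm_eq0; apply/eqP/le_anti; rewrite nm_ge0 andbT.
apply/ler_addgt0Pl => e e0; rewrite addr0.
have c0 : (T 0 0)%:~R < 0 :> R by rewrite ltrz0.
have [m mP] := quadratic_exp (T 0 0)%:~R 0 B0 c0 e0.
apply: le_trans (bnd (1 + m%:R ^+ 2) _) _; first by rewrite ltr_pwDl // sqr_ge0.
suff -> : (T 0 0)%:~R * (1 + m%:R ^+ 2) = (T 0 0)%:~R + m%:R * 0 + m%:R ^+ 2 * (T 0 0)%:~R :> R by [].
by ring.
Qed.

Lemma half_plane_series : exists a : 'rV[int]_1 -> C,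
  [/\ forall y : R, 0 < y -> exists M, forall A : {fset 'rV[int]_1},
        \sum_(T <- A) nm (a T) * expR (- (2 * pi * ((T 0 0)%:~R * y))) <= M,
      forall z, 0 < Im z -> usum (fun T => a T * ce ((T 0 0)%:~R * z)) (f z)
    & forall B (T : 'rV[int]_1), (forall z, 0 < Im z -> nm (f z) <= B) -> T 0 0 < 0 -> a T = 0].
Proof. by exists coef; split; [exact: half_abs|exact: half_usum|exact: cusp_coef]. Qed.

Lemma absz_natr (V : pzRingType) (n : int) : 0 <= n -> (`|n|%N)%:R = n%:~R :> V.
Proof. by case: n. Qed.

Lemma absz_natrN (V : pzRingType) (n : int) : n < 0 -> (`|n|%N)%:R = - n%:~R :> V.
Proof. by case: n => // n _; rewrite NegzE mulrNz opprK. Qed.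

Section Strip.
Variables (m : nat) (zw : 'rV[C]_m -> C) (A c1 c2 : R).
Hypothesis zwc : cterm zw.
Hypothesis c1_gt0 : 0 < c1.

(* The nonnegative Fourier modes are powers of q = e(z) and the negative ones
   are powers of e(i h - z); on the strip both are bounded away from 1. *)
Lemma strip_term : exists2 p : 'rV[C]_m -> C, cterm p & forall w,
  `|Re (zw w)| <= A -> c1 <= Im (zw w) -> Im (zw w) <= c2 -> p w = f (zw w).
Proof.
have [a [half_abs half_usum _]] := half_plane_series.
(* [h] exceeds the heights of the strip by at least 1, so that [i h - z] has imaginary part at least
   1. *)
pose h := `|c2| + 1; have h0 : 0 < h by rewrite ltr_wpDl.
have tp := two_pi_gt0 R.
pose z (l : 'I_2) w := if l == ord0 then zw w else (0 +i* h) + (-1) * zw w.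
pose b (T : 'rV[int]_1) := if 0 <= T 0 0 then a T else a T * ce ((T 0 0)%:~R * (0 +i* h)).
pose al (T : 'rV[int]_1) (l : 'I_2) : nat :=
  if (l == ord0) == (0 <= T 0 0) then `|(T 0%R 0%R)|%N else 0%N.
have c0 : 0 < Num.min c1 1 by rewrite lt_min c1_gt0 ltr01.
have al0 T : al T ord0 = if 0 <= T 0 0 then `|(T 0%R 0%R)|%N else 0%N.
  by rewrite /al eqxx; case: leP.
have al1 T : al T (lift ord0 ord0) = if 0 <= T 0 0 then 0%N else `|(T 0%R 0%R)|%N.
  by rewrite /al; case: leP.
have z1 w : z (lift ord0 ord0) w = (0 +i* h) + (-1) * zw w by [].
have z0' w : z ord0 w = zw w by [].
clearbody al; have zc l : cterm (z l).
  rewrite /z; case: eqP => // _; apply: ctermD; first exact: cterm_cst.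
  by apply: ctermM => //; exact: cterm_cst.
have abs (rho : 'I_2 -> R) : (forall l, 0 < rho l < 1) -> exists M : R,
    forall B : {fset 'rV[int]_1}, \sum_(T <- B) nm (b T) * \prod_l rho l ^+ al T l <= M.
  move=> rP; pose r0 := rho ord0; pose r1 := rho (lift ord0 ord0).
  have /andP[r00 r01] : 0 < r0 < 1 by exact: rP.
  have /andP[r10 r11] : 0 < r1 < 1 by exact: rP.
  (* Enlarging the second radius preserves upper bounds and keeps the corresponding height [y2] at
     least [h / 2], inside the half-plane. *)
  pose r := Num.max r1 (expR (- (2 * pi * (h / 2)))).
  have rr0 : 0 < r by rewrite lt_max r10.
  have rr1 : r < 1.
    rewrite gt_max r11 /= expR_lt1 oppr_lt0 mulr_gt0 // divr_gt0 //.
  pose y1 := - ln r0 / (2 * pi); have y10 : 0 < y1 by rewrite divr_gt0 // oppr_gt0 ln_lt0 // r00.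
  pose y2 := h + ln r / (2 * pi).
  have y20 : 0 < y2.
    have : - (2 * pi * (h / 2)) <= ln r.
      by rewrite -[leLHS]expRK ler_ln ?posrE ?expR_gt0 // le_max lexx orbT.
    have -> : ln r = ln r / (2 * pi) * (2 * pi) by rewrite divfK // gt_eqF.
    rewrite /y2; move: (ln r / (2 * pi)) => x hx.
    have : 0 <= 2 * pi * (h / 2 + x) by lra.
    by rewrite pmulr_rge0 //; lra.
  have [M1 MP1] := half_abs _ y10; have [M2 MP2] := half_abs _ y20.
  exists (M1 + M2) => B; apply: le_trans (lerD (MP1 B) (MP2 B)); rewrite -big_split /=.
  apply: ler_sum => T _; rewrite !big_ord_recl big_ord0 mulr1 -/r0 -/r1 /b al0 al1.
  have E1 := expR_ge0 (- (2 * pi * ((T 0 0)%:~R * y1))).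
  have E2 := expR_ge0 (- (2 * pi * ((T 0 0)%:~R * y2))).
  have nT := nm_ge0 (a T).
  case: (leP 0 (T 0 0)) => T0.
    rewrite expr0 mulr1 ler_wpDr ?mulr_ge0 // ler_wpM2l // le_eqVlt; apply/orP; left; apply/eqP.
    rewrite -[in LHS](lnK (x := r0)) ?posrE // -expRM_natl; congr expR.
    rewrite absz_natr //.
    have : ln r0 = - (y1 * (2 * pi)) by rewrite /y1 divfK ?gt_eqF // opprK.
    by move=> ->; ring.
  rewrite expr0 mul1r ler_wpDl ?mulr_ge0 // nmM -mulrA ler_wpM2l //.
  apply: le_trans (_ : nm (ce ((T 0 0)%:~R * (0 +i* h))) * r ^+ `|(T 0%R 0%R)|%N <= _).
    rewrite ler_wpM2l ?nm_ge0 // lerXn2r ?nnegrE ?(ltW r10) ?(ltW rr0) //.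
    by rewrite le_max lexx.
  rewrite le_eqVlt; apply/orP; left; apply/eqP.
  rewrite nm_ce -[in LHS](lnK (x := r)) ?posrE // -expRM_natl -expRD; congr expR.
  rewrite absz_natrN //.
  rewrite cImMi /=.
  have -> : ln r = (y2 - h) * (2 * pi) by rewrite /y2 addrC addKr divfK ?gt_eqF.
  by ring.
have [p pc pP] := cterm_series A c0 abs zc; exists p => // w wA w1 w2.
have zA l : `|Re (z l w)| <= A /\ Num.min c1 1 <= Im (z l w).
  rewrite /z; case: eqP => _; first by rewrite ge_min w1.
  rewrite cReD cImD mulN1r cReN cImN /= add0r normrN ge_min; split=> //.
  by apply/orP; right; have := ler_norm c2; rewrite /h; lra.
have z0 : 0 < Im (zw w) by exact: lt_le_trans c1_gt0 w1.
apply: usum_unique (pP w zA) _; apply: usum_eq (half_usum _ z0) => T.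
rewrite !big_ord_recl big_ord0 mulr1 /b al0 al1 z1 z0'.
case: (leP 0 (T 0 0)) => T0.
  rewrite mul0r ce0 mulr1 absz_natr //.
rewrite mul0r ce0 mul1r -mulrA -ceD; congr (_ * ce _).
rewrite absz_natrN //.
by ring.
Qed.

End Strip.

Section Cusp.
Variable B : R.
Hypothesis f_bnd : forall z, 0 < Im z -> nm (f z) <= B.

(** Boundedness removes the negative frequencies, so the single variable [ce z] suffices and the
    height may be unbounded. *)
Lemma cusp_term m (zw : 'rV[C]_m -> C) (A c : R) : cterm zw -> 0 < c ->
  exists2 p : 'rV[C]_m -> C, cterm p & forall w,
  `|Re (zw w)| <= A -> c <= Im (zw w) -> p w = f (zw w).
Proof.
move=> zwc c0; pose al (T : 'rV[int]_1) (l : 'I_1) : nat := `|(T 0%R 0%R)|%N.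
have [a [half_abs half_usum coef0]] := half_plane_series.
have tp := two_pi_gt0 R.
have coefE (T : 'rV[int]_1) : a T = 0 \/ 0 <= T 0 0.
  by have [T0|T0] := ltP (T 0 0) 0; [left; exact: coef0 f_bnd T0|right].
have abs (rho : 'I_1 -> R) : (forall l, 0 < rho l < 1) -> exists M : R,
    forall E : {fset 'rV[int]_1}, \sum_(T <- E) nm (a T) * \prod_l rho l ^+ al T l <= M.
  move=> rP; pose r0 := rho ord0; have /andP[r00 r01] : 0 < r0 < 1 by exact: rP.
  pose y1 := - ln r0 / (2 * pi); have y10 : 0 < y1 by rewrite divr_gt0 // oppr_gt0 ln_lt0 // r00.
  have [M MP] := half_abs _ y10; exists M => E; apply: le_trans (MP E); apply: ler_sum => T _.
  rewrite big_ord1 -/r0 /al; have [->|T0] := coefE T; first by rewrite nm0 !mul0r.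
  rewrite ler_wpM2l ?nm_ge0 // le_eqVlt; apply/orP; left; apply/eqP.
  rewrite -[in LHS](lnK (x := r0)) ?posrE // -expRM_natl; congr expR.
  rewrite absz_natr //.
  have : ln r0 = - (y1 * (2 * pi)) by rewrite /y1 divfK ?gt_eqF // opprK.
  by move=> ->; ring.
have [p pc pP] := cterm_series A c0 abs (fun=> zwc); exists p => // w wA wc.
have z0 : 0 < Im (zw w) by lra.
apply: usum_unique (pP w (fun=> conj wA wc)) _; apply: usum_eq (half_usum _ z0) => T.
rewrite big_ord1 /al; have [->|T0] := coefE T; first by rewrite !mul0r.
by rewrite absz_natr.
Qed.

End Cusp.
End HalfPlaneSeries.

(** A synonym of the real plane that carries at once the normed and the complete structure asked for
    by [Baire]. *)
Definition real_plane (R : realType) : Type := 'rV[R]_2.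
HB.instance Definition _ (R : realType) := NormedModule.on (real_plane R).
HB.instance Definition _ (R : realType) := Complete.on (real_plane R).

(** * Omitted discs by Baire's theorem *)

Section OmittedValue.
Variable R : realType.
Local Notation C := R[i].
Local Notation Re := (@complex.Re R).
Local Notation Im := (@complex.Im R).

Lemma seq_bound (T : eqType) (s : seq T) (L : T -> R) : exists2 B : R, 0 <= B & forall x, x \in s -> L x <= B.
Proof.
elim: s => [|x s [B B0 BP]]; first by exists 0.
exists (Num.max B (L x)) => [|y]; first by rewrite le_max B0.
rewrite inE le_max => /orP[/eqP->|/BP->//]; by rewrite lexx orbT.
Qed.

(* Otherwise q takes, by the open mapping theorem, values in a dense open set
   on each half-plane, hence some value at points of arbitrarily large height. *)
Lemma omitted_disc (q : C -> C) (Y0 : R) : (forall z, Y0 < Im z -> differentiable q z) ->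
  (forall c, (forall z, Y0 < Im z -> q z = c) \/ exists Y, forall z, Y < Im z -> q z != c) ->
  exists c eps Y, [/\ 0 < eps, Y0 <= Y & forall z, Y < Im z -> eps <= nm (q z - c)].
Proof.
move=> qd qv; have [[c qc]|ncst] := pselect (exists c, forall z, Y0 < Im z -> q z = c).
  exists (c - 1), 1, Y0; split=> // z /qc ->; rewrite opprB addrC subrK nm1; by [].
apply: contrapT => none.
have cls (c : C) (eps Y : R) : 0 < eps -> Y0 <= Y -> exists2 z, Y < Im z & nm (q z - c) < eps.
  move=> e0 YY; apply: contrapT => /forall2NP h; apply: none; exists c, eps, Y; split=> // z zY.
  by have [//|/negP] := h z; rewrite -leNgt.
have nloc z : Y0 < Im z -> ~ locally_zero (fun w => q w - q z) z.
  move=> zY lz; apply: ncst; exists (q z) => w wY; apply/subr0_eq.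
  have [w' w'Y|t t0 tP] := @half_plane_identity R (fun w => q w - q z) Y0 z w _ zY wY lz.
    by apply: differentiableB; [exact: qd|exact: differentiable_cst].
  by have := tP 0; rewrite nm0 addr0; apply.
(* The values taken above height [Y0 + n]: an open set by the open mapping theorem, and dense
   because no disc is omitted. *)
pose D (n : nat) : set (real_plane R) :=
  [set v | exists2 z, Y0 + n%:R < Im z & q z = v 0 0 +i* v 0 1].
have YD n : Y0 <= Y0 + n%:R :> R by rewrite lerDl.
have Dod n : open (D n) /\ dense (D n).
  split.
    rewrite openE => v [z zn zq].
    have zY : Y0 < Im z by apply: le_lt_trans (YD n) zn.
    have s0 : 0 < Im z - (Y0 + n%:R) by rewrite subr_gt0.
    have hd : holo_disc q z (Im z - (Y0 + n%:R)).
      move=> w wz; apply: qd; have := nm_Im (w - z); rewrite cImB ler_norml => /andP[h _].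
      by have := YD n; lra.
    have [d d0 dP] := open_mapping s0 s0 hd (nloc z zY).
    have d2 : 0 < d / 2 by rewrite divr_gt0.
    apply/nbhs_ballP; exists (d / 2) => //= v' [_ vv'].
    have [|w ws qw] := dP (v' 0 0 +i* v' 0 1).
      rewrite zq; apply: le_lt_trans (nm_le_ReIm _) _; rewrite cReB cImB /=.
      have := vv' 0 0; have := vv' 0 1; rewrite /ball /= => h1 h2.
      by rewrite distrC [X in _ + X]distrC; lra.
    exists (z + w) => //; rewrite cImD; have := nm_Im w; rewrite ler_norml => /andP[h _]; lra.
  move=> O [v Ov] oO; have := oO; rewrite openE => /(_ v Ov)/nbhs_ballP[e /= e0 eO].
  have [z zn zq] := cls (v 0 0 +i* v 0 1) e (Y0 + n%:R) e0 (YD n).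
  exists (\row_j (if j == 0 then Re (q z) else Im (q z))); split; last first.
    by exists z => //; rewrite !mxE /=; case: (q z).
  apply: eO; split=> // i j; rewrite (ord1 i) mxE.
  have hr := nm_Re (q z - (v 0 0 +i* v 0 1)); have hi := nm_Im (q z - (v 0 0 +i* v 0 1)).
  rewrite cReB /= in hr; rewrite cImB /= in hi.
  rewrite /ball /= distrC; case: (eqVneq j 0) => [->|j0]; first exact: le_lt_trans hr zq.
  have -> : j = 1 by apply/val_inj; case: j j0 => -[|[|]] //=.
  exact: le_lt_trans hi zq.
have [v [_ vD]] := Baire Dod (ex_intro _ (0 : 'rV[R]_2) I) openT.
have [qc|[Y YP]] := qv (v 0 0 +i* v 0 1); first by apply: ncst; exists (v 0 0 +i* v 0 1).
have [z zn zq] := vD (Num.trunc `|Y - Y0|).+1 I.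
have := YP z; rewrite zq eqxx => h; suff : false by []; apply: h; apply: lt_trans zn.
by have := truncnS_gt `|Y - Y0|; have := ler_norm (Y - Y0); lra.
Qed.

End OmittedValue.

(** * Behaviour of the coordinates at the cusp in genus one *)

Section ModularCurve.
Variables (R : realType) (N : nat).
Local Notation C := R[i].
Local Notation Re := (@complex.Re R).
Local Notation Im := (@complex.Im R).
Variables (F : 'M[C]_1 -> projective_space R N) (k : int) (phi : 'I_N.+1 -> 'M[C]_1 -> C).
Hypothesis phim : forall i, modular_form k (phi i).
Hypothesis Fphi : forall tau, siegel_space tau -> \val (F tau) = <[\row_i phi i tau]>%VS.
Hypothesis Forb : forall tau tau', siegel_space tau -> siegel_space tau' ->
  (F tau = F tau' <-> same_orbit tau tau').
Variable V : set (projective_space R N).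
Hypothesis Vv : projective_variety V.
Hypothesis VX : zariski_open_in V (F @` @siegel_space R 1).

Let l0 : 'I_(sym_dim 1) := enum_rank (sym_pair (0 : 'I_1) 0).
Let f i (u : C) : C := tubefun (phi i) (0 + u *: ev_ R l0).

Lemma siegel_space1 (z : C) : siegel_space (z%:M : 'M[C]_1) <-> 0 < Im z.
Proof.
have q (x : 'cV[R]_1) : (x^T *m map_mx Im (z%:M : 'M[C]_1) *m x) 0 0 = x 0 0 ^+ 2 * Im z.
  by rewrite !mxE big_ord1 !mxE big_ord1 !mxE eqxx mulr1n; ring.
split=> [[_ /(_ (const_mx 1))]|z0].
  rewrite q mxE expr1n mul1r; apply; apply/eqP => /matrixP/(_ 0 0); rewrite !mxE => /eqP.
  by rewrite oner_eq0.
split=> [|x x0]; first by rewrite tr_scalar_mx.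
rewrite q mulr_gt0 // exprn_even_gt0 //=; apply: contraNneq x0 => x0.
by apply/eqP/matrixP => i j; rewrite !ord1 mxE.
Qed.

Lemma sym_mx1 (u : C) : sym_mx (0 + u *: ev_ R l0) = u%:M :> 'M[C]_1.
Proof. by apply/matrixP => i j; rewrite !ord1 !mxE -/l0 !eqxx /= add0r mulr1 mulr1n. Qed.

Lemma Om_line (u : C) : 0 < Im u -> Om (imv (0 + u *: ev_ R l0)).
Proof. by move=> u0; apply/Om_space; rewrite sym_mx1; apply/siegel_space1. Qed.

Lemma curveE i u : 0 < Im u -> f i u = phi i u%:M.
Proof. by move=> u0; rewrite /f tubefunE ?sym_mx1 //; exact: Om_line. Qed.

Lemma curve_per i u : f i (u + 1) = f i u.
Proof. by rewrite /f scalerDl scale1r addrA (tubefun_per (phim i)). Qed.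

Lemma curve_dif i u : 0 < Im u -> differentiable (f i) u.
Proof. by move=> u0; apply: (tubefun_dif (phim i)); exact: Om_line. Qed.

Lemma curve_val u : 0 < Im u -> \val (F u%:M) = <[\row_i f i u]>%VS.
Proof.
move=> u0; rewrite Fphi; last exact/siegel_space1.
by congr (<[_]>%VS); apply/rowP => i; rewrite !mxE curveE.
Qed.

(** For [g = 1] the single pivot of [orbit_pivot_bound] is [Im z] itself. *)
Lemma curve_height (tau : 'M[C]_1) : siegel_space tau -> exists L : R, forall z, 0 < Im z ->
  F z%:M = F tau -> Im z <= L.
Proof.
move=> Ht; have [L LP] := orbit_pivot_bound (isT : (0 < 1)%N) Ht; exists L => z z0 zt.
have [M SM Mz] : same_orbit tau z%:M by apply/Forb => //; exact/siegel_space1.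
apply: (LP M (fun=> Im z) 1%:M SM _ (fun=> z0) _ ord0) => //.
  by split=> [i|i j]; rewrite ?mxE ?eqxx // !ord1 ltnn.
by move=> i j; rewrite -Mz !ord1 /gram big_ord1 !mxE eqxx mulr1n !mulr1.
Qed.

(* The zero set of h has countable image in the quotient, cut out there by a
   hyperplane; hence finite image, and orbits have bounded height. *)
Lemma linear_comb_nonzero (a : 'I_N.+1 -> C) z1 : 0 < Im z1 -> \sum_i a i * f i z1 != 0 ->
  exists2 Y, 0 <= Y & forall z, Y < Im z -> \sum_i a i * f i z != 0.
Proof.
move=> z10 hz1; pose h z := \sum_i a i * f i z.
have hd z : 0 < Im z -> differentiable h z.
  move=> z0; have -> : h = \sum_i (fun z => a i * f i z) by rewrite fct_sumE.
  apply: differentiable_sum => i; apply: differentiableM; first exact: differentiable_cst.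
  exact: curve_dif.
have hdisc z : 0 < Im z -> holo_disc h z (Im z).
  move=> z0 w wz; apply: hd; have := nm_Im (w - z); rewrite cImB ler_norml => /andP[h1 _].
  by have := wz; lra.
have nlz z : 0 < Im z -> ~ locally_zero h z.
  move=> z0 /(half_plane_identity hd z0 z10)[t t0 tP]; move/eqP: hz1; apply.
  by have := tP 0; rewrite nm0 addr0; apply.
pose Z := [set z | 0 < Im z /\ h z = 0].
have cZ : countable Z.
  apply: countable_isolated => z [z0 hz]; have [/(nlz z z0)//|[t t0 tP]] := zero_or_isolated z0 (hdisc z z0).
  by exists t => // w w0 wt [_ hw]; have := tP w w0 wt; rewrite hw eqxx.
have EZ : F @` @siegel_space R 1 `&` hyperplane a `<=` (fun z => F z%:M) @` Z.
  move=> _ [[tau Ht <-] [v vE va]]; pose z := tau 0 0.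
  have tz : tau = z%:M by rewrite [tau]mx11_scalar.
  have z0 : 0 < Im z by apply/siegel_space1; rewrite -tz.
  exists z; rewrite ?tz //; split=> //.
  have /vlineP[c cE] : \row_i f i z \in <[v]>%VS by rewrite -vE tz curve_val // memv_line.
  transitivity (c * \sum_i a i * v 0 i); last by rewrite va mulr0.
  rewrite mulr_sumr; apply: eq_bigr => i _.
  by have /rowP/(_ i) := cE; rewrite !mxE => ->; rewrite mulrCA.
have fin := countable_hyperplane_section Vv VX (subset_countable EZ (image_countable _ cZ)).
have /finite_seqP[s sE] := fin.
have /choice[L LP] (x : projective_space R N) : exists L : R,
    (F @` @siegel_space R 1) x -> forall z, 0 < Im z -> F z%:M = x -> Im z <= L.
  have [[tau Ht <-]|nx] := pselect ((F @` @siegel_space R 1) x); last by exists 0.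
  by have [L LP] := curve_height Ht; exists L.
have [B B0 BP] := seq_bound s L; exists B => [|z zB]; [exact: B0|apply/eqP => hz].
have z0 : 0 < Im z by lra.
have Xz : (F @` @siegel_space R 1) (F z%:M) by exists z%:M => //; exact/siegel_space1.
have : Im z <= L (F z%:M) by exact: LP.
have : L (F z%:M) <= B.
  apply: BP; have : [set` s] (F z%:M); last by [].
  rewrite -sE; split=> //; exists (\row_i f i z); first exact: curve_val.
  by rewrite -[RHS]hz; apply: eq_bigr => i _; rewrite mxE.
lra.
Qed.

Lemma curve_cusp : exists Y1 : R, 0 < Y1 /\ exists psi : 'I_N.+1 -> C -> C,
  [/\ forall i z, psi i (z + 1) = psi i z,
      forall i z, 0 < Im z -> differentiable (psi i) z,
      forall i, exists B : R, forall z, 0 < Im z -> nm (psi i z) <= B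
    & forall z, 0 < Im z -> \val (F (z + (0 +i* Y1))%:M) = <[\row_i psi i z]>%VS].
Proof.
(* Homogeneous coordinates do not vanish together, so some [f j] is nonzero at the point [i]; it
   serves as common denominator at large height. *)
have [j fj] : exists j, f j (0 +i* 1) != 0.
  apply: contrapT => /forallNP h; have := valP (F (0 +i* 1)%:M).
  rewrite curve_val //= dim_vline.
  suff -> : \row_i f i (0 +i* 1) = 0 by rewrite eqxx.
  by apply/rowP => i; rewrite !mxE; apply/eqP; apply: contraT => /h.
have sumj z : \sum_i (i == j)%:R * f i z = f j z.
  by rewrite (bigD1 j) //= eqxx mul1r big1 ?addr0 // => i /negbTE ->; rewrite mul0r.
have [||Y0 Y00 Y0P] := @linear_comb_nonzero (fun i => (i == j)%:R) (0 +i* 1); rewrite ?sumj //.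
have fjn z : Y0 < Im z -> f j z != 0 by move=> /Y0P; rewrite sumj.
pose q i z := f i z / f j z.
have qd i z : Y0 < Im z -> differentiable (q i) z.
  move=> zY; have z0 : 0 < Im z by lra.
  apply: differentiableM; first exact: curve_dif.
  by apply: differentiableV; [exact: curve_dif|exact: fjn].
have qv i c : (forall z, Y0 < Im z -> q i z = c) \/ exists Y, forall z, Y < Im z -> q i z != c.
  (* [(q i - c) * f j] is a linear combination of the coordinates, so [linear_comb_nonzero] keeps a
     nonconstant [q i] away from the value [c] at large height. *)
  have lin z : Y0 < Im z -> (\sum_l ((l == i)%:R - c * (l == j)%:R) * f l z) = (q i z - c) * f j z.
    move=> zY; rewrite mulrBl divfK ?fjn //.
    under eq_bigr do rewrite mulrBl -mulrA.
    rewrite sumrB -mulr_sumr sumj (bigD1 i) //= eqxx mul1r big1 ?addr0 // => l /negbTE ->.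
    by rewrite mul0r.
  have [[z1 z1Y z1q]|nz] := pselect (exists2 z, Y0 < Im z & q i z != c); last first.
    by left=> z zY; apply/eqP; apply: contraT => zq; case: nz; exists z.
  have [||Y Y_0 YP] := @linear_comb_nonzero (fun l => (l == i)%:R - c * (l == j)%:R) z1.
  - by lra.
  - by rewrite lin // mulf_neq0 ?fjn // subr_eq0.
  right; exists (Num.max Y Y0) => z; rewrite gt_max => /andP[zY zY0].
  by have := YP z zY; rewrite (lin z zY0) mulf_eq0 negb_or subr_eq0 => /andP[].
have /choice[c /choice[eps /choice[Y YP]]] i := omitted_disc (qd i) (qv i).
have [B B0 BP] := seq_bound (enum 'I_N.+1) Y.
pose Y1 := Num.max B Y0 + 1; have Y10 : 0 < Y1 by rewrite /Y1 ltr_wpDl // le_max B0.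
pose T z : C := z + (0 +i* Y1).
have TY z : 0 < Im z -> Y0 < Im (T z).
  have : Y0 <= Num.max B Y0 by rewrite le_max lexx orbT.
  by rewrite /T cImD /Y1 /=; lra.
have Te z i : 0 < Im z -> eps i <= nm (q i (T z) - c i).
  move=> z0; have [_ _] := YP i; apply; have := BP i; rewrite mem_enum => /(_ isT).
  have : B <= Num.max B Y0 by rewrite le_max lexx.
  by rewrite /T cImD /Y1 /=; lra.
have e0 i : 0 < eps i by have [] := YP i.
have Tn z i : 0 < Im z -> q i (T z) - c i != 0.
  by move=> z0; rewrite -nm_gt0; apply: lt_le_trans (e0 i) (Te z i z0).
(* All coordinates are multiplied by one factor, so the projective point is unchanged. Since [q i /
   (q i - c i) = 1 + c i / (q i - c i)], the omitted discs bound the product. *)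
pose psi0 i z := q i (T z) * \prod_l (q l (T z) - c l)^-1.
have Td z : differentiable T z.
  have -> : T = fun u => (0 +i* Y1) + u * 1 by apply/funext => u; rewrite /T mulr1 addrC.
  exact: differentiable_affine.
have qTd i z : 0 < Im z -> differentiable (fun z => q i (T z)) z.
  by move=> z0; exact: differentiable_comp (Td z) (qd i (T z) (TY z z0)).
have psid i z : 0 < Im z -> differentiable (psi0 i) z.
  move=> z0; apply: differentiableM; first exact: qTd.
  have H (s : seq 'I_N.+1) : differentiable (fun z => \prod_(l <- s) (q l (T z) - c l)^-1) z.
    elim: s => [|l s IH].
      have -> : (fun z => \prod_(l <- [::]) (q l (T z) - c l)^-1) = fun=> 1.
        by apply/funext => w; rewrite big_nil.
      exact: differentiable_cst.
    have -> : (fun z => \prod_(l0 <- l :: s) (q l0 (T z) - c l0)^-1) =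
        (fun z => (q l (T z) - c l)^-1) * (fun z => \prod_(l <- s) (q l (T z) - c l)^-1).
      by apply/funext => w; rewrite big_cons.
    have d1 := differentiableB (qTd l z z0) (differentiable_cst (c l) z).
    exact: differentiableM (differentiableV d1 (Tn z l z0)) IH.
  exact: H.
have qper i z : q i (T (z + 1)) = q i (T z) by rewrite /q /T addrAC !curve_per.
exists Y1; split=> //; exists (fun i => upper (psi0 i)); split.
- move=> i; apply: upper_per => z _; rewrite /psi0 qper; congr (_ * _).
  by apply: eq_bigr => l _; rewrite qper.
- by move=> i z z0; exact: upper_dif z0 (psid i z z0).
- move=> i; exists ((1 + nm (c i) / eps i) * \prod_(l | l != i) (eps l)^-1) => z z0.
  rewrite upperE // /psi0 (bigD1 i) //= mulrA nmM.
  have le l : nm (q l (T z) - c l)^-1 <= (eps l)^-1.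
    by rewrite nmV lef_pV2 ?posrE ?nm_gt0 ?Tn //; exact: Te.
  apply: ler_pM; rewrite ?nm_ge0 //.
    have -> : q i (T z) / (q i (T z) - c i) = 1 + c i * (q i (T z) - c i)^-1.
      by have := Tn z i z0; move: (q i (T z)) => x xn; field.
    by apply: le_trans (nmD _ _) _; rewrite nm1 nmM lerD2l ler_wpM2l ?nm_ge0.
  by rewrite nm_prod; apply: ler_prod => l _; rewrite nm_ge0 le.
move=> z z0; have Tz0 : 0 < Im (T z) by have := TY z z0; lra.
rewrite curve_val //; pose s := (f j (T z))^-1 * \prod_l (q l (T z) - c l)^-1.
have s0 : s != 0.
  rewrite mulf_neq0 ?invr_neq0 ?fjn //; first exact: TY.
  by rewrite prodf_seq_neq0; apply/allP => l _ /=; rewrite invr_neq0 // Tn.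
have -> : \row_i upper (psi0 i) z = s *: \row_i f i (T z).
  by apply/rowP => i; rewrite !mxE upperE // /psi0 /q /s -!mulrA mulrC -mulrA.
apply/eqP; rewrite eqEsubv -!memvE; apply/andP; split; apply/vlineP.
  by exists s^-1; rewrite scalerA mulVf // scale1r.
by exists s.
Qed.

End ModularCurve.

(** * From finitely many definable charts to the open set [U] *)

Section Assembly.
Variables (R : realType) (g N : nat) (F : 'M[R[i]]_g -> projective_space R N).
Local Notation C := R[i].
Local Notation Re := (@complex.Re R).
Local Notation Im := (@complex.Im R).

(** Quantification over [pr] lets one chart be read in the coordinates of [tau], for openness and
    definability, and in the space holding the graph of [F]. *)
Definition definable_chart (W : set 'M[C]_g) : Prop :=
  [/\ W `<=` @siegel_space R g,
      forall m (pr : 'rV[C]_m -> 'M[C]_g), (forall w, (pr w)^T = pr w) ->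
        (forall a b, cont_term (fun w => Re (pr w a b)) /\ cont_term (fun w => Im (pr w a b))) ->
        def_open (pr @^-1` W)
    & forall m (pr : 'rV[C]_m -> 'M[C]_g), (forall a b, cterm (fun w => pr w a b)) ->
        exists2 p : 'I_N.+1 -> 'rV[C]_m -> C, forall k, cterm (p k) &
        forall w, W (pr w) -> \val (F (pr w)) = <[\row_k p k w]>%VS].

Variables (I : finType) (W : I -> set 'M[C]_g).
Hypothesis W_chart : forall i, definable_chart (W i).
Hypothesis W_fund : forall tau, siegel_fundamental_set tau -> exists i, W i tau.
Hypothesis W_onto : forall tau, siegel_space tau -> exists2 tau', exists i, W i tau' & F tau' = F tau.
Hypothesis Forb : forall tau tau', siegel_space tau -> siegel_space tau' ->
  (F tau = F tau' <-> same_orbit tau tau').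
Hypothesis FX : quasi_projective (F @` @siegel_space R g).

Lemma definable_charts_cover : exists U : set 'M[C]_g,
    [/\ definable_sym U, open_sym U, U `<=` @siegel_space R g
      & @siegel_fundamental_set R g `<=` U] /\
    [/\ definable_restriction F U,
        forall tau tau', U tau -> U tau' -> (F tau = F tau' <-> same_orbit tau tau')
      & quasi_projective (F @` U)].
Proof.
pose U := [set tau | exists i, W i tau]; exists U.
have UH : U `<=` @siegel_space R g by move=> tau [j]; have [h _ _] := W_chart j; exact: h.
have Usym tau : U tau -> tau^T = tau by move=> /UH[].
have dW i : def_open (@sym_mx g C @^-1` W i).
  have [_ h _] := W_chart i; apply: h => [w|a b]; first exact: tr_sym_mx.
  have [h1 h2] := @cont_term_var R _ (enum_rank (sym_pair a b) : 'I_(sym_dim g)).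
  by split; [apply: cont_term_ext h1|apply: cont_term_ext h2] => w; rewrite mxE.
split; split=> //.
- split; first exact: Usym.
  apply: (definableC_ext _ (definableC_ex (fun i => (dW i).1))) => w.
  by split=> -[i Wi]; exists i.
- split; first exact: Usym.
  have -> : @sym_mx g C @^-1` U = \bigcup_(i in [set: I]) (@sym_mx g C @^-1` W i).
    by apply/seteqP; split=> w [j]; [exists j|move=> _ Wj; exists j].
  by apply: bigcup_open => i _; have [] := dW i.
- move=> i; pose pr (w : 'rV[C]_(sym_dim g + N)) := sym_mx (lsubmx w).
  have prE w a b : pr w a b = w 0 (lshift N (enum_rank (sym_pair a b))) by rewrite !mxE.
  have prc a b : cterm (fun w => pr w a b).
    by apply: cterm_ext (cterm_var _ _) => w; rewrite prE.
  have dW2 j : definableC (pr @^-1` W j).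
    have [_ h _] := W_chart j; apply: (h _ pr _ _).1 => [w|a b]; first exact: tr_sym_mx.
    have [h1 h2] := @cont_term_var R _ (lshift N (enum_rank (sym_pair a b) : 'I_(sym_dim g))).
    by split; [apply: cont_term_ext h1|apply: cont_term_ext h2] => w; rewrite prE.
  have G j : definableC [set w | (pr @^-1` W j) w /\
      (F \o pr) w = affine_chart i (\row_k w 0 (rshift (sym_dim g) k))].
    have [_ _ h] := W_chart j; have [p pc pP] := h _ pr prc.
    apply: (definableC_graph i (dW2 j) _ pc) => // k; exact: cterm_var.
  apply: (definableC_ext _ (definableC_ex G)) => w.
  have rE : \row_k w 0 (rshift (sym_dim g) k) = rsubmx w by apply/rowP => k; rewrite !mxE.
  split=> [[j /= [Wj Fj]]|[[j Wj] Fj]]; first by split; [exists j|rewrite -rE].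
  by exists j; split=> //=; rewrite rE.
- by move=> tau tau' /UH h1 /UH h2; exact: Forb.
(* Every orbit meets some [W i], so quasi-projectivity is inherited from the whole image. *)
suff -> : F @` U = F @` @siegel_space R g by [].
apply/seteqP; split=> _ [tau Ht <-]; first by exists tau => //; exact: UH.
by have [tau' Ut' <-] := W_onto Ht; exists tau'.
Qed.

End Assembly.

(** * Charts in genus at least two *)

Section HigherGenus.
Variables (R : realType) (g N : nat) (F : 'M[R[i]]_g -> projective_space R N).
Local Notation C := R[i].
Local Notation Re := (@complex.Re R).
Local Notation Im := (@complex.Im R).
Local Notation mr P := (map_mx (intr : int -> R) P).
Hypothesis g_gt1 : (1 < g)%N.
Variables (k : int) (phi : 'I_N.+1 -> 'M[C]_g -> C).
Hypothesis phim : forall i, modular_form k (phi i).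
Hypothesis Fphi : forall tau, siegel_space tau -> \val (F tau) = <[\row_i phi i tau]>%VS.
Hypothesis Forb : forall tau tau', siegel_space tau -> siegel_space tau' ->
  (F tau = F tau' <-> same_orbit tau tau').

Lemma higher_genus_charts : exists (I : finType) (W : I -> set 'M[C]_g),
  [/\ forall i, definable_chart F (W i),
      forall tau, siegel_fundamental_set tau -> exists i, W i tau
    & forall tau, siegel_space tau -> exists2 tau', exists i, W i tau' & F tau' = F tau].
Proof.
have g0 : (0 < g)%N := ltnW g_gt1.
have [K1 K11 FK] := fundamental_reduced R g.
(* One constant for both reductions: [K1] for the fundamental set, [2 ^ g] for the orbit
   representatives. *)
pose K := Num.max K1 (2 ^+ g).
have K_1 : 1 <= K by rewrite le_max K11.
have mono K' (Y : 'M[R]_g) : K' <= K -> siegel_form K' (4 / 5) Y -> siegel_form K (4 / 5) Y.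
  move=> K'K [d [U [[h1 h2 h3 h4] h5]]]; exists d, U; split=> //; split=> // [i l il|i j].
    by apply: le_trans (h3 i l il) _; rewrite ler_wpM2r // ltW.
  by apply: le_trans (h4 i j) _.
have [|B [c [M [B1 c0 cov]]]] := @siegel_cover R g K (4 / 5) g0 K_1.
  by rewrite divr_gt0.
(* Integers of absolute value at most [M] are coded by ordinals shifted by [M], which makes the
   index set of the pieces a finite type. *)
pose mat (t : {ffun 'I_g * 'I_g -> 'I_(M + M).+1}) : 'M[int]_g :=
  \matrix_(i, j) ((t (i, j))%:Z - M%:Z).
pose I := {t | mr (mat t) \in unitmx}.
have covI tau : tau^T = tau -> (forall i j, `|Re (tau i j)| < 1) ->
    siegel_form K (4 / 5) (map_mx Im tau) -> exists t : I, piece B c (mat (val t)) tau.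
  move=> symt ret /cov[P [PM uP cc]].
  pose t : {ffun 'I_g * 'I_g -> 'I_(M + M).+1} :=
    [ffun ij => inord (absz (P ij.1 ij.2 + M%:Z))].
  have tP : mat t = P.
    apply/matrixP => i j; rewrite mxE ffunE /=; have := PM i j => h.
    rewrite inordK; first by lia.
    by lia.
  have ut : mr (mat t) \in unitmx by rewrite tP.
  by exists (Sub t ut); rewrite SubK tP.
exists I, (fun t => piece B c (mat (val t))); split.
- move=> t; split.
  + move=> tau; apply: piece_space => //; exact: valP t.
  + move=> m pr prs prc; exact: def_open_piece.
  move=> m pr prc.
  have /choice[p pP] i : exists p : 'rV[C]_m -> C, cterm p /\
      forall w, piece B c (mat (val t)) (pr w) -> p w = phi i (pr w).
    have [p pc pP] := piece_term g0 B1 c0 g_gt1 (phim i) (valP t) prc.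
    by exists p.
  exists p => [i|w pw]; first by have [] := pP i.
  rewrite Fphi; last exact: (piece_space g0 B1 c0 (valP t) pw).
  by congr (<[_]>%VS); apply/rowP => i; rewrite !mxE; have [_ ->] := pP i.
- move=> tau /FK[[symt _] ret sf]; apply: covI => //; apply: mono sf; by rewrite le_max lexx.
move=> tau Ht; have [tau' [[symt _] Ft ret sf]] := orbit_reduced Forb g0 Ht.
exists tau' => //; apply: covI => //; apply: mono sf; by rewrite le_max lexx orbT.
Qed.

End HigherGenus.

(** * Charts in genus one *)

Section GenusOne.
Variables (R : realType) (N : nat) (F : 'M[R[i]]_1 -> projective_space R N).
Local Notation C := R[i].
Local Notation Re := (@complex.Re R).
Local Notation Im := (@complex.Im R).
Variables (k : int) (phi : 'I_N.+1 -> 'M[C]_1 -> C).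
Hypothesis phim : forall i, modular_form k (phi i).
Hypothesis Fphi : forall tau, siegel_space tau -> \val (F tau) = <[\row_i phi i tau]>%VS.
Hypothesis Forb : forall tau tau', siegel_space tau -> siegel_space tau' ->
  (F tau = F tau' <-> same_orbit tau tau').
Hypothesis FX : quasi_projective (F @` @siegel_space R 1).

Lemma genus_one_charts : exists (I : finType) (W : I -> set 'M[C]_1),
  [/\ forall i, definable_chart F (W i),
      forall tau, siegel_fundamental_set tau -> exists i, W i tau
    & forall tau, siegel_space tau -> exists2 tau', exists i, W i tau' & F tau' = F tau].
Proof.
have [V Vv VX] := FX.
have [Y1 [Y10 [psi [psi_per psi_dif psi_bnd psiE]]]] := curve_cusp phim Fphi Forb Vv VX.
(* The cusp region and the strip overlap, so both can be open. The bound [1/2] leaves room below the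
   reduction bound [4/5], and the cusp region starts at [Y1 + 1] so that the shifted variable
   [z - i Y1] has height at least 1, the constant given to [cusp_term]. *)
pose W (b : bool) : set 'M[C]_1 := [set tau | `|Re (tau 0 0)| < 1 /\
  if b then is_true (Y1 + 1 < Im (tau 0 0)) else 1 / 2 < Im (tau 0 0) /\ Im (tau 0 0) < Y1 + 2].
have tauE (tau : 'M[C]_1) : tau = (tau 0 0)%:M by rewrite [LHS]mx11_scalar.
have WIm b tau : W b tau -> 0 < Im (tau 0 0) by move=> [_]; case: b => [|[]]; lra.
have WH b : W b `<=` @siegel_space R 1.
  by move=> tau /WIm t0; rewrite [tau]tauE; apply/siegel_space1.
have cov (tau : 'M[C]_1) K : (forall i j, `|Re (tau i j)| < 1) -> siegel_form K (4 / 5) (map_mx Im tau) ->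
    exists b, W b tau.
  move=> ret [d [U [[[U1 _] _ _ _] [d0 Y]]]].
  have I0 : 4 / 5 <= Im (tau 0 0).
    by have := Y 0 0; rewrite mxE /gram big_ord1 U1 !mulr1 => ->; exact: d0.
  have [h|h] := ltP (Y1 + 1) (Im (tau 0 0)); first by exists true.
  by exists false; split=> //; lra.
exists bool, W; split.
- move=> b; split=> //.
  + move=> m pr prs prc; have [cr ci] := prc 0 0.
    have cc (x : R) : cont_term (fun=> x : R) (m := m) by exact: cont_term_cst.
    have d1 := def_open_abs cr (cc 1); case: b.
      by apply: def_open_ext (def_open_and d1 (def_open_lt (cc (Y1 + 1)) ci)) => w.
    by apply: def_open_ext (def_open_and d1 (def_open_and (def_open_lt (cc (1 / 2)) ci)
      (def_open_lt ci (cc (Y1 + 2))))) => w.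
  move=> m pr prc; case: b.
    have zc : cterm (fun w => pr w 0 0 + (0 +i* (- Y1))) by apply: ctermD => //; exact: cterm_cst.
    have /choice[p pP] i : exists p : 'rV[C]_m -> C, cterm p /\ forall w, W true (pr w) ->
        p w = psi i (pr w 0 0 + (0 +i* (- Y1))).
      have [B BP] := psi_bnd i.
      have [p pc pP] := cusp_term (psi_per i) (psi_dif i) BP 1 zc ltr01; exists p; split=> // w [w1 w2].
      by apply: pP; rewrite ?cReD ?cImD /= ?addr0; lra.
    exists p => [i|w Ww]; first by have [] := pP i.
    have -> : \row_i p i w = \row_i psi i (pr w 0 0 + (0 +i* (- Y1))).
      by apply/rowP => i; rewrite !mxE; have [_ ->] := pP i.
    rewrite -psiE; last by have [_ h] := Ww; rewrite cImD /=; lra.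
    rewrite -addrA (_ : (0 +i* (- Y1)) + (0 +i* Y1) = 0) ?addr0 -?tauE //.
    by apply/eqP; rewrite eq_complex /= addr0 addNr eqxx.
  have /choice[p pP] i : exists p : 'rV[C]_m -> C, cterm p /\ forall w, W false (pr w) ->
      p w = phi i (pr w).
    have h2 : 0 < 1 / 2 :> R by rewrite divr_gt0.
    have [p pc pP] := strip_term (curve_per phim i) (curve_dif phim i) 1 (Y1 + 2) (prc 0 0) h2.
    exists p; split=> // w Ww; have [w1 [w2 w3]] := Ww.
    rewrite pP ?ltW // curveE; last exact: WIm Ww.
    by rewrite -tauE.
  exists p => [i|w Ww]; first by have [] := pP i.
  rewrite Fphi; last exact: WH Ww.
  by congr (<[_]>%VS); apply/rowP => i; rewrite !mxE; have [_ ->] := pP i.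
- have [K _ FK] := fundamental_reduced R 1.
  by move=> tau /FK[_ ret sf]; exact: cov ret sf.
move=> tau Ht; have [tau' [_ Ft ret sf]] := orbit_reduced Forb (isT : (0 < 1)%N) Ht.
by exists tau' => //; exact: cov ret sf.
Qed.

End GenusOne.

Theorem theorem8p3 (R : realType) (g N : nat) (g_ge1 : (1 <= g)%N)
    (F : 'M[R[i]]_g -> projective_space R N) :
  holomorphic_map F ->
  given_by_modular_forms F ->
  induces_embedding F ->
  (exists2 V, projective_variety V &
     zariski_open_in V (F @` @siegel_space R g)) ->
  exists U : set 'M[R[i]]_g,
    [/\ definable_sym U,
        open_sym U,
        U `<=` @siegel_space R g
      & @siegel_fundamental_set R g `<=` U] /\
    [/\ definable_restriction F U,
        forall tau tau', U tau -> U tau' ->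
          (F tau = F tau' <-> same_orbit tau tau')
      & quasi_projective (F @` U)].
Proof.
move=> _ [k [phi [phim Fphi]]] [Forb _ _ _] FX.
have [I [W [Wc Wf Wo]]] : exists (I : finType) (W : I -> set 'M[R[i]]_g),
    [/\ forall i, definable_chart F (W i),
        forall tau, siegel_fundamental_set tau -> exists i, W i tau
      & forall tau, siegel_space tau -> exists2 tau', exists i, W i tau' & F tau' = F tau].
  move: g_ge1 F phi phim Fphi Forb FX; case: g => [//|[|g']] _ F phi phim Fphi Forb FX.
    exact: genus_one_charts phim Fphi Forb FX.
  exact: higher_genus_charts phim Fphi Forb.
exact: definable_charts_cover Wc Wf Wo Forb FX.
Qed.
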